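(* Let $0<q<1$, let $\Gamma$ be an appropriate curve with interior $\mathcal D_-$ and exterior $\mathcal D_+$, and let $w$ be an admissible function in $\mathcal D_-$. Let $P_n(z)$ be the monic $n$th-degree orthogonal polynomial with respect to the admissible measure $w(x)\,d_qx$, i.e. $$\int_{-1}^{1}P_n(x)P_m(x)w(x)\,d_qx=\gamma_n\delta_{n,m}.$$ Let $$h(s)=\sum_{k=-\infty}^{\infty}\frac{2sq^k}{s^2-q^{2k}}=\sum_{k=-\infty}^{\infty}\left(\frac{q^k}{s-q^k}+\frac{q^k}{s+q^k}\right).$$ Then $$Y(z)=\begin{bmatrix} P_n(z) & \displaystyle\oint_\Gamma \frac{P_n(s)w(s)h(s)}{2\pi i(z-s)}\,ds\\[2mm] \gamma_{n-1}^{-1}P_{n-1}(z) & \displaystyle\oint_\Gamma\frac{P_{n-1}(s)w(s)h(s)}{2\pi i(z-s)\gamma_{n-1}}\,ds\end{bmatrix}$$ is the unique solution of the following $q$-Riemann-Hilbert problem for a $2\times2$ complex matrix function $Y(z)$, $z\in\mathbb C$: (i) $Y(z)$ is analytic on $\mathbb C\setminus\Gamma$; (ii) $Y(z)$ has continuous boundary values $Y_-(s)$ and $Y_+(s)$ as $z$ approaches $s\in\Gamma$ from $\mathcal D_-$ and $\mathcal D_+$ respectively, where $$Y_+(s)=Y_-(s)\begin{pmatrix}1 & w(s)h(s)\\ 0&1\end{pmatrix},\qquad s\in\Gamma;$$ (iii) $Y(z)$ satisfies $$Y(z)\begin{pmatrix} z^{-n}&0\\0&z^{n}\end{pmatrix}=I+O\!\left(\frac1{|z|}\right)\quad\text{as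 } |z|\to\infty.$$
   Context: A positively oriented Jordan curve $\Gamma$ in $\mathbb C$ with interior $\mathcal D_-$ and exterior $\mathcal D_+$ is called appropriate if $\pm q^m\in\mathcal D_-$ for all integers $m\ge 0$ and $\pm q^m\in\mathcal D_+$ for all integers $m<0$. A function $w$ is called admissible if it is analytic in $\mathcal D_-$ and $w(z)\in\mathbb R$ for $z\in\mathbb R$. The Jackson integral is $$\int_{-1}^{1}f(x)\,d_qx=(1-q)\sum_{k=0}^{\infty}\bigl(f(q^k)+f(-q^k)\bigr)q^k .$$
   Formalization: The second row of Y carries an extra factor 1−q (as printed, z^n Y_22 tends to 1/(1−q), not 1); Γ is assumed rectifiable with 0 in D_-; w is assumed continuous on D_- ∪ Γ; n ≥ 1 and γ_{n−1} ≠ 0; uniqueness is meant on C∖Γ. *)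

(* Defs.v *)
(* Stdlib reals with Coquelicot's complex numbers and matrices. *)
From Stdlib Require Import Reals ZArith Lra.
From Coquelicot Require Import Coquelicot.

Open Scope R_scope.

(** * Jordan curves and contour integrals *)

(* A closed curve is given by a parametrization [c : R -> C], of which only the
   restriction to [0,1] matters. *)
Definition unit_interval (t : R) : Prop := 0 <= t <= 1.

Definition on_curve (c : R -> C) (z : C) : Prop :=
  exists t : R, unit_interval t /\ c t = z.

Definition jordan_curve (c : R -> C) : Prop :=
  continuous_on unit_interval c /\
  c 0 = c 1 /\
  (forall s t : R, 0 <= s < 1 -> 0 <= t < 1 -> c s = c t -> s = t).

Definition rectifiable (c : R -> C) : Prop :=
  exists L : R, forall (N : nat) (t : nat -> R),
    (forall i, unit_interval (t i)) ->
    (forall i, t i <= t (S i)) ->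
    sum_n (fun i => Cmod (c (t (S i)) - c (t i))) N <= L.

(* Same component of the complement of the curve; the complement is open, so
   its components are its path components. *)
Definition connected_off (c : R -> C) (z1 z2 : C) : Prop :=
  exists p : R -> C,
    continuous_on unit_interval p /\ p 0 = z1 /\ p 1 = z2 /\
    (forall t : R, unit_interval t -> ~ on_curve c (p t)).

Definition bounded_component (c : R -> C) (z : C) : Prop :=
  exists M : R, forall z' : C, connected_off c z z' -> Cmod z' <= M.

(* [interior c] and [exterior c] are the sets D_- and D_+. *)
Definition interior (c : R -> C) (z : C) : Prop :=
  ~ on_curve c z /\ bounded_component c z.

Definition exterior (c : R -> C) (z : C) : Prop :=
  ~ on_curve c z /\ ~ bounded_component c z.

(* Coquelicot's [Riemann_sum] with the increment of the parameter replaced by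
   the increment of [c]:  sum of  f (c (tau_j)) * (c (t_{j+1}) - c (t_j)). *)
Definition contour_sum (c : R -> C) (f : C -> C) (ptd : SF_seq) : C :=
  seq.foldr Cplus (RtoC 0)
    (seq.pairmap
       (fun x y : R * R => (f (c (snd y)) * (c (fst y) - c (fst x)))%C)
       (SF_h ptd, 0) (SF_t ptd)).

Definition is_contour_int (c : R -> C) (f : C -> C) (l : C) : Prop :=
  filterlim (contour_sum c f) (Riemann_fine 0 1) (@locally C_UniformSpace l).

(* Total operator, built like Coquelicot's [RInt]. *)
Definition contour_int (c : R -> C) (f : C -> C) : C :=
  @iota C_CompleteNormedModule (is_contour_int c f).

Definition two_pi_i : C := (RtoC (2 * PI) * Ci)%C.

(* Winding number +1 around every interior point. *)
Definition positively_oriented (c : R -> C) : Prop :=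
  forall z : C, interior c z ->
    is_contour_int c (fun s => / (s - z))%C two_pi_i.

(* The condition at 0, the limit of the points ±q^m, is implicit in the
   requirement that the jump w h be defined on the curve: the poles of h
   accumulate at 0. *)
Definition appropriate (q : R) (c : R -> C) : Prop :=
  jordan_curve c /\ rectifiable c /\ positively_oriented c /\
  interior c (RtoC 0) /\
  (forall m : Z, (0 <= m)%Z ->
     interior c (RtoC (powerRZ q m)) /\ interior c (RtoC (- powerRZ q m))) /\
  (forall m : Z, (m < 0)%Z ->
     exterior c (RtoC (powerRZ q m)) /\ exterior c (RtoC (- powerRZ q m))).

(** * Weights, Jackson integral, orthogonal polynomials *)

(* Complex differentiability at each point of the set; meant for open sets. *)
Definition analytic_on (D : C -> Prop) (f : C -> C) : Prop :=
  forall z : C, D z -> @ex_derive C_AbsRing C_NormedModule f z.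

(* The values of w on the curve, which enter the contour integrals and the
   jump, are the boundary values of w from the interior. *)
Definition admissible (c : R -> C) (w : C -> C) : Prop :=
  analytic_on (interior c) w /\
  @continuous_on C_UniformSpace C_UniformSpace
    (fun z => interior c z \/ on_curve c z) w /\
  (forall x : R, interior c (RtoC x) -> Im (w (RtoC x)) = 0).

Definition C_Series (a : nat -> C) : C :=
  (Series (fun k => Re (a k)), Series (fun k => Im (a k))).

Definition C_Zseries (a : Z -> C) : C :=
  (C_Series (fun k => a (Z.of_nat k)) +
   C_Series (fun k => a (- Z.of_nat (S k))%Z))%C.

Definition jackson (q : R) (f : C -> C) : C :=
  (RtoC (1 - q) *
   C_Series (fun k => (f (RtoC (q ^ k)%R) + f (RtoC (- q ^ k)%R))
                      * RtoC (q ^ k)%R))%C.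

Definition monic_poly (n : nat) (p : C -> C) : Prop :=
  exists a : nat -> C,
    a n = RtoC 1 /\
    forall z : C, p z = sum_n (fun k => a k * z ^ k)%C n.

Definition orthogonal_polys
    (q : R) (w : C -> C) (P : nat -> C -> C) (gamma : nat -> C) : Prop :=
  (forall n : nat, monic_poly n (P n)) /\
  (forall n m : nat,
     jackson q (fun x => P n x * P m x * w x)%C =
     if Nat.eqb n m then gamma n else RtoC 0).

Definition h_term (q : R) (s : C) (k : Z) : C :=
  (2 * s * RtoC (powerRZ q k) / (s ^ 2 - RtoC (powerRZ q (2 * k))))%C.

Definition h (q : R) (s : C) : C := C_Zseries (h_term q s).

Lemma h_termE (q : R) (s : C) (k : Z) : 0 < q ->
  s <> RtoC (powerRZ q k) -> s <> RtoC (- powerRZ q k) ->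
  h_term q s k =
  (RtoC (powerRZ q k) / (s - RtoC (powerRZ q k)) +
   RtoC (powerRZ q k) / (s + RtoC (powerRZ q k)))%C.
Proof.
intros hq h1 h2; unfold h_term.
assert (E : powerRZ q (2 * k) = powerRZ q k * powerRZ q k).
{ replace (2 * k)%Z with (k + k)%Z by ring.
  apply powerRZ_add; lra. }
rewrite E, RtoC_mult.
assert (n1 : (s - RtoC (powerRZ q k))%C <> RtoC 0).
{ now apply Cminus_eq_contra. }
assert (n2 : (s + RtoC (powerRZ q k))%C <> RtoC 0).
{ intros H; apply h2; rewrite RtoC_opp.
  replace s with ((s + RtoC (powerRZ q k)) - RtoC (powerRZ q k))%C by ring.
  rewrite H; ring. }
field; repeat split; auto.
replace (s ^ 2 - RtoC (powerRZ q k) * RtoC (powerRZ q k))%C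
  with ((s - RtoC (powerRZ q k)) * (s + RtoC (powerRZ q k)))%C by ring.
now apply Cmult_neq_0.
Qed.

(** * The q-Riemann-Hilbert problem *)

Definition mat2 : Type := @matrix C 2 2.

Definition mat (a11 a12 a21 a22 : C) : mat2 :=
  [[a11, a12], [a21, a22]].

Definition entry (A : mat2) (i j : nat) : C := coeff_mat (RtoC 0) A i j.

Definition Mmult2 (A B : mat2) : mat2 := @Mmult C_Ring 2 2 2 A B.

Definition boundary_limit
    (D : C -> Prop) (Y : C -> mat2) (s : C) (L : mat2) : Prop :=
  forall i j : nat, (i < 2)%nat -> (j < 2)%nat ->
    filterlim (fun z => entry (Y z) i j)
      (within D (@locally C_UniformSpace s))
      (@locally C_UniformSpace (entry L i j)).

Definition continuous_on_curve (c : R -> C) (Y : C -> mat2) : Prop :=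
  forall i j : nat, (i < 2)%nat -> (j < 2)%nat ->
    @continuous_on C_UniformSpace C_UniformSpace
      (on_curve c) (fun s => entry (Y s) i j).

Definition rhp_analytic (c : R -> C) (Y : C -> mat2) : Prop :=
  forall i j : nat, (i < 2)%nat -> (j < 2)%nat ->
    analytic_on (fun z => ~ on_curve c z) (fun z => entry (Y z) i j).

Definition rhp_jump (c : R -> C) (w hq : C -> C) (Y : C -> mat2) : Prop :=
  exists Ym Yp : C -> mat2,
    continuous_on_curve c Ym /\ continuous_on_curve c Yp /\
    forall s : C, on_curve c s ->
      boundary_limit (interior c) Y s (Ym s) /\
      boundary_limit (exterior c) Y s (Yp s) /\
      Yp s = Mmult2 (Ym s) (mat (RtoC 1) (w s * hq s)%C (RtoC 0) (RtoC 1)).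

Definition rhp_asymptotics (n : nat) (Y : C -> mat2) : Prop :=
  exists K M : R, 0 < M /\
    forall z : C, M < Cmod z ->
    forall i j : nat, (i < 2)%nat -> (j < 2)%nat ->
      Cmod (entry (Mmult2 (Y z) (mat (/ z ^ n)%C (RtoC 0) (RtoC 0) (z ^ n)%C)) i j
            - entry (mat (RtoC 1) (RtoC 0) (RtoC 0) (RtoC 1)) i j)
      <= K / Cmod z.

Definition q_RHP (q : R) (c : R -> C) (w : C -> C) (n : nat) (Y : C -> mat2)
  : Prop :=
  rhp_analytic c Y /\ rhp_jump c w (h q) Y /\ rhp_asymptotics n Y.

(* The second row carries the factor 1 - q because, by residues,
     (1 / (2 pi i)) ∮ f(s) h(s) ds = sum_k (f(q^k) + f(-q^k)) q^k
                                   = (1 - q)^{-1} ∫ f d_q x,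
   so that the (2,2) entry without it is z^{-n} (1 / (1 - q) + O(1/z)). *)
Definition Y_sol (q : R) (c : R -> C) (w : C -> C)
    (P : nat -> C -> C) (gamma : nat -> C) (n : nat) (z : C) : mat2 :=
  mat
    (P n z)
    (contour_int c (fun s => P n s * w s * h q s / (two_pi_i * (z - s))))%C
    (RtoC (1 - q) / gamma (n - 1)%nat * P (n - 1)%nat z)%C
    (contour_int c (fun s => RtoC (1 - q) * P (n - 1)%nat s * w s * h q s
                      / (two_pi_i * (z - s) * gamma (n - 1)%nat)))%C.

(* Main.v *)
(* Existence: [h] is a locally uniformly convergent sum of simple poles at [q^k] and [-q^k]. Cauchy's
   formula, applied termwise, shows that the Cauchy transform of [P_n w h] is a function [R] outside
   the curve and [R - P_n w h] inside, where [R] is the sum of the residue terms and is continuous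
   across the curve; this gives the jump. Orthogonality kills the first [n] moments of [R], which
   gives the behaviour at infinity.
   As [w] is only continuous up to a rectifiable curve, Cauchy's theorem is needed in a strong form.
   The curve is replaced by a closed path on a fine grid, to which a discrete Stokes formula applies.
   Grid squares far from the curve have winding number 0 or 1 and carry no circulation; the squares
   near the curve are controlled by their number and by a bound for the sum of the squared winding
   numbers.
   Uniqueness: a 2x2 minor made of one row of each of two solutions has no jump, so it is continuous
   on the plane and holomorphic off a rectifiable curve. Small squares that meet the curve contribute
   negligibly to contour integrals, so Liouville's theorem applies and the minor is constant. *)
Require Import Defs.
From Stdlib Require Import Reals ZArith.
From Coquelicot Require Import Coquelicot.
From Stdlib Require Import Lra Lia Psatz ClassicalEpsilon.
(* [Stdlib.Reals] also defines an [interior]; the second import makes the name refer to [Defs]. *)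
Require Import Defs.
Open Scope R_scope.

(** * Continuity and differentiability in terms of the modulus *)

(** The obstacle is Cauchy's theorem on a curve that the grid path follows on both sides. [f] comes
    with no continuation across the curve, so it is extended, discontinuously, by its value at a
    point of the closed interior at comparable distance. The weights on the grid edges are means of
    this extension over boxes of [m] by [m] grid points: the circulation of such means around one
    cell of side [d] telescopes to a discrete contour sum around a box of side [delta = m d]. A box
    inside the domain then has almost zero sum by Cauchy's theorem for squares, and a box near the
    curve has a small one by continuity. The winding numbers of the grid path are unknown only
    within [eta = delta^2] of the curve; there the inequality between arithmetic and geometric
    means, weighted by [delta], separates the number of cells from the squared winding numbers, for
    which an isoperimetric inequality holds. In the uniqueness part the minors also replace the
    inversion of a solution: those between the rows of one solution give its determinant, and those
    between two solutions express the rows of one through the other by Cramer's rule. *)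

Definition ccont_on (S : C -> Prop) (f : C -> C) (z : C) : Prop :=
  forall eps : R, 0 < eps -> exists del : R, 0 < del /\
    forall y : C, S y -> Cmod (y - z) < del -> Cmod (f y - f z) < eps.

Definition ccont (f : C -> C) (z : C) : Prop := ccont_on (fun _ => True) f z.

Definition is_cdiff (f : C -> C) (z l : C) : Prop :=
  forall eps : R, 0 < eps -> exists del : R, 0 < del /\
    forall y : C, Cmod (y - z) < del ->
      Cmod (f y - f z - l * (y - z)) <= eps * Cmod (y - z).

Definition cdiff (f : C -> C) (z : C) : Prop := exists l : C, is_cdiff f z l.

Lemma Cmod_minus_sym (x y : C) : Cmod (x - y) = Cmod (y - x).
Proof. rewrite <- Cmod_opp; f_equal; ring. Qed.

Lemma Cmod_triangle_minus (x y : C) : Cmod (x - y) <= Cmod x + Cmod y.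
Proof. unfold Cminus; rewrite <- (Cmod_opp y); apply Cmod_triangle. Qed.

Lemma Cmod_dist_triangle (x y z : C) : Cmod (x - z) <= Cmod (x - y) + Cmod (y - z).
Proof. replace (x - z)%C with ((x - y) + (y - z))%C by ring; apply Cmod_triangle. Qed.

Lemma Cmod_triangle_inv (x y : C) : Cmod x - Cmod y <= Cmod (x - y).
Proof.
pose proof (Cmod_triangle (x - y) y) as H.
replace (x - y + y)%C with x in H by ring; lra.
Qed.

Lemma Cmod_Re_Im (z : C) : Cmod z <= Rabs (Re z) + Rabs (Im z).
Proof.
replace z with (RtoC (Re z) + RtoC (Im z) * Ci)%C at 1
  by (destruct z; unfold Re, Im, RtoC, Ci, Cplus, Cmult; simpl; f_equal; ring).
eapply Rle_trans; [apply Cmod_triangle|].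
rewrite Cmod_mult, Cmod_Ci, !Cmod_R; lra.
Qed.

Lemma Im_le_Cmod (z : C) : Rabs (Im z) <= Cmod z.
Proof. eapply Rle_trans; [apply Rmax_r|apply Rmax_Cmod]. Qed.

(** Balls of the product uniform structure on [C] are squares. The disc of radius [d] contains the
    square of half-side [d / sqrt 2], hence the factor [sqrt 2]. *)
Lemma locally_Cmod (z : C) (P : C -> Prop) :
  @locally C_UniformSpace z P <->
  exists del : R, 0 < del /\ forall y : C, Cmod (y - z) < del -> P y.
Proof.
split.
- intros [d Hd]; exists d; split; [apply cond_pos|].
  intros y Hy; apply Hd, C_NormedModule_mixin_compat1; exact Hy.
- intros [d [Hd H]].
  assert (Hs : 0 < sqrt 2) by (apply sqrt_lt_R0; lra).
  assert (Hp : 0 < d / sqrt 2) by (apply Rdiv_lt_0_compat; lra).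
  exists (mkposreal _ Hp); intros y Hy; apply H.
  pose proof (C_NormedModule_mixin_compat2 z y (mkposreal _ Hp) Hy) as H2.
  simpl in H2; replace d with (sqrt 2 * (d / sqrt 2)) by (field; lra); exact H2.
Qed.

Lemma filterlim_Cmod (T : Type) (F : (T -> Prop) -> Prop) (f : T -> C) (l : C) :
  Filter F ->
  filterlim f F (@locally C_UniformSpace l) <->
  (forall eps : R, 0 < eps -> F (fun x => Cmod (f x - l) < eps)).
Proof.
intros FF; split.
- intros H eps He; apply (H (fun y => Cmod (y - l) < eps)).
  apply locally_Cmod; exists eps; auto.
- intros H P HP; apply locally_Cmod in HP; destruct HP as [d [Hd HP]].
  unfold filtermap; eapply filter_imp; [|apply (H d Hd)]; intros; auto.
Qed.

Lemma within_locally_Cmod (D : C -> Prop) (f : C -> C) (z l : C) :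
  filterlim f (within D (@locally C_UniformSpace z)) (@locally C_UniformSpace l) <->
  (forall eps : R, 0 < eps -> exists del : R, 0 < del /\
     forall y : C, D y -> Cmod (y - z) < del -> Cmod (f y - l) < eps).
Proof.
rewrite filterlim_Cmod by apply within_filter, locally_filter.
split; intros H eps He; destruct (H eps He) as [d Hd].
- destruct (proj1 (locally_Cmod z _) (ex_intro _ d Hd)) as [d' [Hd' K]].
  exists d'; split; auto.
- apply locally_Cmod; exists d; split; [apply Hd|]; intros y Hy Dy; now apply Hd.
Qed.

Lemma continuous_on_ccont_on (S : C -> Prop) (f : C -> C) :
  @continuous_on C_UniformSpace C_UniformSpace S f <->
  forall z : C, S z -> ccont_on S f z.
Proof.
unfold continuous_on, ccont_on.
split; intros H z Hz; apply within_locally_Cmod; auto.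
Qed.

Lemma ex_derive_cdiff (f : C -> C) (z : C) :
  @ex_derive C_AbsRing C_NormedModule f z <-> cdiff f z.
Proof.
split; intros [l Hl]; exists l.
- destruct Hl as [_ Hl].
  intros eps He.
  specialize (Hl z (fun P HP => HP) (mkposreal eps He)).
  apply locally_C, locally_Cmod in Hl.
  destruct Hl as [d [Hd H]]; exists d; split; auto.
  intros y Hy; specialize (H y Hy).
  replace (f y - f z - l * (y - z))%C with (f y - f z - (y - z) * l)%C by ring.
  exact H.
- split; [apply is_linear_scal_l|].
  intros x Hx.
  (* The differential is tested at every limit of the neighbourhood filter of [z]; by uniqueness of
     limits this is [z] alone. *)
  assert (x = z).
  { symmetry; exact (@is_filter_lim_locally_unique C_AbsRing (AbsRing_NormedModule C_AbsRing) z x Hx). }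
  subst x; intros eps; apply locally_C, locally_Cmod.
  destruct (Hl eps (cond_pos eps)) as [d [Hd H]]; exists d; split; auto.
  intros y Hy; specialize (H y Hy).
  replace (f y - f z - l * (y - z))%C with (f y - f z - (y - z) * l)%C in H by ring.
  exact H.
Qed.

Lemma ccont_on_sub (S S' : C -> Prop) (f : C -> C) (z : C) :
  (forall y, S' y -> S y) -> ccont_on S f z -> ccont_on S' f z.
Proof.
intros HS H eps He; destruct (H eps He) as [d [Hd K]]; exists d; split; auto.
Qed.

Lemma ccont_on_ext_loc (S : C -> Prop) (f g : C -> C) (z : C) (r : R) :
  0 < r -> (forall y, S y -> Cmod (y - z) < r -> f y = g y) -> f z = g z ->
  ccont_on S f z -> ccont_on S g z.
Proof.
intros Hr Hfg Hz H eps He; destruct (H eps He) as [d [Hd K]].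
exists (Rmin d r); split; [now apply Rmin_glb_lt|].
intros y Sy Hy.
rewrite <- Hz, <- Hfg; auto.
- apply K; auto; eapply Rlt_le_trans; [exact Hy|apply Rmin_l].
- eapply Rlt_le_trans; [exact Hy|apply Rmin_r].
Qed.

Lemma cdiff_ext_loc (f g : C -> C) (z : C) (r : R) :
  0 < r -> (forall y, Cmod (y - z) < r -> f y = g y) -> cdiff f z -> cdiff g z.
Proof.
intros Hr Hfg [l H]; exists l; intros eps He; destruct (H eps He) as [d [Hd K]].
exists (Rmin d r); split; [now apply Rmin_glb_lt|].
intros y Hy.
rewrite <- (Hfg z), <- Hfg.
- apply K; eapply Rlt_le_trans; [exact Hy|apply Rmin_l].
- eapply Rlt_le_trans; [exact Hy|apply Rmin_r].
- replace (z - z)%C with (RtoC 0) by ring; rewrite Cmod_0; exact Hr.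
Qed.

Lemma ccont_on_const (S : C -> Prop) (a z : C) : ccont_on S (fun _ => a) z.
Proof.
intros eps He; exists 1; split; [lra|]; intros.
replace (a - a)%C with (RtoC 0) by ring; now rewrite Cmod_0.
Qed.

Lemma ccont_on_id (S : C -> Prop) (z : C) : ccont_on S (fun s => s) z.
Proof. intros eps He; exists eps; auto. Qed.

Lemma ccont_on_plus (S : C -> Prop) (f g : C -> C) (z : C) :
  ccont_on S f z -> ccont_on S g z -> ccont_on S (fun s => f s + g s)%C z.
Proof.
intros Hf Hg eps He.
destruct (Hf (eps / 2)) as [d1 [Hd1 K1]]; [lra|].
destruct (Hg (eps / 2)) as [d2 [Hd2 K2]]; [lra|].
exists (Rmin d1 d2); split; [now apply Rmin_glb_lt|].
intros y Sy Hy.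
replace (f y + g y - (f z + g z))%C with ((f y - f z) + (g y - g z))%C by ring.
eapply Rle_lt_trans; [apply Cmod_triangle|].
specialize (K1 y Sy (Rlt_le_trans _ _ _ Hy (Rmin_l _ _))).
specialize (K2 y Sy (Rlt_le_trans _ _ _ Hy (Rmin_r _ _))); lra.
Qed.

Lemma ccont_on_mult (S : C -> Prop) (f g : C -> C) (z : C) :
  ccont_on S f z -> ccont_on S g z -> ccont_on S (fun s => f s * g s)%C z.
Proof.
intros Hf Hg eps He.
pose proof (Cmod_ge_0 (f z)) as Pf; pose proof (Cmod_ge_0 (g z)) as Pg.
set (M := Cmod (f z) + Cmod (g z) + 1).
assert (HM : 0 < M) by (unfold M; lra).
(* With [e <= 1] the product of the two increments is at most [e * e <= e], which is the summand 1
   in [M]. *)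
set (e := Rmin 1 (eps / (2 * M))).
assert (Hq : 0 < eps / (2 * M)) by (apply Rdiv_lt_0_compat; lra).
assert (H0e : 0 < e) by (unfold e; apply Rmin_glb_lt; lra).
destruct (Hf e H0e) as [d1 [Hd1 K1]].
destruct (Hg e H0e) as [d2 [Hd2 K2]].
exists (Rmin d1 d2); split; [now apply Rmin_glb_lt|].
intros y Sy Hy.
specialize (K1 y Sy (Rlt_le_trans _ _ _ Hy (Rmin_l _ _))).
specialize (K2 y Sy (Rlt_le_trans _ _ _ Hy (Rmin_r _ _))).
replace (f y * g y - f z * g z)%C
  with ((f y - f z) * (g y - g z) + f z * (g y - g z) + (f y - f z) * g z)%C by ring.
eapply Rle_lt_trans; [apply Cmod_triangle|].
eapply Rle_lt_trans; [apply Rplus_le_compat_r, Cmod_triangle|].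
rewrite !Cmod_mult.
pose proof (Cmod_ge_0 (f y - f z)); pose proof (Cmod_ge_0 (g y - g z)).
assert (e <= 1) by apply Rmin_l.
assert (E2 : e <= eps / (2 * M)) by apply Rmin_r.
assert (E3 : e * M <= eps / 2).
{ apply Rle_trans with (eps / (2 * M) * M); [apply Rmult_le_compat_r; lra|].
  right; field; lra. }
unfold M in E3; nra.
Qed.

Lemma ccont_on_inv (S : C -> Prop) (f : C -> C) (z : C) :
  f z <> RtoC 0 -> ccont_on S f z -> ccont_on S (fun s => / f s)%C z.
Proof.
intros Hz Hf eps He.
assert (Hm : 0 < Cmod (f z)) by now apply Cmod_gt_0.
set (m := Cmod (f z)) in *.
assert (Hq : 0 < eps * (m * m / 2)) by (apply Rmult_lt_0_compat; nra).
destruct (Hf (Rmin (m / 2) (eps * (m * m / 2)))) as [d [Hd K]].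
{ apply Rmin_glb_lt; lra. }
exists d; split; auto; intros y Sy Hy; specialize (K y Sy Hy).
destruct (Rmin_Rgt_l _ _ _ K) as [K1 K2].
assert (Hy2 : m / 2 <= Cmod (f y)).
{ pose proof (Cmod_triangle_inv (f z) (f y)) as T.
  rewrite Cmod_minus_sym in T; unfold m in *; lra. }
assert (Hfy : f y <> RtoC 0) by (apply Cmod_gt_0; lra).
replace (/ f y - / f z)%C with ((f z - f y) / (f y * f z))%C by (field; auto).
rewrite Cmod_div by now apply Cmult_neq_0.
rewrite Cmod_mult, Cmod_minus_sym; fold m.
apply Rmult_lt_reg_r with (Cmod (f y) * m); [nra|].
unfold Rdiv; rewrite Rmult_assoc, Rinv_l by nra; rewrite Rmult_1_r.
eapply Rlt_le_trans; [exact K2|].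
apply Rmult_le_compat_l; nra.
Qed.

Lemma ccont_on_opp (S : C -> Prop) (f : C -> C) (z : C) :
  ccont_on S f z -> ccont_on S (fun s => - f s)%C z.
Proof.
intros H eps He; destruct (H eps He) as [d [Hd K]]; exists d; split; auto.
intros y Sy Hy; replace (- f y - - f z)%C with (- (f y - f z))%C by ring.
rewrite Cmod_opp; auto.
Qed.

Lemma ccont_on_minus (S : C -> Prop) (f g : C -> C) (z : C) :
  ccont_on S f z -> ccont_on S g z -> ccont_on S (fun s => f s - g s)%C z.
Proof. intros; apply ccont_on_plus; [|apply ccont_on_opp]; auto. Qed.

Lemma ccont_on_div (S : C -> Prop) (f g : C -> C) (z : C) :
  g z <> RtoC 0 -> ccont_on S f z -> ccont_on S g z ->
  ccont_on S (fun s => f s / g s)%C z.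
Proof. intros; apply ccont_on_mult; [|apply ccont_on_inv]; auto. Qed.

Lemma ccont_on_pow (S : C -> Prop) (n : nat) (z : C) : ccont_on S (fun s => s ^ n)%C z.
Proof.
induction n as [|n IH]; simpl.
- apply ccont_on_const.
- apply ccont_on_mult; [apply ccont_on_id|exact IH].
Qed.

(* Caratheodory's form of differentiability reduces the rules to those for continuity. *)
Definition diff_quot (f : C -> C) (a l s : C) : C :=
  if excluded_middle_informative (s = a) then l else ((f s - f a) / (s - a))%C.

Lemma diff_quot_neq (f : C -> C) (a l s : C) : s <> a ->
  diff_quot f a l s = ((f s - f a) / (s - a))%C.
Proof. intros H; unfold diff_quot; destruct excluded_middle_informative; tauto. Qed.

Lemma diff_quot_eq (f : C -> C) (a l : C) : diff_quot f a l a = l.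
Proof. unfold diff_quot; destruct excluded_middle_informative; tauto. Qed.

Lemma diff_quot_spec (f : C -> C) (a l s : C) :
  (f s - f a)%C = (diff_quot f a l s * (s - a))%C.
Proof.
destruct (classic (s = a)) as [->|H]; [ring|].
rewrite diff_quot_neq by auto; field; now apply Cminus_eq_contra.
Qed.

Lemma is_cdiff_factor (f phi : C -> C) (z : C) (r : R) : 0 < r -> ccont phi z ->
  (forall y, Cmod (y - z) < r -> (f y - f z)%C = (phi y * (y - z))%C) ->
  is_cdiff f z (phi z).
Proof.
intros Hr Hphi Hf eps He; destruct (Hphi eps He) as [d [Hd K]].
exists (Rmin d r); split; [now apply Rmin_glb_lt|].
intros y Hy; destruct (Rmin_Rgt_l _ _ _ Hy) as [Hy1 Hy2].
rewrite Hf by exact Hy2.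
replace (phi y * (y - z) - phi z * (y - z))%C with ((phi y - phi z) * (y - z))%C by ring.
rewrite Cmod_mult; apply Rmult_le_compat_r; [apply Cmod_ge_0|left; now apply K].
Qed.

Lemma is_cdiff_diff_quot (f : C -> C) (z l : C) :
  is_cdiff f z l -> ccont (diff_quot f z l) z.
Proof.
intros Hl eps He; destruct (Hl (eps / 2) ltac:(lra)) as [d [Hd K]].
exists d; split; auto; intros y _ Hy; rewrite diff_quot_eq.
destruct (classic (y = z)) as [->|Hne].
- rewrite diff_quot_eq; replace (l - l)%C with (RtoC 0) by ring; now rewrite Cmod_0.
- specialize (K y Hy); rewrite (diff_quot_spec f z l) in K.
  replace (diff_quot f z l y * (y - z) - l * (y - z))%C
    with ((diff_quot f z l y - l) * (y - z))%C in K by ring.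
  rewrite Cmod_mult in K.
  assert (P : 0 < Cmod (y - z)) by now apply Cmod_gt_0, Cminus_eq_contra.
  apply Rmult_le_reg_r in K; auto; lra.
Qed.

Lemma is_cdiff_ccont (f : C -> C) (z l : C) : is_cdiff f z l -> ccont f z.
Proof.
intros H; apply (ccont_on_ext_loc _ (fun y => f z + diff_quot f z l y * (y - z))%C _ z 1);
  [lra|intros y _ _|ring|].
- rewrite <- diff_quot_spec; ring.
- apply ccont_on_plus; [apply ccont_on_const|apply ccont_on_mult].
  + now apply is_cdiff_diff_quot.
  + apply ccont_on_minus; [apply ccont_on_id|apply ccont_on_const].
Qed.

Lemma cdiff_ccont (f : C -> C) (z : C) : cdiff f z -> ccont f z.
Proof. intros [l H]; exact (is_cdiff_ccont f z l H). Qed.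

Lemma is_cdiff_const (a z : C) : is_cdiff (fun _ => a) z 0.
Proof.
apply (is_cdiff_factor _ (fun _ => RtoC 0) z 1); [lra|apply ccont_on_const|intros; ring].
Qed.

Lemma is_cdiff_id (z : C) : is_cdiff (fun s => s) z 1.
Proof.
apply (is_cdiff_factor _ (fun _ => RtoC 1) z 1); [lra|apply ccont_on_const|intros; ring].
Qed.

Lemma is_cdiff_plus (f g : C -> C) (z l m : C) :
  is_cdiff f z l -> is_cdiff g z m -> is_cdiff (fun s => f s + g s)%C z (l + m).
Proof.
intros Hf Hg; rewrite <- (diff_quot_eq f z l), <- (diff_quot_eq g z m).
apply (is_cdiff_factor _ (fun y => diff_quot f z l y + diff_quot g z m y)%C z 1); [lra| |].
- apply ccont_on_plus; now apply is_cdiff_diff_quot.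
- intros y _.
  transitivity ((f y - f z) + (g y - g z))%C; [ring|].
  rewrite (diff_quot_spec f z l), (diff_quot_spec g z m); ring.
Qed.

Lemma is_cdiff_mult (f g : C -> C) (z l m : C) :
  is_cdiff f z l -> is_cdiff g z m ->
  is_cdiff (fun s => f s * g s)%C z (l * g z + f z * m).
Proof.
intros Hf Hg; rewrite <- (diff_quot_eq f z l), <- (diff_quot_eq g z m).
apply (is_cdiff_factor _ (fun y => diff_quot f z l y * g y + f z * diff_quot g z m y)%C z 1);
  [lra| |].
- apply ccont_on_plus; apply ccont_on_mult; try now apply is_cdiff_diff_quot.
  + exact (is_cdiff_ccont g z m Hg).
  + apply ccont_on_const.
- intros y _.
  transitivity ((f y - f z) * g y + f z * (g y - g z))%C; [ring|].
  rewrite (diff_quot_spec f z l), (diff_quot_spec g z m); ring.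
Qed.

Lemma is_cdiff_inv (f : C -> C) (z l : C) :
  f z <> RtoC 0 -> is_cdiff f z l ->
  is_cdiff (fun s => / f s)%C z (- l / (f z * f z)).
Proof.
intros Hz Hf; pose proof (is_cdiff_ccont f z l Hf) as Cf.
destruct (Cf (Cmod (f z)) (proj1 (Cmod_gt_0 _) Hz)) as [d [Hd K]].
rewrite <- (diff_quot_eq f z l).
apply (is_cdiff_factor _ (fun y => - diff_quot f z l y / (f y * f z))%C z d); auto.
- apply ccont_on_div; [now apply Cmult_neq_0| |].
  + now apply ccont_on_opp, is_cdiff_diff_quot.
  + apply ccont_on_mult; [exact Cf|apply ccont_on_const].
- intros y Hy; specialize (K y I Hy).
  assert (Hfy : f y <> RtoC 0).
  { intros E; rewrite E, Cmod_minus_sym in K.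
    replace (f z - 0)%C with (f z) in K by ring; lra. }
  transitivity (- (f y - f z) / (f y * f z))%C; [field; auto|].
  rewrite (diff_quot_spec f z l); field; auto.
Qed.

Lemma cdiff_const (a z : C) : cdiff (fun _ => a) z.
Proof. eexists; apply is_cdiff_const. Qed.

Lemma cdiff_id (z : C) : cdiff (fun s => s) z.
Proof. eexists; apply is_cdiff_id. Qed.

Lemma cdiff_plus (f g : C -> C) (z : C) :
  cdiff f z -> cdiff g z -> cdiff (fun s => f s + g s)%C z.
Proof. intros [l Hl] [m Hm]; eexists; apply is_cdiff_plus; eauto. Qed.

Lemma cdiff_mult (f g : C -> C) (z : C) :
  cdiff f z -> cdiff g z -> cdiff (fun s => f s * g s)%C z.
Proof. intros [l Hl] [m Hm]; eexists; apply is_cdiff_mult; eauto. Qed.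

Lemma cdiff_inv (f : C -> C) (z : C) :
  f z <> RtoC 0 -> cdiff f z -> cdiff (fun s => / f s)%C z.
Proof. intros Hz [l Hl]; eexists; apply is_cdiff_inv; eauto. Qed.

Lemma cdiff_opp (f : C -> C) (z : C) : cdiff f z -> cdiff (fun s => - f s)%C z.
Proof.
intros H; apply (cdiff_ext_loc (fun s => - RtoC 1 * f s)%C _ _ 1); [lra| |].
- intros; ring.
- apply cdiff_mult; [apply cdiff_const|exact H].
Qed.

Lemma cdiff_minus (f g : C -> C) (z : C) :
  cdiff f z -> cdiff g z -> cdiff (fun s => f s - g s)%C z.
Proof. intros; apply cdiff_plus; [|apply cdiff_opp]; auto. Qed.

Lemma cdiff_div (f g : C -> C) (z : C) :
  g z <> RtoC 0 -> cdiff f z -> cdiff g z -> cdiff (fun s => f s / g s)%C z.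
Proof. intros; apply cdiff_mult; [|apply cdiff_inv]; auto. Qed.

Lemma cdiff_pow (n : nat) (z : C) : cdiff (fun s => s ^ n)%C z.
Proof.
induction n as [|n IH]; simpl.
- apply cdiff_const.
- apply cdiff_mult; [apply cdiff_id|exact IH].
Qed.

(** * Finite sums *)

Fixpoint Rsum (n : nat) (f : nat -> R) : R :=
  match n with O => 0 | S k => Rsum k f + f k end.

Fixpoint Csum (n : nat) (f : nat -> C) : C :=
  match n with O => RtoC 0 | S k => (Csum k f + f k)%C end.

Lemma Rsum_le (n : nat) (f g : nat -> R) :
  (forall k, (k < n)%nat -> f k <= g k) -> Rsum n f <= Rsum n g.
Proof.
induction n as [|n IH]; simpl; intros H; [lra|].
apply Rplus_le_compat; auto with arith.
Qed.

Lemma Rsum_ext (n : nat) (f g : nat -> R) :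
  (forall k, (k < n)%nat -> f k = g k) -> Rsum n f = Rsum n g.
Proof.
induction n as [|n IH]; simpl; intros H; [easy|].
rewrite IH, H; auto with arith.
Qed.

Lemma Csum_ext (n : nat) (f g : nat -> C) :
  (forall k, (k < n)%nat -> f k = g k) -> Csum n f = Csum n g.
Proof.
induction n as [|n IH]; simpl; intros H; [easy|].
rewrite IH, H; auto with arith.
Qed.

Lemma Rsum_const (n : nat) (a : R) : Rsum n (fun _ => a) = INR n * a.
Proof. induction n as [|n IH]; simpl Rsum; [simpl; ring|]. rewrite IH, S_INR; ring. Qed.

Lemma Rsum_plus (n : nat) (f g : nat -> R) :
  Rsum n (fun k => f k + g k) = Rsum n f + Rsum n g.
Proof. induction n as [|n IH]; simpl; [ring|]. rewrite IH; ring. Qed.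

Lemma Rsum_scal (n : nat) (a : R) (f : nat -> R) :
  Rsum n (fun k => a * f k) = a * Rsum n f.
Proof. induction n as [|n IH]; simpl; [ring|]. rewrite IH; ring. Qed.

Lemma Rsum_pos (n : nat) (f : nat -> R) :
  (forall k, (k < n)%nat -> 0 <= f k) -> 0 <= Rsum n f.
Proof.
intros H; apply Rle_trans with (Rsum n (fun _ => 0)).
- rewrite Rsum_const; lra.
- now apply Rsum_le.
Qed.

Lemma Rsum_swap (n m : nat) (f : nat -> nat -> R) :
  Rsum n (fun i => Rsum m (fun j => f i j)) = Rsum m (fun j => Rsum n (fun i => f i j)).
Proof.
induction n as [|n IH]; simpl.
- symmetry; rewrite Rsum_const; ring.
- rewrite IH, <- Rsum_plus; easy.
Qed.

Lemma Csum_plus (n : nat) (f g : nat -> C) :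
  Csum n (fun k => f k + g k)%C = (Csum n f + Csum n g)%C.
Proof. induction n as [|n IH]; simpl; [ring|]. rewrite IH; ring. Qed.

Lemma Csum_minus (n : nat) (f g : nat -> C) :
  Csum n (fun k => f k - g k)%C = (Csum n f - Csum n g)%C.
Proof. induction n as [|n IH]; simpl; [ring|]. rewrite IH; ring. Qed.

Lemma Csum_scal (n : nat) (a : C) (f : nat -> C) :
  Csum n (fun k => a * f k)%C = (a * Csum n f)%C.
Proof. induction n as [|n IH]; simpl; [ring|]. rewrite IH; ring. Qed.

Lemma Csum_zero (n : nat) (f : nat -> C) :
  (forall k, (k < n)%nat -> f k = RtoC 0) -> Csum n f = RtoC 0.
Proof.
induction n as [|n IH]; simpl; intros H; [easy|].
rewrite IH, H; auto with arith; ring.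
Qed.

Lemma Csum_swap (n m : nat) (f : nat -> nat -> C) :
  Csum n (fun i => Csum m (fun j => f i j)) = Csum m (fun j => Csum n (fun i => f i j)).
Proof.
induction n as [|n IH]; simpl.
- symmetry; apply Csum_zero; easy.
- rewrite IH, <- Csum_plus; easy.
Qed.

Lemma Csum_telescope (n : nat) (f : nat -> C) :
  Csum n (fun k => f (S k) - f k)%C = (f n - f O)%C.
Proof. induction n as [|n IH]; simpl; [ring|]. rewrite IH; ring. Qed.

Lemma Rsum_telescope (n : nat) (f : nat -> R) :
  Rsum n (fun k => f (S k) - f k) = f n - f O.
Proof. induction n as [|n IH]; simpl; [ring|]. rewrite IH; ring. Qed.

Lemma Cmod_Csum (n : nat) (f : nat -> C) : Cmod (Csum n f) <= Rsum n (fun k => Cmod (f k)).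
Proof.
induction n as [|n IH]; simpl; [rewrite Cmod_0; lra|].
eapply Rle_trans; [apply Cmod_triangle|lra].
Qed.

Lemma Csum_single (n k : nat) (f : nat -> C) :
  (k < n)%nat -> (forall j, (j < n)%nat -> j <> k -> f j = RtoC 0) -> Csum n f = f k.
Proof.
induction n as [|n IH]; intros Hk H; [lia|]; simpl.
destruct (Nat.eq_dec k n) as [->|Hn].
- rewrite Csum_zero; [ring|]; intros; apply H; lia.
- rewrite IH, (H n); [ring|lia|lia|lia|]; intros; apply H; lia.
Qed.

Lemma sum_n_Rsum (f : nat -> R) (n : nat) : sum_n f n = Rsum (S n) f.
Proof.
induction n as [|n IH].
- rewrite sum_O; simpl; ring.
- rewrite sum_Sn, IH; reflexivity.
Qed.

Lemma sum_n_Csum (f : nat -> C) (n : nat) : @sum_n C_Ring f n = Csum (S n) f.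
Proof.
induction n as [|n IH].
- rewrite sum_O; simpl; ring.
- rewrite sum_Sn, IH; reflexivity.
Qed.

(** * Contour integrals along rectifiable curves *)

Definition Rcont_on (a b : R) (f : R -> C) : Prop :=
  forall t, a <= t <= b -> forall eps, 0 < eps -> exists del, 0 < del /\
    forall s, a <= s <= b -> Rabs (s - t) < del -> Cmod (f s - f t) < eps.

Lemma continuous_on_Rcont_on (c : R -> C) :
  continuous_on unit_interval c -> Rcont_on 0 1 c.
Proof.
intros H t Ht eps He.
specialize (H t Ht).
assert (HF : Filter (within unit_interval (locally t))) by apply within_filter, locally_filter.
pose proof (proj1 (filterlim_Cmod _ _ _ _ HF) H eps He) as H'; clear H; rename H' into H.
destruct H as [d Hd]; exists d; split; [apply cond_pos|]; intros s Hs Hst.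
apply Hd; auto.
Qed.

Lemma Rcont_on_continuous_on (c : R -> C) :
  Rcont_on 0 1 c -> continuous_on unit_interval c.
Proof.
intros H t Ht.
assert (HF : Filter (within unit_interval (locally t))) by apply within_filter, locally_filter.
apply (filterlim_Cmod _ _ _ _ HF); intros eps He.
destruct (H t Ht eps He) as [d [Hd K]].
exists (mkposreal d Hd); intros s Hs Ds; apply K; auto.
Qed.

(** Compactness of [[a, b]] for a gauge: every point lies in a selected neighbourhood, and the radii
    used stay above one [e]. [Q t d] carries whatever local property the radius [d] at [t] was
    chosen for. *)
Lemma interval_cover (a b : R) (Q : R -> R -> Prop) :
  (forall t, a <= t <= b -> exists d, 0 < d /\ Q t d) ->
  exists e, 0 < e /\ forall x, a <= x <= b ->
    exists t d, a <= t <= b /\ Q t d /\ Rabs (x - t) < d /\ e <= d.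
Proof.
intros H.
assert (H' : forall t, exists d : posreal, a <= t <= b -> Q t d).
{ intros t; destruct (classic (a <= t <= b)) as [Ht|Ht].
  - destruct (H t Ht) as [d [Hd K]]; exists (mkposreal d Hd); auto.
  - exists (mkposreal 1 Rlt_0_1); tauto. }
destruct (choice _ H') as [delta Hdelta].
destruct (compactness_value_1d a b delta) as [e He].
exists e; split; [apply cond_pos|]; intros x Hx.
apply NNPP; intros N; apply (He x Hx); intros [t [Ht [H1 H2]]].
apply N; exists t, (delta t); auto.
Qed.

Lemma Rcont_on_unif (a b : R) (f : R -> C) : Rcont_on a b f ->
  forall eps, 0 < eps -> exists del, 0 < del /\
    forall s t, a <= s <= b -> a <= t <= b -> Rabs (s - t) < del ->
      Cmod (f s - f t) < eps.
Proof.
intros H eps He.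
destruct (interval_cover a b (fun t d => forall s, a <= s <= b ->
   Rabs (s - t) < 2 * d -> Cmod (f s - f t) < eps / 2)) as [e [He0 K]].
{ intros t Ht; destruct (H t Ht (eps / 2)) as [d [Hd K]]; [lra|].
  exists (d / 2); split; [lra|]; intros; apply K; auto; lra. }
exists e; split; auto; intros s t Hs Ht Hst.
destruct (K s Hs) as [u [d [Hu [Q [H1 H2]]]]].
eapply Rle_lt_trans; [apply (Cmod_dist_triangle _ (f u))|].
assert (Cmod (f s - f u) < eps / 2) by (apply Q; auto; lra).
assert (Cmod (f t - f u) < eps / 2).
{ apply Q; auto; unfold Rabs in *; repeat destruct Rcase_abs; lra. }
rewrite (Cmod_minus_sym (f u)); lra.
Qed.

(** All estimates along the curve go through this domination of chords by increments, so [l] may be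
    any such function; arc length is the one constructed next. *)
Definition length_bound (c : R -> C) (l : R -> R) : Prop :=
  forall a b, 0 <= a -> a <= b -> b <= 1 -> Cmod (c b - c a) <= l b - l a.

(** [l t] is the supremum of the polygonal sums with vertices at parameters in [[0, t]]. A chain in
    [[0, a]] continued by [a] and then [b] is a chain in [[0, b]] that is longer by at least the
    chord from [c a] to [c b]. *)
Lemma rectifiable_length (c : R -> C) : rectifiable c -> exists l, length_bound c l.
Proof.
intros [L HL].
set (E := fun (t x : R) => exists (N : nat) (u : nat -> R),
  (forall i, 0 <= u i <= t) /\ (forall i, u i <= u (S i)) /\
  x = Rsum N (fun i => Cmod (c (u (S i)) - c (u i)))).
assert (HE : forall t, exists m, 0 <= t <= 1 -> is_lub (E t) m).
{ intros t; destruct (classic (0 <= t <= 1)) as [Ht|Ht]; [|exists 0; tauto].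
  destruct (completeness (E t)) as [m Hm].
  - exists L; intros x [N [u [H1 [H2 ->]]]].
    eapply Rle_trans; [|apply (HL N u)].
    + rewrite sum_n_Rsum; simpl; rewrite <- (Rplus_0_r (Rsum N _)) at 1.
      apply Rplus_le_compat_l, Cmod_ge_0.
    + intros i; specialize (H1 i); unfold unit_interval; lra.
    + exact H2.
  - exists 0, 0%nat, (fun _ => 0); repeat split; intros; try lra.
  - exists m; auto. }
destruct (choice _ HE) as [l Hl]; exists l; intros a b Ha Hab Hb.
destruct (Hl a) as [_ A2]; [lra|]; destruct (Hl b) as [B1 _]; [lra|].
enough (l a <= l b - Cmod (c b - c a)) by lra.
apply A2; intros x [N [u [H1 [H2 ->]]]].
enough (Rsum N (fun i => Cmod (c (u (S i)) - c (u i))) + Cmod (c b - c a) <= l b) by lra.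
(* The chain [u] up to index [N], then [a], then [b] for all later indices: [E] asks for an infinite
   monotone sequence. *)
set (v := fun i => if le_lt_dec i N then u i else if Nat.eq_dec i (S N) then a else b).
apply Rle_trans with (Rsum (S (S N)) (fun i => Cmod (c (v (S i)) - c (v i)))).
- simpl; apply Rplus_le_compat.
  + rewrite <- (Rplus_0_r (Rsum N _)); apply Rplus_le_compat; [|apply Cmod_ge_0].
    right; apply Rsum_ext; intros k Hk; unfold v.
    destruct (le_lt_dec k N); [|lia]; destruct (le_lt_dec (S k) N); [easy|lia].
  + unfold v; destruct (le_lt_dec (S N) N); [lia|].
    destruct (le_lt_dec (S (S N)) N); [lia|].
    destruct (Nat.eq_dec (S (S N)) (S N)); [lia|].
    destruct (Nat.eq_dec (S N) (S N)); [lra|lia].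
- apply B1; exists (S (S N)), v; repeat split.
  + unfold v; destruct (le_lt_dec i N); [apply H1|].
    destruct (Nat.eq_dec i (S N)); lra.
  + unfold v; destruct (le_lt_dec i N); [specialize (H1 i); lra|].
    destruct (Nat.eq_dec i (S N)); lra.
  + intros i; unfold v.
    destruct (le_lt_dec i N); destruct (le_lt_dec (S i) N); try lia.
    * apply H2.
    * destruct (Nat.eq_dec (S i) (S N)); [apply H1|lia].
    * destruct (Nat.eq_dec i (S N)); destruct (Nat.eq_dec (S i) (S N)); try lia; lra.
Qed.

Lemma length_bound_mono (c : R -> C) (l : R -> R) (a b : R) :
  length_bound c l -> 0 <= a -> a <= b -> b <= 1 -> l a <= l b.
Proof. intros H H1 H2 H3; specialize (H a b H1 H2 H3); pose proof (Cmod_ge_0 (c b - c a)); lra. Qed.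

Definition ugrid (n i : nat) : R := INR i / INR n.

(** Left-endpoint Riemann-Stieltjes sum over the uniform grid, for the curve stopped at time [t].
    Differences in [t] are additive, so one fixed [n] can be compared with any partition or tagged
    subdivision, piece by piece. *)
Definition usum (c phi : R -> C) (n : nat) (t : R) : C :=
  Csum n (fun i => phi (ugrid n i) *
     (c (Rmin t (ugrid n (S i))) - c (Rmin t (ugrid n i))))%C.

Lemma ugrid_S (n i : nat) : (0 < n)%nat -> ugrid n (S i) = ugrid n i + / INR n.
Proof. intros H; apply lt_0_INR in H; unfold ugrid; rewrite S_INR; field; lra. Qed.

Lemma ugrid_range (n i : nat) : (0 < n)%nat -> (i <= n)%nat -> 0 <= ugrid n i <= 1.
Proof.
intros H Hi; apply lt_0_INR in H; apply le_INR in Hi; pose proof (pos_INR i).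
unfold ugrid; split.
- apply Rdiv_le_0_compat; lra.
- apply Rmult_le_reg_r with (INR n); [lra|].
  unfold Rdiv; rewrite Rmult_assoc, Rinv_l; lra.
Qed.

(** Only grid cells that meet [[a, b]] contribute. The left end of such a cell lies in [[a, b]] or
    precedes [a] by less than one mesh; the first case costs [e1], the second [e1 + e2]. *)
Lemma usum_local (c phi : R -> C) (l : R -> R) (n : nat) (a b tau e1 e2 : R) :
  length_bound c l -> (0 < n)%nat -> 0 <= a -> a <= tau -> tau <= b -> b <= 1 ->
  (forall x, a <= x <= b -> Cmod (phi x - phi tau) <= e1) ->
  (forall x y, 0 <= x <= 1 -> 0 <= y <= 1 -> Rabs (x - y) <= / INR n ->
     Cmod (phi x - phi y) <= e2) ->
  Cmod (usum c phi n b - usum c phi n a - phi tau * (c b - c a)) <=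
  (e1 + e2) * (l b - l a).
Proof.
intros Hl Hn Ha Hat Htb Hb H1 H2.
assert (Hn0 : ugrid n 0 = 0) by (unfold ugrid; simpl; unfold Rdiv; ring).
assert (Hnn : ugrid n n = 1) by (unfold ugrid; field; apply not_0_INR; lia).
assert (He1 : 0 <= e1) by (eapply Rle_trans; [apply Cmod_ge_0|apply (H1 a); lra]).
assert (Hin : 0 < / INR n) by (apply Rinv_0_lt_compat, lt_0_INR; lia).
assert (He2 : 0 <= e2).
{ eapply Rle_trans; [apply Cmod_ge_0|apply (H2 a a); try lra].
  rewrite Rminus_diag, Rabs_R0; lra. }
(* The differences of [g] and [k] from one grid point to the next are the increments of [c] and [l]
   over the part of the cell inside [[a, b]], so both telescope to the totals. *)
set (g := fun i => (c (Rmin b (ugrid n i)) - c (Rmin a (ugrid n i)))%C).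
set (k := fun i => l (Rmin b (ugrid n i)) - l (Rmin a (ugrid n i))).
replace (c b - c a)%C with (Csum n (fun i => g (S i) - g i)%C).
2:{ rewrite Csum_telescope; unfold g; rewrite Hn0, Hnn.
    rewrite !(Rmin_right _ 0), !(Rmin_left _ 1) by lra; ring. }
replace (l b - l a) with (Rsum n (fun i => k (S i) - k i)).
2:{ rewrite Rsum_telescope; unfold k; rewrite Hn0, Hnn.
    rewrite !(Rmin_right _ 0), !(Rmin_left _ 1) by lra; ring. }
unfold usum; rewrite <- Csum_scal, <- Rsum_scal, <- !Csum_minus.
eapply Rle_trans; [apply Cmod_Csum|]; apply Rsum_le; intros i Hi.
replace (phi (ugrid n i) * (c (Rmin b (ugrid n (S i))) - c (Rmin b (ugrid n i))) -
  phi (ugrid n i) * (c (Rmin a (ugrid n (S i))) - c (Rmin a (ugrid n i))) -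
  phi tau * (g (S i) - g i))%C with ((phi (ugrid n i) - phi tau) * (g (S i) - g i))%C
  by (unfold g; ring).
rewrite Cmod_mult.
pose proof (ugrid_range n i Hn (Nat.lt_le_incl _ _ Hi)) as Ri.
pose proof (ugrid_range n (S i) Hn Hi) as RSi.
pose proof (ugrid_S n i Hn) as ES.
unfold g, k.
destruct (Rle_lt_dec (ugrid n (S i)) a) as [Ca|Ca].
{ rewrite !(Rmin_right _ (ugrid n (S i))), !(Rmin_right _ (ugrid n i)) by lra.
  replace (_ - _ - _)%C with (RtoC 0) by ring.
  rewrite Cmod_0, Rmult_0_r; right; ring. }
destruct (Rle_lt_dec b (ugrid n i)) as [Cb|Cb].
{ rewrite !(Rmin_left _ (ugrid n (S i))), !(Rmin_left _ (ugrid n i)) by lra.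
  replace (_ - _ - _)%C with (RtoC 0) by ring.
  rewrite Cmod_0, Rmult_0_r; right; ring. }
assert (Hosc : Cmod (phi (ugrid n i) - phi tau) <= e1 + e2).
{ destruct (Rle_lt_dec a (ugrid n i)) as [D|D].
  - specialize (H1 (ugrid n i)); lra.
  - eapply Rle_trans; [apply (Cmod_dist_triangle _ (phi a))|].
    assert (Cmod (phi (ugrid n i) - phi a) <= e2).
    { apply H2; try lra; unfold Rabs; destruct Rcase_abs; lra. }
    assert (Cmod (phi a - phi tau) <= e1) by (apply H1; lra); lra. }
apply Rmult_le_compat; try apply Cmod_ge_0; auto.
rewrite (Rmin_left a (ugrid n (S i))) by lra.
rewrite (Rmin_right b (ugrid n i)) by lra.
assert (Hm : a <= Rmin b (ugrid n (S i))) by (apply Rmin_glb; lra).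
assert (Hm' : ugrid n i <= Rmin b (ugrid n (S i))) by (apply Rmin_glb; lra).
assert (Hm2 : Rmin b (ugrid n (S i)) <= b) by apply Rmin_l.
destruct (Rle_lt_dec (ugrid n i) a) as [D|D].
- rewrite (Rmin_right a (ugrid n i)) by lra.
  replace (_ - _ - _)%C with (c (Rmin b (ugrid n (S i))) - c a)%C by ring.
  eapply Rle_trans; [apply Hl; lra|lra].
- rewrite (Rmin_left a (ugrid n i)) by lra.
  replace (_ - _ - _)%C with (c (Rmin b (ugrid n (S i))) - c (ugrid n i))%C by ring.
  eapply Rle_trans; [apply Hl; lra|lra].
Qed.

Lemma usum_0 (c phi : R -> C) (n : nat) : (0 < n)%nat -> usum c phi n 0 = RtoC 0.
Proof.
intros Hn; unfold usum; apply Csum_zero; intros k Hk.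
rewrite !Rmin_left; [ring| |]; apply ugrid_range; lia.
Qed.

Lemma usum_partition (c phi : R -> C) (l : R -> R) (n N : nat) (t : nat -> R) (e1 e2 : R) :
  length_bound c l -> (0 < n)%nat -> t O = 0 -> t N = 1 ->
  (forall k, (k < N)%nat -> t k <= t (S k)) ->
  (forall k x, (k < N)%nat -> t k <= x <= t (S k) -> Cmod (phi x - phi (t k)) <= e1) ->
  (forall x y, 0 <= x <= 1 -> 0 <= y <= 1 -> Rabs (x - y) <= / INR n ->
     Cmod (phi x - phi y) <= e2) ->
  Cmod (usum c phi n 1 - Csum N (fun k => phi (t k) * (c (t (S k)) - c (t k)))%C)
  <= (e1 + e2) * (l 1 - l 0).
Proof.
intros Hl Hn H0 H1 Hm E1 E2.
assert (Hr : forall k, (k <= N)%nat -> 0 <= t k).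
{ induction k; intros Hk; [lra|]; specialize (IHk ltac:(lia)); specialize (Hm k ltac:(lia)); lra. }
assert (Hr1 : forall j k, (k + j = N)%nat -> t k <= 1).
{ induction j; intros k Hk.
  - replace k with N by lia; lra.
  - specialize (IHj (S k) ltac:(lia)); specialize (Hm k ltac:(lia)); lra. }
replace (usum c phi n 1)
  with (Csum N (fun k => usum c phi n (t (S k)) - usum c phi n (t k))%C).
2:{ rewrite (Csum_telescope N (fun k => usum c phi n (t k))), H0, H1, usum_0; auto; ring. }
replace (l 1 - l 0) with (Rsum N (fun k => l (t (S k)) - l (t k))).
2:{ rewrite (Rsum_telescope N (fun k => l (t k))), H0, H1; ring. }
rewrite <- Csum_minus, <- Rsum_scal.
eapply Rle_trans; [apply Cmod_Csum|]; apply Rsum_le; intros k Hk.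
specialize (Hm k Hk).
apply usum_local; auto; try lra.
- apply Hr; lia.
- apply (Hr1 (N - S k)%nat); lia.
Qed.

Lemma C_cauchy (u : nat -> C) :
  (forall eps, 0 < eps -> exists N, forall n m, (N <= n)%nat -> (N <= m)%nat ->
     Cmod (u n - u m) <= eps) ->
  exists l, forall eps, 0 < eps -> exists N, forall n, (N <= n)%nat -> Cmod (u n - l) <= eps.
Proof.
intros H.
assert (HR : forall p : C -> R, (forall x y, Rabs (p x - p y) <= Cmod (x - y)) ->
  ex_finite_lim_seq (fun n => p (u n))).
{ intros p Hp; apply ex_lim_seq_cauchy_corr; intros eps.
  destruct (H (eps / 2)) as [N HN]; [pose proof (cond_pos eps); lra|].
  exists N; intros n m Hn Hm; eapply Rle_lt_trans; [apply Hp|].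
  specialize (HN n m Hn Hm); pose proof (cond_pos eps); lra. }
destruct (HR Re) as [x Hx].
{ intros a b; rewrite <- (re_le_Cmod (a - b)); right; reflexivity. }
destruct (HR Im) as [y Hy].
{ intros a b; rewrite <- (Im_le_Cmod (a - b)); right; reflexivity. }
exists (x, y); intros eps He.
apply is_lim_seq_spec in Hx; apply is_lim_seq_spec in Hy.
assert (He2 : 0 < eps / 2) by lra.
destruct (Hx (mkposreal _ He2)) as [N1 K1]; destruct (Hy (mkposreal _ He2)) as [N2 K2].
exists (max N1 N2); intros n Hn.
specialize (K1 n ltac:(lia)); specialize (K2 n ltac:(lia)); simpl in K1, K2.
eapply Rle_trans; [apply Cmod_Re_Im|].
change (Rabs (Re (u n) - x) + Rabs (Im (u n) - y) <= eps); lra.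
Qed.

Lemma unif_inv_nat (phi : R -> C) : Rcont_on 0 1 phi -> forall e, 0 < e ->
  exists n0, forall n, (n0 <= n)%nat -> (0 < n)%nat /\
   (forall x y, 0 <= x <= 1 -> 0 <= y <= 1 -> Rabs (x - y) <= / INR n ->
     Cmod (phi x - phi y) <= e).
Proof.
intros H e He; destruct (Rcont_on_unif 0 1 phi H e He) as [d [Hd K]].
destruct (archimed_cor1 d Hd) as [N [HN1 HN2]].
exists N; intros n Hn; split; [lia|]; intros x y Hx Hy Hxy.
left; apply K; auto; eapply Rle_lt_trans; [exact Hxy|].
eapply Rle_lt_trans; [|exact HN1].
apply Rinv_le_contravar; [apply lt_0_INR; lia|now apply le_INR].
Qed.

Lemma usum_uniform (c phi : R -> C) (n : nat) : (0 < n)%nat ->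
  usum c phi n 1 = Csum n (fun k => phi (ugrid n k) * (c (ugrid n (S k)) - c (ugrid n k)))%C.
Proof.
intros Hn; apply Csum_ext; intros k Hk.
now rewrite !Rmin_right by (apply ugrid_range; lia).
Qed.

(** The sums form a Cauchy sequence: the uniform grid with [m] cells is itself a partition, with
    which [usum_partition] compares the sum over [n] cells. *)
Lemma usum_limit (c phi : R -> C) (l : R -> R) : length_bound c l -> Rcont_on 0 1 phi ->
  exists I, forall eps, 0 < eps -> exists N, forall n, (N <= n)%nat ->
    Cmod (usum c phi n 1 - I) <= eps.
Proof.
intros Hl Hphi.
pose proof (length_bound_mono c l 0 1 Hl ltac:(lra) ltac:(lra) ltac:(lra)) as HL.
apply C_cauchy; intros eps He.
set (e := eps / (2 * (l 1 - l 0 + 1))).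
assert (He' : 0 < e) by (unfold e; apply Rdiv_lt_0_compat; lra).
destruct (unif_inv_nat phi Hphi e He') as [n0 H0].
exists n0; intros n m Hn Hm.
destruct (H0 n Hn) as [Hn1 Hn2]; destruct (H0 m Hm) as [Hm1 Hm2].
rewrite (usum_uniform c phi m Hm1).
eapply Rle_trans; [apply usum_partition with (l := l) (e1 := e) (e2 := e); auto|].
- unfold ugrid; simpl; unfold Rdiv; ring.
- unfold ugrid; field; apply not_0_INR; lia.
- intros k Hk; rewrite ugrid_S by auto.
  enough (0 < / INR m) by lra; apply Rinv_0_lt_compat, lt_0_INR; lia.
- intros k x Hk Hx.
  pose proof (ugrid_range m k Hm1 ltac:(lia)); pose proof (ugrid_range m (S k) Hm1 Hk).
  rewrite ugrid_S in * by auto.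
  apply Hm2; try lra; rewrite Rabs_pos_eq; lra.
- unfold e; apply Rle_trans with (eps / (l 1 - l 0 + 1) * (l 1 - l 0)).
  + right; field; lra.
  + apply Rle_trans with (eps / (l 1 - l 0 + 1) * (l 1 - l 0 + 1)).
    * apply Rmult_le_compat_l; [|lra].
      apply Rlt_le, Rdiv_lt_0_compat; lra.
    * right; field; lra.
Qed.

Lemma contour_sum_cons (c : R -> C) (f : C -> C) (h : R * R) (s : SF_seq) :
  contour_sum c f (SF_cons h s) =
  (f (c (snd h)) * (c (SF_h s) - c (fst h)) + contour_sum c f s)%C.
Proof.
unfold contour_sum, SF_cons; simpl; f_equal.
destruct (SF_t s); reflexivity.
Qed.

Lemma pointed_head_le_last (s : SF_seq) : pointed_subdiv s ->
  SF_h s <= seq.last (SF_h s) (SF_lx s).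
Proof.
induction s as [x|h s IH] using SF_cons_ind; intros H.
- simpl; lra.
- assert (E : seq.last (SF_h (SF_cons h s)) (SF_lx (SF_cons h s))
              = seq.last (SF_h s) (SF_lx s)) by reflexivity.
  rewrite E; eapply Rle_trans; [|apply IH; eapply ptd_cons; eauto].
  specialize (H O); rewrite SF_size_cons in H; specialize (H ltac:(apply Nat.lt_0_succ)).
  simpl in H; simpl; lra.
Qed.

(** Induction on the tagged subdivision, with one application of [usum_local] per piece and its tag
    as [tau]. The bound accumulates as an increment of [l], so the number of pieces does not
    enter. *)
Lemma contour_sum_usum (c : R -> C) (f : C -> C) (l : R -> R) (n : nat) (e1 e2 del : R)
  (s : SF_seq) :
  length_bound c l -> (0 < n)%nat ->
  (forall x y, 0 <= x <= 1 -> 0 <= y <= 1 -> Rabs (x - y) <= / INR n ->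
     Cmod (f (c x) - f (c y)) <= e2) ->
  (forall x y, 0 <= x <= 1 -> 0 <= y <= 1 -> Rabs (x - y) < del ->
     Cmod (f (c x) - f (c y)) <= e1) ->
  pointed_subdiv s -> 0 <= SF_h s -> seq.last (SF_h s) (SF_lx s) <= 1 ->
  seq_step (SF_lx s) < del ->
  Cmod (usum c (fun t => f (c t)) n (seq.last (SF_h s) (SF_lx s)) -
        usum c (fun t => f (c t)) n (SF_h s) - contour_sum c f s) <=
  (e1 + e2) * (l (seq.last (SF_h s) (SF_lx s)) - l (SF_h s)).
Proof.
intros Hl Hn He2 He1.
induction s as [x|h s IH] using SF_cons_ind; intros Hp H0 H1 Hs.
- simpl; unfold contour_sum; simpl.
  match goal with |- Cmod ?X <= _ => replace X with (RtoC 0) by ring end.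
  rewrite Cmod_0; right; ring.
- assert (E : seq.last (SF_h (SF_cons h s)) (SF_lx (SF_cons h s))
              = seq.last (SF_h s) (SF_lx s)) by reflexivity.
  rewrite E in *; clear E.
  pose proof (Hp O) as P0; rewrite SF_size_cons in P0; specialize (P0 ltac:(apply Nat.lt_0_succ)).
  simpl in P0, H0.
  pose proof (ptd_cons _ _ Hp) as Hp'.
  pose proof (pointed_head_le_last s Hp') as Hhl.
  assert (Hst : Rmax (Rabs (SF_h s - fst h)) (seq_step (SF_lx s)) < del) by exact Hs.
  assert (S1 : Rabs (SF_h s - fst h) < del) by (eapply Rle_lt_trans; [apply Rmax_l|exact Hst]).
  assert (S2 : seq_step (SF_lx s) < del) by (eapply Rle_lt_trans; [apply Rmax_r|exact Hst]).
  specialize (IH Hp' ltac:(lra) H1 S2).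
  rewrite contour_sum_cons; simpl (SF_h (SF_cons h s)).
  set (U := usum c (fun t => f (c t)) n) in *.
  assert (K : Cmod (U (SF_h s) - U (fst h) - f (c (snd h)) * (c (SF_h s) - c (fst h)))
     <= (e1 + e2) * (l (SF_h s) - l (fst h))).
  { apply (usum_local c (fun t => f (c t)) l); auto; try lra.
    rewrite Rabs_pos_eq in S1 by lra.
    intros x Hx; apply He1; try lra; unfold Rabs; destruct Rcase_abs; lra. }
  set (la := seq.last (SF_h s) (SF_lx s)) in *.
  replace (U la - U (fst h) - (f (c (snd h)) * (c (SF_h s) - c (fst h)) + contour_sum c f s))%C
    with ((U (SF_h s) - U (fst h) - f (c (snd h)) * (c (SF_h s) - c (fst h))) +
          (U la - U (SF_h s) - contour_sum c f s))%C by ring.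
  eapply Rle_trans; [apply Cmod_triangle|]; simpl; lra.
Qed.

Lemma is_contour_int_usum_limit (c : R -> C) (f : C -> C) (l : R -> R) (I : C) :
  length_bound c l -> Rcont_on 0 1 (fun t => f (c t)) ->
  (forall eps, 0 < eps -> exists N, forall n, (N <= n)%nat ->
    Cmod (usum c (fun t => f (c t)) n 1 - I) <= eps) ->
  is_contour_int c f I.
Proof.
intros Hl Hphi HI.
pose proof (length_bound_mono c l 0 1 Hl ltac:(lra) ltac:(lra) ltac:(lra)) as HL.
apply (filterlim_Cmod _ _ _ _ (@filter_filter _ _ (Riemann_fine_filter 0 1))).
intros eps He.
set (e := eps / (4 * (l 1 - l 0 + 1))).
assert (He' : 0 < e) by (unfold e; apply Rdiv_lt_0_compat; lra).
destruct (Rcont_on_unif 0 1 _ Hphi e He') as [del [Hd K]].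
destruct (unif_inv_nat _ Hphi e He') as [n0 H0].
destruct (HI (eps / 4)) as [N HN]; [lra|].
set (n := max n0 N).
destruct (H0 n ltac:(unfold n; lia)) as [Hn1 Hn2].
specialize (HN n ltac:(unfold n; lia)).
exists (mkposreal del Hd); intros s Hs [Hp [Hh Hla]].
rewrite Rmin_left in Hh by lra; rewrite Rmax_right in Hla by lra.
assert (S : Cmod (usum c (fun t => f (c t)) n (seq.last (SF_h s) (SF_lx s)) -
        usum c (fun t => f (c t)) n (SF_h s) - contour_sum c f s) <=
  (e + e) * (l (seq.last (SF_h s) (SF_lx s)) - l (SF_h s))).
{ apply contour_sum_usum with (del := del); auto; try lra.
  intros x y Hx Hy Hxy; left; auto. }
rewrite Hla, Hh, usum_0 in S by auto.
replace (contour_sum c f s - I)%C with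
  ((usum c (fun t => f (c t)) n 1 - I) -
   (usum c (fun t => f (c t)) n 1 - 0 - contour_sum c f s))%C by ring.
eapply Rle_lt_trans; [apply Cmod_triangle_minus|].
assert ((e + e) * (l 1 - l 0) <= eps / 2).
{ apply Rle_trans with ((e + e) * (l 1 - l 0 + 1)); [apply Rmult_le_compat_l; lra|].
  right; unfold e; field; lra. }
lra.
Qed.

Lemma contour_int_unique (c : R -> C) (f : C -> C) (I : C) :
  is_contour_int c f I -> contour_int c f = I.
Proof.
intros H; unfold contour_int, is_contour_int.
apply (@iota_filterlim_locally C_AbsRing C_CompleteNormedModule SF_seq (Riemann_fine 0 1)); auto.
apply Proper_StrongProper, Riemann_fine_filter.
Qed.

Definition regular_curve (c : R -> C) : Prop :=
  Rcont_on 0 1 c /\ rectifiable c.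

Definition cont_on_curve (c : R -> C) (f : C -> C) : Prop :=
  forall z, on_curve c z -> ccont_on (on_curve c) f z.

Lemma on_curve_c (c : R -> C) (t : R) : 0 <= t <= 1 -> on_curve c (c t).
Proof. intros H; exists t; auto. Qed.

Lemma cont_on_curve_Rcont (c : R -> C) (f : C -> C) :
  Rcont_on 0 1 c -> cont_on_curve c f -> Rcont_on 0 1 (fun t => f (c t)).
Proof.
intros Hc Hf t Ht eps He.
destruct (Hf (c t) (on_curve_c c t Ht) eps He) as [d [Hd K]].
destruct (Hc t Ht d Hd) as [d' [Hd' K']].
exists d'; split; auto; intros s Hs Hst; apply K; auto using on_curve_c.
Qed.

Lemma contour_int_usum (c : R -> C) (f : C -> C) :
  regular_curve c -> cont_on_curve c f ->
  forall eps, 0 < eps -> exists N, forall n, (N <= n)%nat ->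
    Cmod (usum c (fun t => f (c t)) n 1 - contour_int c f) <= eps.
Proof.
intros [Hc Hr] Hf; destruct (rectifiable_length c Hr) as [l Hl].
pose proof (cont_on_curve_Rcont c f Hc Hf) as Hphi.
destruct (usum_limit c _ l Hl Hphi) as [I HI].
pose proof (is_contour_int_usum_limit c f l I Hl Hphi HI) as H.
now rewrite (contour_int_unique c f I H).
Qed.

Lemma contour_int_partition (c : R -> C) (f : C -> C) (l : R -> R) (N : nat)
  (t : nat -> R) (e : R) :
  regular_curve c -> length_bound c l -> cont_on_curve c f -> t O = 0 -> t N = 1 ->
  (forall k, (k < N)%nat -> t k <= t (S k)) ->
  (forall k x, (k < N)%nat -> t k <= x <= t (S k) -> Cmod (f (c x) - f (c (t k))) <= e) ->
  Cmod (contour_int c f - Csum N (fun k => f (c (t k)) * (c (t (S k)) - c (t k)))%C)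
  <= e * (l 1 - l 0).
Proof.
intros Hr Hl Hf H0 H1 Hm He.
pose proof (length_bound_mono c l 0 1 Hl ltac:(lra) ltac:(lra) ltac:(lra)) as HL.
pose proof (cont_on_curve_Rcont c f (proj1 Hr) Hf) as Hphi.
apply le_epsilon; intros eps Heps.
set (e' := eps / (2 * (l 1 - l 0 + 1))).
assert (He' : 0 < e') by (unfold e'; apply Rdiv_lt_0_compat; lra).
destruct (unif_inv_nat _ Hphi e' He') as [n0 K0].
destruct (contour_int_usum c f Hr Hf (eps / 2)) as [n1 K1]; [lra|].
set (n := max n0 n1).
destruct (K0 n ltac:(unfold n; lia)) as [Hn1 Hn2]; specialize (K1 n ltac:(unfold n; lia)).
pose proof (usum_partition c (fun t => f (c t)) l n N t e e' Hl Hn1 H0 H1 Hm He Hn2) as P.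
eapply Rle_trans; [apply (Cmod_dist_triangle _ (usum c (fun t => f (c t)) n 1))|].
rewrite (Cmod_minus_sym (contour_int c f)).
assert (e' * (l 1 - l 0) <= eps / 2).
{ apply Rle_trans with (e' * (l 1 - l 0 + 1)); [apply Rmult_le_compat_l; lra|].
  right; unfold e'; field; lra. }
lra.
Qed.

Lemma contour_int_bound (c : R -> C) (f : C -> C) (l : R -> R) (M : R) :
  regular_curve c -> length_bound c l -> cont_on_curve c f ->
  (forall z, on_curve c z -> Cmod (f z) <= M) ->
  Cmod (contour_int c f) <= M * (l 1 - l 0).
Proof.
intros Hr Hl Hf HM.
apply le_epsilon; intros eps Heps.
destruct (contour_int_usum c f Hr Hf eps Heps) as [n1 K1].
specialize (K1 (S n1) ltac:(lia)).
rewrite usum_uniform in K1 by lia.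
set (n := S n1) in *.
set (S := Csum n _) in K1.
assert (HS : Cmod S <= M * (l 1 - l 0)).
{ unfold S; eapply Rle_trans; [apply Cmod_Csum|].
  replace (l 1 - l 0) with (Rsum n (fun k => l (ugrid n (Datatypes.S k)) - l (ugrid n k))).
  2:{ rewrite (Rsum_telescope n (fun k => l (ugrid n k))).
      f_equal; f_equal; unfold ugrid; simpl INR; [field|unfold Rdiv; ring].
      apply (not_0_INR n); unfold n; lia. }
  rewrite <- Rsum_scal; apply Rsum_le; intros k Hk.
  pose proof (ugrid_range n k ltac:(unfold n; lia) ltac:(lia)).
  pose proof (ugrid_range n (Datatypes.S k) ltac:(unfold n; lia) ltac:(lia)).
  rewrite Cmod_mult; apply Rmult_le_compat; try apply Cmod_ge_0.
  - apply HM, on_curve_c; auto.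
  - apply Hl; try lra.
    rewrite ugrid_S by (unfold n; lia).
    enough (0 < / INR n) by lra; apply Rinv_0_lt_compat, lt_0_INR; unfold n; lia. }
replace (contour_int c f) with (S - (S - contour_int c f))%C by ring.
eapply Rle_trans; [apply Cmod_triangle_minus|lra].
Qed.

Lemma Cmod_le_eps_eq (x y : C) : (forall eps, 0 < eps -> Cmod (x - y) <= eps) -> x = y.
Proof.
intros H.
assert (E : Cmod (x - y) = 0).
{ apply Rle_antisym; [|apply Cmod_ge_0]; apply le_epsilon; intros; rewrite Rplus_0_l; auto. }
apply Cmod_eq_0 in E; replace x with ((x - y) + y)%C by ring; rewrite E; ring.
Qed.

Lemma usum_linear (c phi psi : R -> C) (a b : C) (n : nat) (t : R) :
  usum c (fun s => a * phi s + b * psi s)%C n t =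
  (a * usum c phi n t + b * usum c psi n t)%C.
Proof.
unfold usum; rewrite <- !Csum_scal, <- Csum_plus; apply Csum_ext; intros; ring.
Qed.

Lemma contour_int_linear (c : R -> C) (f g : C -> C) (a b : C) :
  regular_curve c -> cont_on_curve c f -> cont_on_curve c g ->
  contour_int c (fun s => a * f s + b * g s)%C =
  (a * contour_int c f + b * contour_int c g)%C.
Proof.
intros Hr Hf Hg.
assert (Hfg : cont_on_curve c (fun s => a * f s + b * g s)%C).
{ intros z Hz; apply ccont_on_plus; apply ccont_on_mult;
    auto using ccont_on_const. }
apply Cmod_le_eps_eq; intros eps He.
pose proof (Cmod_ge_0 a); pose proof (Cmod_ge_0 b).
set (e := eps / (Cmod a + Cmod b + 1)).
assert (He' : 0 < e) by (apply Rdiv_lt_0_compat; lra).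
destruct (contour_int_usum c f Hr Hf e He') as [n1 K1].
destruct (contour_int_usum c g Hr Hg e He') as [n2 K2].
destruct (contour_int_usum c _ Hr Hfg e He') as [n3 K3].
set (n := max n1 (max n2 n3)).
specialize (K1 n ltac:(unfold n; lia)); specialize (K2 n ltac:(unfold n; lia)).
specialize (K3 n ltac:(unfold n; lia)).
rewrite (usum_linear c (fun t => f (c t)) (fun t => g (c t))) in K3.
set (u1 := usum c (fun t => f (c t)) n 1) in *.
set (u2 := usum c (fun t => g (c t)) n 1) in *.
set (I3 := contour_int c (fun s => a * f s + b * g s)%C) in *.
replace (I3 - (a * contour_int c f + b * contour_int c g))%C with
  (a * (u1 - contour_int c f) + b * (u2 - contour_int c g) - (a * u1 + b * u2 - I3))%C by ring.
eapply Rle_trans; [apply Cmod_triangle_minus|].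
eapply Rle_trans; [apply Rplus_le_compat_r, Cmod_triangle|].
rewrite !Cmod_mult.
assert (Cmod a * Cmod (u1 - contour_int c f) <= Cmod a * e) by (apply Rmult_le_compat_l; lra).
assert (Cmod b * Cmod (u2 - contour_int c g) <= Cmod b * e) by (apply Rmult_le_compat_l; lra).
assert (e * (Cmod a + Cmod b + 1) = eps) by (unfold e; field; lra).
nra.
Qed.

Lemma contour_int_ext (c : R -> C) (f g : C -> C) :
  regular_curve c -> cont_on_curve c f ->
  (forall z, on_curve c z -> f z = g z) -> contour_int c f = contour_int c g.
Proof.
intros Hr Hf Hfg.
assert (Hg : cont_on_curve c g).
{ intros z Hz; apply (ccont_on_ext_loc _ f g z 1); auto; lra. }
apply Cmod_le_eps_eq; intros eps He.
destruct (contour_int_usum c f Hr Hf (eps / 2)) as [n1 K1]; [lra|].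
destruct (contour_int_usum c g Hr Hg (eps / 2)) as [n2 K2]; [lra|].
set (n := S (max n1 n2)).
specialize (K1 n ltac:(unfold n; lia)); specialize (K2 n ltac:(unfold n; lia)).
assert (E : usum c (fun t => f (c t)) n 1 = usum c (fun t => g (c t)) n 1).
{ rewrite !usum_uniform by (unfold n; lia); apply Csum_ext; intros k Hk.
  rewrite Hfg; auto; apply on_curve_c, ugrid_range; unfold n in *; lia. }
rewrite E in K1.
eapply Rle_trans; [apply (Cmod_dist_triangle _ (usum c (fun t => g (c t)) n 1))|].
rewrite (Cmod_minus_sym (contour_int c f)); lra.
Qed.

(** * Covering a rectifiable curve by small discs *)

(** Finite upper Minkowski content of dimension one, expressed by covering numbers. This form is
    independent of any parametrization and applies equally to single points and finite unions. *)
Definition thin (E : C -> Prop) : Prop :=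
  exists K : R, 0 <= K /\ forall sig : R, 0 < sig <= 1 ->
    exists (N : nat) (p : nat -> C), INR N <= K / sig /\
      forall z, E z -> exists k, (k < N)%nat /\ Cmod (z - p k) <= sig.

(* The pieces are cut where the arc length passes the multiples of [sig]. *)
Lemma curve_partition (c : R -> C) (l : R -> R) (sig : R) :
  Rcont_on 0 1 c -> length_bound c l -> 0 < sig ->
  exists (N : nat) (t : nat -> R), t O = 0 /\ t N = 1 /\
    (forall k, 0 <= t k <= 1) /\
    (forall k, t k <= t (S k)) /\
    (forall k x, t k <= x <= t (S k) -> Cmod (c x - c (t k)) <= sig) /\
    INR N <= (l 1 - l 0) / sig + 2.
Proof.
intros Hc Hl Hs.
assert (HL : l 0 <= l 1) by (apply (length_bound_mono c); auto; lra).
set (E := fun (k : nat) (t : R) => 0 <= t <= 1 /\ l t <= l 0 + INR k * sig).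
assert (HE : forall k, exists m, is_lub (E k) m).
{ intros k; destruct (completeness (E k)) as [m Hm]; [| |now exists m].
  - exists 1; intros x [Hx _]; lra.
  - exists 0; split; [lra|]; pose proof (pos_INR k); nra. }
destruct (choice _ HE) as [m Hm].
assert (Hm01 : forall k, 0 <= m k <= 1).
{ intros k; destruct (Hm k) as [A B]; split.
  - apply A; split; [lra|]; pose proof (pos_INR k); nra.
  - apply B; intros x [Hx _]; lra. }
set (t := fun k => match k with O => 0 | S j => m j end).
(* [up] exceeds its argument by at most 1; together with the initial piece this is the [+ 2] in the
   bound of [N]. *)
set (N0 := Z.to_nat (up ((l 1 - l 0) / sig))).
assert (Hq : 0 <= (l 1 - l 0) / sig) by (apply Rdiv_le_0_compat; lra).
destruct (archimed ((l 1 - l 0) / sig)) as [Hup1 Hup2].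
assert (HN0 : INR N0 = IZR (up ((l 1 - l 0) / sig))).
{ unfold N0; rewrite INR_IZR_INZ, Z2Nat.id; auto.
  apply le_IZR; lra. }
exists (S N0), t; split; [reflexivity|]; split; [|split; [|split; [|split]]].
- simpl; apply Rle_antisym; [apply Hm01|].
  apply (proj1 (Hm N0)); split; [lra|]; rewrite HN0.
  apply Rlt_le in Hup1.
  assert ((l 1 - l 0) / sig * sig = l 1 - l 0) by (field; lra).
  assert ((l 1 - l 0) / sig * sig <= IZR (up ((l 1 - l 0) / sig)) * sig)
    by (apply Rmult_le_compat_r; lra).
  lra.
- intros [|k]; simpl; [lra|apply Hm01].
- intros [|k]; simpl; [apply Hm01|].
  apply (proj2 (Hm k)); intros x [Hx Hx2]; apply (proj1 (Hm (S k))); split; auto.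
  rewrite S_INR; lra.
- intros k x Hx.
  (* [l] may jump at the cut points, so the increment is bounded by [sig] strictly between two of
     them; continuity of [c] then reaches the end points. *)
  assert (Hopen : forall s s', t k < s -> s <= s' -> s' < t (S k) -> Cmod (c s' - c s) <= sig).
  { intros s s' H1 H2 H3.
    assert (0 <= t k) by (destruct k; simpl; [lra|apply Hm01]).
    assert (t (S k) <= 1) by (simpl; apply Hm01).
    assert (Rs : 0 <= s) by lra.
    assert (Rs' : s' <= 1) by lra.
    eapply Rle_trans; [apply Hl; lra|].
    assert (Hup : l s' <= l 0 + INR k * sig).
    { apply NNPP; intros Hn; apply Rnot_le_lt in Hn.
      assert (m k <= s'); [|simpl in H3; lra].
      apply (proj2 (Hm k)); intros y [Hy Hy2].
      apply Rnot_lt_le; intros Hlt.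
      assert (l s' <= l y) by (apply (length_bound_mono c); auto; lra); lra. }
    destruct k as [|k].
    - simpl in Hup, H1.
      assert (l 0 <= l s) by (apply (length_bound_mono c l 0 s Hl); lra).
      lra.
    - assert (l 0 + INR k * sig < l s); [|rewrite S_INR in Hup; lra].
      apply Rnot_le_lt; intros Hn; simpl in H1.
      assert (s <= m k) by (apply (proj1 (Hm k)); split; [lra|auto]); lra. }
  destruct (Req_dec x (t k)) as [->|Hne].
  { replace (c (t k) - c (t k))%C with (RtoC 0) by ring; rewrite Cmod_0; lra. }
  assert (Htk : 0 <= t k) by (destruct k; simpl; [lra|apply Hm01]).
  assert (HtS : t (S k) <= 1) by (simpl; apply Hm01).
  apply le_epsilon; intros eps He.
  destruct (Rcont_on_unif 0 1 c Hc (eps / 2) ltac:(lra)) as [d [Hd Kd]].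
  set (eta := Rmin (d / 2) ((x - t k) / 2)).
  assert (He1 : 0 < eta) by (unfold eta; apply Rmin_glb_lt; lra).
  assert (eta <= d / 2) by apply Rmin_l.
  assert (eta <= (x - t k) / 2) by apply Rmin_r.
  eapply Rle_trans; [apply (Cmod_dist_triangle _ (c (x - eta)))|].
  eapply Rle_trans; [apply Rplus_le_compat_l, (Cmod_dist_triangle _ (c (t k + eta)))|].
  assert (Cmod (c x - c (x - eta)) < eps / 2).
  { apply Kd; try lra; rewrite Rabs_pos_eq; lra. }
  assert (Cmod (c (t k + eta) - c (t k)) < eps / 2).
  { apply Kd; try lra; rewrite Rabs_pos_eq; lra. }
  assert (Cmod (c (x - eta) - c (t k + eta)) <= sig) by (apply Hopen; lra).
  lra.
- rewrite S_INR, HN0; lra.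
Qed.

Lemma partition_find (N : nat) (t : nat -> R) (x : R) :
  t O <= x -> x <= t N -> (0 < N)%nat ->
  exists k, (k < N)%nat /\ t k <= x <= t (S k).
Proof.
induction N as [|N IH]; intros H0 H1 HN; [lia|].
destruct (Rle_lt_dec (t N) x) as [H|H].
- exists N; split; [lia|lra].
- destruct N as [|N]; [lra|].
  destruct IH as [k [Hk K]]; [auto|lra|lia|]; exists k; split; [lia|auto].
Qed.

Lemma thin_curve (c : R -> C) : regular_curve c -> thin (on_curve c).
Proof.
intros [Hc Hr]; destruct (rectifiable_length c Hr) as [l Hl].
assert (HL : l 0 <= l 1) by (apply (length_bound_mono c); auto; lra).
exists (l 1 - l 0 + 2); split; [lra|]; intros sig Hs.
destruct (curve_partition c l sig Hc Hl ltac:(lra)) as [N [t [H0 [H1 [H01 [Hm [Ho HN]]]]]]].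
exists N, (fun k => c (t k)); split.
- eapply Rle_trans; [exact HN|]; unfold Rdiv; rewrite Rmult_plus_distr_r.
  apply Rplus_le_compat_l.
  assert (1 <= / sig) by (rewrite <- Rinv_1; apply Rinv_le_contravar; lra); lra.
- intros z [x [Hx <-]].
  destruct (partition_find N t x) as [k [Hk K]].
  + unfold unit_interval in Hx; lra.
  + unfold unit_interval in Hx; lra.
  + destruct N; [lra|lia].
  + exists k; split; auto.
Qed.

Lemma thin_single (a : C) : thin (fun z => z = a).
Proof.
exists 1; split; [lra|]; intros sig Hs; exists 1%nat, (fun _ => a); split.
- simpl; apply Rmult_le_reg_r with sig; [lra|]; unfold Rdiv.
  rewrite Rmult_assoc, Rinv_l; lra.
- intros z ->; exists O; split; [lia|].
  replace (a - a)%C with (RtoC 0) by ring; rewrite Cmod_0; lra.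
Qed.

Lemma thin_union (E F : C -> Prop) : thin E -> thin F -> thin (fun z => E z \/ F z).
Proof.
intros [K1 [P1 H1]] [K2 [P2 H2]]; exists (K1 + K2); split; [lra|]; intros sig Hs.
destruct (H1 sig Hs) as [N1 [p1 [B1 C1]]]; destruct (H2 sig Hs) as [N2 [p2 [B2 C2]]].
exists (N1 + N2)%nat, (fun k => if lt_dec k N1 then p1 k else p2 (k - N1)%nat); split.
- rewrite plus_INR; unfold Rdiv in *; lra.
- intros z [Hz|Hz].
  + destruct (C1 z Hz) as [k [Hk Kz]]; exists k; split; [lia|].
    destruct (lt_dec k N1); [auto|lia].
  + destruct (C2 z Hz) as [k [Hk Kz]]; exists (N1 + k)%nat; split; [lia|].
    destruct (lt_dec (N1 + k) N1); [lia|].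
    replace (N1 + k - N1)%nat with k by lia; auto.
Qed.

(** * The interior and the exterior *)

(** Around each parameter the radius is chosen so small that it is also a lower bound for the
    distance to [z]; the uniform radius from [interval_cover] then bounds all distances. *)
Lemma curve_dist_pos (c : R -> C) (z : C) : Rcont_on 0 1 c -> ~ on_curve c z ->
  exists r, 0 < r /\ forall s, on_curve c s -> r <= Cmod (s - z).
Proof.
intros Hc Hz.
destruct (interval_cover 0 1 (fun t d => forall s, 0 <= s <= 1 -> Rabs (s - t) < d ->
    d <= Cmod (c s - z))) as [e [He K]].
{ intros t Ht.
  assert (Hp : 0 < Cmod (c t - z)).
  { apply Cmod_gt_0; intros E; apply Hz; exists t; split; auto.
    replace (c t) with ((c t - z) + z)%C by ring; rewrite E; ring. }
  destruct (Hc t Ht (Cmod (c t - z) / 2) ltac:(lra)) as [d [Hd Kd]].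
  exists (Rmin d (Cmod (c t - z) / 2)); split; [apply Rmin_glb_lt; lra|].
  intros s Hs Hst.
  assert (Kst := Kd s Hs (Rlt_le_trans _ _ _ Hst (Rmin_l _ _))).
  eapply Rle_trans; [apply Rmin_r|].
  pose proof (Cmod_dist_triangle (c t) (c s) z).
  rewrite (Cmod_minus_sym (c t) (c s)) in H; lra. }
exists e; split; auto; intros s [x [Hx <-]].
destruct (K x Hx) as [t [d [Ht [Q [H1 H2]]]]].
specialize (Q x Hx H1); lra.
Qed.

Lemma curve_bounded (c : R -> C) : regular_curve c ->
  exists M, 0 < M /\ forall s, on_curve c s -> Cmod s <= M.
Proof.
intros [Hc Hr]; destruct (rectifiable_length c Hr) as [l Hl].
assert (HL : l 0 <= l 1) by (apply (length_bound_mono c); auto; lra).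
pose proof (Cmod_ge_0 (c 0)).
exists (Cmod (c 0) + (l 1 - l 0) + 1); split; [lra|].
intros s [t [[H0 H1] <-]].
replace (c t) with (c 0 + (c t - c 0))%C by ring.
eapply Rle_trans; [apply Cmod_triangle|].
assert (Cmod (c t - c 0) <= l t - l 0) by (apply Hl; lra).
assert (l t <= l 1) by (apply (length_bound_mono c); auto; lra); lra.
Qed.

Lemma connected_off_sym (c : R -> C) (a b : C) : connected_off c a b -> connected_off c b a.
Proof.
intros [p [Hp [H0 [H1 Ho]]]]; exists (fun t => p (1 - t)); split; [|split; [|split]].
- apply continuous_on_Rcont_on in Hp; apply Rcont_on_continuous_on.
  intros t Ht eps He; destruct (Hp (1 - t) ltac:(lra) eps He) as [d [Hd K]].
  exists d; split; auto; intros s Hs Hst; apply K; [lra|].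
  replace (1 - s - (1 - t)) with (- (s - t)) by ring; now rewrite Rabs_Ropp.
- now rewrite Rminus_0_r.
- now rewrite Rminus_diag.
- intros t Ht; apply Ho; unfold unit_interval in *; lra.
Qed.

(** The concatenation is written [p (min 1 (2t)) + r (max 0 (2t - 1)) - y]: at every time one of the
    two paths rests at [y], and continuity is that of a sum, with no gluing at [1/2]. *)
Lemma connected_off_trans (c : R -> C) (x y z : C) :
  connected_off c x y -> connected_off c y z -> connected_off c x z.
Proof.
intros [p [Hp [P0 [P1 Po]]]] [r [Hr [R0 [R1 Ro]]]].
apply continuous_on_Rcont_on in Hp, Hr.
exists (fun t => p (Rmin 1 (2 * t)) + r (Rmax 0 (2 * t - 1)) - y)%C.
split; [|split; [|split]].
- apply Rcont_on_continuous_on; intros t Ht eps He.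
  destruct (Hp (Rmin 1 (2 * t))) with (eps := eps / 2) as [d1 [Hd1 K1]]; [|lra|].
  { split; [apply Rmin_glb; lra|apply Rmin_l]. }
  destruct (Hr (Rmax 0 (2 * t - 1))) with (eps := eps / 2) as [d2 [Hd2 K2]]; [|lra|].
  { split; [apply Rmax_l|apply Rmax_lub; lra]. }
  exists (Rmin d1 d2 / 2); split.
  { apply Rdiv_lt_0_compat; [now apply Rmin_glb_lt|lra]. }
  intros s Hs Hst.
  assert (Rmin d1 d2 <= d1) by apply Rmin_l.
  assert (Rmin d1 d2 <= d2) by apply Rmin_r.
  replace (_ - _)%C with ((p (Rmin 1 (2 * s)) - p (Rmin 1 (2 * t))) +
     (r (Rmax 0 (2 * s - 1)) - r (Rmax 0 (2 * t - 1))))%C by ring.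
  eapply Rle_lt_trans; [apply Cmod_triangle|].
  assert (Cmod (p (Rmin 1 (2 * s)) - p (Rmin 1 (2 * t))) < eps / 2).
  { apply K1; [split; [apply Rmin_glb; lra|apply Rmin_l]|].
    assert (Hst1 : 2 * Rabs (s - t) < d1) by lra.
    clear - Hst1; unfold Rmin, Rabs in *.
    destruct (Rle_dec 1 (2 * s)); destruct (Rle_dec 1 (2 * t));
      repeat destruct Rcase_abs; lra. }
  assert (Cmod (r (Rmax 0 (2 * s - 1)) - r (Rmax 0 (2 * t - 1))) < eps / 2).
  { apply K2; [split; [apply Rmax_l|apply Rmax_lub; lra]|].
    assert (Hst2 : 2 * Rabs (s - t) < d2) by lra.
    clear - Hst2; unfold Rmax, Rabs in *.
    destruct (Rle_dec 0 (2 * s - 1)); destruct (Rle_dec 0 (2 * t - 1));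
      repeat destruct Rcase_abs; lra. }
  lra.
- rewrite Rmin_right, Rmax_left by lra; rewrite Rmult_0_r, P0, R0; ring.
- rewrite Rmin_left, Rmax_right by lra; replace (2 * 1 - 1) with 1 by ring.
  rewrite P1, R1; ring.
- intros t Ht; unfold unit_interval in Ht.
  destruct (Rle_dec (2 * t) 1) as [H|H].
  + rewrite Rmin_right, Rmax_left, R0 by lra.
    replace (p (2 * t)%R + y - y)%C with (p (2 * t)%R) by ring.
    apply Po; unfold unit_interval; lra.
  + rewrite Rmin_left, Rmax_right, P1 by lra.
    replace (y + r (2 * t - 1)%R - y)%C with (r (2 * t - 1)%R) by ring.
    apply Ro; unfold unit_interval; lra.
Qed.

Definition segment (a b : C) (t : R) : C := (a + RtoC t * (b - a))%C.

Lemma connected_off_segment (c : R -> C) (a b : C) :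
  (forall t, 0 <= t <= 1 -> ~ on_curve c (segment a b t)) -> connected_off c a b.
Proof.
intros H; exists (segment a b); split; [|split; [|split]]; auto.
- apply Rcont_on_continuous_on; intros t Ht eps He.
  pose proof (Cmod_ge_0 (b - a)).
  exists (eps / (Cmod (b - a) + 1)); split; [apply Rdiv_lt_0_compat; lra|].
  intros s Hs Hst; unfold segment.
  replace (_ - _)%C with (RtoC (s - t) * (b - a))%C by (rewrite RtoC_minus; ring).
  rewrite Cmod_mult, Cmod_R.
  apply Rle_lt_trans with (Rabs (s - t) * (Cmod (b - a) + 1)).
  + apply Rmult_le_compat_l; [apply Rabs_pos|lra].
  + apply Rlt_le_trans with (eps / (Cmod (b - a) + 1) * (Cmod (b - a) + 1)).
    * apply Rmult_lt_compat_r; lra.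
    * right; field; lra.
- unfold segment; ring.
- unfold segment; ring.
Qed.

Lemma connected_off_r (c : R -> C) (a b : C) : connected_off c a b -> ~ on_curve c b.
Proof. intros [p [_ [_ [<- H]]]]; apply H; unfold unit_interval; lra. Qed.

Lemma interior_connected (c : R -> C) (a b : C) :
  connected_off c a b -> interior c a -> interior c b.
Proof.
intros H [_ [M HM]]; split; [eapply connected_off_r; eauto|].
exists M; intros z Hz; apply HM; eapply connected_off_trans; eauto.
Qed.

Lemma exterior_connected (c : R -> C) (a b : C) :
  connected_off c a b -> exterior c a -> exterior c b.
Proof.
intros H [_ Ha]; split; [eapply connected_off_r; eauto|].
intros [M HM]; apply Ha; exists M; intros z Hz; apply HM.
eapply connected_off_trans; [apply connected_off_sym|]; eauto.
Qed.

Lemma off_curve_cases (c : R -> C) (z : C) :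
  ~ on_curve c z -> interior c z \/ exterior c z.
Proof. intros H; destruct (classic (bounded_component c z)); [left|right]; split; auto. Qed.

Lemma interior_not_exterior (c : R -> C) (z : C) : interior c z -> ~ exterior c z.
Proof. intros [_ H] [_ H']; auto. Qed.

Lemma off_curve_ball (c : R -> C) (z : C) : Rcont_on 0 1 c -> ~ on_curve c z ->
  exists r, 0 < r /\ forall y, Cmod (y - z) < r -> connected_off c z y.
Proof.
intros Hc Hz; destruct (curve_dist_pos c z Hc Hz) as [r [Hr K]].
exists r; split; auto; intros y Hy; apply connected_off_segment; intros t Ht Hon.
specialize (K _ Hon); unfold segment in K.
replace (z + RtoC t * (y - z) - z)%C with (RtoC t * (y - z))%C in K by ring.
rewrite Cmod_mult, Cmod_R, Rabs_pos_eq in K by lra.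
pose proof (Cmod_ge_0 (y - z)); nra.
Qed.

Lemma interior_open (c : R -> C) (z : C) : Rcont_on 0 1 c -> interior c z ->
  exists r, 0 < r /\ forall y, Cmod (y - z) < r -> interior c y.
Proof.
intros Hc Hz; destruct (off_curve_ball c z Hc (proj1 Hz)) as [r [Hr K]].
exists r; split; auto; intros y Hy; eapply interior_connected; eauto.
Qed.

Lemma exterior_open (c : R -> C) (z : C) : Rcont_on 0 1 c -> exterior c z ->
  exists r, 0 < r /\ forall y, Cmod (y - z) < r -> exterior c y.
Proof.
intros Hc Hz; destruct (off_curve_ball c z Hc (proj1 Hz)) as [r [Hr K]].
exists r; split; auto; intros y Hy; eapply exterior_connected; eauto.
Qed.

(** The outward ray from [z] avoids the disc that holds the curve and leaves every bounded set; [k]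
    makes [k z] longer than the alleged bound [B]. *)
Lemma far_exterior (c : R -> C) (M : R) (z : C) :
  0 < M -> (forall s, on_curve c s -> Cmod s <= M) -> M < Cmod z -> exterior c z.
Proof.
intros HM Hc Hz; split.
- intros H; specialize (Hc z H); lra.
- intros [B HB].
  set (k := (Rabs B + 1) / Cmod z + 1).
  pose proof (Rabs_pos B).
  assert (Hk0 : 0 <= (Rabs B + 1) / Cmod z) by (apply Rdiv_le_0_compat; lra).
  assert (Hk : 1 <= k) by (unfold k; lra).
  assert (Hco : connected_off c z (RtoC k * z)).
  { apply connected_off_segment; intros t Ht Hon; specialize (Hc _ Hon).
    unfold segment in Hc.
    replace (z + RtoC t * (RtoC k * z - z))%C with (RtoC (1 + t * (k - 1)) * z)%C in Hc
      by (rewrite RtoC_plus, RtoC_mult, RtoC_minus; ring).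
    rewrite Cmod_mult, Cmod_R, Rabs_pos_eq in Hc by nra.
    assert (0 <= t * (k - 1)) by nra; nra. }
  specialize (HB _ Hco); rewrite Cmod_mult, Cmod_R, Rabs_pos_eq in HB by lra.
  assert (k * Cmod z = Rabs B + 1 + Cmod z) by (unfold k; field; lra).
  pose proof (Rle_abs B); lra.
Qed.

(** * The closed interior: compactness and approximate projection *)

Definition closed_interior (c : R -> C) (z : C) : Prop := interior c z \/ on_curve c z.

(** Heine-Cantor for a closed bounded set, closedness being the second hypothesis. The compactness
    used is that of a square around [S]: the gauge at a point off [S] keeps clear of [S], so such a
    point is never selected for a point of [S]. *)
Lemma compact_unif (S : C -> Prop) (M : R) (f : C -> C) :
  (forall z, S z -> Cmod z <= M) ->
  (forall z, ~ S z -> exists d, 0 < d /\ forall y, Cmod (y - z) < d -> ~ S y) ->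
  (forall z, S z -> ccont_on S f z) ->
  forall eps, 0 < eps -> exists del, 0 < del /\
    forall x y, S x -> S y -> Cmod (x - y) < del -> Cmod (f x - f y) < eps.
Proof.
intros HD Hop Hf eps He.
(* The factor 4 absorbs the passage from coordinates to the modulus, which costs 2, and the distance
   from [x] to [y]. *)
assert (HQ : forall p : R * R, exists d : posreal,
  (S p -> forall x, S x -> Cmod (x - p) < 4 * d -> Cmod (f x - f p) < eps / 2) /\
  (~ S p -> forall x, Cmod (x - p) < 4 * d -> ~ S x)).
{ intros p; destruct (classic (S p)) as [Hp|Hp].
  - destruct (Hf p Hp (eps / 2) ltac:(lra)) as [d [Hd K]].
    assert (Hd4 : 0 < d / 4) by lra.
    exists (mkposreal _ Hd4); simpl; split; [|tauto]; intros _ x Hx Hxp; apply K; auto; lra.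
  - destruct (Hop p Hp) as [d [Hd K]].
    assert (Hd4 : 0 < d / 4) by lra.
    exists (mkposreal _ Hd4); simpl; split; [tauto|]; intros _ x Hxp; apply K; lra. }
destruct (choice _ HQ) as [delta Hdelta].
destruct (compactness_value_2d (-M) M (-M) M (fun u v => delta (u, v))) as [d Hd].
exists d; split; [apply cond_pos|]; intros x y Hx Hy Hxy.
pose proof (HD x Hx) as Bx.
pose proof (re_le_Cmod x) as Bx1; pose proof (Im_le_Cmod x) as Bx2.
apply NNPP; intros Hn; apply (Hd (Re x) (Im x)).
{ apply Rabs_le_between; lra. }
{ apply Rabs_le_between; lra. }
intros [u [v [Hu [Hv [H1 [H2 H3]]]]]]; apply Hn; clear Hn.
destruct (Hdelta (u, v)) as [K1 K2].
set (e := delta (u, v)) in *.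
assert (Hxu : Cmod (x - (u, v)) < 2 * e).
{ eapply Rle_lt_trans; [apply Cmod_Re_Im|].
  change (Rabs (Re x - u) + Rabs (Im x - v) < 2 * e); lra. }
destruct (classic (S (u, v))) as [Hc|Hc].
- assert (Cmod (f x - f (u, v)) < eps / 2).
  { apply (K1 Hc); auto; pose proof (cond_pos e); lra. }
  assert (Cmod (f y - f (u, v)) < eps / 2).
  { apply (K1 Hc); auto.
    eapply Rle_lt_trans; [apply (Cmod_dist_triangle _ x)|].
    rewrite (Cmod_minus_sym y x); pose proof (cond_pos e); lra. }
  eapply Rle_lt_trans; [apply (Cmod_dist_triangle _ (f (u, v)))|].
  rewrite (Cmod_minus_sym (f (u, v))); lra.
- exfalso; apply (K2 Hc x); auto; pose proof (cond_pos e); lra.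
Qed.

Lemma closed_interior_compl_open (c : R -> C) (z : C) :
  Rcont_on 0 1 c -> ~ closed_interior c z ->
  exists d, 0 < d /\ forall y, Cmod (y - z) < d -> ~ closed_interior c y.
Proof.
intros Hc Hz; unfold closed_interior in Hz.
destruct (off_curve_cases c z) as [Hi|Hi]; try tauto.
destruct (exterior_open c z Hc Hi) as [d [Hd K]].
exists d; split; auto; intros y Hy [H|H]; specialize (K y Hy).
- eapply interior_not_exterior; eauto.
- now apply (proj1 K).
Qed.

Lemma closed_interior_bounded (c : R -> C) : regular_curve c ->
  exists M, 0 < M /\ forall z, closed_interior c z -> Cmod z <= M.
Proof.
intros Hr; destruct (curve_bounded c Hr) as [M [HM HMc]].
exists M; split; auto; intros z [Hz|Hz]; auto; apply Rnot_lt_le; intros Hlt.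
eapply interior_not_exterior; eauto; eapply far_exterior; eauto.
Qed.

(** Serves to extend functions from the closed interior to the plane. Off the closed interior the
    distance to the curve has a positive infimum, so some point of the curve is less than twice that
    far, and it replaces a nearest point. [pr] is in general discontinuous. *)
Lemma curve_projection (c : R -> C) : regular_curve c ->
  exists pr : C -> C, forall z, closed_interior c (pr z) /\
    (closed_interior c z -> pr z = z) /\
    (forall s, on_curve c s -> Cmod (pr z - z) <= 2 * Cmod (s - z)).
Proof.
intros Hr; apply (choice (fun z p => closed_interior c p /\
  (closed_interior c z -> p = z) /\
  (forall s, on_curve c s -> Cmod (p - z) <= 2 * Cmod (s - z)))); intros z.
destruct (classic (closed_interior c z)) as [Hz|Hz].
- exists z; repeat split; auto; intros s _.
  replace (z - z)%C with (RtoC 0) by ring; rewrite Cmod_0.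
  pose proof (Cmod_ge_0 (s - z)); lra.
- assert (Hon : ~ on_curve c z) by (unfold closed_interior in Hz; tauto).
  destruct (curve_dist_pos c z (proj1 Hr) Hon) as [r [Hr0 K]].
  (* [m] is minus the distance from [z] to the curve. *)
  destruct (completeness (fun x => exists s, on_curve c s /\ x = - Cmod (s - z))) as [m [Hm1 Hm2]].
  + exists 0; intros x [s [_ ->]]; pose proof (Cmod_ge_0 (s - z)); lra.
  + exists (- Cmod (c 0 - z)), (c 0); split; auto; apply on_curve_c; lra.
  + assert (Hmr : m <= - r) by (apply Hm2; intros x [s [Hs ->]]; specialize (K s Hs); lra).
    destruct (classic (exists s, on_curve c s /\ 2 * m < - Cmod (s - z))) as [[s [Hs Hsm]]|Hn].
    * exists s; split; [right; auto|]; split; [tauto|]; intros s' Hs'.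
      assert (- Cmod (s' - z) <= m) by (apply Hm1; eauto); lra.
    * exfalso; assert (m <= 2 * m); [|lra].
      apply Hm2; intros x [s [Hs ->]]; apply Rnot_lt_le; intros H; apply Hn; eauto.
Qed.

(** * Integrals along the sides of rectangles *)

Definition cRInt (g : R -> C) (a b : R) : C := @RInt C_R_CompleteNormedModule g a b.

Lemma norm_C_R (x : C) : @norm R_AbsRing C_R_NormedModule x = Cmod x.
Proof. symmetry; apply Cmod_norm. Qed.

(** Integrability is obtained from two-sided continuity; [cl] clamps the argument to [[a, b]] and so
    extends [g] continuously beyond the end points. *)
Lemma cRInt_ex (g : R -> C) (a b : R) : a <= b -> Rcont_on a b g ->
  @ex_RInt C_R_NormedModule g a b.
Proof.
intros Hab H.
set (cl := fun t => Rmax a (Rmin b t)).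
apply (@ex_RInt_ext C_R_NormedModule (fun t => g (cl t))).
{ intros x Hx; rewrite Rmin_left, Rmax_right in Hx by lra.
  unfold cl; rewrite Rmin_right, Rmax_right by lra; easy. }
apply (@ex_RInt_continuous C_R_CompleteNormedModule); intros t Ht.
apply (filterlim_Cmod _ _ _ _ (@filter_filter _ _ (locally_filter t))); intros eps He.
assert (Hcl : forall s, a <= cl s <= b).
{ intros s; unfold cl; split; [apply Rmax_l|apply Rmax_lub; [lra|apply Rmin_l]]. }
destruct (H (cl t) (Hcl t) eps He) as [d [Hd K]].
exists (mkposreal d Hd); intros s Hs; apply K; auto.
assert (Hst : Rabs (s - t) < d) by exact Hs.
eapply Rle_lt_trans; [|exact Hst].
unfold cl, Rmax, Rmin, Rabs.
destruct (Rle_dec b s); destruct (Rle_dec b t);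
  repeat (destruct Rle_dec); repeat destruct Rcase_abs; lra.
Qed.

Lemma cRInt_bound (g : R -> C) (a b M : R) : a <= b -> Rcont_on a b g ->
  (forall x, a <= x <= b -> Cmod (g x) <= M) -> Cmod (cRInt g a b) <= (b - a) * M.
Proof.
intros Hab Hg HM; rewrite <- norm_C_R.
apply (@norm_RInt_le_const C_R_NormedModule g a b); auto.
- intros x Hx; rewrite norm_C_R; auto.
- apply (@RInt_correct C_R_CompleteNormedModule), cRInt_ex; auto.
Qed.

Lemma cRInt_Chasles (g : R -> C) (a b d : R) : a <= b -> b <= d -> Rcont_on a d g ->
  cRInt g a d = (cRInt g a b + cRInt g b d)%C.
Proof.
intros Hab Hbd Hg; symmetry.
apply (@RInt_Chasles C_R_CompleteNormedModule); apply cRInt_ex; auto.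
- intros t Ht eps He; destruct (Hg t ltac:(lra) eps He) as [e [He' K]].
  exists e; split; auto; intros; apply K; lra.
- intros t Ht eps He; destruct (Hg t ltac:(lra) eps He) as [e [He' K]].
  exists e; split; auto; intros; apply K; lra.
Qed.

Lemma cRInt_ext (f g : R -> C) (a b : R) : a <= b ->
  (forall x, a <= x <= b -> f x = g x) -> cRInt f a b = cRInt g a b.
Proof.
intros Hab H; apply (@RInt_ext C_R_CompleteNormedModule); intros x Hx.
rewrite Rmin_left, Rmax_right in Hx by lra; apply H; lra.
Qed.

Lemma cRInt_plus (f g : R -> C) (a b : R) : a <= b -> Rcont_on a b f -> Rcont_on a b g ->
  cRInt (fun x => f x + g x)%C a b = (cRInt f a b + cRInt g a b)%C.
Proof.
intros; apply (@RInt_plus C_R_CompleteNormedModule); apply cRInt_ex; auto.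
Qed.

(** The integral is linear over [R]; multiplication by a complex [k] mixes the two components and is
    checked on each of them. *)
Lemma cRInt_scal (k : C) (f : R -> C) (a b : R) : a <= b -> Rcont_on a b f ->
  cRInt (fun x => k * f x)%C a b = (k * cRInt f a b)%C.
Proof.
intros Hab Hf; apply (@is_RInt_unique C_R_CompleteNormedModule).
assert (Hi : @is_RInt C_R_NormedModule f a b (cRInt f a b)).
{ apply (@RInt_correct C_R_CompleteNormedModule), cRInt_ex; auto. }
set (L := cRInt f a b) in *.
pose proof (@is_RInt_fct_extend_fst R_NormedModule R_NormedModule f a b L Hi) as H1.
pose proof (@is_RInt_fct_extend_snd R_NormedModule R_NormedModule f a b L Hi) as H2.
apply (@is_RInt_fct_extend_pair R_NormedModule R_NormedModule); simpl.
- apply (@is_RInt_minus R_NormedModule); apply (@is_RInt_scal R_NormedModule); auto.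
- apply (@is_RInt_plus R_NormedModule); apply (@is_RInt_scal R_NormedModule); auto.
Qed.

Definition in_rect (x0 x1 y0 y1 : R) (z : C) : Prop :=
  x0 <= Re z <= x1 /\ y0 <= Im z <= y1.

(** Counterclockwise: bottom minus top, plus [i] times right minus left, since [dz = i dy] on
    vertical sides. *)
Definition rect (f : C -> C) (x0 x1 y0 y1 : R) : C :=
  (cRInt (fun x => f (x, y0)) x0 x1 - cRInt (fun x => f (x, y1)) x0 x1
   + Ci * (cRInt (fun y => f (x1, y)) y0 y1 - cRInt (fun y => f (x0, y)) y0 y1))%C.

Lemma Cmod_pair_h (s t y : R) : Cmod ((s, y) - (t, y)) = Rabs (s - t).
Proof.
replace ((s, y) - (t, y))%C with (RtoC (s - t)); [apply Cmod_R|].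
unfold Cminus, Cplus, Copp, RtoC; simpl; f_equal; ring.
Qed.

Lemma Cmod_pair_v (s t x : R) : Cmod ((x, s) - (x, t)) = Rabs (s - t).
Proof.
replace ((x, s) - (x, t))%C with (RtoC (s - t) * Ci)%C.
- rewrite Cmod_mult, Cmod_Ci, Cmod_R; ring.
- unfold Cminus, Cplus, Copp, Cmult, RtoC, Ci; simpl; f_equal; ring.
Qed.

Lemma Rcont_h (S : C -> Prop) (f : C -> C) (a b y : R) :
  (forall x, a <= x <= b -> S (x, y)) ->
  (forall z, S z -> ccont_on S f z) -> Rcont_on a b (fun x => f (x, y)).
Proof.
intros HS H t Ht eps He; destruct (H (t, y) (HS t Ht) eps He) as [d [Hd K]].
exists d; split; auto; intros s Hs Hst; apply K; auto.
now rewrite Cmod_pair_h.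
Qed.

Lemma Rcont_v (S : C -> Prop) (f : C -> C) (x a b : R) :
  (forall y, a <= y <= b -> S (x, y)) ->
  (forall z, S z -> ccont_on S f z) -> Rcont_on a b (fun y => f (x, y)).
Proof.
intros HS H t Ht eps He; destruct (H (x, t) (HS t Ht) eps He) as [d [Hd K]].
exists d; split; auto; intros s Hs Hst; apply K; auto.
now rewrite Cmod_pair_v.
Qed.

Definition cont_rect (f : C -> C) (x0 x1 y0 y1 : R) : Prop :=
  forall z, in_rect x0 x1 y0 y1 z -> ccont_on (in_rect x0 x1 y0 y1) f z.

Lemma cont_rect_h (f : C -> C) (x0 x1 y0 y1 a b y : R) :
  cont_rect f x0 x1 y0 y1 -> x0 <= a -> b <= x1 -> y0 <= y <= y1 ->
  Rcont_on a b (fun x => f (x, y)).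
Proof.
intros H Ha Hb Hy; eapply Rcont_h; [|exact H].
intros x Hx; split; simpl; lra.
Qed.

Lemma cont_rect_v (f : C -> C) (x0 x1 y0 y1 a b x : R) :
  cont_rect f x0 x1 y0 y1 -> y0 <= a -> b <= y1 -> x0 <= x <= x1 ->
  Rcont_on a b (fun y => f (x, y)).
Proof.
intros H Ha Hb Hx; eapply Rcont_v; [|exact H].
intros y Hy; split; simpl; lra.
Qed.

Lemma cont_rect_sub (f : C -> C) (x0 x1 y0 y1 a0 a1 b0 b1 : R) :
  cont_rect f x0 x1 y0 y1 -> x0 <= a0 -> a1 <= x1 -> y0 <= b0 -> b1 <= y1 ->
  cont_rect f a0 a1 b0 b1.
Proof.
intros H H1 H2 H3 H4 z Hz.
apply (ccont_on_sub (in_rect x0 x1 y0 y1)).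
- intros y [Hy1 Hy2]; split; lra.
- apply H; destruct Hz; split; lra.
Qed.

Lemma rect_split_x (f : C -> C) (x0 x1 x2 y0 y1 : R) :
  x0 <= x1 -> x1 <= x2 -> y0 <= y1 -> cont_rect f x0 x2 y0 y1 ->
  rect f x0 x2 y0 y1 = (rect f x0 x1 y0 y1 + rect f x1 x2 y0 y1)%C.
Proof.
intros H1 H2 H3 Hf; unfold rect.
rewrite (cRInt_Chasles (fun x => f (x, y0)) x0 x1 x2), (cRInt_Chasles (fun x => f (x, y1)) x0 x1 x2);
  auto; try ring; eapply cont_rect_h; eauto; lra.
Qed.

Lemma rect_split_y (f : C -> C) (x0 x1 y0 y1 y2 : R) :
  x0 <= x1 -> y0 <= y1 -> y1 <= y2 -> cont_rect f x0 x1 y0 y2 ->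
  rect f x0 x1 y0 y2 = (rect f x0 x1 y0 y1 + rect f x0 x1 y1 y2)%C.
Proof.
intros H1 H2 H3 Hf; unfold rect.
rewrite (cRInt_Chasles (fun y => f (x0, y)) y0 y1 y2), (cRInt_Chasles (fun y => f (x1, y)) y0 y1 y2);
  auto; try ring; eapply cont_rect_v; eauto; lra.
Qed.

Lemma rect_degenerate_x (f : C -> C) (x y0 y1 : R) : rect f x x y0 y1 = RtoC 0.
Proof.
unfold rect, cRInt; rewrite !(@RInt_point C_R_CompleteNormedModule).
change (@zero C_R_CompleteNormedModule) with (RtoC 0); ring.
Qed.

Lemma rect_degenerate_y (f : C -> C) (x0 x1 y : R) : rect f x0 x1 y y = RtoC 0.
Proof.
unfold rect, cRInt; rewrite !(@RInt_point C_R_CompleteNormedModule).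
change (@zero C_R_CompleteNormedModule) with (RtoC 0); ring.
Qed.

Lemma mono_steps (X : nat -> R) (i j : nat) :
  (forall k, X k <= X (S k)) -> (i <= j)%nat -> X i <= X j.
Proof.
intros H Hij; induction Hij as [|j Hij IH]; [lra|]; specialize (H j); lra.
Qed.

Lemma rect_grid (f : C -> C) (X Y : nat -> R) (n m : nat) :
  (forall k, X k <= X (S k)) -> (forall k, Y k <= Y (S k)) ->
  cont_rect f (X O) (X n) (Y O) (Y m) ->
  rect f (X O) (X n) (Y O) (Y m) =
  Csum n (fun i => Csum m (fun j => rect f (X i) (X (S i)) (Y j) (Y (S j)))).
Proof.
intros HX HY; revert m.
assert (Hcol : forall m x0 x1, x0 <= x1 -> cont_rect f x0 x1 (Y O) (Y m) ->
  rect f x0 x1 (Y O) (Y m) = Csum m (fun j => rect f x0 x1 (Y j) (Y (S j)))).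
{ induction m as [|m IH]; intros x0 x1 H01 Hf; simpl; [apply rect_degenerate_y|].
  rewrite (rect_split_y f x0 x1 (Y O) (Y m)); auto.
  - rewrite IH; auto; eapply cont_rect_sub; eauto; lra.
  - apply mono_steps; [auto|lia]. }
induction n as [|n IH]; intros m Hf; simpl; [apply rect_degenerate_x|].
assert (X O <= X n) by (apply mono_steps; [auto|lia]).
assert (Y O <= Y m) by (apply mono_steps; [auto|lia]).
rewrite (rect_split_x f (X O) (X n)); auto.
specialize (HX n).
rewrite IH, (Hcol m (X n)); auto; eapply cont_rect_sub; eauto; lra.
Qed.

Definition on_edges (x0 x1 y0 y1 : R) (z : C) : Prop :=
  in_rect x0 x1 y0 y1 z /\ (Re z = x0 \/ Re z = x1 \/ Im z = y0 \/ Im z = y1).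

(** Continuity is relative to a set [S] that contains the edges, because functions with a Cauchy
    kernel, singular inside the square, are among the integrands. *)
Lemma rect_bound (S : C -> Prop) (f : C -> C) (x y r M : R) : 0 <= r ->
  (forall z, on_edges x (x + r) y (y + r) z -> S z) ->
  (forall z, S z -> ccont_on S f z) ->
  (forall z, on_edges x (x + r) y (y + r) z -> Cmod (f z) <= M) ->
  Cmod (rect f x (x + r) y (y + r)) <= 4 * r * M.
Proof.
intros Hr HS Hf HM; unfold rect.
assert (Hh : forall t, t = y \/ t = y + r -> Cmod (cRInt (fun s => f (s, t)) x (x + r)) <= r * M).
{ intros t Ht; replace (r * M) with ((x + r - x) * M) by ring.
  assert (He : forall s, x <= s <= x + r -> on_edges x (x + r) y (y + r) (s, t)).
  { intros s Hs; split; [split; simpl; lra|simpl; tauto]. }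
  apply cRInt_bound; [lra| |intros; apply HM, He; auto].
  apply (Rcont_h S f); auto. }
assert (Hv : forall t, t = x \/ t = x + r -> Cmod (cRInt (fun s => f (t, s)) y (y + r)) <= r * M).
{ intros t Ht; replace (r * M) with ((y + r - y) * M) by ring.
  assert (He : forall s, y <= s <= y + r -> on_edges x (x + r) y (y + r) (t, s)).
  { intros s Hs; split; [split; simpl; lra|simpl; tauto]. }
  apply cRInt_bound; [lra| |intros; apply HM, He; auto].
  apply (Rcont_v S f); auto. }
eapply Rle_trans; [apply Cmod_triangle|].
rewrite Cmod_mult, Cmod_Ci.
pose proof (Hh y ltac:(auto)); pose proof (Hh (y + r) ltac:(auto)).
pose proof (Hv x ltac:(auto)); pose proof (Hv (x + r) ltac:(auto)).
pose proof (Cmod_triangle_minus (cRInt (fun s => f (s, y)) x (x + r))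
  (cRInt (fun s => f (s, y + r)) x (x + r))).
pose proof (Cmod_triangle_minus (cRInt (fun s => f (x + r, s)) y (y + r))
  (cRInt (fun s => f (x, s)) y (y + r))).
lra.
Qed.

Lemma rect_lincomb (S : C -> Prop) (f g : C -> C) (k : C) (x0 x1 y0 y1 : R) :
  x0 <= x1 -> y0 <= y1 -> (forall z, on_edges x0 x1 y0 y1 z -> S z) ->
  (forall z, S z -> ccont_on S f z) -> (forall z, S z -> ccont_on S g z) ->
  rect (fun z => f z + k * g z)%C x0 x1 y0 y1 = (rect f x0 x1 y0 y1 + k * rect g x0 x1 y0 y1)%C.
Proof.
intros Hx Hy HS Hf Hg.
assert (Hh : forall u, (forall z, S z -> ccont_on S u z) -> forall t, t = y0 \/ t = y1 ->
  Rcont_on x0 x1 (fun x => u (x, t))).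
{ intros u Hu t Ht; apply (Rcont_h S u); auto; intros s Hs; apply HS.
  split; [split; simpl; lra|simpl; tauto]. }
assert (Hv : forall u, (forall z, S z -> ccont_on S u z) -> forall t, t = x0 \/ t = x1 ->
  Rcont_on y0 y1 (fun y => u (t, y))).
{ intros u Hu t Ht; apply (Rcont_v S u); auto; intros s Hs; apply HS.
  split; [split; simpl; lra|simpl; tauto]. }
assert (Hkg : forall z, S z -> ccont_on S (fun z => k * g z)%C z)
  by (intros z Hz; apply ccont_on_mult; auto using ccont_on_const).
unfold rect.
rewrite (cRInt_plus (fun x => f (x, y0)) (fun x => k * g (x, y0))%C)
  by (first [assumption | apply (Hh f); now auto | apply (Hh (fun z => k * g z)%C); now auto]).
rewrite (cRInt_plus (fun x => f (x, y1)) (fun x => k * g (x, y1))%C)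
  by (first [assumption | apply (Hh f); now auto | apply (Hh (fun z => k * g z)%C); now auto]).
rewrite (cRInt_plus (fun y => f (x0, y)) (fun y => k * g (x0, y))%C)
  by (first [assumption | apply (Hv f); now auto | apply (Hv (fun z => k * g z)%C); now auto]).
rewrite (cRInt_plus (fun y => f (x1, y)) (fun y => k * g (x1, y))%C)
  by (first [assumption | apply (Hv f); now auto | apply (Hv (fun z => k * g z)%C); now auto]).
rewrite (cRInt_scal k (fun x => g (x, y0))), (cRInt_scal k (fun x => g (x, y1))),
  (cRInt_scal k (fun y => g (x0, y))), (cRInt_scal k (fun y => g (x1, y)))
  by (first [assumption | apply (Hh g); now auto | apply (Hv g); now auto]).
ring.
Qed.

Lemma rect_ext (f g : C -> C) (x0 x1 y0 y1 : R) : x0 <= x1 -> y0 <= y1 ->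
  (forall z, on_edges x0 x1 y0 y1 z -> f z = g z) -> rect f x0 x1 y0 y1 = rect g x0 x1 y0 y1.
Proof.
intros Hx Hy H; unfold rect.
rewrite (cRInt_ext (fun x => f (x, y0)) (fun x => g (x, y0))),
  (cRInt_ext (fun x => f (x, y1)) (fun x => g (x, y1))),
  (cRInt_ext (fun y => f (x0, y)) (fun y => g (x0, y))),
  (cRInt_ext (fun y => f (x1, y)) (fun y => g (x1, y))); auto;
  intros t Ht; apply H; split; try (split; simpl; lra); simpl; tauto.
Qed.

Lemma Rcont_const (v : C) (a b : R) : Rcont_on a b (fun _ => v).
Proof.
intros t Ht eps He; exists 1; split; [lra|]; intros.
replace (v - v)%C with (RtoC 0) by ring; now rewrite Cmod_0.
Qed.

Lemma cRInt_const (v : C) (a b : R) : cRInt (fun _ => v) a b = (RtoC (b - a) * v)%C.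
Proof.
unfold cRInt; rewrite (@RInt_const C_R_CompleteNormedModule).
change (((b - a) * fst v, (b - a) * snd v)%R = (RtoC (b - a) * v)%C).
unfold Cmult, RtoC; simpl; f_equal; ring.
Qed.

Lemma cRInt_diff_const (g h : R -> C) (v : C) (a b : R) : a <= b ->
  Rcont_on a b g -> (forall x, h x = (g x + v)%C) ->
  cRInt h a b = (cRInt g a b + RtoC (b - a) * v)%C.
Proof.
intros Hab Hg Hh; rewrite (cRInt_ext h (fun x => g x + v)%C) by auto.
rewrite cRInt_plus, cRInt_const by auto using Rcont_const; reflexivity.
Qed.

(** Between opposite sides the integrand changes by a constant. The horizontal pair contributes
    [- (x1 - x0) b i (y1 - y0)], the vertical pair the opposite. *)
Lemma rect_affine (a b : C) (x0 x1 y0 y1 : R) : x0 <= x1 -> y0 <= y1 ->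
  rect (fun z => a + b * z)%C x0 x1 y0 y1 = RtoC 0.
Proof.
intros Hx Hy.
assert (Hc : cont_rect (fun z => a + b * z)%C x0 x1 y0 y1).
{ intros z _; apply ccont_on_plus; [apply ccont_on_const|].
  apply ccont_on_mult; [apply ccont_on_const|apply ccont_on_id]. }
unfold rect.
rewrite (cRInt_diff_const (fun x => a + b * (x, y0)) (fun x => a + b * (x, y1))
  (b * (RtoC (y1 - y0) * Ci)))%C; auto.
- rewrite (cRInt_diff_const (fun y => a + b * (x0, y)) (fun y => a + b * (x1, y))
    (b * RtoC (x1 - x0)))%C; auto.
  + ring.
  + apply (cont_rect_v _ x0 x1 y0 y1 _ _ _ Hc); lra.
  + intros y; replace ((x1, y) : C) with ((x0, y) + RtoC (x1 - x0))%C; [ring|].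
    unfold Cplus, RtoC; simpl; f_equal; ring.
- apply (cont_rect_h _ x0 x1 y0 y1 _ _ _ Hc); lra.
- intros x; replace ((x, y1) : C) with ((x, y0) + RtoC (y1 - y0) * Ci)%C; [ring|].
  unfold Cplus, Cmult, Ci, RtoC; simpl; f_equal; ring.
Qed.

(** * Cauchy's theorem for squares *)

Lemma nested_point (a d : nat -> R) :
  (forall n, 0 <= d n) -> (forall n, a n <= a (S n)) ->
  (forall n, a (S n) + d (S n) <= a n + d n) -> exists p, forall n, a n <= p <= a n + d n.
Proof.
intros Hd Ha Hb.
assert (Hdec : forall n m, (n <= m)%nat -> a m + d m <= a n + d n).
{ intros n m H; induction H as [|m H IH]; [lra|]; specialize (Hb m); lra. }
assert (Hle : forall n m, a m <= a n + d n).
{ intros n m; destruct (Nat.le_ge_cases n m) as [H|H].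
  - specialize (Hdec n m H); specialize (Hd m); lra.
  - pose proof (mono_steps a m n Ha H); specialize (Hd n); lra. }
destruct (completeness (fun x => exists n, x = a n)) as [p [Hp1 Hp2]].
- exists (a O + d O); intros x [n ->]; auto.
- exists (a O), O; auto.
- exists p; intros n; split; [apply Hp1; eauto|].
  apply Hp2; intros x [m ->]; auto.
Qed.

Lemma cdiff_cont_rect (f : C -> C) (x0 x1 y0 y1 : R) :
  (forall z, in_rect x0 x1 y0 y1 z -> ccont f z) -> cont_rect f x0 x1 y0 y1.
Proof.
intros H z Hz; apply (ccont_on_sub (fun _ => True)); auto; now apply H.
Qed.

Lemma goursat_quarter (f : C -> C) (x y h : R) : 0 <= h ->
  cont_rect f x (x + 2 * h) y (y + 2 * h) ->
  exists x' y', (x' = x \/ x' = x + h) /\ (y' = y \/ y' = y + h) /\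
    Cmod (rect f x (x + 2 * h) y (y + 2 * h)) <=
    4 * Cmod (rect f x' (x' + h) y' (y' + h)).
Proof.
intros Hh Hf.
rewrite (rect_split_x f x (x + h)) by (auto; lra).
rewrite (rect_split_y f x (x + h) y (y + h)) by
  (try lra; eapply cont_rect_sub; eauto; lra).
rewrite (rect_split_y f (x + h) (x + 2 * h) y (y + h)) by
  (try lra; eapply cont_rect_sub; eauto; lra).
replace (x + 2 * h) with (x + h + h) by ring.
replace (y + 2 * h) with (y + h + h) by ring.
set (A := rect f x (x + h) y (y + h)).
set (B := rect f x (x + h) (y + h) (y + h + h)).
set (D := rect f (x + h) (x + h + h) y (y + h)).
set (E := rect f (x + h) (x + h + h) (y + h) (y + h + h)).
assert (H : Cmod (A + B + (D + E)) <= Cmod A + Cmod B + (Cmod D + Cmod E)).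
{ eapply Rle_trans; [apply Cmod_triangle|].
  pose proof (Cmod_triangle A B); pose proof (Cmod_triangle D E); lra. }
destruct (Rle_lt_dec (Cmod (A + B + (D + E))) (4 * Cmod A)) as [H1|H1].
{ exists x, y; auto. }
destruct (Rle_lt_dec (Cmod (A + B + (D + E))) (4 * Cmod B)) as [H2|H2].
{ exists x, (y + h); auto. }
destruct (Rle_lt_dec (Cmod (A + B + (D + E))) (4 * Cmod D)) as [H3|H3].
{ exists (x + h), y; auto. }
exists (x + h), (y + h); repeat split; auto; fold E; lra.
Qed.

(** Bisection: some quarter keeps at least a quarter of the modulus, the affine part at the limit
    point integrates to zero, and the remainder is at most [4 d n * (e * 2 d n)]. The factor [4 ^ n]
    turns this into [8 e r^2]. *)
Lemma goursat (f : C -> C) (x0 y0 r : R) : 0 <= r ->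
  (forall z, in_rect x0 (x0 + r) y0 (y0 + r) z -> cdiff f z) ->
  rect f x0 (x0 + r) y0 (y0 + r) = RtoC 0.
Proof.
intros Hr Hf.
assert (Hcont : cont_rect f x0 (x0 + r) y0 (y0 + r)).
{ apply cdiff_cont_rect; intros; apply cdiff_ccont; auto. }
set (d := fun n => r / 2 ^ n).
assert (Hd : forall n, 0 <= d n).
{ intros n; unfold d; apply Rdiv_le_0_compat; auto; apply pow_lt; lra. }
assert (HdS : forall n, d n = 2 * d (S n)).
{ intros n; unfold d; simpl; field; apply pow_nonzero; lra. }
set (T := fun (n : nat) (p : R * R) =>
  Cmod (rect f (fst p) (fst p + d n) (snd p) (snd p + d n))).
(* The quarter is chosen for all pairs of step and corner at once, with continuity as a guard, so
   that dependent choice becomes the plain recursion [u]. *)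
assert (Hstep : forall np : nat * (R * R), exists p' : R * R,
  let (n, p) := np in
  cont_rect f (fst p) (fst p + d n) (snd p) (snd p + d n) ->
  (fst p' = fst p \/ fst p' = fst p + d (S n)) /\
  (snd p' = snd p \/ snd p' = snd p + d (S n)) /\ T n p <= 4 * T (S n) p').
{ intros [n [x y]]; simpl fst; simpl snd.
  destruct (classic (cont_rect f x (x + d n) y (y + d n))) as [H|H].
  - unfold T; simpl fst; simpl snd; rewrite HdS in H |- *.
    destruct (goursat_quarter f x y (d (S n)) (Hd _) H) as [x' [y' K]].
    exists (x', y'); auto.
  - exists (x, y); tauto. }
destruct (choice _ Hstep) as [g Hg].
set (u := fix u n := match n with O => (x0, y0) | S k => g (k, u k) end).
assert (Hu : forall n, x0 <= fst (u n) /\ fst (u n) + d n <= x0 + r /\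
  y0 <= snd (u n) /\ snd (u n) + d n <= y0 + r /\ T O (u O) <= 4 ^ n * T n (u n)).
{ induction n as [|n IH].
  - simpl; replace (d O) with r by (unfold d; simpl; field); lra.
  - destruct IH as [I1 [I2 [I3 [I4 I5]]]].
    destruct (Hg (n, u n)) as [K1 [K2 K3]].
    { eapply cont_rect_sub; eauto; lra. }
    change (g (n, u n)) with (u (S n)) in *.
    pose proof (Hd (S n)); rewrite HdS in I2, I4.
    repeat split; try lra.
    eapply Rle_trans; [exact I5|]; simpl pow.
    assert (0 < 4 ^ n) by (apply pow_lt; lra); nra. }
assert (Hmono : forall n, (fst (u (S n)) = fst (u n) \/ fst (u (S n)) = fst (u n) + d (S n)) /\
  (snd (u (S n)) = snd (u n) \/ snd (u (S n)) = snd (u n) + d (S n))).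
{ intros n; destruct (Hu n) as [I1 [I2 [I3 [I4 I5]]]].
  destruct (Hg (n, u n)) as [K1 [K2 K3]]; [eapply cont_rect_sub; eauto; lra|].
  split; auto. }
destruct (nested_point (fun n => fst (u n)) d Hd) as [px Hpx].
{ intros n; destruct (Hmono n) as [[->| ->] _]; pose proof (Hd (S n)); lra. }
{ intros n; rewrite (HdS n); destruct (Hmono n) as [[->| ->] _]; pose proof (Hd (S n)); lra. }
destruct (nested_point (fun n => snd (u n)) d Hd) as [py Hpy].
{ intros n; destruct (Hmono n) as [_ [->| ->]]; pose proof (Hd (S n)); lra. }
{ intros n; rewrite (HdS n); destruct (Hmono n) as [_ [->| ->]]; pose proof (Hd (S n)); lra. }
set (p := (px, py) : C).
destruct (Hf p) as [l Hl].
{ specialize (Hpx O); specialize (Hpy O); simpl in Hpx, Hpy.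
  replace (d O) with r in * by (unfold d; simpl; field); split; simpl; lra. }
apply Cmod_le_eps_eq; intros eps He.
replace (rect f x0 (x0 + r) y0 (y0 + r) - 0)%C with (rect f x0 (x0 + r) y0 (y0 + r)) by ring.
set (e := eps / (8 * r * r + 1)).
assert (He' : 0 < e) by (unfold e; apply Rdiv_lt_0_compat; nra).
destruct (Hl e He') as [del [Hdel K]].
assert (Hn : exists n, 2 * d n < del).
{ destruct (pow_lt_1_zero (1 / 2)) with (y := del / (2 * r + 1)) as [N HN].
  - rewrite Rabs_pos_eq; lra.
  - apply Rdiv_lt_0_compat; lra.
  - exists N; specialize (HN N (le_n N)).
    rewrite Rabs_pos_eq in HN by (apply pow_le; lra).
    assert (E : d N = r * (1 / 2) ^ N).
    { unfold d, Rdiv; rewrite Rmult_1_l, pow_inv; ring. }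
    rewrite E.
    assert (P : 0 < (1 / 2) ^ N) by (apply pow_lt; lra).
    apply Rlt_le_trans with ((2 * r + 1) * (del / (2 * r + 1))); [|right; field; lra].
    apply Rle_lt_trans with ((2 * r + 1) * (1 / 2) ^ N); [nra|].
    apply Rmult_lt_compat_l; lra. }
destruct Hn as [n Hn].
destruct (Hu n) as [I1 [I2 [I3 [I4 I5]]]].
set (x := fst (u n)) in *; set (y := snd (u n)) in *.
specialize (Hpx n); specialize (Hpy n); simpl in Hpx, Hpy; fold x in Hpx; fold y in Hpy.
assert (HT : T n (u n) <= 4 * d n * (e * (2 * d n))).
{ unfold T; fold x y.
  assert (Hc1 : cont_rect f x (x + d n) y (y + d n)) by (eapply cont_rect_sub; eauto; lra).
  set (a := (f p - l * p)%C).
  set (E := fun z => (f z - (a + l * z))%C).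
  assert (HcA : cont_rect (fun z => a + l * z)%C x (x + d n) y (y + d n)).
  { intros z _; apply ccont_on_plus; [apply ccont_on_const|].
    apply ccont_on_mult; [apply ccont_on_const|apply ccont_on_id]. }
  assert (HcE : cont_rect E x (x + d n) y (y + d n)).
  { intros z Hz; apply ccont_on_minus; [now apply Hc1|now apply HcA]. }
  pose proof (Hd n) as Hdn.
  rewrite (rect_ext f (fun z => E z + 1 * (a + l * z))%C) by (try lra; intros; unfold E; ring).
  rewrite (rect_lincomb (in_rect x (x + d n) y (y + d n))), rect_affine, Cmult_0_r, Cplus_0_r
    by (auto; try lra; intros z Hz; apply Hz).
  apply (rect_bound (in_rect x (x + d n) y (y + d n))); auto; [intros z Hz; apply Hz|].
  intros z [[Hz1 Hz2] _].
  assert (Hzp : Cmod (z - p) <= 2 * d n).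
  { eapply Rle_trans; [apply Cmod_Re_Im|].
    change (Rabs (Re z - px) + Rabs (Im z - py) <= 2 * d n).
    assert (Rabs (Re z - px) <= d n) by (apply Rabs_le; lra).
    assert (Rabs (Im z - py) <= d n) by (apply Rabs_le; lra); lra. }
  unfold E, a; replace (f z - (f p - l * p + l * z))%C with (f z - f p - l * (z - p))%C by ring.
  eapply Rle_trans; [apply K; lra|].
  apply Rmult_le_compat_l; lra. }
assert (HT0 : T O (u O) = Cmod (rect f x0 (x0 + r) y0 (y0 + r))).
{ unfold T; simpl; replace (d O) with r by (unfold d; simpl; field); easy. }
rewrite <- HT0; eapply Rle_trans; [exact I5|].
assert (E4 : 4 ^ n * (d n * d n) = r * r).
{ unfold d; replace 4 with (2 * 2) by ring; rewrite Rpow_mult_distr; field.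
  apply pow_nonzero; lra. }
apply Rle_trans with (4 ^ n * (4 * d n * (e * (2 * d n)))).
- apply Rmult_le_compat_l; [apply pow_le; lra|exact HT].
- replace (4 ^ n * (4 * d n * (e * (2 * d n)))) with (8 * e * (4 ^ n * (d n * d n))) by ring.
  rewrite E4; apply Rle_trans with (e * (8 * r * r + 1)); [nra|].
  right; unfold e; field; nra.
Qed.

(** * Counting grid points near a thin set *)

Definition ind (P : Prop) : R := if excluded_middle_informative P then 1 else 0.

Lemma ind_range (P : Prop) : 0 <= ind P <= 1.
Proof. unfold ind; destruct excluded_middle_informative; lra. Qed.

Lemma ind_true (P : Prop) : P -> ind P = 1.
Proof. unfold ind; destruct excluded_middle_informative; tauto. Qed.

Lemma ind_false (P : Prop) : ~ P -> ind P = 0.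
Proof. unfold ind; destruct excluded_middle_informative; tauto. Qed.

Lemma count_interval (n : nat) (alpha beta : R) : alpha <= beta ->
  Rsum n (fun i => ind (alpha <= INR i <= beta)) <= beta - alpha + 1.
Proof.
intros Hab.
(* Strengthened for the induction on [n]: only indices up to the smaller of [n - 1] and [beta]
   count. *)
assert (H : Rsum n (fun i => ind (alpha <= INR i <= beta)) <=
  Rmax 0 (Rmin (INR n - 1) beta - alpha + 1)).
{ induction n as [|n IH]; simpl Rsum; [apply Rmax_l|].
  rewrite S_INR; replace (INR n + 1 - 1) with (INR n) by ring.
  destruct (classic (alpha <= INR n <= beta)) as [H|H].
  - rewrite ind_true by auto; rewrite (Rmin_left (INR n)) by lra.
    rewrite (Rmax_right 0 (INR n - alpha + 1)) by lra.
    enough (Rmax 0 (Rmin (INR n - 1) beta - alpha + 1) <= INR n - alpha) by lra.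
    apply Rmax_lub; [lra|]; pose proof (Rmin_l (INR n - 1) beta); lra.
  - rewrite ind_false, Rplus_0_r by auto; eapply Rle_trans; [exact IH|].
    apply Rle_max_compat_l.
    assert (Rmin (INR n - 1) beta <= Rmin (INR n) beta); [|lra].
    apply Rle_min_compat_r; lra. }
eapply Rle_trans; [exact H|]; apply Rmax_lub; [lra|].
pose proof (Rmin_r (INR n - 1) beta); lra.
Qed.

Lemma count_grid (n : nat) (x d a rad : R) : 0 < d -> 0 <= rad ->
  Rsum n (fun i => ind (Rabs (x + INR i * d - a) <= rad)) <= 2 * rad / d + 1.
Proof.
intros Hd Hr.
assert (0 < / d) by now apply Rinv_0_lt_compat.
apply Rle_trans with (Rsum n (fun i => ind ((a - rad - x) / d <= INR i <= (a + rad - x) / d))).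
- apply Rsum_le; intros i _.
  destruct (classic (Rabs (x + INR i * d - a) <= rad)) as [H1|H1].
  + rewrite (ind_true (_ <= _ <= _)); [apply ind_range|].
    apply Rabs_le_between in H1.
    split; apply Rmult_le_reg_r with d; auto; unfold Rdiv;
      rewrite Rmult_assoc, Rinv_l by lra; lra.
  + rewrite ind_false; [apply ind_range|auto].
- eapply Rle_trans; [apply count_interval|].
  + unfold Rdiv; apply Rmult_le_compat_r; lra.
  + right; field; lra.
Qed.

Definition grid_near (E : C -> Prop) (rad x y : R) : Prop :=
  exists e, E e /\ Rabs (x - Re e) <= rad /\ Rabs (y - Im e) <= rad.

Lemma Rsum_nonneg_term (N k : nat) (f : nat -> R) :
  (forall j, 0 <= f j) -> (k < N)%nat -> f k <= Rsum N f.
Proof.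
intros Hf; induction N as [|N IH]; intros Hk; [lia|]; simpl.
destruct (Nat.eq_dec k N) as [->|Hn].
- pose proof (Rsum_pos N f (fun j _ => Hf j)); lra.
- specialize (IH ltac:(lia)); specialize (Hf N); lra.
Qed.

(** Cover [E] by at most [K / sig] discs of radius [sig]. A grid point near [E] is within
    [rad + sig] of some centre in each coordinate, and each centre admits at most
    [2 (rad + sig) / d + 1] such indices per coordinate. *)
Lemma thin_count (E : C -> Prop) : thin E -> exists K, 0 <= K /\
  forall sig d rad x y n m, 0 < sig <= 1 -> 0 < d -> 0 <= rad ->
    Rsum n (fun i => Rsum m (fun j => ind (grid_near E rad (x + INR i * d) (y + INR j * d))))
    <= K / sig * ((2 * (rad + sig) / d + 1) * (2 * (rad + sig) / d + 1)).
Proof.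
intros [K [HK H]]; exists K; split; auto; intros sig d rad x y n m Hs Hd Hr.
destruct (H sig Hs) as [N [p [HN Hp]]].
set (a := fun i k => ind (Rabs (x + INR i * d - Re (p k)) <= rad + sig)).
set (b := fun j k => ind (Rabs (y + INR j * d - Im (p k)) <= rad + sig)).
assert (Ha : forall i k, 0 <= a i k <= 1) by (intros; apply ind_range).
assert (Hb : forall i k, 0 <= b i k <= 1) by (intros; apply ind_range).
apply Rle_trans with (Rsum n (fun i => Rsum m (fun j => Rsum N (fun k => a i k * b j k)))).
- apply Rsum_le; intros i _; apply Rsum_le; intros j _.
  destruct (classic (grid_near E rad (x + INR i * d) (y + INR j * d))) as [Hg|Hg].
  + rewrite ind_true by auto; destruct Hg as [e [He [G1 G2]]].
    destruct (Hp e He) as [k [Hk Hek]].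
    apply Rle_trans with (a i k * b j k).
    * assert (Re e - Re (p k) = Re (e - p k)) as E1 by reflexivity.
      assert (Im e - Im (p k) = Im (e - p k)) as E2 by reflexivity.
      pose proof (re_le_Cmod (e - p k)); pose proof (Im_le_Cmod (e - p k)).
      unfold a, b; rewrite !ind_true; [lra| |].
      -- replace (y + INR j * d - Im (p k)) with ((y + INR j * d - Im e) + (Im e - Im (p k))) by ring.
         eapply Rle_trans; [apply Rabs_triang|]; rewrite E2; lra.
      -- replace (x + INR i * d - Re (p k)) with ((x + INR i * d - Re e) + (Re e - Re (p k))) by ring.
         eapply Rle_trans; [apply Rabs_triang|]; rewrite E1; lra.
    * apply (Rsum_nonneg_term N k (fun k => a i k * b j k)); auto.
      intros; apply Rmult_le_pos; [apply Ha|apply Hb].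
  + rewrite ind_false by auto; apply Rsum_pos; intros.
    apply Rmult_le_pos; [apply Ha|apply Hb].
- set (q := 2 * (rad + sig) / d + 1).
  assert (Hq : 0 <= q).
  { unfold q; assert (0 <= 2 * (rad + sig) / d) by (apply Rdiv_le_0_compat; lra); lra. }
  apply Rle_trans with (Rsum N (fun _ => q * q)).
  + erewrite Rsum_ext; [|intros i _; apply Rsum_swap].
    rewrite Rsum_swap; apply Rsum_le; intros k _.
    erewrite Rsum_ext; [|intros i _; rewrite Rsum_scal, Rmult_comm; reflexivity].
    rewrite Rsum_scal; apply Rmult_le_compat.
    * apply Rsum_pos; intros; apply Hb.
    * apply Rsum_pos; intros; apply Ha.
    * apply count_grid; lra.
    * apply count_grid; lra.
  + rewrite Rsum_const; apply Rmult_le_compat_r; [apply Rmult_le_pos|]; auto.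
Qed.

(* Only the squares that meet [E] contribute; there are O(1/d) of them, and each contributes o(d). *)
Lemma painleve_square (f : C -> C) (E : C -> Prop) (x0 y0 r : R) : 0 < r -> thin E ->
  cont_rect f x0 (x0 + r) y0 (y0 + r) ->
  (forall z, in_rect x0 (x0 + r) y0 (y0 + r) z -> ~ E z -> cdiff f z) ->
  rect f x0 (x0 + r) y0 (y0 + r) = RtoC 0.
Proof.
intros Hr HE Hf Hd.
destruct (thin_count E HE) as [K [HK Hcount]].
apply Cmod_le_eps_eq; intros eps He.
replace (rect f x0 (x0 + r) y0 (y0 + r) - 0)%C with (rect f x0 (x0 + r) y0 (y0 + r)) by ring.
(* A square that meets [E] contributes at most [4 d e], and there are at most [25 K / d] of them, by
   [thin_count] with both radii equal to [d]. *)
set (e := eps / (4 * 25 * K + 1)).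
assert (He' : 0 < e) by (unfold e; apply Rdiv_lt_0_compat; lra).
destruct (compact_unif (in_rect x0 (x0 + r) y0 (y0 + r))
  (Rabs x0 + Rabs y0 + 2 * r) f) with (eps := e) as [del [Hdel Kd]]; auto.
{ intros z [Hz1 Hz2]; eapply Rle_trans; [apply Cmod_Re_Im|].
  unfold Rabs; repeat destruct Rcase_abs; lra. }
{ intros z Hz.
  assert (Hout : Re z < x0 \/ x0 + r < Re z \/ Im z < y0 \/ y0 + r < Im z).
  { unfold in_rect in Hz; lra. }
  set (g := Rmax (Rmax (x0 - Re z) (Re z - x0 - r)) (Rmax (y0 - Im z) (Im z - y0 - r))).
  exists g.
  assert (G : x0 - Re z <= g /\ Re z - x0 - r <= g /\ y0 - Im z <= g /\ Im z - y0 - r <= g /\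
     (g = x0 - Re z \/ g = Re z - x0 - r \/ g = y0 - Im z \/ g = Im z - y0 - r)).
  { unfold g, Rmax; repeat destruct Rle_dec; lra. }
  split; [lra|]; intros y Hy [Hy1 Hy2].
  pose proof (re_le_Cmod (y - z)) as R1; pose proof (Im_le_Cmod (y - z)) as R2.
  change (Re (y - z)) with (Re y - Re z) in R1; change (Im (y - z)) with (Im y - Im z) in R2.
  apply Rabs_le_between in R1; apply Rabs_le_between in R2; lra. }
assert (Hn : exists n, (0 < n)%nat /\ r / INR n <= 1 /\ 3 * (r / INR n) < del).
{ destruct (archimed_cor1 (Rmin (/ r) (del / (4 * r)))) as [n [Hn1 Hn2]].
  - apply Rmin_glb_lt; [now apply Rinv_0_lt_compat|apply Rdiv_lt_0_compat; lra].
  - exists n; split; auto.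
    assert (H1 : / INR n <= / r) by (left; eapply Rlt_le_trans; [exact Hn1|apply Rmin_l]).
    assert (H2 : / INR n <= del / (4 * r)) by (left; eapply Rlt_le_trans; [exact Hn1|apply Rmin_r]).
    unfold Rdiv; split.
    + rewrite <- (Rinv_r r) by lra; apply Rmult_le_compat_l; lra.
    + apply Rle_lt_trans with (3 * (r * (del / (4 * r)))).
      * apply Rmult_le_compat_l; [lra|]; apply Rmult_le_compat_l; lra.
      * replace (3 * (r * (del / (4 * r)))) with (3 / 4 * del) by (field; lra); lra. }
destruct Hn as [n [Hn0 [Hn1 Hn2]]].
set (d := r / INR n) in *.
assert (Hnn : INR n <> 0) by (apply not_0_INR; lia).
assert (Hd0 : 0 < d) by (apply Rdiv_lt_0_compat; [lra|apply lt_0_INR; lia]).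
set (X := fun i => x0 + INR i * d); set (Y := fun j => y0 + INR j * d).
assert (HX0 : X O = x0) by (unfold X; simpl; ring).
assert (HY0 : Y O = y0) by (unfold Y; simpl; ring).
assert (HXn : X n = x0 + r) by (unfold X, d; field; auto).
assert (HYn : Y n = y0 + r) by (unfold Y, d; field; auto).
assert (HXS : forall i, X (S i) = X i + d) by (intros; unfold X; rewrite S_INR; ring).
assert (HYS : forall i, Y (S i) = Y i + d) by (intros; unfold Y; rewrite S_INR; ring).
assert (HXm : forall i, X i <= X (S i)) by (intros; rewrite HXS; lra).
assert (HYm : forall i, Y i <= Y (S i)) by (intros; rewrite HYS; lra).
assert (Hgrid : rect f (X O) (X n) (Y O) (Y n) =
  Csum n (fun i => Csum n (fun j => rect f (X i) (X (S i)) (Y j) (Y (S j))))).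
{ apply rect_grid; auto; rewrite HX0, HY0, HXn, HYn; auto. }
rewrite HX0, HY0, HXn, HYn in Hgrid; rewrite Hgrid.
eapply Rle_trans; [apply Cmod_Csum|].
apply Rle_trans with (Rsum n (fun i => Rsum n (fun j =>
  (4 * d * e) * ind (grid_near E d (X i) (Y j))))).
- apply Rsum_le; intros i Hi; eapply Rle_trans; [apply Cmod_Csum|].
  apply Rsum_le; intros j Hj.
  assert (Bi : x0 <= X i /\ X (S i) <= x0 + r).
  { rewrite <- HXn, <- HX0; split; apply mono_steps; auto; lia. }
  assert (Bj : y0 <= Y j /\ Y (S j) <= y0 + r).
  { rewrite <- HYn, <- HY0; split; apply mono_steps; auto; lia. }
  rewrite HXS, HYS in *.
  assert (Hsub : cont_rect f (X i) (X i + d) (Y j) (Y j + d))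
    by (eapply cont_rect_sub; eauto; lra).
  destruct (classic (exists z, in_rect (X i) (X i + d) (Y j) (Y j + d) z /\ E z)) as [[z [[Z1 Z2] HzE]]|Hno].
  + rewrite ind_true; [|exists z; repeat split; auto; apply Rabs_le; lra].
    rewrite Rmult_1_r.
    set (a := f (X i, Y j)).
    assert (Hc1 : cont_rect (fun z => a + 0 * z)%C (X i) (X i + d) (Y j) (Y j + d)).
    { intros w _; apply ccont_on_plus; [apply ccont_on_const|].
      apply ccont_on_mult; [apply ccont_on_const|apply ccont_on_id]. }
    assert (Hc2 : cont_rect (fun z => f z - a)%C (X i) (X i + d) (Y j) (Y j + d)).
    { intros w Hw; apply ccont_on_minus; [now apply Hsub|apply ccont_on_const]. }
    rewrite (rect_ext f (fun z => (f z - a) + 1 * (a + 0 * z))%C) by (try lra; intros; ring).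
    rewrite (rect_lincomb (in_rect (X i) (X i + d) (Y j) (Y j + d))), rect_affine, Cmult_0_r, Cplus_0_r
      by (auto; try lra; intros w Hw; apply Hw).
    apply (rect_bound (in_rect (X i) (X i + d) (Y j) (Y j + d))); auto; try lra.
    { intros w Hw; apply Hw. }
    intros w [[W1 W2] _]; left; apply Kd.
    * split; lra.
    * split; simpl; lra.
    * eapply Rle_lt_trans; [apply Cmod_Re_Im|].
      change (Rabs (Re w - X i) + Rabs (Im w - Y j) < del).
      rewrite !Rabs_pos_eq by lra; lra.
  + rewrite goursat; [rewrite Cmod_0|lra|].
    * apply Rmult_le_pos; [|apply ind_range].
      apply Rmult_le_pos; lra.
    * intros z Hz; apply Hd; [destruct Hz; split; lra|].
      intros HzE; apply Hno; eauto.
- erewrite Rsum_ext; [|intros i _; apply Rsum_scal].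
  rewrite Rsum_scal.
  eapply Rle_trans; [apply Rmult_le_compat_l; [|apply (Hcount d d d x0 y0); lra]|].
  + apply Rmult_le_pos; lra.
  + replace (2 * (d + d) / d + 1) with 5 by (field; lra).
    replace (4 * d * e * (K / d * (5 * 5))) with (e * (4 * 25 * K)) by (field; lra).
    apply Rle_trans with (e * (4 * 25 * K + 1)); [apply Rmult_le_compat_l; lra|].
    right; unfold e; field; lra.
Qed.

(** * The integral of the Cauchy kernel around a square *)

Lemma cRInt_real (g : R -> R) (a b v : R) : is_RInt g a b v ->
  cRInt (fun x => RtoC (g x)) a b = RtoC v.
Proof.
intros H; apply (@is_RInt_unique C_R_CompleteNormedModule).
apply (@is_RInt_fct_extend_pair R_NormedModule R_NormedModule); simpl; auto.
pose proof (@is_RInt_const R_NormedModule a b 0) as K.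
assert (E : @scal R_Ring R_NormedModule (b - a) 0 = 0) by apply Rmult_0_r.
rewrite E in K; exact K.
Qed.

Lemma atan_integral (a r : R) : 0 < r ->
  cRInt (fun x => RtoC (2 * r / (r * r + (x - a) * (x - a)))) (a - r) (a + r) = RtoC PI.
Proof.
intros Hr; apply cRInt_real.
assert (Hpos : forall x, 0 < r * r + (x - a) * (x - a)) by (intros x; pose proof (Rle_0_sqr (x - a)) as Q; unfold Rsqr in Q; nra).
replace PI with (minus (2 * atan ((a + r - a) / r)) (2 * atan ((a - r - a) / r))).
- apply (is_RInt_derive (fun x => 2 * atan ((x - a) / r))).
  + intros x _; auto_derive; auto; unfold Rsqr.
    field; repeat split; try lra; specialize (Hpos x); nra.
  + intros x _; apply continuity_pt_filterlim.
    apply derivable_continuous_pt.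
    apply ex_derive_Reals_0; auto_derive; specialize (Hpos x); lra.
- replace ((a + r - a) / r) with 1 by (field; lra).
  replace ((a - r - a) / r) with (- (1)) by (field; lra).
  rewrite atan_opp, atan_1; change (2 * (PI / 4) - 2 * - (PI / 4) = PI); field.
Qed.

(** Opposite sides are integrated together. In coordinates centred at [a], bottom minus top is
    [2 r i / (r^2 + x^2)] and right minus left is [2 r / (r^2 + y^2)]; with the factor [i] of the
    vertical sides each pair gives [i PI] by the arctangent, so no logarithm enters. *)
Lemma rect_inv (a : C) (r : R) : 0 < r ->
  rect (fun z => / (z - a))%C (Re a - r) (Re a + r) (Im a - r) (Im a + r) = two_pi_i.
Proof.
intros Hr; unfold rect; destruct a as [ax ay]; simpl Re; simpl Im.
assert (Hcont : forall z, z <> (ax, ay) -> ccont_on (fun z => z <> (ax, ay)) (fun z => / (z - (ax, ay)))%C z).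
{ intros z Hz; apply ccont_on_inv.
  - now apply Cminus_eq_contra.
  - apply ccont_on_minus; [apply ccont_on_id|apply ccont_on_const]. }
assert (Hh : forall y, y <> ay -> Rcont_on (ax - r) (ax + r) (fun x => / ((x, y) - (ax, ay)))%C).
{ intros y Hy; apply (Rcont_h (fun z => z <> (ax, ay)) (fun z => / (z - (ax, ay)))%C); auto.
  intros x _ E; inversion E; auto. }
assert (Hv : forall x, x <> ax -> Rcont_on (ay - r) (ay + r) (fun y => / ((x, y) - (ax, ay)))%C).
{ intros y Hy; apply (Rcont_v (fun z => z <> (ax, ay)) (fun z => / (z - (ax, ay)))%C); auto.
  intros x _ E; inversion E; auto. }
assert (Hneg : forall g a b, a <= b -> Rcont_on a b g -> (- cRInt g a b)%C = cRInt (fun x => (- RtoC 1) * g x)%C a b).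
{ intros g a b Hab Hg; rewrite cRInt_scal; auto; ring. }
assert (Hsc : forall g, Rcont_on (ax - r) (ax + r) g -> Rcont_on (ax - r) (ax + r) (fun x => - RtoC 1 * g x)%C).
{ intros g Hg t Ht eps He; destruct (Hg t Ht eps He) as [d [Hd K]]; exists d; split; auto.
  intros s Hs Hst; replace (- RtoC 1 * g s - - RtoC 1 * g t)%C with (- (g s - g t))%C by ring.
  rewrite Cmod_opp; auto. }
assert (Hsc' : forall g, Rcont_on (ay - r) (ay + r) g -> Rcont_on (ay - r) (ay + r) (fun x => - RtoC 1 * g x)%C).
{ intros g Hg t Ht eps He; destruct (Hg t Ht eps He) as [d [Hd K]]; exists d; split; auto.
  intros s Hs Hst; replace (- RtoC 1 * g s - - RtoC 1 * g t)%C with (- (g s - g t))%C by ring.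
  rewrite Cmod_opp; auto. }
assert (Hsplit : forall A B D E : C, (A - B + Ci * (D - E))%C = (A + (- B) + Ci * (D + (- E)))%C)
  by (intros; ring).
rewrite Hsplit.
rewrite (Hneg (fun x => / ((x, (ay + r)%R) - (ax, ay)))%C) by (try apply Hh; lra).
rewrite <- cRInt_plus by (try apply Hsc; try apply Hh; lra).
rewrite (Hneg (fun y => / (((ax - r)%R, y) - (ax, ay)))%C) by (try apply Hv; lra).
rewrite <- cRInt_plus by (try apply Hsc'; try apply Hv; lra).
assert (Hnz : forall u, (r * r + u * u)%R <> 0)
  by (intros u; pose proof (Rle_0_sqr u) as Q; unfold Rsqr in Q; nra).
assert (Hp : forall u v : R, (u * u + v * v <> 0)%R -> (/ (u, v))%C = (u / (u * u + v * v), - v / (u * u + v * v))%R).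
{ intros u v _; unfold Cinv; simpl; rewrite !Rmult_1_r; reflexivity. }
rewrite (cRInt_ext _ (fun x => Ci * RtoC (2 * r / (r * r + (x - ax) * (x - ax))))%C); [|lra|].
2:{ intros x _.
    replace ((x, (ay - r)%R) - (ax, ay))%C with ((x - ax, - r) : C)
      by (unfold Cminus, Cplus, Copp; simpl; f_equal; ring).
    replace ((x, (ay + r)%R) - (ax, ay))%C with ((x - ax, r) : C)
      by (unfold Cminus, Cplus, Copp; simpl; f_equal; ring).
    specialize (Hnz (x - ax)).
    rewrite !Hp by nra.
    unfold Cplus, Cmult, Copp, Ci, RtoC; simpl; f_equal; field; nra. }
rewrite (cRInt_ext (fun y => / (((ax + r)%R, y) - (ax, ay)) +
    - RtoC 1 * / (((ax - r)%R, y) - (ax, ay)))%C (fun y => RtoC (2 * r / (r * r + (y - ay) * (y - ay))))%C); [|lra|].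
2:{ intros y _.
    replace (((ax + r)%R, y) - (ax, ay))%C with ((r, y - ay) : C)
      by (unfold Cminus, Cplus, Copp; simpl; f_equal; ring).
    replace (((ax - r)%R, y) - (ax, ay))%C with ((- r, y - ay) : C)
      by (unfold Cminus, Cplus, Copp; simpl; f_equal; ring).
    specialize (Hnz (y - ay)).
    rewrite !Hp by nra.
    unfold Cplus, Cmult, Copp, Ci, RtoC; simpl; f_equal; field; nra. }
rewrite cRInt_scal; [|lra|].
2:{ intros t Ht eps He.
    assert (Hc : continuity_pt (fun x => 2 * r / (r * r + (x - ax) * (x - ax))) t).
    { apply derivable_continuous_pt, ex_derive_Reals_0; auto_derive; apply Hnz. }
    destruct (Hc eps He) as [d [Hd K]]; exists d; split; auto; intros s _ Hst.
    rewrite <- RtoC_minus, Cmod_R.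
    destruct (Req_dec t s) as [<-|Hne]; [rewrite Rminus_diag, Rabs_R0; auto|].
    apply K; split; [split; [exact I|exact Hne]|exact Hst]. }
rewrite !atan_integral by auto.
unfold two_pi_i; rewrite RtoC_mult; ring.
Qed.

(** * Discrete Stokes formula for closed paths on a grid *)

Definition adj (a a' : nat) : Prop := a' = a \/ a' = S a \/ a = S a'.

(* Each step goes from [(a k, b k)] horizontally to [(a (S k), b k)] and then
   vertically to [(a (S k), b (S k))]; [X i j] and [Y i j] are the weights of the
   edges leaving [(i, j)] to the right and upwards. *)
Definition grid_sum (X Y : nat -> nat -> C) (a b : nat -> nat) (N : nat) : C :=
  Csum N (fun k =>
    RtoC (INR (a (S k)) - INR (a k)) * X (Nat.min (a k) (a (S k))) (b k) +
    RtoC (INR (b (S k)) - INR (b k)) * Y (a (S k)) (Nat.min (b k) (b (S k))))%C.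

Definition circulation (X Y : nat -> nat -> C) (i j : nat) : C :=
  (X i j + Y (S i) j - X i (S j) - Y i j)%C.

(** Signed number of crossings of the vertical ray going up from the cell [(i, j)], leftward
    crossings counting [+1]; for a closed path this is its winding number around the cell. *)
Definition wind (a b : nat -> nat) (N i j : nat) : R :=
  - Rsum N (fun k => (INR (a (S k)) - INR (a k)) *
      ind (Nat.min (a k) (a (S k)) = i /\ (j < b k)%nat)).

Lemma Csum_truncate (M b : nat) (g : nat -> C) : (b <= M)%nat ->
  Csum M (fun j => RtoC (ind (j < b)%nat) * g j)%C = Csum b g.
Proof.
intros H; induction H as [|M H IH]; simpl.
- apply Csum_ext; intros k Hk; rewrite ind_true by auto; ring.
- rewrite IH, ind_false by lia; ring.
Qed.

Lemma RtoC_Rsum (n : nat) (f : nat -> R) : RtoC (Rsum n f) = Csum n (fun k => RtoC (f k)).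
Proof. induction n as [|n IH]; simpl; [easy|]. rewrite RtoC_plus, IH; easy. Qed.

(** Sum of the weights along the bottom row and then up the column [i]. Vertical edges are exact
    differences of it; horizontal ones differ from such a difference by the circulation enclosed
    between them and the bottom row. *)
Definition potential (X Y : nat -> nat -> C) (i j : nat) : C :=
  (Csum i (fun i' => X i' O) + Csum j (fun j' => Y i j'))%C.

Lemma grid_potential (X Y : nat -> nat -> C) (M a a' b : nat) : adj a a' -> (Nat.min a a' < M)%nat -> (b <= M)%nat ->
  (RtoC (INR a' - INR a) * X (Nat.min a a') b)%C =
  (potential X Y a' b - potential X Y a b - Csum M (fun i => Csum M (fun j =>
     RtoC ((INR a' - INR a) * ind (Nat.min a a' = i /\ (j < b)%nat)) * circulation X Y i j)))%C.
Proof.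
set (Phi := potential X Y).
assert (Hbase : forall a b, X a b = (Phi (S a) b - Phi a b - Csum b (circulation X Y a))%C).
{ clear a a' b; intros a b; unfold Phi, potential, circulation; simpl.
  induction b as [|b IH]; simpl; [ring|].
  replace (X a (S b)) with (X a b - (X a b - X a (S b)))%C by ring.
  rewrite IH at 1; ring. }
assert (Hsum : forall (m b : nat) (v : R), (m < M)%nat -> (b <= M)%nat ->
  Csum M (fun i => Csum M (fun j => RtoC (v * ind (m = i /\ (j < b)%nat)) * circulation X Y i j))%C
  = (RtoC v * Csum b (circulation X Y m))%C).
{ clear a a' b; intros m b v Hm Hb.
  rewrite (Csum_single M m); auto.
  - rewrite <- (Csum_truncate M b), <- Csum_scal by auto; apply Csum_ext; intros j Hj.
    rewrite RtoC_mult.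
    replace (ind (m = m /\ (j < b)%nat)) with (ind (j < b)%nat); [ring|].
    unfold ind; repeat destruct excluded_middle_informative; tauto.
  - intros i Hi Hne; apply Csum_zero; intros j Hj.
    rewrite ind_false, Rmult_0_r by (intros [E _]; auto); ring. }
intros Hadj Hm Hb; rewrite Hsum by auto.
destruct Hadj as [->|[->| ->]].
- rewrite Rminus_diag; ring.
- rewrite Nat.min_l by lia; rewrite S_INR.
  replace (INR a + 1 - INR a) with 1 by ring; rewrite (Hbase a b) at 1; ring.
- rewrite Nat.min_r by lia; rewrite S_INR.
  replace (INR a' - (INR a' + 1)) with (- (1)) by ring; rewrite RtoC_opp.
  rewrite (Hbase a' b) at 1; ring.
Qed.

Definition closed_grid_path (M N : nat) (a b : nat -> nat) : Prop :=
  (forall k, (a k < M)%nat /\ (b k < M)%nat) /\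
  (forall k, (k < N)%nat -> adj (a k) (a (S k)) /\ adj (b k) (b (S k))) /\
  a N = a O /\ b N = b O.

(** The differences of [potential] cancel around the path. Each horizontal edge leaves, with sign,
    the circulations of the cells below it, and collecting them cell by cell gives the crossing
    count [wind]. *)
Lemma grid_stokes (X Y : nat -> nat -> C) (M N : nat) (a b : nat -> nat) :
  closed_grid_path M N a b ->
  grid_sum X Y a b N =
  Csum M (fun i => Csum M (fun j => RtoC (wind a b N i j) * circulation X Y i j))%C.
Proof.
intros [Hr [Ha [Ea Eb]]].
set (Phi := potential X Y).
set (w := fun k i j => (INR (a (S k)) - INR (a k)) *
   ind (Nat.min (a k) (a (S k)) = i /\ (j < b k)%nat)).
transitivity (Csum N (fun k => (Phi (a (S k)) (b (S k)) - Phi (a k) (b k)) -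
  Csum M (fun i => Csum M (fun j => RtoC (w k i j) * circulation X Y i j)))%C).
- apply Csum_ext; intros k Hk.
  destruct (Ha k Hk) as [A1 A2]; destruct (Hr k) as [R1 R2].
  rewrite (grid_potential X Y M) by (auto; lia).
  fold Phi.
  change (Csum M (fun i => Csum M (fun j => RtoC ((INR (a (S k)) - INR (a k)) *
     ind (Nat.min (a k) (a (S k)) = i /\ (j < b k)%nat)) * circulation X Y i j))%C)
   with (Csum M (fun i => Csum M (fun j => RtoC (w k i j) * circulation X Y i j))%C).
  replace (RtoC (INR (b (S k)) - INR (b k)) * Y (a (S k)) (Nat.min (b k) (b (S k))))%C
    with (Phi (a (S k)) (b (S k)) - Phi (a (S k)) (b k))%C; [ring|].
  unfold Phi, potential; destruct A2 as [->|[->| ->]].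
  + rewrite Rminus_diag; ring.
  + rewrite Nat.min_l, S_INR by lia; simpl.
    replace (INR (b k) + 1 - INR (b k)) with 1 by ring; ring.
  + rewrite Nat.min_r, S_INR by lia; simpl.
    replace (INR (b (S k)) - (INR (b (S k)) + 1)) with (- (1)) by ring.
    rewrite RtoC_opp; ring.
- rewrite Csum_minus, (Csum_telescope N (fun k => Phi (a k) (b k))), Ea, Eb.
  rewrite Csum_swap.
  replace (Csum M (fun j => Csum N (fun i => Csum M (fun j0 => RtoC (w i j j0) * circulation X Y j j0))))%C
   with (Csum M (fun i => Csum M (fun j => RtoC (- wind a b N i j) * circulation X Y i j)))%C.
  + replace (Phi (a O) (b O) - Phi (a O) (b O) -
      Csum M (fun i => Csum M (fun j => RtoC (- wind a b N i j) * circulation X Y i j)))%C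
    with (- RtoC 1 * Csum M (fun i => Csum M (fun j => RtoC (- wind a b N i j) * circulation X Y i j)))%C
      by ring.
    rewrite <- Csum_scal; apply Csum_ext; intros i _.
    rewrite <- Csum_scal; apply Csum_ext; intros j _.
    rewrite RtoC_opp; ring.
  + apply Csum_ext; intros i _; rewrite Csum_swap; apply Csum_ext; intros j _.
    unfold wind; rewrite Ropp_involutive; fold (w 0%nat).
    rewrite RtoC_Rsum, Cmult_comm, <- Csum_scal; apply Csum_ext; intros k _.
    unfold w; ring.
Qed.

Lemma wind_integer (a b : nat -> nat) (N i j : nat) : exists z : Z, wind a b N i j = IZR z.
Proof.
unfold wind.
assert (H : exists z : Z, Rsum N (fun k => (INR (a (S k)) - INR (a k)) *
      ind (Nat.min (a k) (a (S k)) = i /\ (j < b k)%nat)) = IZR z).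
{ induction N as [|N [z IH]]; simpl Rsum; [exists 0%Z; easy|].
  unfold ind; destruct excluded_middle_informative.
  - exists (z + (Z.of_nat (a (S N)) - Z.of_nat (a N)))%Z.
    rewrite plus_IZR, minus_IZR, <- !INR_IZR_INZ; rewrite <- IH; unfold ind; ring.
  - exists z; rewrite <- IH; unfold ind; ring. }
destruct H as [z Hz]; exists (- z)%Z; rewrite Hz, opp_IZR; ring.
Qed.

Lemma Rabs_Rsum (n : nat) (f : nat -> R) : Rabs (Rsum n f) <= Rsum n (fun k => Rabs (f k)).
Proof.
induction n as [|n IH]; simpl; [rewrite Rabs_R0; lra|].
eapply Rle_trans; [apply Rabs_triang|lra].
Qed.

Lemma wind_le_columns (a b : nat -> nat) (N i j : nat) :
  (forall k, (k < N)%nat -> adj (a k) (a (S k))) ->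
  Rabs (wind a b N i j) <= Rsum N (fun k => ind (Nat.min (a k) (a (S k)) = i)).
Proof.
intros Ha; unfold wind; rewrite Rabs_Ropp; eapply Rle_trans; [apply Rabs_Rsum|].
apply Rsum_le; intros k Hk; specialize (Ha k Hk).
rewrite Rabs_mult.
assert (H1 : Rabs (INR (a (S k)) - INR (a k)) <= 1).
{ destruct Ha as [->|[->| ->]]; rewrite ?S_INR; apply Rabs_le; lra. }
rewrite (Rabs_pos_eq (ind _)) by apply ind_range.
pose proof (Rabs_pos (INR (a (S k)) - INR (a k))).
unfold ind; repeat destruct excluded_middle_informative; try tauto; lra.
Qed.

(** [wind] can also be counted along a horizontal ray. The indicator of the quadrant [i < a],
    [j < b] returns to its initial value around the path; its changes under horizontal steps sum to
    [- wind], so those under vertical steps, which occur only across row [j], sum to [wind]. *)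
Lemma wind_le_rows (M N : nat) (a b : nat -> nat) (i j : nat) :
  closed_grid_path M N a b ->
  Rabs (wind a b N i j) <= Rsum N (fun k => ind (Nat.min (b k) (b (S k)) = j)).
Proof.
intros [_ [Ha [Ea Eb]]].
set (psi := fun k => ind ((i < a k)%nat /\ (j < b k)%nat)).
set (psi' := fun k => ind ((i < a (S k))%nat /\ (j < b k)%nat)).
assert (E : wind a b N i j = Rsum N (fun k => psi (S k) - psi' k)).
{ unfold wind.
  rewrite (Rsum_ext N _ (fun k => psi' k - psi k)).
  - assert (T : Rsum N (fun k => psi (S k) - psi k) = 0).
    { rewrite Rsum_telescope; unfold psi; rewrite Ea, Eb; ring. }
    rewrite (Rsum_ext N _ (fun k => (psi (S k) - psi' k) + (psi' k - psi k))) in T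
      by (intros; ring).
    rewrite Rsum_plus in T; lra.
  - intros k Hk; destruct (Ha k Hk) as [A _]; unfold psi, psi'.
    destruct A as [->|[->| ->]]; rewrite ?S_INR;
      unfold ind; repeat destruct excluded_middle_informative; try lia; lra. }
rewrite E; eapply Rle_trans; [apply Rabs_Rsum|].
apply Rsum_le; intros k Hk; destruct (Ha k Hk) as [_ A]; unfold psi, psi'.
unfold adj in A; unfold ind; repeat destruct excluded_middle_informative; try lia;
  unfold Rabs; destruct Rcase_abs; lra.
Qed.

Lemma Rsum_ind_eq (M m : nat) : Rsum M (fun i => ind (m = i)) <= 1.
Proof.
enough (H : Rsum M (fun i => ind (m = i)) <= ind (m < M)%nat)
  by (eapply Rle_trans; [exact H|apply ind_range]).
induction M as [|M IH]; simpl; [apply ind_range|].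
unfold ind in *; repeat destruct excluded_middle_informative; try lia; lra.
Qed.

(** A discrete isoperimetric inequality in the manner of Loomis and Whitney: [|wind|] is at most the
    number [H i] of steps in its column and at most the number [V j] of steps in its row, so the sum
    of squares is at most the product of the sums of [H] and [V]. *)
Lemma wind_square_sum (M N : nat) (a b : nat -> nat) :
  closed_grid_path M N a b ->
  Rsum M (fun i => Rsum M (fun j => wind a b N i j * wind a b N i j)) <= INR N * INR N.
Proof.
intros Hp.
set (H := fun i => Rsum N (fun k => ind (Nat.min (a k) (a (S k)) = i))).
set (V := fun j => Rsum N (fun k => ind (Nat.min (b k) (b (S k)) = j))).
assert (HH : Rsum M H <= INR N).
{ unfold H; rewrite Rsum_swap, <- (Rmult_1_r (INR N)), <- Rsum_const.
  apply Rsum_le; intros; apply Rsum_ind_eq. }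
assert (HV : Rsum M V <= INR N).
{ unfold V; rewrite Rsum_swap, <- (Rmult_1_r (INR N)), <- Rsum_const.
  apply Rsum_le; intros; apply Rsum_ind_eq. }
assert (PH : forall i, 0 <= H i) by (intros; apply Rsum_pos; intros; apply ind_range).
assert (PV : forall i, 0 <= V i) by (intros; apply Rsum_pos; intros; apply ind_range).
apply Rle_trans with (Rsum M (fun i => Rsum M (fun j => H i * V j))).
- apply Rsum_le; intros i _; apply Rsum_le; intros j _.
  assert (W1 : Rabs (wind a b N i j) <= H i)
    by (apply wind_le_columns; intros k Hk; now apply (proj1 (proj2 Hp))).
  assert (W2 : Rabs (wind a b N i j) <= V j) by (eapply wind_le_rows; eauto).
  replace (wind a b N i j * wind a b N i j) with (Rabs (wind a b N i j) * Rabs (wind a b N i j)).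
  + apply Rmult_le_compat; auto; apply Rabs_pos.
  + rewrite <- Rabs_mult; apply Rabs_pos_eq, Rle_0_sqr.
- erewrite Rsum_ext; [|intros i _; rewrite Rsum_scal, Rmult_comm; reflexivity].
  rewrite Rsum_scal; apply Rmult_le_compat; auto; apply Rsum_pos; auto.
Qed.

(** * Grid paths approximating a curve *)

Definition gpt (o : C) (d : R) (i j : nat) : C := (Re o + INR i * d, Im o + INR j * d).

Definition in_frame (o : C) (d : R) (M : nat) (z : C) : Prop :=
  0 <= Re z - Re o < INR M * d /\ 0 <= Im z - Im o < INR M * d.

Lemma grid_path_exists (o : C) (d : R) (M N : nat) (u : nat -> C) : 0 < d ->
  (forall k, in_frame o d M (u k)) ->
  (forall k, (k < N)%nat -> Cmod (u (S k) - u k) <= d) -> u N = u O ->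
  exists a b, closed_grid_path M N a b /\ forall k, Cmod (gpt o d (a k) (b k) - u k) <= 2 * d.
Proof.
intros Hd Hf Hu Hc.
assert (Hfl : forall x, 0 <= x -> exists n : nat, INR n * d <= x < (INR n + 1) * d).
{ intros x Hx; destruct (nfloor_ex (x / d)) as [n Hn].
  - apply Rdiv_le_0_compat; lra.
  - exists n; assert (E : x / d * d = x) by (field; lra).
    split; [rewrite <- E; apply Rmult_le_compat_r; lra|].
    rewrite <- E at 1; apply Rmult_lt_compat_r; lra. }
(* Indices are chosen as functions of the point and not of [k], so that [u N = u O] closes the grid
   path. *)
assert (Ha : forall z : C, exists n : nat, 0 <= Re z - Re o ->
  INR n * d <= Re z - Re o < (INR n + 1) * d).
{ intros z; destruct (Rle_dec 0 (Re z - Re o)) as [H|H].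
  - destruct (Hfl _ H) as [n Hn]; exists n; auto.
  - exists O; tauto. }
assert (Hb : forall z : C, exists n : nat, 0 <= Im z - Im o ->
  INR n * d <= Im z - Im o < (INR n + 1) * d).
{ intros z; destruct (Rle_dec 0 (Im z - Im o)) as [H|H].
  - destruct (Hfl _ H) as [n Hn]; exists n; auto.
  - exists O; tauto. }
destruct (choice _ Ha) as [fa Hfa]; destruct (choice _ Hb) as [fb Hfb].
assert (HA : forall k, INR (fa (u k)) * d <= Re (u k) - Re o < (INR (fa (u k)) + 1) * d)
  by (intros k; apply Hfa; destruct (Hf k); lra).
assert (HB : forall k, INR (fb (u k)) * d <= Im (u k) - Im o < (INR (fb (u k)) + 1) * d)
  by (intros k; apply Hfb; destruct (Hf k); lra).
assert (Hadj : forall m m' x x', INR m * d <= x < (INR m + 1) * d ->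
   INR m' * d <= x' < (INR m' + 1) * d -> Rabs (x' - x) <= d -> adj m m').
{ intros m m' x x' H1 H2 H3; apply Rabs_le_between in H3.
  assert (L1 : (m' < m + 2)%nat).
  { apply INR_lt; rewrite plus_INR; simpl (INR 2).
    apply Rmult_lt_reg_r with d; auto; lra. }
  assert (L2 : (m < m' + 2)%nat).
  { apply INR_lt; rewrite plus_INR; simpl (INR 2).
    apply Rmult_lt_reg_r with d; auto; lra. }
  unfold adj; lia. }
exists (fun k => fa (u k)), (fun k => fb (u k)); split; [split; [|split; [|split]]|].
- intros k; destruct (Hf k) as [F1 F2]; specialize (HA k); specialize (HB k); split;
    apply INR_lt, (Rmult_lt_reg_r d); auto; lra.
- intros k Hk; specialize (Hu k Hk); split.
  + apply (Hadj _ _ (Re (u k) - Re o) (Re (u (S k)) - Re o)); auto.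
    pose proof (re_le_Cmod (u (S k) - u k)) as E.
    change (Re (u (S k) - u k)%C) with (Re (u (S k)) - Re (u k)) in E.
    replace (Re (u (S k)) - Re o - (Re (u k) - Re o)) with (Re (u (S k)) - Re (u k)) by ring; lra.
  + apply (Hadj _ _ (Im (u k) - Im o) (Im (u (S k)) - Im o)); auto.
    pose proof (Im_le_Cmod (u (S k) - u k)) as E.
    change (Im (u (S k) - u k)%C) with (Im (u (S k)) - Im (u k)) in E.
    replace (Im (u (S k)) - Im o - (Im (u k) - Im o)) with (Im (u (S k)) - Im (u k)) by ring; lra.
- now rewrite Hc.
- now rewrite Hc.
- intros k; specialize (HA k); specialize (HB k).
  eapply Rle_trans; [apply Cmod_Re_Im|].
  change (Rabs (Re o + INR (fa (u k)) * d - Re (u k)) +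
    Rabs (Im o + INR (fb (u k)) * d - Im (u k)) <= 2 * d).
  assert (Rabs (Re o + INR (fa (u k)) * d - Re (u k)) <= d) by (apply Rabs_le; lra).
  assert (Rabs (Im o + INR (fb (u k)) * d - Im (u k)) <= d) by (apply Rabs_le; lra).
  lra.
Qed.

Lemma gpt_near (o : C) (d : R) (i j i' j' : nat) : 0 <= d ->
  Rabs (INR i - INR i') <= 1 -> j = j' \/ (i = i' /\ Rabs (INR j - INR j') <= 1) ->
  Cmod (gpt o d i j - gpt o d i' j') <= d.
Proof.
intros Hd Hi [<-|[<- Hj]]; unfold gpt.
- rewrite Cmod_pair_h.
  replace (Re o + INR i * d - (Re o + INR i' * d)) with ((INR i - INR i') * d) by ring.
  rewrite Rabs_mult, (Rabs_pos_eq d) by auto; nra.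
- rewrite Cmod_pair_v.
  replace (Im o + INR j * d - (Im o + INR j' * d)) with ((INR j - INR j') * d) by ring.
  rewrite Rabs_mult, (Rabs_pos_eq d) by auto; nra.
Qed.

Lemma adj_min (a a' : nat) : adj a a' ->
  Rabs (INR a' - INR a) <= 1 /\ Rabs (INR (Nat.min a a') - INR a) <= 1 /\
  Rabs (INR (Nat.min a a') - INR a') <= 1.
Proof.
intros [->|[->| ->]].
- rewrite Nat.min_id, Rminus_diag, Rabs_R0; lra.
- rewrite Nat.min_l, S_INR by lia; repeat split; apply Rabs_le; lra.
- rewrite Nat.min_r, S_INR by lia; repeat split; apply Rabs_le; lra.
Qed.

(** Three errors add up: edge weights against [phi] times the edge vectors, vertices of the grid
    path against points of the curve, and the partition sum against the integral. The first two cost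
    [2 e d] per step each, the last [e (l 1 - l 0)]. *)
Lemma grid_sum_approx (c : R -> C) (l : R -> R) (phi : C -> C) (X Y : nat -> nat -> C)
  (o : C) (d e : R) (M N : nat) (t : nat -> R) (a b : nat -> nat) :
  regular_curve c -> length_bound c l -> cont_on_curve c phi -> c 0 = c 1 ->
  0 < d -> 0 <= e ->
  t O = 0 -> t N = 1 -> (forall k, t k <= t (S k)) ->
  (forall k x, t k <= x <= t (S k) -> Cmod (c x - c (t k)) <= d) ->
  closed_grid_path M N a b ->
  (forall k, Cmod (gpt o d (a k) (b k) - c (t k)) <= 2 * d) ->
  (forall k x, (k < N)%nat -> t k <= x <= t (S k) -> Cmod (phi (c x) - phi (c (t k))) <= e) ->
  (forall k i j, (k < N)%nat -> Cmod (gpt o d i j - c (t k)) <= 4 * d ->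
     Cmod (X i j - RtoC d * phi (c (t k))) <= e * d /\
     Cmod (Y i j - RtoC d * (Ci * phi (c (t k)))) <= e * d) ->
  Cmod (grid_sum X Y a b N - contour_int c phi) <= e * (4 * (INR N * d) + (l 1 - l 0)).
Proof.
intros Hr Hl Hphi Hc01 Hd He Ht0 Ht1 Htm Htc Hp Hv Hosc HXY.
destruct Hp as [_ [Hadj [Ea Eb]]].
set (v := fun k => gpt o d (a k) (b k)).
set (f := fun k => phi (c (t k))).
assert (Hfc : f N = f O) by (unfold f; rewrite Ht0, Ht1, Hc01; easy).
assert (Hstep : forall k, (v (S k) - v k =
   RtoC (INR (a (S k)) - INR (a k)) * RtoC d + RtoC (INR (b (S k)) - INR (b k)) * (RtoC d * Ci))%C).
{ intros k; unfold v, gpt, Cminus, Cplus, Copp, Cmult, RtoC, Ci; simpl; f_equal; ring. }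
assert (B1 : Cmod (grid_sum X Y a b N - Csum N (fun k => f k * (v (S k) - v k))%C)
  <= INR N * (2 * (e * d))).
{ unfold grid_sum; rewrite <- Csum_minus, <- Rsum_const.
  eapply Rle_trans; [apply Cmod_Csum|]; apply Rsum_le; intros k Hk.
  destruct (Hadj k Hk) as [A1 A2].
  destruct (adj_min _ _ A1) as [A3 [A4 A5]]; destruct (adj_min _ _ A2) as [A6 [A7 A8]].
  rewrite Hstep.
  set (ma := Nat.min (a k) (a (S k))) in *; set (mb := Nat.min (b k) (b (S k))) in *.
  replace (_ - _)%C with
    (RtoC (INR (a (S k)) - INR (a k)) * (X ma (b k) - RtoC d * f k) +
     RtoC (INR (b (S k)) - INR (b k)) * (Y (a (S k)) mb - RtoC d * (Ci * f k)))%C by ring.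
  eapply Rle_trans; [apply Cmod_triangle|]; rewrite !Cmod_mult, !Cmod_R.
  assert (D1 : Cmod (X ma (b k) - RtoC d * f k) <= e * d).
  { apply (HXY k); auto.
    eapply Rle_trans; [apply (Cmod_dist_triangle _ (v k))|].
    specialize (Hv k); fold (v k) in Hv.
    assert (Cmod (gpt o d ma (b k) - v k) <= d); [|lra].
    apply gpt_near; auto; lra. }
  (* The vertical edge may be [4 * d] away from [c (t k)]: [d] along the edge, [2 * d] for rounding
     and [d] for the step of the curve. *)
  assert (D2 : Cmod (Y (a (S k)) mb - RtoC d * (Ci * f k)) <= e * d).
  { apply (HXY k); auto.
    eapply Rle_trans; [apply (Cmod_dist_triangle _ (v (S k)))|].
    eapply Rle_trans; [apply Rplus_le_compat_l, (Cmod_dist_triangle _ (c (t (S k))))|].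
    specialize (Hv (S k)); fold (v (S k)) in Hv.
    assert (Cmod (c (t (S k)) - c (t k)) <= d) by (apply Htc; specialize (Htm k); lra).
    assert (Cmod (gpt o d (a (S k)) mb - v (S k)) <= d); [|lra].
    apply gpt_near; [lra| |right; split; auto].
    rewrite Rminus_diag, Rabs_R0; lra. }
  pose proof (Cmod_ge_0 (X ma (b k) - RtoC d * f k)).
  pose proof (Cmod_ge_0 (Y (a (S k)) mb - RtoC d * (Ci * f k))).
  pose proof (Rabs_pos (INR (a (S k)) - INR (a k))).
  pose proof (Rabs_pos (INR (b (S k)) - INR (b k))).
  nra. }
(* Summation by parts for the rounding errors [v k - c (t k)]. *)
assert (B2 : Cmod (Csum N (fun k => f k * (v (S k) - v k))%C -
    Csum N (fun k => f k * (c (t (S k)) - c (t k)))%C) <= INR N * (2 * (e * d))).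
{ set (w := fun k => (v k - c (t k))%C).
  replace (Csum N (fun k => f k * (v (S k) - v k))%C -
    Csum N (fun k => f k * (c (t (S k)) - c (t k)))%C)%C
   with (Csum N (fun k => (f (S k) * w (S k) - f k * w k) - (f (S k) - f k) * w (S k))%C).
  2:{ rewrite <- Csum_minus; apply Csum_ext; intros; unfold w; ring. }
  rewrite Csum_minus, (Csum_telescope N (fun k => f k * w k)%C).
  replace (f N * w N)%C with (f O * w O)%C.
  2:{ rewrite Hfc; unfold w, v; rewrite Ea, Eb, Ht0, Ht1, Hc01; easy. }
  match goal with |- Cmod ?X <= _ => replace X with
    (- Csum N (fun k => (f (S k) - f k) * w (S k)))%C by ring end.
  rewrite Cmod_opp, <- Rsum_const.
  eapply Rle_trans; [apply Cmod_Csum|]; apply Rsum_le; intros k Hk.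
  rewrite Cmod_mult.
  assert (Cmod (f (S k) - f k) <= e) by (apply Hosc; auto; specialize (Htm k); lra).
  assert (Cmod (w (S k)) <= 2 * d) by apply Hv.
  pose proof (Cmod_ge_0 (f (S k) - f k)); pose proof (Cmod_ge_0 (w (S k))).
  apply Rle_trans with (e * (2 * d)); [apply Rmult_le_compat; auto|lra]. }
assert (B3 : Cmod (contour_int c phi - Csum N (fun k => f k * (c (t (S k)) - c (t k)))%C)
  <= e * (l 1 - l 0)) by (apply contour_int_partition; auto).
set (P := Csum N (fun k => f k * (v (S k) - v k))%C) in *.
set (Q := Csum N (fun k => f k * (c (t (S k)) - c (t k)))%C) in *.
replace (grid_sum X Y a b N - contour_int c phi)%C with
  ((grid_sum X Y a b N - P) + (P - Q) - (contour_int c phi - Q))%C by ring.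
eapply Rle_trans; [apply Cmod_triangle_minus|].
eapply Rle_trans; [apply Rplus_le_compat_r, Cmod_triangle|].
lra.
Qed.

(** * Winding numbers *)

(** A partition of the curve and the grid path of mesh [d] that follows it. By the last clause the
    number of steps is at most of order [1 / d]. *)
Definition grid_approx (c : R -> C) (l : R -> R) (o : C) (d : R) (M N : nat)
  (t : nat -> R) (a b : nat -> nat) : Prop :=
  t O = 0 /\ t N = 1 /\ (forall k, 0 <= t k <= 1) /\ (forall k, t k <= t (S k)) /\
  (forall k x, t k <= x <= t (S k) -> Cmod (c x - c (t k)) <= d) /\
  closed_grid_path M N a b /\
  (forall k, Cmod (gpt o d (a k) (b k) - c (t k)) <= 2 * d) /\
  INR N * d <= l 1 - l 0 + 2 * d.

Lemma grid_approx_exists (c : R -> C) (l : R -> R) (o : C) (d : R) (M : nat) :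
  Rcont_on 0 1 c -> length_bound c l -> c 0 = c 1 -> 0 < d ->
  (forall s, on_curve c s -> in_frame o d M s) ->
  exists N t a b, grid_approx c l o d M N t a b.
Proof.
intros Hc Hl H01 Hd Hf.
destruct (curve_partition c l d Hc Hl Hd) as [N [t [T0 [T1 [T2 [T3 [T4 T5]]]]]]].
destruct (grid_path_exists o d M N (fun k => c (t k)) Hd) as [a [b [P1 P2]]].
- intros k; apply Hf, on_curve_c, T2.
- intros k Hk; apply T4; specialize (T3 k); lra.
- now rewrite T0, T1.
- exists N, t, a, b.
  refine (conj T0 (conj T1 (conj T2 (conj T3 (conj T4 (conj P1 (conj P2 _))))))).
  apply Rle_trans with (((l 1 - l 0) / d + 2) * d); [apply Rmult_le_compat_r; lra|].
  right; field; lra.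
Qed.

(** The constant is [4 (N d) + L] with [N d <= L + 2 d], where [L = l 1 - l 0]. *)
Lemma grid_approx_sum (c : R -> C) (l : R -> R) (phi : C -> C) (X Y : nat -> nat -> C)
  (o : C) (d e : R) (M N : nat) (t : nat -> R) (a b : nat -> nat) :
  regular_curve c -> length_bound c l -> cont_on_curve c phi -> c 0 = c 1 ->
  0 < d -> 0 <= e -> grid_approx c l o d M N t a b ->
  (forall s s', on_curve c s -> on_curve c s' -> Cmod (s - s') <= d ->
     Cmod (phi s - phi s') <= e) ->
  (forall s i j, on_curve c s -> Cmod (gpt o d i j - s) <= 4 * d ->
     Cmod (X i j - RtoC d * phi s) <= e * d /\
     Cmod (Y i j - RtoC d * (Ci * phi s)) <= e * d) ->
  Cmod (grid_sum X Y a b N - contour_int c phi) <= e * (5 * (l 1 - l 0) + 8 * d).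
Proof.
intros Hr Hl Hphi H01 Hd He [T0 [T1 [T2 [T3 [T4 [T5 [T6 T7]]]]]]] Hosc HXY.
eapply Rle_trans; [eapply (grid_sum_approx c l phi X Y o d e M N t a b); auto|].
- intros k x Hk Hx; apply Hosc; try apply on_curve_c; auto.
  specialize (T2 k) as Q1; specialize (T2 (Datatypes.S k)); lra.
- intros k i j Hk; apply HXY, on_curve_c; auto.
- apply Rmult_le_compat_l; lra.
Qed.

Lemma inv_diff (s s' z : C) (m m' : R) : 0 < m -> 0 < m' ->
  m <= Cmod (s - z) -> m' <= Cmod (s' - z) ->
  Cmod (/ (s - z) - / (s' - z)) <= Cmod (s - s') / (m * m').
Proof.
intros Hm Hm' H H'.
assert (N1 : (s - z)%C <> RtoC 0) by (apply Cmod_gt_0; lra).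
assert (N2 : (s' - z)%C <> RtoC 0) by (apply Cmod_gt_0; lra).
replace (/ (s - z) - / (s' - z))%C with ((s' - s) / ((s - z) * (s' - z)))%C by (field; auto).
rewrite Cmod_div, Cmod_mult, Cmod_minus_sym by (apply Cmult_neq_0; auto).
unfold Rdiv; apply Rmult_le_compat_l; [apply Cmod_ge_0|].
apply Rinv_le_contravar; [nra|]; apply Rmult_le_compat; lra.
Qed.

Lemma cauchy_kernel_cont (c : R -> C) (z : C) : ~ on_curve c z ->
  cont_on_curve c (fun s => / (s - z))%C.
Proof.
intros Hz s Hs; apply ccont_on_inv.
- apply Cminus_eq_contra; intros ->; auto.
- apply ccont_on_minus; [apply ccont_on_id|apply ccont_on_const].
Qed.

(** * Edge integrals, and crossing counts compared with the contour integral *)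

Definition hedge (f : C -> C) (o : C) (d : R) (i j : nat) : C :=
  cRInt (fun x => f (x, Im o + INR j * d)) (Re o + INR i * d) (Re o + INR (S i) * d).

Definition vedge (f : C -> C) (o : C) (d : R) (i j : nat) : C :=
  (Ci * cRInt (fun y => f (Re o + INR i * d, y)%R) (Im o + INR j * d) (Im o + INR (S j) * d))%C.

Lemma circulation_edges (f : C -> C) (o : C) (d : R) (i j : nat) :
  circulation (hedge f o d) (vedge f o d) i j =
  rect f (Re o + INR i * d) (Re o + INR i * d + d) (Im o + INR j * d) (Im o + INR j * d + d).
Proof.
unfold circulation, hedge, vedge, rect.
assert (E1 : Re o + INR (S i) * d = Re o + INR i * d + d) by (rewrite S_INR; ring).
assert (E2 : Im o + INR (S j) * d = Im o + INR j * d + d) by (rewrite S_INR; ring).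
rewrite E1, E2; ring.
Qed.

Lemma cRInt_near_const (g : R -> C) (v : C) (a d e : R) : 0 <= d -> Rcont_on a (a + d) g ->
  (forall x, a <= x <= a + d -> Cmod (g x - v) <= e) ->
  Cmod (cRInt g a (a + d) - RtoC d * v) <= e * d.
Proof.
intros Hd Hg He.
assert (Hgv : Rcont_on a (a + d) (fun x => g x - v)%C).
{ intros t Ht eps Heps; destruct (Hg t Ht eps Heps) as [r [Hr K]]; exists r; split; auto.
  intros s Hs Hst; replace (g s - v - (g t - v))%C with (g s - g t)%C by ring; auto. }
rewrite (cRInt_diff_const (fun x => g x - v)%C g v) by (auto; try lra; intros; ring).
replace (a + d - a) with d by ring.
match goal with |- Cmod ?X <= _ =>
  replace X with (cRInt (fun x => g x - v)%C a (a + d)) by ring end.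
replace (e * d) with ((a + d - a) * e) by ring.
apply cRInt_bound; auto; lra.
Qed.

Lemma hedge_approx (f : C -> C) (o v : C) (d e : R) (i j : nat) : 0 <= d ->
  (forall z, Cmod (z - gpt o d i j) <= d ->
     ccont_on (fun z => Cmod (z - gpt o d i j) <= d) f z) ->
  (forall z, Cmod (z - gpt o d i j) <= d -> Cmod (f z - v) <= e) ->
  Cmod (hedge f o d i j - RtoC d * v) <= e * d.
Proof.
intros Hd Hf He; unfold hedge.
replace (Re o + INR (S i) * d) with (Re o + INR i * d + d) by (rewrite S_INR; ring).
assert (Hin : forall x, Re o + INR i * d <= x <= Re o + INR i * d + d ->
  Cmod ((x, Im o + INR j * d) - gpt o d i j) <= d).
{ intros x Hx; unfold gpt; rewrite Cmod_pair_h; apply Rabs_le; lra. }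
apply cRInt_near_const; auto; eapply Rcont_h; [|exact Hf]; auto.
Qed.

Lemma vedge_approx (f : C -> C) (o v : C) (d e : R) (i j : nat) : 0 <= d ->
  (forall z, Cmod (z - gpt o d i j) <= d ->
     ccont_on (fun z => Cmod (z - gpt o d i j) <= d) f z) ->
  (forall z, Cmod (z - gpt o d i j) <= d -> Cmod (f z - v) <= e) ->
  Cmod (vedge f o d i j - RtoC d * (Ci * v)) <= e * d.
Proof.
intros Hd Hf He; unfold vedge.
replace (Im o + INR (S j) * d) with (Im o + INR j * d + d) by (rewrite S_INR; ring).
assert (Hin : forall y, Im o + INR j * d <= y <= Im o + INR j * d + d ->
  Cmod ((Re o + INR i * d, y) - gpt o d i j) <= d).
{ intros y Hy; unfold gpt; rewrite Cmod_pair_v; apply Rabs_le; lra. }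
match goal with |- Cmod (Ci * ?I - _) <= _ =>
  replace (Ci * I - RtoC d * (Ci * v))%C with (Ci * (I - RtoC d * v))%C by ring end.
rewrite Cmod_mult, Cmod_Ci, Rmult_1_l.
apply cRInt_near_const; auto; eapply Rcont_v; [|exact Hf]; auto.
Qed.

Definition cell_center (o : C) (d : R) (i j : nat) : C :=
  (Re o + INR i * d + d / 2, Im o + INR j * d + d / 2).

Lemma cell_separation (x y d : R) (i i' : nat) : 0 < d ->
  x + INR i * d <= y + INR i' * d + d / 2 <= x + INR i * d + d -> x = y -> i = i'.
Proof.
intros Hd H E.
destruct (Nat.lt_trichotomy i i') as [L|[L|L]]; auto; exfalso.
- apply le_INR in L; rewrite S_INR in L.
  assert ((INR i + 1) * d <= INR i' * d) by (apply Rmult_le_compat_r; lra); lra.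
- apply le_INR in L; rewrite S_INR in L.
  assert ((INR i' + 1) * d <= INR i * d) by (apply Rmult_le_compat_r; lra); lra.
Qed.

(** The factor [two_pi_i] is kept: the value is [two_pi_i] times the winding number. *)
Definition wnum (c : R -> C) (z : C) : C := contour_int c (fun s => / (s - z))%C.

(* The discrete Stokes formula applied to the exact edge integrals of [1 / (s - z)], whose
   circulation vanishes around every cell except the one containing [z]. *)
Lemma wind_wnum (c : R -> C) (l : R -> R) (o : C) (d eta : R) (M N : nat)
  (t : nat -> R) (a b : nat -> nat) (i j : nat) :
  regular_curve c -> length_bound c l -> c 0 = c 1 ->
  0 < d -> 10 * d <= eta -> grid_approx c l o d M N t a b -> (i < M)%nat -> (j < M)%nat ->
  (forall s, on_curve c s -> eta <= Cmod (s - cell_center o d i j)) ->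
  Cmod (RtoC (wind a b N i j) * two_pi_i - wnum c (cell_center o d i j))
  <= 10 * d / (eta * eta) * (5 * (l 1 - l 0) + 8 * d).
Proof.
intros Hr Hl H01 Hd Hde Hg Hi Hj Heta.
set (z := cell_center o d i j) in *.
set (f := fun s => (/ (s - z))%C).
assert (Hz : ~ on_curve c z).
{ intros H; specialize (Heta z H); replace (z - z)%C with (RtoC 0) in Heta by ring.
  rewrite Cmod_0 in Heta; lra. }
assert (He : 0 < eta * eta) by nra.
assert (HS : grid_sum (hedge f o d) (vedge f o d) a b N = (RtoC (wind a b N i j) * two_pi_i)%C).
{ rewrite (grid_stokes _ _ M) by apply Hg.
  assert (Hcell : forall i' j', i' <> i \/ j' <> j ->
    circulation (hedge f o d) (vedge f o d) i' j' = RtoC 0).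
  { intros i' j' Hne; rewrite circulation_edges; apply goursat; [lra|].
    intros w [W1 W2]; apply cdiff_inv.
    - apply Cminus_eq_contra; intros ->.
      unfold z, cell_center in W1, W2; simpl in W1, W2.
      assert (i' = i) by (apply (cell_separation (Re o) (Re o) d); auto).
      assert (j' = j) by (apply (cell_separation (Im o) (Im o) d); auto); lia.
    - apply cdiff_minus; [apply cdiff_id|apply cdiff_const]. }
  rewrite (Csum_single M i); auto.
  - rewrite (Csum_single M j); auto.
    + rewrite circulation_edges.
      replace (rect f (Re o + INR i * d) (Re o + INR i * d + d)
         (Im o + INR j * d) (Im o + INR j * d + d)) with two_pi_i; auto.
      rewrite <- (rect_inv z (d / 2)) by lra; unfold z, cell_center; simpl.
      f_equal; field.
    + intros j' _ Hj'; rewrite Hcell by auto; ring.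
  - intros i' _ Hi'; apply Csum_zero; intros j' _; rewrite Hcell by auto; ring. }
rewrite <- HS.
apply (grid_approx_sum c l f _ _ o d _ M N t a b); auto.
- now apply cauchy_kernel_cont.
- left; apply Rdiv_lt_0_compat; lra.
- intros s s' Hs Hs' Hss.
  eapply Rle_trans; [apply (inv_diff s s' z eta eta); auto; lra|].
  unfold Rdiv; apply Rmult_le_compat_r; [left; now apply Rinv_0_lt_compat|lra].
- intros s i' j' Hs Hn; specialize (Heta s Hs).
  (* On an edge near [s] the points are within [5 * d] of [s], so [10 * d <= eta] leaves them at
     least [eta / 2] from [z]. The kernels then differ by at most [5 d / (eta / 2 * eta)], which is
     the bound of the statement. *)
  assert (Hfar : forall w, Cmod (w - gpt o d i' j') <= d ->
     Cmod (w - s) <= 5 * d /\ eta / 2 <= Cmod (w - z)).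
  { intros w Hw.
    assert (W1 : Cmod (w - s) <= 5 * d)
      by (eapply Rle_trans; [apply (Cmod_dist_triangle _ (gpt o d i' j'))|lra]).
    split; auto.
    pose proof (Cmod_dist_triangle s w z) as T; rewrite (Cmod_minus_sym s w) in T; lra. }
  assert (Hcont : forall w, Cmod (w - gpt o d i' j') <= d ->
     ccont_on (fun w => Cmod (w - gpt o d i' j') <= d) f w).
  { intros w Hw; apply ccont_on_inv.
    - destruct (Hfar w Hw); apply Cmod_gt_0; lra.
    - apply ccont_on_minus; [apply ccont_on_id|apply ccont_on_const]. }
  assert (Hval : forall w, Cmod (w - gpt o d i' j') <= d ->
     Cmod (f w - f s) <= 10 * d / (eta * eta)).
  { intros w Hw; destruct (Hfar w Hw) as [F1 F2].
    eapply Rle_trans; [apply (inv_diff w s z (eta / 2) eta); auto; lra|].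
    replace (10 * d / (eta * eta)) with (5 * d / (eta / 2 * eta)) by (field; lra).
    unfold Rdiv; apply Rmult_le_compat_r; [left; apply Rinv_0_lt_compat; nra|lra]. }
  split; [apply hedge_approx|apply vedge_approx]; auto; lra.
Qed.

Lemma frame_exists (c : R -> C) (z : C) (d : R) : regular_curve c -> 0 < d ->
  exists (o : C) (M i : nat), (i < M)%nat /\ cell_center o d i i = z /\
    forall s, on_curve c s -> in_frame o d M s.
Proof.
intros Hr Hd; destruct (curve_bounded c Hr) as [B [HB Hc]].
set (R0 := B + Cmod z).
pose proof (Cmod_ge_0 z).
destruct (nfloor_ex (R0 / d)) as [K [HK1 HK2]].
{ apply Rdiv_le_0_compat; unfold R0; lra. }
assert (HKd : R0 < (INR K + 1) * d).
{ replace R0 with (R0 / d * d) by (field; lra); apply Rmult_lt_compat_r; lra. }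
set (i := S K).
assert (Ei : INR i = INR K + 1) by apply S_INR.
exists (Re z - INR i * d - d / 2, Im z - INR i * d - d / 2), (2 * i + 1)%nat, i.
split; [lia|]; split.
- unfold cell_center; simpl; destruct z; simpl; f_equal; ring.
- intros s Hs; specialize (Hc s Hs).
  pose proof (re_le_Cmod s) as S1; pose proof (Im_le_Cmod s) as S2.
  pose proof (re_le_Cmod z) as Z1; pose proof (Im_le_Cmod z) as Z2.
  apply Rabs_le_between in S1; apply Rabs_le_between in S2.
  apply Rabs_le_between in Z1; apply Rabs_le_between in Z2.
  assert (EM : INR (2 * i + 1) = 2 * INR i + 1) by (rewrite plus_INR, mult_INR; simpl; ring).
  unfold in_frame; rewrite EM.
  change (Re (Re z - INR i * d - d / 2, Im z - INR i * d - d / 2)) with (Re z - INR i * d - d / 2).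
  change (Im (Re z - INR i * d - d / 2, Im z - INR i * d - d / 2)) with (Im z - INR i * d - d / 2).
  rewrite Ei; unfold R0 in HKd.
  split; lra.
Qed.

(** The grid is placed with [z] at the centre of a cell; the integer is the crossing count of that
    cell, and the error in [wind_wnum] tends to zero with the mesh. *)
Lemma wnum_near_integer (c : R -> C) (z : C) : regular_curve c -> c 0 = c 1 -> ~ on_curve c z ->
  forall eps, 0 < eps -> exists n : Z, Cmod (RtoC (IZR n) * two_pi_i - wnum c z) <= eps.
Proof.
intros Hr H01 Hz eps He.
destruct (curve_dist_pos c z (proj1 Hr) Hz) as [eta [Heta Hdist]].
destruct (rectifiable_length c (proj2 Hr)) as [l Hl].
pose proof (length_bound_mono c l 0 1 Hl ltac:(lra) ltac:(lra) ltac:(lra)) as HL.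
set (Q := 10 / (eta * eta) * (5 * (l 1 - l 0) + 8 * eta)).
assert (HQ : 0 <= Q).
{ apply Rmult_le_pos; [|lra]; left; apply Rdiv_lt_0_compat; nra. }
set (d := Rmin (eta / 10) (eps / (Q + 1))).
assert (Hd : 0 < d) by (apply Rmin_glb_lt; [lra|apply Rdiv_lt_0_compat; lra]).
assert (Hd1 : d <= eta / 10) by apply Rmin_l.
assert (Hd2 : d <= eps / (Q + 1)) by apply Rmin_r.
destruct (frame_exists c z d Hr Hd) as [o [M [i [Hi [Hcc Hframe]]]]].
destruct (grid_approx_exists c l o d M (proj1 Hr) Hl H01 Hd Hframe) as [N [t [a [b Hg]]]].
destruct (wind_integer a b N i i) as [n Hn].
exists n; rewrite <- Hn, <- Hcc.
eapply Rle_trans; [eapply (wind_wnum c l o d eta M N t a b i i); eauto; try lra|].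
- rewrite Hcc; auto.
- apply Rle_trans with (d * Q).
  + unfold Q, Rdiv; replace (10 * d * / (eta * eta) * (5 * (l 1 - l 0) + 8 * d))
      with (d * (10 * / (eta * eta) * (5 * (l 1 - l 0) + 8 * d))) by ring.
    apply Rmult_le_compat_l; [lra|]; apply Rmult_le_compat_l; [|lra].
    left; apply Rmult_lt_0_compat; [lra|apply Rinv_0_lt_compat; nra].
  + apply Rle_trans with (eps / (Q + 1) * (Q + 1)); [|right; field; lra].
    apply Rle_trans with (d * (Q + 1)); [apply Rmult_le_compat_l; lra|].
    apply Rmult_le_compat_r; lra.
Qed.

Lemma Cmod_two_pi_i : Cmod two_pi_i = 2 * PI.
Proof.
unfold two_pi_i; rewrite Cmod_mult, Cmod_Ci, Cmod_R, Rabs_pos_eq; [ring|].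
pose proof PI_RGT_0; lra.
Qed.

Lemma two_pi_gt_6 : 6 < 2 * PI.
Proof. pose proof PI2_3_2; lra. Qed.

Lemma IZR_close_eq (n m : Z) : Rabs (IZR n - IZR m) < 1 -> n = m.
Proof.
rewrite <- minus_IZR, <- abs_IZR; intros H; apply lt_IZR in H; lia.
Qed.

Lemma wnum_integer (c : R -> C) (z : C) : regular_curve c -> c 0 = c 1 -> ~ on_curve c z ->
  exists n : Z, wnum c z = (RtoC (IZR n) * two_pi_i)%C.
Proof.
intros Hr H01 Hz.
destruct (wnum_near_integer c z Hr H01 Hz 1 ltac:(lra)) as [n Hn].
exists n; symmetry; apply Cmod_le_eps_eq; intros eps He.
(* Two integers that both approximate within 1 differ by at most [2 / (2 PI) < 1], so the integer
   does not depend on the precision. *)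
destruct (wnum_near_integer c z Hr H01 Hz (Rmin 1 eps)) as [m Hm].
{ apply Rmin_glb_lt; lra. }
assert (H1 : Rmin 1 eps <= 1) by apply Rmin_l.
assert (H2 : Rmin 1 eps <= eps) by apply Rmin_r.
assert (E : n = m); [|subst; lra].
apply IZR_close_eq.
assert (D : Cmod ((RtoC (IZR n) - RtoC (IZR m)) * two_pi_i) <= 2).
{ replace ((RtoC (IZR n) - RtoC (IZR m)) * two_pi_i)%C with
    ((RtoC (IZR n) * two_pi_i - wnum c z) - (RtoC (IZR m) * two_pi_i - wnum c z))%C by ring.
  eapply Rle_trans; [apply Cmod_triangle_minus|lra]. }
rewrite Cmod_mult, Cmod_two_pi_i, <- RtoC_minus, Cmod_R in D.
pose proof two_pi_gt_6; pose proof (Rabs_pos (IZR n - IZR m)); nra.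
Qed.

Lemma contour_int_diff_bound (c : R -> C) (l : R -> R) (f g : C -> C) (e : R) :
  regular_curve c -> length_bound c l -> cont_on_curve c f -> cont_on_curve c g ->
  (forall s, on_curve c s -> Cmod (f s - g s) <= e) ->
  Cmod (contour_int c f - contour_int c g) <= e * (l 1 - l 0).
Proof.
intros Hr Hl Hf Hg He.
replace (contour_int c f - contour_int c g)%C with
  (contour_int c (fun s => RtoC 1 * f s + (- RtoC 1) * g s)%C)
  by (rewrite contour_int_linear by auto; ring).
apply contour_int_bound; auto.
- intros s Hs; apply ccont_on_plus; apply ccont_on_mult; auto using ccont_on_const.
- intros s Hs; replace (1 * f s + - (1) * g s)%C with (f s - g s)%C by ring; auto.
Qed.

Lemma wnum_continuous (c : R -> C) (z : C) : regular_curve c -> ~ on_curve c z -> ccont_on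
  (fun y => ~ on_curve c y) (wnum c) z.
Proof.
intros Hr Hz eps He.
destruct (curve_dist_pos c z (proj1 Hr) Hz) as [eta [Heta Hdist]].
destruct (rectifiable_length c (proj2 Hr)) as [l Hl].
pose proof (length_bound_mono c l 0 1 Hl ltac:(lra) ltac:(lra) ltac:(lra)) as HL.
assert (He2 : 0 < eta * eta) by nra.
set (Q := (l 1 - l 0) + 1).
set (r := Rmin (eta / 2) (eps * (eta * eta) / (4 * Q))).
assert (Hr0 : 0 < r).
{ apply Rmin_glb_lt; [lra|]; apply Rdiv_lt_0_compat; unfold Q; nra. }
assert (Hr1 : r <= eta / 2) by apply Rmin_l.
assert (Hr2 : r <= eps * (eta * eta) / (4 * Q)) by apply Rmin_r.
exists r; split; auto; intros y Hy Hyz.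
eapply Rle_lt_trans; [apply (contour_int_diff_bound c l _ _ (2 * r / (eta * eta)));
  auto using cauchy_kernel_cont|].
- intros s Hs; specialize (Hdist s Hs).
  assert (Hsy : eta / 2 <= Cmod (s - y)).
  { pose proof (Cmod_dist_triangle s y z); lra. }
  replace (s - y)%C with (- (y - s))%C by ring; replace (s - z)%C with (- (z - s))%C by ring.
  assert (N1 : (y - s)%C <> RtoC 0) by (apply Cmod_gt_0; rewrite Cmod_minus_sym; lra).
  assert (N2 : (z - s)%C <> RtoC 0) by (apply Cmod_gt_0; rewrite Cmod_minus_sym; lra).
  replace (/ - (y - s) - / - (z - s))%C with (- (/ (y - s) - / (z - s)))%C.
  2:{ field; repeat split; auto. }
  rewrite Cmod_opp.
  eapply Rle_trans; [apply (inv_diff y z s (eta / 2) eta); try lra|].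
  + rewrite Cmod_minus_sym; lra.
  + rewrite Cmod_minus_sym; lra.
  + replace (2 * r / (eta * eta)) with (r / (eta / 2 * eta)) by (field; lra).
    unfold Rdiv; apply Rmult_le_compat_r; [left; apply Rinv_0_lt_compat; nra|lra].
- apply Rle_lt_trans with (2 * (eps * (eta * eta) / (4 * Q)) / (eta * eta) * (l 1 - l 0)).
  + apply Rmult_le_compat_r; [lra|]; unfold Rdiv; apply Rmult_le_compat_r.
    * left; now apply Rinv_0_lt_compat.
    * unfold Rdiv in Hr2; lra.
  + replace (2 * (eps * (eta * eta) / (4 * Q)) / (eta * eta) * (l 1 - l 0))
      with (eps / 2 * ((l 1 - l 0) / Q)) by (field; unfold Q; lra).
    assert ((l 1 - l 0) / Q < 1); [|nra].
    unfold Q; apply Rmult_lt_reg_r with (l 1 - l 0 + 1); [lra|].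
    unfold Rdiv; rewrite Rmult_assoc, Rinv_l; lra.
Qed.

Lemma wnum_far (c : R -> C) : regular_curve c ->
  exists M, 0 < M /\ forall z, M < Cmod z -> ~ on_curve c z /\ Cmod (wnum c z) < 1.
Proof.
intros Hr; destruct (curve_bounded c Hr) as [B [HB Hc]].
destruct (rectifiable_length c (proj2 Hr)) as [l Hl].
pose proof (length_bound_mono c l 0 1 Hl ltac:(lra) ltac:(lra) ltac:(lra)) as HL.
exists (B + (l 1 - l 0) + 1); split; [lra|]; intros z Hz.
assert (Hoff : ~ on_curve c z) by (intros H; specialize (Hc z H); lra).
split; auto.
eapply Rle_lt_trans; [apply (contour_int_bound c _ l (/ (l 1 - l 0 + 1))); auto using cauchy_kernel_cont|].
- intros s Hs; specialize (Hc s Hs).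
  pose proof (Cmod_triangle_inv z s) as T; rewrite Cmod_minus_sym in T.
  rewrite Cmod_inv by (apply Cmod_gt_0; lra).
  apply Rinv_le_contravar; lra.
- apply Rmult_lt_reg_l with (l 1 - l 0 + 1); [lra|].
  rewrite <- Rmult_assoc, Rinv_r; lra.
Qed.

(** Along a partition finer than the modulus of uniform continuity, consecutive values differ by
    less than 1 and are integers, so they agree. *)
Lemma integer_path_constant (g : R -> R) :
  (forall t, 0 <= t <= 1 -> exists n : Z, g t = IZR n) ->
  (forall t, 0 <= t <= 1 -> forall eps, 0 < eps -> exists del, 0 < del /\
     forall s, 0 <= s <= 1 -> Rabs (s - t) < del -> Rabs (g s - g t) < eps) ->
  g 0 = g 1.
Proof.
intros Hint Hc.
destruct (Rcont_on_unif 0 1 (fun t => RtoC (g t))) with (eps := 1) as [d [Hd K]]; [|lra|].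
{ intros t Ht eps He; destruct (Hc t Ht eps He) as [r [Hr K]]; exists r; split; auto.
  intros s Hs Hst; rewrite <- RtoC_minus, Cmod_R; auto. }
destruct (archimed_cor1 d Hd) as [n [Hn1 Hn2]].
assert (H : forall i, (i <= n)%nat -> g (ugrid n i) = g 0).
{ induction i as [|i IH]; intros Hi.
  - f_equal; unfold ugrid; simpl; unfold Rdiv; ring.
  - rewrite <- IH by lia.
    pose proof (ugrid_range n i Hn2 ltac:(lia)) as R1.
    pose proof (ugrid_range n (Datatypes.S i) Hn2 Hi) as R2.
    destruct (Hint _ R1) as [u Hu]; destruct (Hint _ R2) as [v Hv].
    rewrite Hu, Hv; f_equal; apply IZR_close_eq; rewrite <- Hu, <- Hv, <- Cmod_R, RtoC_minus.
    apply K; auto; rewrite ugrid_S by auto.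
    replace (ugrid n i + / INR n - ugrid n i) with (/ INR n) by ring.
    rewrite Rabs_pos_eq; auto; left; apply Rinv_0_lt_compat, lt_0_INR; lia. }
rewrite <- (H n (le_n n)); f_equal; unfold ugrid; field; apply not_0_INR; lia.
Qed.

Lemma wnum_connected (c : R -> C) (z z' : C) : regular_curve c -> c 0 = c 1 ->
  connected_off c z z' -> wnum c z = wnum c z'.
Proof.
intros Hr H01 [p [Hp [P0 [P1 Po]]]]; apply continuous_on_Rcont_on in Hp.
set (g := fun t => Im (wnum c (p t)) / (2 * PI)).
pose proof two_pi_gt_6 as Hpi.
assert (Hw : forall t, 0 <= t <= 1 -> exists n : Z,
   wnum c (p t) = (RtoC (IZR n) * two_pi_i)%C /\ g t = IZR n).
{ intros t Ht; destruct (wnum_integer c (p t) Hr H01 (Po t Ht)) as [n Hn].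
  exists n; split; auto; unfold g; rewrite Hn.
  unfold two_pi_i, Im, Cmult, RtoC, Ci; simpl; field; lra. }
assert (E : g 0 = g 1).
{ apply integer_path_constant.
  - intros t Ht; destruct (Hw t Ht) as [n [_ Hn]]; eauto.
  - intros t Ht eps He.
    destruct (wnum_continuous c (p t) Hr (Po t Ht) eps He) as [r [Hr0 K]].
    destruct (Hp t Ht r Hr0) as [del [Hdel K']]; exists del; split; auto; intros s Hs Hst.
    specialize (K (p s) (Po s Hs) (K' s Hs Hst)).
    pose proof (Im_le_Cmod (wnum c (p s) - wnum c (p t))) as B.
    unfold g; replace (Im (wnum c (p s)) / (2 * PI) - Im (wnum c (p t)) / (2 * PI))
      with (Im (wnum c (p s) - wnum c (p t)) / (2 * PI))
      by (change (Im (wnum c (p s) - wnum c (p t))%C) with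
           (Im (wnum c (p s)) - Im (wnum c (p t))); field; lra).
    unfold Rdiv; rewrite Rabs_mult, (Rabs_pos_eq (/ _)) by (left; apply Rinv_0_lt_compat; lra).
    apply Rle_lt_trans with (Rabs (Im (wnum c (p s) - wnum c (p t))) * 1); [|lra].
    apply Rmult_le_compat_l; [apply Rabs_pos|].
    rewrite <- Rinv_1; apply Rinv_le_contravar; lra. }
destruct (Hw 0 ltac:(lra)) as [n [N1 N2]]; destruct (Hw 1 ltac:(lra)) as [m [M1 M2]].
rewrite P0 in N1; rewrite P1 in M1; rewrite N1, M1.
rewrite N2, M2 in E; now rewrite E.
Qed.

(** An exterior point is connected to points arbitrarily far away, where [wnum] has modulus below 1
    and is an integer multiple of [two_pi_i]. *)
Lemma wnum_exterior (c : R -> C) (z : C) : regular_curve c -> c 0 = c 1 ->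
  exterior c z -> wnum c z = RtoC 0.
Proof.
intros Hr H01 [Hz Hu].
destruct (wnum_far c Hr) as [M [HM Hfar]].
assert (Hz' : exists z', connected_off c z z' /\ M < Cmod z').
{ apply NNPP; intros Hn; apply Hu; exists M; intros z' Hz'.
  apply Rnot_lt_le; intros H; apply Hn; eauto. }
destruct Hz' as [z' [Hc Hz']]; destruct (Hfar z' Hz') as [Hoff Hlt].
rewrite (wnum_connected c z z' Hr H01 Hc).
destruct (wnum_integer c z' Hr H01 Hoff) as [n Hn].
rewrite Hn, Cmod_mult, Cmod_two_pi_i, Cmod_R in Hlt.
pose proof two_pi_gt_6.
assert (n = 0%Z); [|subst; rewrite Hn; ring].
apply IZR_close_eq; rewrite Rminus_0_r.
pose proof (Rabs_pos (IZR n)); nra.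
Qed.

(** * Cauchy's theorem for functions continuous up to a rectifiable curve *)

(** Discrete analogue of [rect] for a box of [m] cells a side: left-endpoint sums with the factor
    [d] left out. *)
Definition box_sum (F : C -> C) (o : C) (d : R) (m i j : nat) : C :=
  (Csum m (fun u => F (gpt o d (i + u) j) - F (gpt o d (i + u) (j + m))) +
   Ci * Csum m (fun v => F (gpt o d (i + m) (j + v)) - F (gpt o d i (j + v))))%C.

Definition box_mean (F : C -> C) (o : C) (d : R) (m i j : nat) : C :=
  (/ RtoC (INR m * INR m) *
   Csum m (fun u => Csum m (fun v => F (gpt o d (i + u) (j + v)))))%C.

Lemma Csum_shift (h : nat -> C) (j m : nat) :
  (Csum m (fun v => h (j + v)%nat) - Csum m (fun v => h (S j + v)%nat))%C = (h j - h (j + m)%nat)%C.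
Proof.
induction m as [|m IH]; cbn [Csum].
- rewrite Nat.add_0_r; ring.
- replace (S j + m)%nat with (j + S m)%nat by lia.
  transitivity ((Csum m (fun v => h (j + v)%nat) - Csum m (fun v => h (S j + v)%nat)) +
    h (j + m)%nat - h (j + S m)%nat)%C; [ring|].
  rewrite IH; ring.
Qed.

(** The weights on opposite edges of a cell are means over boxes shifted by one grid step, and their
    difference telescopes to two opposite sides of the box. Circulation around a microscopic cell
    thus becomes a contour sum around a macroscopic box, where holomorphy can act. *)
Lemma circulation_box_mean (F : C -> C) (o : C) (d : R) (m i j : nat) :
  circulation (fun i j => RtoC d * box_mean F o d m i j)%C
    (fun i j => RtoC d * (Ci * box_mean F o d m i j))%C i j =
  (RtoC d * / RtoC (INR m * INR m) * box_sum F o d m i j)%C.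
Proof.
unfold circulation, box_mean, box_sum.
set (k := (/ RtoC (INR m * INR m))%C).
set (f := fun i j => F (gpt o d i j)).
replace (Csum m (fun u => F (gpt o d (i + u) j) - F (gpt o d (i + u) (j + m)))%C) with
  (Csum m (fun u => Csum m (fun v => F (gpt o d (i + u) (j + v)))) -
   Csum m (fun u => Csum m (fun v => F (gpt o d (i + u) (S j + v)))))%C.
2:{ rewrite <- Csum_minus; apply Csum_ext; intros u _.
    apply (Csum_shift (fun j => F (gpt o d (i + u) j))). }
replace (Csum m (fun v => F (gpt o d (i + m) (j + v)) - F (gpt o d i (j + v)))%C) with
  (Csum m (fun u => Csum m (fun v => F (gpt o d (S i + u) (j + v)))) -
   Csum m (fun u => Csum m (fun v => F (gpt o d (i + u) (j + v)))))%C.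
2:{ rewrite (Csum_swap m m (fun u v => F (gpt o d (S i + u) (j + v)))).
    rewrite (Csum_swap m m (fun u v => F (gpt o d (i + u) (j + v)))).
    rewrite <- Csum_minus; apply Csum_ext; intros v _.
    pose proof (Csum_shift (fun i => F (gpt o d i (j + v))) i m) as E; simpl in E |- *.
    match type of E with (?A - ?B)%C = _ => set (SA := A) in *; set (SB := B) in * end.
    match goal with |- _ = (?x - ?y)%C => replace (x - y)%C with (- (y - x))%C by ring end.
    rewrite <- E; ring. }
ring.
Qed.

Lemma cRInt_riemann (g : R -> C) (a d e : R) (m : nat) : 0 <= d ->
  Rcont_on a (a + INR m * d) g ->
  (forall x y, a <= x <= a + INR m * d -> a <= y <= a + INR m * d -> Rabs (x - y) <= d ->
     Cmod (g x - g y) <= e) ->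
  Cmod (cRInt g a (a + INR m * d) - RtoC d * Csum m (fun u => g (a + INR u * d)))
  <= INR m * (e * d).
Proof.
intros Hd; induction m as [|m IH]; intros Hg He.
- simpl INR; simpl Csum; rewrite !Rmult_0_l, Rplus_0_r.
  unfold cRInt; rewrite (@RInt_point C_R_CompleteNormedModule).
  change (@zero C_R_CompleteNormedModule) with (RtoC 0).
  replace (0 - RtoC d * 0)%C with (RtoC 0) by ring; rewrite Cmod_0; lra.
- rewrite S_INR in *.
  pose proof (pos_INR m) as Pm.
  assert (Pmd : 0 <= INR m * d) by (apply Rmult_le_pos; auto).
  assert (E : a + (INR m + 1) * d = a + INR m * d + d) by ring.
  rewrite E in *.
  rewrite (cRInt_Chasles g a (a + INR m * d)) by (auto; lra).
  cbn [Csum].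
  assert (H1 := IH ltac:(intros t Ht eps Heps; destruct (Hg t ltac:(lra) eps Heps) as [r [Hr K]];
    exists r; split; auto; intros; apply K; auto; lra)
    ltac:(intros; apply He; lra)).
  assert (H2 : Cmod (cRInt g (a + INR m * d) (a + INR m * d + d) -
     RtoC d * g (a + INR m * d)) <= e * d).
  { apply cRInt_near_const; auto.
    - intros t Ht eps Heps; destruct (Hg t ltac:(lra) eps Heps) as [r [Hr K]].
      exists r; split; auto; intros; apply K; auto; lra.
    - intros x Hx; apply He; try lra; rewrite Rabs_pos_eq; lra. }
  match goal with |- Cmod ?X <= _ => replace X with
    ((cRInt g a (a + INR m * d) - RtoC d * Csum m (fun u => g (a + INR u * d)%R)) +
     (cRInt g (a + INR m * d) (a + INR m * d + d) - RtoC d * g (a + INR m * d)%R))%C by ring end.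
  eapply Rle_trans; [apply Cmod_triangle|lra].
Qed.

Lemma box_sum_rect (f : C -> C) (o : C) (d e : R) (m i j : nat) : 0 <= d ->
  let x0 := Re o + INR i * d in let y0 := Im o + INR j * d in
  let x1 := x0 + INR m * d in let y1 := y0 + INR m * d in
  cont_rect f x0 x1 y0 y1 ->
  (forall p q, in_rect x0 x1 y0 y1 p -> in_rect x0 x1 y0 y1 q -> Cmod (p - q) <= d ->
     Cmod (f p - f q) <= e) ->
  Cmod (RtoC d * box_sum f o d m i j - rect f x0 x1 y0 y1) <= 4 * (INR m * (e * d)).
Proof.
intros Hd x0 y0 x1 y1 Hf He.
assert (Pmd : 0 <= INR m * d) by (apply Rmult_le_pos; auto using pos_INR).
assert (Hh : forall y, y0 <= y <= y1 ->
  Cmod (cRInt (fun x => f (x, y)) x0 x1 - RtoC d * Csum m (fun u => f (x0 + INR u * d, y)%R))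
  <= INR m * (e * d)).
{ intros y Hy; apply (cRInt_riemann (fun x => f (x, y))); auto.
  - eapply cont_rect_h; eauto; fold x1; lra.
  - intros p q Hp Hq Hpq; fold x1 in Hp, Hq; apply He.
    + split; simpl; lra.
    + split; simpl; lra.
    + now rewrite Cmod_pair_h. }
assert (Hv : forall x, x0 <= x <= x1 ->
  Cmod (cRInt (fun y => f (x, y)) y0 y1 - RtoC d * Csum m (fun u => f (x, y0 + INR u * d)%R))
  <= INR m * (e * d)).
{ intros x Hx; apply (cRInt_riemann (fun y => f (x, y))); auto.
  - eapply cont_rect_v; eauto; fold y1; lra.
  - intros p q Hp Hq Hpq; fold y1 in Hp, Hq; apply He.
    + split; simpl; lra.
    + split; simpl; lra.
    + now rewrite Cmod_pair_v. }
assert (E : box_sum f o d m i j =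
  (Csum m (fun u => f (x0 + INR u * d, y0)%R) - Csum m (fun u => f (x0 + INR u * d, y1)%R) +
   Ci * (Csum m (fun v => f (x1, y0 + INR v * d)%R) - Csum m (fun v => f (x0, y0 + INR v * d)%R)))%C).
{ unfold box_sum; rewrite !Csum_minus.
  assert (Eg : forall u v, gpt o d (i + u) (j + v) = (x0 + INR u * d, y0 + INR v * d)).
  { intros u v; unfold gpt, x0, y0; rewrite !plus_INR; f_equal; ring. }
  assert (Eu : forall u, gpt o d (i + u) j = (x0 + INR u * d, y0)).
  { intros u; rewrite <- (Nat.add_0_r j), Eg; f_equal; simpl; ring. }
  assert (Ev : forall v, gpt o d i (j + v) = (x0, y0 + INR v * d)).
  { intros v; rewrite <- (Nat.add_0_r i), Eg; f_equal; simpl; ring. }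
  f_equal; [f_equal|f_equal; f_equal]; apply Csum_ext; intros u _; rewrite ?Eu, ?Ev, ?Eg; easy. }
rewrite E; unfold rect.
pose proof (Hh y0 ltac:(unfold y1; lra)) as B1; pose proof (Hh y1 ltac:(unfold y1; lra)) as B2.
pose proof (Hv x1 ltac:(unfold x1; lra)) as B3; pose proof (Hv x0 ltac:(unfold x1; lra)) as B4.
set (I1 := cRInt (fun x => f (x, y0)) x0 x1) in *.
set (I2 := cRInt (fun x => f (x, y1)) x0 x1) in *.
set (I3 := cRInt (fun y => f (x1, y)) y0 y1) in *.
set (I4 := cRInt (fun y => f (x0, y)) y0 y1) in *.
set (S1 := Csum m (fun u => f (x0 + INR u * d, y0)%R)) in *.
set (S2 := Csum m (fun u => f (x0 + INR u * d, y1)%R)) in *.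
set (S3 := Csum m (fun v => f (x1, y0 + INR v * d)%R)) in *.
set (S4 := Csum m (fun v => f (x0, y0 + INR v * d)%R)) in *.
match goal with |- Cmod ?X <= _ => replace X with
  (((I2 - RtoC d * S2) - (I1 - RtoC d * S1)) + Ci * ((I4 - RtoC d * S4) - (I3 - RtoC d * S3)))%C
  by ring end.
eapply Rle_trans; [apply Cmod_triangle|]; rewrite Cmod_mult, Cmod_Ci.
pose proof (Cmod_triangle_minus (I2 - RtoC d * S2) (I1 - RtoC d * S1)).
pose proof (Cmod_triangle_minus (I4 - RtoC d * S4) (I3 - RtoC d * S3)).
lra.
Qed.

(** Opposite sides enter with opposite signs, so the constant [v] cancels and only the oscillation
    of [F] remains. *)
Lemma box_sum_near (F : C -> C) (o v : C) (d e : R) (m i j : nat) :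
  (forall u w, (u <= m)%nat -> (w <= m)%nat -> Cmod (F (gpt o d (i + u) (j + w)) - v) <= e) ->
  Cmod (box_sum F o d m i j) <= 4 * (INR m * e).
Proof.
intros H.
assert (D : forall u w u' w', (u <= m)%nat -> (w <= m)%nat -> (u' <= m)%nat -> (w' <= m)%nat ->
  Cmod (F (gpt o d (i + u) (j + w)) - F (gpt o d (i + u') (j + w'))) <= 2 * e).
{ intros u w u' w' H1 H2 H3 H4; eapply Rle_trans; [apply (Cmod_dist_triangle _ v)|].
  rewrite (Cmod_minus_sym v); specialize (H u w H1 H2) as K1; specialize (H u' w' H3 H4) as K2; lra. }
unfold box_sum; eapply Rle_trans; [apply Cmod_triangle|].
rewrite Cmod_mult, Cmod_Ci.
assert (B1 : Cmod (Csum m (fun u => F (gpt o d (i + u) j) - F (gpt o d (i + u) (j + m)))%C)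
  <= INR m * (2 * e)).
{ rewrite <- Rsum_const; eapply Rle_trans; [apply Cmod_Csum|]; apply Rsum_le; intros u Hu.
  specialize (D u O u m); rewrite Nat.add_0_r in D; apply D; lia. }
assert (B2 : Cmod (Csum m (fun v => F (gpt o d (i + m) (j + v)) - F (gpt o d i (j + v)))%C)
  <= INR m * (2 * e)).
{ rewrite <- Rsum_const; eapply Rle_trans; [apply Cmod_Csum|]; apply Rsum_le; intros u Hu.
  specialize (D m u O u); rewrite Nat.add_0_r in D; apply D; lia. }
lra.
Qed.

Lemma box_mean_near (F : C -> C) (o v : C) (d e : R) (m i j : nat) : (0 < m)%nat ->
  (forall u w, (u < m)%nat -> (w < m)%nat -> Cmod (F (gpt o d (i + u) (j + w)) - v) <= e) ->
  Cmod (box_mean F o d m i j - v) <= e.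
Proof.
intros Hm H; apply lt_0_INR in Hm.
assert (Hnz : RtoC (INR m * INR m) <> RtoC 0) by (intros E; apply RtoC_inj in E; nra).
assert (Ev : forall n, Csum n (fun _ => v) = (RtoC (INR n) * v)%C).
{ induction n as [|n IH]; [simpl; ring|]; cbn [Csum]; rewrite IH, S_INR, RtoC_plus; ring. }
replace (box_mean F o d m i j - v)%C with (/ RtoC (INR m * INR m) *
  Csum m (fun u => Csum m (fun w => F (gpt o d (i + u) (j + w)) - v)))%C.
- rewrite Cmod_mult, Cmod_inv, Cmod_R, Rabs_pos_eq by (auto; nra).
  apply Rmult_le_reg_l with (INR m * INR m); [nra|].
  rewrite <- Rmult_assoc, Rinv_r, Rmult_1_l by nra.
  rewrite Rmult_assoc, <- !Rsum_const.
  eapply Rle_trans; [apply Cmod_Csum|]; apply Rsum_le; intros u Hu.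
  eapply Rle_trans; [apply Cmod_Csum|]; apply Rsum_le; intros w Hw; auto.
- erewrite (Csum_ext m (fun u => Csum m (fun w => F (gpt o d (i + u) (j + w)) - v))%C);
    [|intros u _; rewrite Csum_minus, Ev; reflexivity].
  unfold box_mean; rewrite Csum_minus.
  replace (Csum m (fun _ => RtoC (INR m) * v))%C with (RtoC (INR m * INR m) * v)%C.
  + field; auto.
  + rewrite Csum_scal, Ev, RtoC_mult; ring.
Qed.

Lemma box_in_interior (c : R -> C) (x0 x1 y0 y1 : R) (z : C) :
  (forall s, in_rect x0 x1 y0 y1 s -> ~ on_curve c s) -> in_rect x0 x1 y0 y1 z ->
  interior c z -> forall w, in_rect x0 x1 y0 y1 w -> interior c w.
Proof.
intros Hoff [Hz1 Hz2] Hi w [Hw1 Hw2]; apply (interior_connected c z); auto.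
apply connected_off_segment; intros t Ht; apply Hoff.
unfold segment; destruct z as [zx zy], w as [wx wy]; simpl in *.
split; simpl; nra.
Qed.

Lemma gpt_box_dist (o : C) (d : R) (m i j u w : nat) : 0 <= d -> (u <= m)%nat -> (w <= m)%nat ->
  Cmod (gpt o d (i + u) (j + w) - gpt o d i j) <= 2 * (INR m * d).
Proof.
intros Hd Hu Hw; apply le_INR in Hu, Hw.
eapply Rle_trans; [apply Cmod_Re_Im|].
change (Rabs (Re o + INR (i + u) * d - (Re o + INR i * d)) +
  Rabs (Im o + INR (j + w) * d - (Im o + INR j * d)) <= 2 * (INR m * d)).
rewrite !plus_INR.
replace (Re o + (INR i + INR u) * d - (Re o + INR i * d)) with (INR u * d) by ring.
replace (Im o + (INR j + INR w) * d - (Im o + INR j * d)) with (INR w * d) by ring.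
pose proof (pos_INR u); pose proof (pos_INR w).
rewrite !Rabs_pos_eq by (apply Rmult_le_pos; auto); nra.
Qed.

Definition simply_winding (c : R -> C) : Prop :=
  forall z, interior c z -> wnum c z = two_pi_i.

(** After multiplication by [two_pi_i] distinct integers are at least [2 PI > 1] apart, so an error
    of 1 identifies the value. *)
Lemma wind_determined (w : R) (v : Z) (n : Z) (x : C) :
  w = IZR n -> x = (RtoC (IZR v) * two_pi_i)%C ->
  Cmod (RtoC w * two_pi_i - x) <= 1 -> w = IZR v.
Proof.
intros -> -> H; f_equal; apply IZR_close_eq.
replace (RtoC (IZR n) * two_pi_i - RtoC (IZR v) * two_pi_i)%C
  with ((RtoC (IZR n) - RtoC (IZR v)) * two_pi_i)%C in H by ring.
rewrite Cmod_mult, Cmod_two_pi_i, <- RtoC_minus, Cmod_R in H.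
pose proof two_pi_gt_6; pose proof (Rabs_pos (IZR n - IZR v)); nra.
Qed.

(* Far from the curve the winding number of the grid path is 0 or 1; near the curve only
   [|wind| <= (1/delta + delta wind^2) / 2] is used, together with [wind_square_sum]. *)
Lemma cell_estimate (c : R -> C) (l : R -> R) (f : C -> C) (pr : C -> C) (E : C -> Prop)
  (o : C) (delta eta d eps e1 : R) (m M N : nat) (t : nat -> R) (a b : nat -> nat) (i j : nat) :
  regular_curve c -> length_bound c l -> c 0 = c 1 -> simply_winding c -> thin E ->
  (forall z, closed_interior c z -> ccont_on (closed_interior c) f z) ->
  (forall z, interior c z -> ~ E z -> cdiff f z) ->
  (forall z, closed_interior c z -> pr z = z) ->
  0 < delta -> 0 < eps -> 0 <= e1 -> 0 < eta -> eta <= delta -> 0 < d -> 20 * d <= eta -> (0 < m)%nat -> INR m * d = delta ->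
  10 * d / (eta / 2 * (eta / 2)) * (5 * (l 1 - l 0) + 8 * d) <= 1 ->
  (forall s z, on_curve c s -> Cmod (z - s) <= 6 * delta -> Cmod (f (pr z) - f s) <= eps) ->
  (forall x y, closed_interior c x -> closed_interior c y -> Cmod (x - y) <= d ->
     Cmod (f x - f y) <= e1) ->
  grid_approx c l o d M N t a b -> (i < M)%nat -> (j < M)%nat ->
  Rabs (wind a b N i j) * Cmod (box_sum (fun z => f (pr z)) o d m i j) <=
  4 * INR m * (eps * ind (grid_near (on_curve c) (2 * delta) (Re o + INR i * d) (Im o + INR j * d))
    + e1 + eps / 2 *
    (/ delta * ind (grid_near (on_curve c) eta (Re o + INR i * d) (Im o + INR j * d))
     + delta * (wind a b N i j * wind a b N i j))).
Proof.
intros Hr Hl H01 Hw HE Hf Hdf Hpr Hdel Heps He1 Heta Heta2 Hd Hd2 Hm Hmd Hsmall HF Hosc Hg Hi Hj.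
set (n1 := ind (grid_near (on_curve c) (2 * delta) (Re o + INR i * d) (Im o + INR j * d))).
set (n2 := ind (grid_near (on_curve c) eta (Re o + INR i * d) (Im o + INR j * d))).
set (w := wind a b N i j) in *.
assert (R1 : 0 <= n1 <= 1) by apply ind_range.
assert (R2 : 0 <= n2 <= 1) by apply ind_range.
assert (Pm : 0 < INR m) by now apply lt_0_INR.
assert (Pid : 0 < / delta) by now apply Rinv_0_lt_compat.
assert (Pw : 0 <= w * w) by apply Rle_0_sqr.
set (Z := Cmod (box_sum (fun z => f (pr z)) o d m i j)).
assert (PZ : 0 <= Z) by apply Cmod_ge_0.
assert (Hnear : n1 = 1 -> Z <= 4 * INR m * eps).
{ intros H1; unfold n1, ind in H1; destruct excluded_middle_informative as [[s [Hs [S1 S2]]]|]; [|lra].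
  unfold Z; rewrite Rmult_assoc; apply (box_sum_near _ _ (f s)); intros u v Hu Hv.
  apply HF; auto; eapply Rle_trans; [apply (Cmod_dist_triangle _ (gpt o d i j))|].
  pose proof (gpt_box_dist o d m i j u v ltac:(lra) Hu Hv).
  assert (Cmod (gpt o d i j - s) <= 4 * delta); [|lra].
  eapply Rle_trans; [apply Cmod_Re_Im|].
  change (Rabs (Re o + INR i * d - Re s) + Rabs (Im o + INR j * d - Im s) <= 4 * delta); lra. }
destruct (classic (n2 = 1)) as [N2|N2].
{ assert (N1 : n1 = 1).
  { unfold n2, ind in N2; destruct excluded_middle_informative as [[s [Hs [S1 S2]]]|]; [|lra].
    apply ind_true; exists s; repeat split; auto; lra. }
  specialize (Hnear N1); rewrite N1, N2, !Rmult_1_r.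
  (* Expansion of [delta (|w| - 1 / delta)^2 >= 0]. *)
  assert (Habs : Rabs w <= / 2 * (/ delta + delta * (w * w))).
  { assert (Q : 0 <= delta * ((Rabs w - / delta) * (Rabs w - / delta)))
      by (apply Rmult_le_pos; [lra|apply Rle_0_sqr]).
    assert (Q2 : Rabs w * Rabs w = w * w) by (rewrite <- Rabs_mult; now apply Rabs_pos_eq).
    assert (Q3 : delta * / delta = 1) by (apply Rinv_r; lra).
    replace (delta * ((Rabs w - / delta) * (Rabs w - / delta))) with
      (delta * (Rabs w * Rabs w) - 2 * Rabs w * (delta * / delta) + / delta * (delta * / delta)) in Q by ring.
    rewrite Q2, Q3 in Q; lra. }
  pose proof (Rabs_pos w).
  apply Rle_trans with (/ 2 * (/ delta + delta * (w * w)) * (4 * INR m * eps)).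
  - apply Rmult_le_compat; auto.
  - assert (0 <= 4 * INR m * (eps + e1)) by (apply Rmult_le_pos; lra).
    replace (4 * INR m * (eps + e1 + eps / 2 * (/ delta + delta * (w * w)))) with
      (4 * INR m * (eps + e1) + / 2 * (/ delta + delta * (w * w)) * (4 * INR m * eps)) by (field; lra).
    lra. }
(* The lower left corner of the cell is not near the curve at scale [eta]; the centre is only
   [d / 2] away in each coordinate, and [20 * d <= eta]. *)
assert (Hfar : forall s, on_curve c s -> eta / 2 <= Cmod (s - cell_center o d i j)).
{ intros s Hs; apply Rnot_lt_le; intros Hlt; apply N2, ind_true; exists s; split; auto.
  rewrite Cmod_minus_sym in Hlt.
  pose proof (re_le_Cmod (cell_center o d i j - s)) as B1.
  pose proof (Im_le_Cmod (cell_center o d i j - s)) as B2.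
  change (Re (cell_center o d i j - s)%C) with (Re o + INR i * d + d / 2 - Re s) in B1.
  change (Im (cell_center o d i j - s)%C) with (Im o + INR j * d + d / 2 - Im s) in B2.
  apply Rabs_le_between in B1; apply Rabs_le_between in B2.
  split; apply Rabs_le; lra. }
assert (Hoff : ~ on_curve c (cell_center o d i j)).
{ intros H; specialize (Hfar _ H).
  replace (cell_center o d i j - cell_center o d i j)%C with (RtoC 0) in Hfar by ring.
  rewrite Cmod_0 in Hfar; lra. }
pose proof (wind_wnum c l o d (eta / 2) M N t a b i j Hr Hl H01 Hd ltac:(lra) Hg Hi Hj Hfar) as Hww.
fold w in Hww.
destruct (wind_integer a b N i j) as [nw Hnw]; fold w in Hnw.
assert (Hrest : 0 <= eps * n1 + e1 + eps / 2 * (/ delta * n2 + delta * (w * w))).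
{ assert (0 <= eps * n1) by nra.
  assert (0 <= / delta * n2) by nra.
  assert (0 <= delta * (w * w)) by nra.
  assert (0 <= eps / 2 * (/ delta * n2 + delta * (w * w))) by nra; lra. }
destruct (off_curve_cases c _ Hoff) as [Hin|Hex].
2:{ assert (W0 : w = 0).
    { apply (wind_determined w 0 nw (wnum c (cell_center o d i j))); auto; [|lra].
      rewrite wnum_exterior by auto; ring. }
    rewrite W0, Rabs_R0, Rmult_0_l.
    rewrite W0 in Hrest; apply Rmult_le_pos; [lra|exact Hrest]. }
assert (W1 : w = 1).
{ apply (wind_determined w 1 nw (wnum c (cell_center o d i j))); auto; [|lra].
  rewrite Hw by auto; ring. }
rewrite W1 in Hrest |- *; rewrite Rabs_R1, Rmult_1_l.
assert (P1 : 0 <= eps / 2 * (/ delta * n2 + delta * (1 * 1))).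
{ apply Rmult_le_pos; [lra|]; assert (0 <= / delta * n2) by nra; lra. }
destruct (classic (n1 = 1)) as [N1|N1].
{ specialize (Hnear N1); rewrite N1.
  apply Rle_trans with (4 * INR m * eps); auto.
  apply Rmult_le_compat_l; lra. }
(* The box of side [delta] misses the curve and contains the centre of the cell, an interior point,
   so it lies in the interior. Its exact contour integral vanishes, and [box_sum] keeps only the
   quadrature error. *)
assert (Hdeep : Z <= 4 * INR m * e1).
{ set (x0 := Re o + INR i * d) in *; set (y0 := Im o + INR j * d) in *.
  assert (Hm1 : 1 <= INR m) by (apply (le_INR 1 m); lia).
  assert (Hbox : forall s, in_rect x0 (x0 + delta) y0 (y0 + delta) s -> ~ on_curve c s).
  { intros s [S1 S2] Hs; apply N1, ind_true; exists s; split; auto.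
    split; apply Rabs_le; lra. }
  assert (Hbi : forall s, in_rect x0 (x0 + delta) y0 (y0 + delta) s -> interior c s).
  { apply (box_in_interior c x0 (x0 + delta) y0 (y0 + delta) (cell_center o d i j)); auto.
    unfold cell_center; split; simpl; fold x0 y0; lra. }
  assert (Hcr : cont_rect (fun z => f (pr z)) x0 (x0 + delta) y0 (y0 + delta)).
  { intros s Hs; apply (ccont_on_ext_loc _ f _ s 1); try lra.
    - intros y Hy _; rewrite Hpr; auto; left; auto.
    - rewrite Hpr; auto; left; auto.
    - apply (ccont_on_sub (closed_interior c)); [intros y Hy; left; auto|].
      apply Hf; left; auto. }
  assert (Hrect0 : rect (fun z => f (pr z)) x0 (x0 + delta) y0 (y0 + delta) = RtoC 0).
  { apply (painleve_square _ E); auto; intros z Hz HzE.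
    destruct (interior_open c z (proj1 Hr) (Hbi z Hz)) as [r [Hr0 Kr]].
    apply (cdiff_ext_loc f _ z r); auto.
    intros y Hy; rewrite Hpr; auto; left; auto. }
  pose proof (box_sum_rect (fun z => f (pr z)) o d e1 m i j ltac:(lra)) as BS.
  cbv zeta in BS; fold x0 y0 in BS; rewrite Hmd, Hrect0 in BS.
  assert (BS' : Cmod (RtoC d * box_sum (fun z => f (pr z)) o d m i j - 0) <= 4 * (INR m * (e1 * d))).
  { apply BS; auto; intros p q Hp Hq Hpq.
    rewrite !Hpr by (left; auto); apply Hosc; auto; left; auto. }
  replace (RtoC d * box_sum (fun z => f (pr z)) o d m i j - 0)%C
    with (RtoC d * box_sum (fun z => f (pr z)) o d m i j)%C in BS' by ring.
  rewrite Cmod_mult, Cmod_R, Rabs_pos_eq in BS' by lra; fold Z in BS'.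
  apply Rmult_le_reg_l with d; auto; lra. }
apply Rle_trans with (4 * INR m * e1); auto.
apply Rmult_le_compat_l; [lra|].
assert (0 <= eps * n1) by nra; lra.
Qed.

(** The cells within [2 * delta] of the curve have total area of order [delta], those within [eta]
    of order [eta], and the bound for each cell carries a factor [4 d^2 / delta]. The first family
    then costs a constant times [eps]; so does the second, which has the extra weight [1 / delta],
    because [eta = delta^2]; and so do the squared winding numbers, which have the weight [delta].
    The set [E] admits interior points where [f] is only continuous, such as the base point of a
    difference quotient. *)
Lemma strong_cauchy (c : R -> C) (f : C -> C) (E : C -> Prop) :
  regular_curve c -> c 0 = c 1 -> simply_winding c -> thin E ->
  (forall z, closed_interior c z -> ccont_on (closed_interior c) f z) ->
  (forall z, interior c z -> ~ E z -> cdiff f z) -> contour_int c f = RtoC 0.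
Proof.
intros Hr H01 Hw HE Hf Hdf.
destruct (rectifiable_length c (proj2 Hr)) as [l Hl].
pose proof (length_bound_mono c l 0 1 Hl ltac:(lra) ltac:(lra) ltac:(lra)) as HL.
set (L := l 1 - l 0) in *.
assert (HL0 : 0 <= L) by (unfold L; lra).
destruct (thin_count _ (thin_curve c Hr)) as [K [HK Hcount]].
destruct (closed_interior_bounded c Hr) as [B [HB HBc]].
destruct (curve_projection c Hr) as [pr Hpr].
assert (Hcf : cont_on_curve c f).
{ intros s Hs; apply (ccont_on_sub (closed_interior c)); [intros; right; auto|].
  apply Hf; right; auto. }
(* [246 = 4 * 49 + 2 * 25] comes from the cells near the curve at scales [delta] and [eta], 1 from
   the quadrature error, [2 (L + 2)^2] from the winding numbers, and [5 L + 8] from replacing the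
   integral by the grid sum. *)
set (Q := 246 * K + 1 + 2 * ((L + 2) * (L + 2)) + 5 * L + 8).
assert (HQ : 0 < Q) by (unfold Q; nra).
apply Cmod_le_eps_eq; intros eps0 Heps0.
replace (contour_int c f - 0)%C with (contour_int c f) by ring.
set (eps := eps0 / Q).
assert (Heps : 0 < eps) by now apply Rdiv_lt_0_compat.
assert (HepsQ : eps * Q = eps0) by (unfold eps; field; lra).
rewrite <- HepsQ.
assert (Hunif := compact_unif (closed_interior c) B f HBc
  (fun z Hz => closed_interior_compl_open c z (proj1 Hr) Hz) Hf).
destruct (Hunif eps Heps) as [del0 [Hdel0 Kdel0]].
(* A point within [6 * delta] of a point [s] of the curve is moved by [pr] to within [18 * delta] of
   [s], which stays below [del0]. *)
set (delta := Rmin 1 (del0 / 20)).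
assert (Hdelta : 0 < delta) by (apply Rmin_glb_lt; lra).
assert (Hdelta1 : delta <= 1) by apply Rmin_l.
assert (Hdelta2 : delta <= del0 / 20) by apply Rmin_r.
set (eta := delta * delta).
assert (Heta : 0 < eta) by (unfold eta; nra).
assert (Heta2 : eta <= delta) by (unfold eta; nra).
set (R1 := 2 * B + 1).
assert (HR1 : 0 < R1) by (unfold R1; lra).
(* The quadrature error is paid on every cell of a frame of side at most [R1]; the total is at most
   [4 / delta * R1^2 * e1 = eps]. *)
set (e1 := eps * delta / (4 * (R1 * R1))).
assert (He1 : 0 < e1).
{ apply Rdiv_lt_0_compat; [now apply Rmult_lt_0_compat|].
  apply Rmult_lt_0_compat; [lra|now apply Rmult_lt_0_compat]. }
destruct (Hunif e1 He1) as [del1 [Hdel1 Kdel1]].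
assert (Hee : 0 < eta * eta) by nra.
(* The three bounds on the mesh serve the hypothesis [20 * d <= eta], the winding numbers, which
   must be known within 1, and uniform continuity of [f] with precision [e1]. *)
set (D0 := Rmin (eta / 20) (Rmin (eta * eta / (40 * (5 * L + 8))) (del1 / 2))).
assert (HD0 : 0 < D0).
{ repeat apply Rmin_glb_lt; try lra; apply Rdiv_lt_0_compat; lra. }
destruct (archimed_cor1 (D0 / delta)) as [m [Hm1 Hm2]]; [now apply Rdiv_lt_0_compat|].
assert (Pm : 0 < INR m) by now apply lt_0_INR.
set (d := delta / INR m).
assert (Hd : 0 < d) by now apply Rdiv_lt_0_compat.
assert (Hmd : INR m * d = delta) by (unfold d; field; lra).
assert (HdD : d < D0).
{ unfold d, Rdiv; apply Rlt_le_trans with (delta * (D0 / delta)).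
  - apply Rmult_lt_compat_l; auto.
  - right; field; lra. }
assert (Hd20 : 20 * d <= eta).
{ assert (D0 <= eta / 20) by apply Rmin_l; lra. }
assert (HdR : D0 <= Rmin (eta * eta / (40 * (5 * L + 8))) (del1 / 2)) by apply Rmin_r.
assert (Hd40 : d <= eta * eta / (40 * (5 * L + 8))).
{ eapply Rle_trans; [left; exact HdD|]; eapply Rle_trans; [exact HdR|apply Rmin_l]. }
assert (Hd1 : d < del1).
{ assert (Rmin (eta * eta / (40 * (5 * L + 8))) (del1 / 2) <= del1 / 2) by apply Rmin_r; lra. }
assert (Hsmall : 10 * d / (eta / 2 * (eta / 2)) * (5 * (l 1 - l 0) + 8 * d) <= 1).
{ fold L; apply Rle_trans with (10 * d / (eta / 2 * (eta / 2)) * (5 * L + 8)).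
  - apply Rmult_le_compat_l; [|lra]; left; apply Rdiv_lt_0_compat; [lra|nra].
  - replace (10 * d / (eta / 2 * (eta / 2)) * (5 * L + 8)) with
      (d * (40 * (5 * L + 8) / (eta * eta))) by (field; lra).
    apply Rle_trans with (eta * eta / (40 * (5 * L + 8)) * (40 * (5 * L + 8) / (eta * eta))).
    + apply Rmult_le_compat_r; auto; left; apply Rdiv_lt_0_compat; lra.
    + right; field; lra. }
set (F := fun z => f (pr z)).
assert (HF : forall s z, on_curve c s -> Cmod (z - s) <= 6 * delta -> Cmod (F z - f s) <= eps).
{ intros s z Hs Hzs; left; apply Kdel0; [apply Hpr|right; auto|].
  destruct (Hpr z) as [_ [_ P]]; specialize (P s Hs); rewrite (Cmod_minus_sym s z) in P.
  pose proof (Cmod_dist_triangle (pr z) z s); lra. }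
set (o := (- B, - B) : C).
destruct (nfloor_ex (2 * B / d)) as [n0 [Hn0 Hn0']]; [apply Rdiv_le_0_compat; lra|].
set (M := S n0).
assert (HBd : 2 * B / d * d = 2 * B) by (field; lra).
assert (HM1 : 2 * B < INR M * d).
{ unfold M; rewrite S_INR, <- HBd; apply Rmult_lt_compat_r; auto. }
assert (HM2 : INR M * d <= R1).
{ unfold M, R1; rewrite S_INR.
  assert (INR n0 * d <= 2 * B) by (rewrite <- HBd; apply Rmult_le_compat_r; lra); lra. }
assert (Hframe : forall s, on_curve c s -> in_frame o d M s).
{ intros s Hs; specialize (HBc s (or_intror Hs)).
  pose proof (re_le_Cmod s) as B1; pose proof (Im_le_Cmod s) as B2.
  apply Rabs_le_between in B1; apply Rabs_le_between in B2.
  unfold in_frame, o; simpl Re; simpl Im.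
  change (Re (- B, - B)) with (- B); change (Im (- B, - B)) with (- B); lra. }
destruct (grid_approx_exists c l o d M (proj1 Hr) Hl H01 Hd Hframe) as [N [t [a [b Hg]]]].
set (X := fun i j => (RtoC d * box_mean F o d m i j)%C).
set (Y := fun i j => (RtoC d * (Ci * box_mean F o d m i j))%C).
assert (HA : Cmod (grid_sum X Y a b N - contour_int c f) <= eps * (5 * L + 8 * d)).
{ apply (grid_approx_sum c l f X Y o d eps M N t a b); auto; try lra.
  - intros s s' Hs Hs' Hss; left; apply Kdel0; [right; auto|right; auto|lra].
  - intros s i j Hs Hsij.
    assert (Hmean : Cmod (box_mean F o d m i j - f s) <= eps).
    { apply box_mean_near; auto; intros u v Hu Hv; apply HF; auto.
      eapply Rle_trans; [apply (Cmod_dist_triangle _ (gpt o d i j))|].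
      pose proof (gpt_box_dist o d m i j u v ltac:(lra) ltac:(lia) ltac:(lia)); lra. }
    assert (Ed : Cmod (RtoC d) = d) by (rewrite Cmod_R; apply Rabs_pos_eq; lra).
    unfold X, Y; split.
    + replace (RtoC d * box_mean F o d m i j - RtoC d * f s)%C
        with (RtoC d * (box_mean F o d m i j - f s))%C by ring.
      rewrite Cmod_mult, Ed, Rmult_comm; apply Rmult_le_compat_r; lra.
    + replace (RtoC d * (Ci * box_mean F o d m i j) - RtoC d * (Ci * f s))%C
        with (Ci * (RtoC d * (box_mean F o d m i j - f s)))%C by ring.
      rewrite Cmod_mult, Cmod_Ci, Cmod_mult, Ed, Rmult_1_l, Rmult_comm; apply Rmult_le_compat_r; lra. }
set (w := wind a b N) in *.
set (n1 := fun i j => ind (grid_near (on_curve c) (2 * delta) (Re o + INR i * d) (Im o + INR j * d))).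
set (n2 := fun i j => ind (grid_near (on_curve c) eta (Re o + INR i * d) (Im o + INR j * d))).
set (k := d / (INR m * INR m)).
assert (Hk : 0 <= k) by (left; apply Rdiv_lt_0_compat; [|apply Rmult_lt_0_compat]; auto).
assert (HB1 : Cmod (grid_sum X Y a b N) <=
  Rsum M (fun i => Rsum M (fun j => k * (4 * INR m * (eps * n1 i j + e1 + eps / 2 *
    (/ delta * n2 i j + delta * (w i j * w i j))))))).
{ rewrite (grid_stokes X Y M) by apply Hg.
  eapply Rle_trans; [apply Cmod_Csum|]; apply Rsum_le; intros i Hi.
  eapply Rle_trans; [apply Cmod_Csum|]; apply Rsum_le; intros j Hj.
  unfold X, Y; rewrite circulation_box_mean.
  rewrite !Cmod_mult, !Cmod_R, Cmod_inv, Cmod_R.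
  2:{ intros Ez; apply RtoC_inj in Ez; nra. }
  rewrite (Rabs_pos_eq d), (Rabs_pos_eq (INR m * INR m)) by nra.
  fold w; fold (Rdiv d (INR m * INR m)); fold k.
  replace (Rabs (w i j) * (k * Cmod (box_sum F o d m i j))) with
    (k * (Rabs (w i j) * Cmod (box_sum F o d m i j))) by ring.
  apply Rmult_le_compat_l; auto.
  apply (cell_estimate c l f pr E o delta eta d eps e1 m M N t a b i j); auto; try lra.
  - intros z Hz; now apply Hpr.
  - intros x y Hx Hy Hxy; left; apply Kdel1; auto; lra. }
set (S1 := Rsum M (fun i => Rsum M (fun j => n1 i j))).
set (S2 := Rsum M (fun i => Rsum M (fun j => n2 i j))).
set (S3 := Rsum M (fun i => Rsum M (fun j => w i j * w i j))).
assert (HS1 : S1 * (d * d) <= 49 * K * delta).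
{ apply Rle_trans with (K / delta * ((7 * delta / d) * (7 * delta / d)) * (d * d)).
  - apply Rmult_le_compat_r; [nra|].
    eapply Rle_trans; [apply (Hcount delta d (2 * delta) (Re o) (Im o) M M); lra|].
    assert (H7 : 2 * (2 * delta + delta) / d + 1 <= 7 * delta / d).
    { apply Rmult_le_reg_r with d; auto.
      replace ((2 * (2 * delta + delta) / d + 1) * d) with (6 * delta + d) by (field; lra).
      replace (7 * delta / d * d) with (7 * delta) by (field; lra); lra. }
    assert (0 <= 2 * (2 * delta + delta) / d) by (apply Rdiv_le_0_compat; lra).
    apply Rmult_le_compat_l; [apply Rdiv_le_0_compat; lra|].
    apply Rmult_le_compat; lra.
  - right; field; lra. }
assert (HS2 : S2 * (d * d) <= 25 * K * eta).
{ apply Rle_trans with (K / eta * ((5 * eta / d) * (5 * eta / d)) * (d * d)).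
  - apply Rmult_le_compat_r; [nra|].
    eapply Rle_trans; [apply (Hcount eta d eta (Re o) (Im o) M M); lra|].
    assert (H7 : 2 * (eta + eta) / d + 1 <= 5 * eta / d).
    { apply Rmult_le_reg_r with d; auto.
      replace ((2 * (eta + eta) / d + 1) * d) with (4 * eta + d) by (field; lra).
      replace (5 * eta / d * d) with (5 * eta) by (field; lra); lra. }
    assert (0 <= 2 * (eta + eta) / d) by (apply Rdiv_le_0_compat; lra).
    apply Rmult_le_compat_l; [apply Rdiv_le_0_compat; lra|].
    apply Rmult_le_compat; lra.
  - right; field; lra. }
assert (HS3 : S3 * (d * d) <= (L + 2) * (L + 2)).
{ assert (Hg' := Hg); destruct Hg' as [_ [_ [_ [_ [_ [Hp [_ HN]]]]]]]; fold L in HN.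
  pose proof (wind_square_sum M N a b Hp) as W; fold w in W; fold S3 in W.
  pose proof (pos_INR N).
  apply Rle_trans with ((INR N * d) * (INR N * d)); [nra|].
  assert (0 <= INR N * d) by (apply Rmult_le_pos; lra).
  apply Rmult_le_compat; lra. }
assert (HB2 : Cmod (grid_sum X Y a b N) <=
  4 / delta * (eps * (S1 * (d * d)) + (INR M * d) * (INR M * d) * e1 +
    eps / 2 * (/ delta * (S2 * (d * d)) + delta * (S3 * (d * d))))).
{ eapply Rle_trans; [exact HB1|right].
  transitivity (k * (4 * INR m) * (eps * S1 + INR M * INR M * e1 +
    eps / 2 * (/ delta * S2 + delta * S3))).
  - assert (Hin : forall i, Rsum M (fun j => k * (4 * INR m * (eps * n1 i j + e1 + eps / 2 *
      (/ delta * n2 i j + delta * (w i j * w i j))))) =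
      k * (4 * INR m) * (eps * Rsum M (fun j => n1 i j) + INR M * e1 +
        eps / 2 * (/ delta * Rsum M (fun j => n2 i j) + delta * Rsum M (fun j => w i j * w i j)))).
    { intros i; rewrite <- Rsum_const, <- !Rsum_scal, <- !Rsum_plus, <- !Rsum_scal.
      rewrite <- !Rsum_plus, <- Rsum_scal; apply Rsum_ext; intros; ring. }
    rewrite (Rsum_ext M _ _ (fun i _ => Hin i)).
    unfold S1, S2, S3.
    replace (INR M * INR M * e1) with (INR M * (INR M * e1)) by ring.
    rewrite <- (Rsum_const M (INR M * e1)), <- !Rsum_scal, <- !Rsum_plus, <- !Rsum_scal.
    rewrite <- !Rsum_plus, <- Rsum_scal; apply Rsum_ext; intros; ring.
  - assert (Ek : k * (4 * INR m) = 4 / delta * (d * d)).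
    { unfold k; rewrite <- Hmd; field; lra. }
    rewrite Ek; field; lra. }
assert (HB3 : Cmod (grid_sum X Y a b N) <= eps * (246 * K + 1 + 2 * ((L + 2) * (L + 2)))).
{ eapply Rle_trans; [exact HB2|].
  apply Rle_trans with (4 / delta * (eps * (49 * K * delta) + R1 * R1 * e1 +
    eps / 2 * (/ delta * (25 * K * eta) + delta * ((L + 2) * (L + 2))))).
  - apply Rmult_le_compat_l; [left; apply Rdiv_lt_0_compat; lra|].
    assert (0 <= INR M * d) by lra.
    assert (0 < / delta) by now apply Rinv_0_lt_compat.
    apply Rplus_le_compat; [apply Rplus_le_compat|].
    + apply Rmult_le_compat_l; lra.
    + apply Rmult_le_compat_r; [lra|]; apply Rmult_le_compat; lra.
    + apply Rmult_le_compat_l; [lra|]; apply Rplus_le_compat; apply Rmult_le_compat_l; lra.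
  - right; unfold e1, eta; field; lra. }
replace (contour_int c f) with (grid_sum X Y a b N - (grid_sum X Y a b N - contour_int c f))%C by ring.
eapply Rle_trans; [apply Cmod_triangle_minus|].
apply Rle_trans with (eps * (246 * K + 1 + 2 * ((L + 2) * (L + 2))) + eps * (5 * L + 8)).
- apply Rplus_le_compat; auto.
  eapply Rle_trans; [exact HA|]; apply Rmult_le_compat_l; lra.
- right; unfold Q; ring.
Qed.

(** * Cauchy's formula *)

Lemma Cminus_neq_0 (s a : C) : s <> a -> (s - a)%C <> RtoC 0.
Proof. apply Cminus_eq_contra. Qed.

Lemma Cmod_minus_pos (s a : C) : s <> a -> 0 < Cmod (s - a).
Proof. intros H; now apply Cmod_gt_0, Cminus_neq_0. Qed.

Lemma diff_quot_cont (S : C -> Prop) (f : C -> C) (a l s : C) :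
  is_cdiff f a l -> ccont_on S f s -> ccont_on S (diff_quot f a l) s.
Proof.
intros Hl Hs; destruct (classic (s = a)) as [->|Hne].
- apply (ccont_on_sub (fun _ => True)); auto; now apply is_cdiff_diff_quot.
- apply (ccont_on_ext_loc S (fun s => (f s - f a) / (s - a))%C _ s (Cmod (s - a))).
  + now apply Cmod_minus_pos.
  + intros y _ Hy; rewrite diff_quot_neq; auto.
    intros ->; rewrite Cmod_minus_sym in Hy; lra.
  + now rewrite diff_quot_neq.
  + apply ccont_on_div; [now apply Cminus_neq_0| |].
    * apply ccont_on_minus; auto; apply ccont_on_const.
    * apply ccont_on_minus; [apply ccont_on_id|apply ccont_on_const].
Qed.

Lemma diff_quot_cdiff (f : C -> C) (a l s : C) :
  s <> a -> cdiff f s -> cdiff (diff_quot f a l) s.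
Proof.
intros Hne Hf.
apply (cdiff_ext_loc (fun s => (f s - f a) / (s - a))%C _ s (Cmod (s - a))).
- now apply Cmod_minus_pos.
- intros y Hy; rewrite diff_quot_neq; auto.
  intros ->; rewrite Cmod_minus_sym in Hy; lra.
- apply cdiff_div; [now apply Cminus_neq_0| |].
  + apply cdiff_minus; auto; apply cdiff_const.
  + apply cdiff_minus; [apply cdiff_id|apply cdiff_const].
Qed.

Definition good_curve (c : R -> C) : Prop :=
  regular_curve c /\ c 0 = c 1 /\ simply_winding c.

Definition interior_fun (c : R -> C) (G : C -> C) : Prop :=
  (forall z, closed_interior c z -> ccont_on (closed_interior c) G z) /\
  (forall z, interior c z -> cdiff G z).

Lemma interior_fun_curve (c : R -> C) (G : C -> C) : interior_fun c G -> cont_on_curve c G.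
Proof.
intros [HG _] s Hs; apply (ccont_on_sub (closed_interior c)); [intros; right; auto|].
apply HG; right; auto.
Qed.

Lemma cont_on_curve_mult (c : R -> C) (f g : C -> C) :
  cont_on_curve c f -> cont_on_curve c g -> cont_on_curve c (fun s => f s * g s)%C.
Proof. intros Hf Hg s Hs; apply ccont_on_mult; auto. Qed.

(** The difference quotient of [G] at [a], completed by the derivative, is continuous on the closed
    interior and holomorphic off [a]. A single point is thin, so [strong_cauchy] applies, and [wnum]
    supplies the integral of the subtracted kernel. *)
Lemma cauchy_interior (c : R -> C) (G : C -> C) (a : C) : good_curve c -> interior_fun c G ->
  interior c a -> contour_int c (fun s => G s / (s - a))%C = (two_pi_i * G a)%C.
Proof.
intros [Hr [H01 Hw]] HG Ha; pose proof (interior_fun_curve c G HG) as HGc.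
destruct HG as [Gc Gd]; destruct (Gd a Ha) as [l Hl].
assert (H0 : contour_int c (diff_quot G a l) = RtoC 0).
{ apply (strong_cauchy c _ (fun z => z = a)); auto using thin_single.
  - intros z Hz; apply diff_quot_cont; auto.
  - intros z Hz Hne; apply diff_quot_cdiff; auto. }
assert (Hk : cont_on_curve c (fun s => / (s - a))%C) by (apply cauchy_kernel_cont, Ha).
assert (HGk : cont_on_curve c (fun s => G s / (s - a))%C)
  by (apply cont_on_curve_mult; auto).
rewrite (contour_int_ext c (diff_quot G a l)
  (fun s => RtoC 1 * (G s / (s - a)) + (- G a) * (/ (s - a)))%C) in H0; auto.
- rewrite contour_int_linear in H0 by auto.
  fold (wnum c a) in H0; rewrite Hw in H0 by auto.
  replace (contour_int c (fun s => G s / (s - a)))%C with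
    ((1 * contour_int c (fun s => G s / (s - a)) + - G a * two_pi_i) + two_pi_i * G a)%C by ring.
  rewrite H0; ring.
- intros s Hs; apply (ccont_on_sub (closed_interior c)); [intros; right; auto|].
  apply diff_quot_cont; auto; apply Gc; right; auto.
- intros s Hs; rewrite diff_quot_neq by (intros ->; now apply (proj1 Ha)).
  field; apply Cminus_neq_0; intros ->; now apply (proj1 Ha).
Qed.

Lemma interior_fun_mult (c : R -> C) (f g : C -> C) :
  interior_fun c f -> interior_fun c g -> interior_fun c (fun s => f s * g s)%C.
Proof.
intros [F1 F2] [G1 G2]; split; intros z Hz.
- apply ccont_on_mult; auto.
- apply cdiff_mult; auto.
Qed.

Lemma closed_interior_neq_exterior (c : R -> C) (s z : C) :
  closed_interior c s -> exterior c z -> s <> z.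
Proof.
intros [H|H] Hz ->; [eapply interior_not_exterior; eauto|now apply (proj1 Hz)].
Qed.

Lemma interior_fun_kernel (c : R -> C) (z : C) : exterior c z ->
  interior_fun c (fun s => / (s - z))%C.
Proof.
intros Hz; split; intros s Hs.
- apply ccont_on_inv.
  + apply Cminus_neq_0; eapply closed_interior_neq_exterior; eauto.
  + apply ccont_on_minus; [apply ccont_on_id|apply ccont_on_const].
- apply cdiff_inv.
  + apply Cminus_neq_0; eapply closed_interior_neq_exterior; eauto; left; auto.
  + apply cdiff_minus; [apply cdiff_id|apply cdiff_const].
Qed.

Lemma cauchy_exterior (c : R -> C) (G : C -> C) (a : C) : good_curve c -> interior_fun c G ->
  exterior c a -> contour_int c (fun s => G s / (s - a))%C = RtoC 0.
Proof.
intros [Hr [H01 Hw]] HG Ha.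
destruct (interior_fun_mult c _ _ HG (interior_fun_kernel c a Ha)) as [F1 F2].
apply (strong_cauchy c _ (fun z => z = a)); auto using thin_single.
Qed.

(** * Cauchy-type integrals *)

Lemma curve_fun_bounded (c : R -> C) (phi : C -> C) : regular_curve c -> cont_on_curve c phi ->
  exists M, 0 < M /\ forall s, on_curve c s -> Cmod (phi s) <= M.
Proof.
intros Hr Hphi.
pose proof (cont_on_curve_Rcont c phi (proj1 Hr) Hphi) as Hc.
destruct (Rcont_on_unif 0 1 _ Hc 1 Rlt_0_1) as [d [Hd Kd]].
destruct (archimed_cor1 d Hd) as [n [Hn1 Hn2]].
exists (Rsum (S n) (fun i => Cmod (phi (c (ugrid n i)))) + 1); split.
- pose proof (Rsum_pos (S n) (fun i => Cmod (phi (c (ugrid n i)))) (fun _ _ => Cmod_ge_0 _)); lra.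
- intros s [t [Ht <-]].
  destruct (partition_find n (fun i => ugrid n i) t) as [i [Hi Hti]]; auto.
  + unfold ugrid; simpl; unfold Rdiv; rewrite Rmult_0_l; apply Ht.
  + unfold ugrid; unfold Rdiv; rewrite Rinv_r; [apply Ht|apply not_0_INR; lia].
  + rewrite ugrid_S in Hti by auto.
    assert (Cmod (phi (c t) - phi (c (ugrid n i))) < 1).
    { apply Kd; auto; [apply ugrid_range; lia|rewrite Rabs_pos_eq; lra]. }
    pose proof (Cmod_triangle_inv (phi (c t)) (phi (c (ugrid n i)))).
    assert (Cmod (phi (c (ugrid n i))) <= Rsum (S n) (fun i => Cmod (phi (c (ugrid n i))))); [|lra].
    apply (Rsum_nonneg_term (S n) i (fun i => Cmod (phi (c (ugrid n i))))); [|lia].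
    intros; apply Cmod_ge_0.
Qed.

(** The remainder of the kernel is exact: [1/(s-y) - 1/(s-z) - (y-z)/(s-z)^2 = (y-z)^2 / ((s-y)
    (s-z)^2)], where the denominator is bounded below along the curve as soon as
    [|y - z| < eta / 2]. *)
Lemma cauchy_type_cdiff (c : R -> C) (phi : C -> C) (z : C) : regular_curve c ->
  cont_on_curve c phi -> ~ on_curve c z ->
  cdiff (fun z => contour_int c (fun s => phi s * / (s - z))%C) z.
Proof.
intros Hr Hphi Hz.
destruct (curve_dist_pos c z (proj1 Hr) Hz) as [eta [Heta Hdist]].
destruct (rectifiable_length c (proj2 Hr)) as [l Hl].
pose proof (length_bound_mono c l 0 1 Hl ltac:(lra) ltac:(lra) ltac:(lra)) as HL.
destruct (curve_fun_bounded c phi Hr Hphi) as [M [HM0 HM]].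
assert (Hk : forall y, ~ on_curve c y -> cont_on_curve c (fun s => phi s * / (s - y))%C).
{ intros y Hy; apply cont_on_curve_mult; auto; now apply cauchy_kernel_cont. }
assert (Hk2 : cont_on_curve c (fun s => phi s * / (s - z) * / (s - z))%C).
{ apply (cont_on_curve_mult c (fun s => phi s * / (s - z))%C); auto; now apply cauchy_kernel_cont. }
exists (contour_int c (fun s => phi s * / (s - z) * / (s - z)))%C.
intros eps He.
set (Q := 2 * M / (eta * eta * eta) * (l 1 - l 0) + 1).
assert (HQ0 : 0 <= 2 * M / (eta * eta * eta)).
{ left; apply Rdiv_lt_0_compat; [lra|]; repeat apply Rmult_lt_0_compat; auto. }
assert (HQ : 0 < Q) by (unfold Q; nra).
exists (Rmin (eta / 2) (eps / Q)); split.
{ apply Rmin_glb_lt; [lra|now apply Rdiv_lt_0_compat]. }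
intros y Hy.
destruct (Rmin_Rgt_l _ _ _ Hy) as [Hy1 Hy2].
assert (Hdy : forall s, on_curve c s -> eta / 2 <= Cmod (s - y)).
{ intros s Hs; specialize (Hdist s Hs); pose proof (Cmod_dist_triangle s y z); lra. }
assert (Hyo : ~ on_curve c y).
{ intros H; specialize (Hdy y H); replace (y - y)%C with (RtoC 0) in Hdy by ring.
  rewrite Cmod_0 in Hdy; lra. }
set (I2 := contour_int c (fun s => phi s * / (s - z) * / (s - z))%C).
set (Iz := contour_int c (fun s => phi s * / (s - z))%C).
set (Iy := contour_int c (fun s => phi s * / (s - y))%C).
assert (Hlin : contour_int c (fun s => RtoC 1 * (phi s * / (s - z)) +
   (y - z) * (phi s * / (s - z) * / (s - z)))%C = (1 * Iz + (y - z) * I2)%C)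
  by (apply contour_int_linear; auto).
replace (Iy - Iz - I2 * (y - z))%C with (Iy - (1 * Iz + (y - z) * I2))%C by ring.
rewrite <- Hlin.
eapply Rle_trans; [apply (contour_int_diff_bound c l _ _
  (2 * M / (eta * eta * eta) * (Cmod (y - z) * Cmod (y - z)))); auto|].
- intros s Hs; apply ccont_on_plus; apply ccont_on_mult; auto using ccont_on_const; now apply Hk.
- intros s Hs; specialize (Hdist s Hs); specialize (Hdy s Hs); specialize (HM s Hs).
  assert (N1 : (s - y)%C <> RtoC 0) by (apply Cmod_gt_0; lra).
  assert (N2 : (s - z)%C <> RtoC 0) by (apply Cmod_gt_0; lra).
  replace (phi s * / (s - y) - (1 * (phi s * / (s - z)) + (y - z) * (phi s * / (s - z) * / (s - z))))%C
    with (phi s * ((y - z) * (y - z)) / ((s - y) * ((s - z) * (s - z))))%C by (field; auto).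
  rewrite Cmod_div by (repeat apply Cmult_neq_0; auto).
  rewrite !Cmod_mult.
  pose proof (Cmod_ge_0 (y - z)) as P; pose proof (Cmod_ge_0 (phi s)).
  replace (2 * M / (eta * eta * eta) * (Cmod (y - z) * Cmod (y - z))) with
    (M * (Cmod (y - z) * Cmod (y - z)) / (eta / 2 * (eta * eta))) by (field; lra).
  unfold Rdiv; apply Rmult_le_compat.
  + apply Rmult_le_pos; [auto|now apply Rmult_le_pos].
  + left; apply Rinv_0_lt_compat; repeat apply Rmult_lt_0_compat; lra.
  + apply Rmult_le_compat_r; [now apply Rmult_le_pos|auto].
  + apply Rinv_le_contravar; [repeat apply Rmult_lt_0_compat; lra|].
    apply Rmult_le_compat; [lra|nra|lra|apply Rmult_le_compat; lra].
- pose proof (Cmod_ge_0 (y - z)) as P.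
  apply Rle_trans with (Q * Cmod (y - z) * Cmod (y - z)); [unfold Q; nra|].
  apply Rmult_le_compat_r; auto.
  apply Rle_trans with (Q * (eps / Q)); [apply Rmult_le_compat_l; lra|].
  right; field; lra.
Qed.

(** * Geometrically dominated series *)

Definition is_csum (a : nat -> C) (s : C) : Prop :=
  forall eps, 0 < eps -> exists N, forall n, (N <= n)%nat -> Cmod (Csum n a - s) <= eps.

Lemma is_csum_unique (a : nat -> C) (s s' : C) : is_csum a s -> is_csum a s' -> s = s'.
Proof.
intros H H'; apply Cmod_le_eps_eq; intros eps He.
destruct (H (eps / 2) ltac:(lra)) as [N K]; destruct (H' (eps / 2) ltac:(lra)) as [N' K'].
specialize (K (max N N') ltac:(lia)); specialize (K' (max N N') ltac:(lia)).
eapply Rle_trans; [apply (Cmod_dist_triangle _ (Csum (max N N') a))|].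
rewrite (Cmod_minus_sym s); lra.
Qed.

Lemma is_csum_linear (a b : nat -> C) (s t x y : C) : is_csum a s -> is_csum b t ->
  is_csum (fun k => x * a k + y * b k)%C (x * s + y * t)%C.
Proof.
intros Ha Hb eps He.
pose proof (Cmod_ge_0 x); pose proof (Cmod_ge_0 y).
set (e := eps / (Cmod x + Cmod y + 1)).
assert (He' : 0 < e) by (apply Rdiv_lt_0_compat; lra).
assert (Ee : e * (Cmod x + Cmod y + 1) = eps) by (unfold e; field; lra).
destruct (Ha e He') as [N K]; destruct (Hb e He') as [N' K'].
exists (max N N'); intros n Hn; specialize (K n ltac:(lia)); specialize (K' n ltac:(lia)).
rewrite Csum_plus, !Csum_scal.
replace (x * Csum n a + y * Csum n b - (x * s + y * t))%C with
  (x * (Csum n a - s) + y * (Csum n b - t))%C by ring.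
eapply Rle_trans; [apply Cmod_triangle|]; rewrite !Cmod_mult; nra.
Qed.

Lemma is_csum_ext (a b : nat -> C) (s : C) : (forall k, a k = b k) -> is_csum a s -> is_csum b s.
Proof.
intros E H eps He; destruct (H eps He) as [N K]; exists N; intros n Hn.
rewrite <- (Csum_ext n a) by auto; auto.
Qed.

(** [C_Series] is a total operator; domination by a geometric series is the form of convergence
    under which its values are identified here. *)
Definition geom_dom (q K : R) (a : nat -> C) : Prop := forall k, Cmod (a k) <= K * q ^ k.

Lemma is_csum_C_Series (q K : R) (a : nat -> C) : 0 <= q < 1 -> geom_dom q K a ->
  is_csum a (C_Series a).
Proof.
intros Hq Ha.
assert (Hs : forall p : C -> R, (forall z, Rabs (p z) <= Cmod z) -> ex_series (fun k => p (a k))).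
{ intros p Hp; apply (@ex_series_le R_AbsRing R_CompleteNormedModule _ (fun k => K * q ^ k)).
  - intros k; eapply Rle_trans; [apply Hp|apply Ha].
  - apply (@ex_series_scal_l R_AbsRing), ex_series_geom; rewrite Rabs_pos_eq; lra. }
assert (Hl : forall p : C -> R, (forall z, Rabs (p z) <= Cmod z) ->
  (forall n, p (Csum n a) = Rsum n (fun k => p (a k))) ->
  forall eps, 0 < eps -> exists N, forall n, (N <= n)%nat ->
    Rabs (p (Csum n a) - Series (fun k => p (a k))) < eps).
{ intros p Hp Hsum eps He.
  pose proof (Series_correct _ (Hs p Hp)) as H.
  assert (H' : is_lim_seq (sum_n (fun k => p (a k))) (Series (fun k => p (a k)))) by exact H.
  apply is_lim_seq_spec in H'; destruct (H' (mkposreal eps He)) as [N HN].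
  exists (S N); intros [|n] Hn; [lia|].
  specialize (HN n ltac:(lia)); rewrite sum_n_Rsum in HN; rewrite Hsum; exact HN. }
assert (SRe : forall n, Re (Csum n a) = Rsum n (fun k => Re (a k))).
{ induction n as [|n IH]; [reflexivity|]; cbn [Csum Rsum]; rewrite <- IH; reflexivity. }
assert (SIm : forall n, Im (Csum n a) = Rsum n (fun k => Im (a k))).
{ induction n as [|n IH]; [reflexivity|]; cbn [Csum Rsum]; rewrite <- IH; reflexivity. }
intros eps He.
destruct (Hl Re re_le_Cmod SRe (eps / 2) ltac:(lra)) as [N1 K1].
destruct (Hl Im Im_le_Cmod SIm (eps / 2) ltac:(lra)) as [N2 K2].
exists (max N1 N2); intros n Hn.
specialize (K1 n ltac:(lia)); specialize (K2 n ltac:(lia)).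
eapply Rle_trans; [apply Cmod_Re_Im|].
change (Rabs (Re (Csum n a) - Series (fun k => Re (a k))) +
  Rabs (Im (Csum n a) - Series (fun k => Im (a k))) <= eps); lra.
Qed.

Lemma geom_dom_tail (q K : R) (a : nat -> C) (n m : nat) : 0 <= q < 1 -> geom_dom q K a ->
  Cmod (Csum (n + m) a - Csum n a) <= K * (q ^ n - q ^ (n + m)) / (1 - q).
Proof.
intros Hq Ha; induction m as [|m IH].
- rewrite Nat.add_0_r; replace (Csum n a - Csum n a)%C with (RtoC 0) by ring.
  rewrite Cmod_0; right; field; lra.
- rewrite Nat.add_succ_r; cbn [Csum].
  replace (Csum (n + m) a + a (n + m)%nat - Csum n a)%C with
    ((Csum (n + m) a - Csum n a) + a (n + m)%nat)%C by ring.
  eapply Rle_trans; [apply Cmod_triangle|].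
  specialize (Ha (n + m)%nat).
  apply Rle_trans with (K * (q ^ n - q ^ (n + m)) / (1 - q) + K * q ^ (n + m)); [lra|].
  right; simpl; field; lra.
Qed.

Lemma C_Series_tail (q K : R) (a : nat -> C) (n : nat) : 0 <= q < 1 -> geom_dom q K a ->
  Cmod (Csum n a - C_Series a) <= K * q ^ n / (1 - q).
Proof.
intros Hq Ha; apply le_epsilon; intros eps He.
assert (HK : 0 <= K).
{ specialize (Ha O); simpl in Ha; pose proof (Cmod_ge_0 (a O)); lra. }
destruct (is_csum_C_Series q K a Hq Ha eps He) as [N HN].
specialize (HN (n + N)%nat ltac:(lia)).
eapply Rle_trans; [apply (Cmod_dist_triangle _ (Csum (n + N) a))|].
apply Rplus_le_compat; auto.
rewrite Cmod_minus_sym; eapply Rle_trans; [apply (geom_dom_tail q K); auto|].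
unfold Rdiv; apply Rmult_le_compat_r; [left; apply Rinv_0_lt_compat; lra|].
apply Rmult_le_compat_l; auto; pose proof (pow_le q (n + N) (proj1 Hq)); lra.
Qed.

Lemma C_Series_bound (q K : R) (a : nat -> C) : 0 <= q < 1 -> geom_dom q K a ->
  Cmod (C_Series a) <= K / (1 - q).
Proof.
intros Hq Ha; pose proof (C_Series_tail q K a O Hq Ha) as H; simpl in H.
replace (0 - C_Series a)%C with (- C_Series a)%C in H by ring.
rewrite Cmod_opp, Rmult_1_r in H; exact H.
Qed.

(** * The discrete integral over the points [q^k] and [-q^k] *)

(** The Jackson integral without its factor [1 - q], the form in which the residues of [f h]
    appear. *)
Definition jack_sum (q : R) (f : C -> C) : C :=
  C_Series (fun k => (f (RtoC (q ^ k)%R) + f (RtoC (- q ^ k)%R)) * RtoC (q ^ k)%R)%C.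

Definition jack_bounded (q B : R) (f : C -> C) : Prop :=
  forall k : nat, Cmod (f (RtoC (q ^ k)%R)) <= B /\ Cmod (f (RtoC (- q ^ k)%R)) <= B.

Lemma jack_bounded_dom (q B : R) (f : C -> C) : 0 <= q < 1 -> jack_bounded q B f ->
  geom_dom q (2 * B) (fun k => (f (RtoC (q ^ k)%R) + f (RtoC (- q ^ k)%R)) * RtoC (q ^ k)%R)%C.
Proof.
intros Hq Hf k; destruct (Hf k) as [F1 F2]; rewrite Cmod_mult, Cmod_R.
pose proof (pow_le q k (proj1 Hq)); rewrite Rabs_pos_eq by auto.
apply Rmult_le_compat_r; auto; eapply Rle_trans; [apply Cmod_triangle|lra].
Qed.

Lemma jack_sum_linear (q B B' : R) (f g : C -> C) (x y : C) : 0 <= q < 1 ->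
  jack_bounded q B f -> jack_bounded q B' g ->
  jack_sum q (fun s => x * f s + y * g s)%C = (x * jack_sum q f + y * jack_sum q g)%C.
Proof.
intros Hq Hf Hg.
pose proof (jack_bounded_dom q B f Hq Hf) as Df; pose proof (jack_bounded_dom q B' g Hq Hg) as Dg.
apply (is_csum_unique (fun k => x * ((f (RtoC (q ^ k)%R) + f (RtoC (- q ^ k)%R)) * RtoC (q ^ k)%R) +
   y * ((g (RtoC (q ^ k)%R) + g (RtoC (- q ^ k)%R)) * RtoC (q ^ k)%R))%C).
- apply (is_csum_ext (fun k => (x * f (RtoC (q ^ k)%R) + y * g (RtoC (q ^ k)%R) +
    (x * f (RtoC (- q ^ k)%R) + y * g (RtoC (- q ^ k)%R))) * RtoC (q ^ k)%R)%C).
  { intros; ring. }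
  apply (is_csum_C_Series q (Cmod x * (2 * B) + Cmod y * (2 * B'))); auto; intros k.
  replace ((x * f (RtoC (q ^ k)%R) + y * g (RtoC (q ^ k)%R) +
    (x * f (RtoC (- q ^ k)%R) + y * g (RtoC (- q ^ k)%R))) * RtoC (q ^ k)%R)%C with
   (x * ((f (RtoC (q ^ k)%R) + f (RtoC (- q ^ k)%R)) * RtoC (q ^ k)%R) +
   y * ((g (RtoC (q ^ k)%R) + g (RtoC (- q ^ k)%R)) * RtoC (q ^ k)%R))%C by ring.
  eapply Rle_trans; [apply Cmod_triangle|]; rewrite !(Cmod_mult x), !(Cmod_mult y).
  specialize (Df k); specialize (Dg k); cbv beta in Df, Dg.
  pose proof (Cmod_ge_0 x); pose proof (Cmod_ge_0 y).
  rewrite Rmult_plus_distr_r, !(Rmult_assoc (Cmod _)).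
  apply Rplus_le_compat; apply Rmult_le_compat_l; auto.
- apply is_csum_linear; eapply is_csum_C_Series; eauto.
Qed.

Lemma jack_sum_ext (q : R) (f g : C -> C) :
  (forall k : nat, f (RtoC (q ^ k)%R) = g (RtoC (q ^ k)%R) /\
     f (RtoC (- q ^ k)%R) = g (RtoC (- q ^ k)%R)) -> jack_sum q f = jack_sum q g.
Proof.
intros H; unfold jack_sum, C_Series; f_equal; apply Series_ext; intros k;
  destruct (H k) as [-> ->]; easy.
Qed.

Lemma jack_sum_bound (q B : R) (f : C -> C) : 0 <= q < 1 -> jack_bounded q B f ->
  Cmod (jack_sum q f) <= 2 * B / (1 - q).
Proof. intros Hq Hf; apply C_Series_bound; auto; now apply jack_bounded_dom. Qed.

Lemma jackson_jack_sum (q : R) (f : C -> C) : jackson q f = (RtoC (1 - q) * jack_sum q f)%C.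
Proof. reflexivity. Qed.

(** * The function h *)

(** For an appropriate curve the poles of the terms [hp] lie inside and those of the terms [hm]
    outside. *)
Definition hp (q : R) (k : nat) (s : C) : C := h_term q s (Z.of_nat k).
Definition hm (q : R) (k : nat) (s : C) : C := h_term q s (- Z.of_nat (S k))%Z.

(** One lower bound for all denominators of [h]. For [0 < q < 1], letting [k] tend to infinity shows
    that it also keeps [s] away from 0, where the poles accumulate. *)
Definition pole_dist (q rho : R) (s : C) : Prop :=
  forall k : Z, rho <= Cmod (s ^ 2 - RtoC (powerRZ q (2 * k)))%C.

Definition pole_region (q rho r : R) (s : C) : Prop := pole_dist q rho s /\ Cmod s <= r.

(** The first summand dominates the terms [hp]; the other two dominate the terms [hm], according to
    whether the pole is large compared with [r] or not. The sum serves both families. *)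
Definition h_const (rho r : R) : R := 2 * r / rho + 4 * r + 4 * (r * r * r) / rho.

Lemma h_const_pos (rho r : R) : 0 < rho -> 0 <= r -> 0 <= h_const rho r.
Proof.
intros Hrho Hr; unfold h_const.
assert (0 <= 2 * r / rho) by (apply Rdiv_le_0_compat; lra).
assert (0 <= 4 * (r * r * r) / rho).
{ apply Rdiv_le_0_compat; auto; apply Rmult_le_pos; [lra|]; repeat apply Rmult_le_pos; auto. }
lra.
Qed.

Lemma powerRZ_double (q : R) (k : Z) : 0 < q ->
  powerRZ q (2 * k) = powerRZ q k * powerRZ q k.
Proof.
intros Hq; replace (2 * k)%Z with (k + k)%Z by ring; apply powerRZ_add; lra.
Qed.

Lemma Cmod_h_term (q : R) (s : C) (k : Z) : 0 < q ->
  (s ^ 2 - RtoC (powerRZ q (2 * k)))%C <> RtoC 0 ->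
  Cmod (h_term q s k) = 2 * Cmod s * powerRZ q k / Cmod (s ^ 2 - RtoC (powerRZ q (2 * k)))%C.
Proof.
intros Hq Hnz; unfold h_term; rewrite Cmod_div by auto.
rewrite !Cmod_mult, !Cmod_R, (Rabs_pos_eq 2), Rabs_pos_eq by (try lra; left; apply powerRZ_lt; auto).
easy.
Qed.

Lemma pole_dist_nz (q rho : R) (s : C) (k : Z) : 0 < rho -> pole_dist q rho s ->
  (s ^ 2 - RtoC (powerRZ q (2 * k)))%C <> RtoC 0.
Proof. intros Hr H; apply Cmod_gt_0; specialize (H k); lra. Qed.

Lemma hp_dom (q rho r : R) (s : C) : 0 < q < 1 -> 0 < rho -> pole_region q rho r s ->
  geom_dom q (h_const rho r) (fun k => hp q k s).
Proof.
intros Hq Hrho [Hs Hr] k; unfold hp; rewrite Cmod_h_term by (try lra; eapply pole_dist_nz; eauto).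
rewrite <- pow_powerRZ.
pose proof (Cmod_ge_0 s) as Ps; pose proof (pow_le q k ltac:(lra)) as Pq.
specialize (Hs (Z.of_nat k)); set (D := Cmod (s ^ 2 - _)) in *.
apply Rle_trans with (2 * r / rho * q ^ k).
- unfold Rdiv; rewrite (Rmult_assoc (2 * r)), (Rmult_comm (/ rho)), <- Rmult_assoc.
  apply Rmult_le_compat.
  + apply Rmult_le_pos; [lra|auto].
  + left; apply Rinv_0_lt_compat; lra.
  + apply Rmult_le_compat_r; [auto|lra].
  + apply Rinv_le_contravar; auto.
- apply Rmult_le_compat_r; auto; unfold h_const.
  assert (0 <= 4 * (r * r * r) / rho); [|lra].
  apply Rdiv_le_0_compat; auto; apply Rmult_le_pos; [lra|]; repeat apply Rmult_le_pos; lra.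
Qed.

(** With [p = q^(-(k+1))] the term is [2 |s| p / |s^2 - p^2|]. If [p^2 >= 2 r^2], the denominator is
    at least [p^2 / 2] and the term is of order [1 / p]. Otherwise the denominator is at least [rho]
    and [p] is bounded in terms of [r]; here [p q^k >= 1] supplies the factor [q^k]. *)
Lemma hm_dom (q rho r : R) (s : C) : 0 < q < 1 -> 0 < rho -> pole_region q rho r s ->
  geom_dom q (h_const rho r) (fun k => hm q k s).
Proof.
intros Hq Hrho [Hs Hr] k; unfold hm; rewrite Cmod_h_term by (try lra; eapply pole_dist_nz; eauto).
pose proof (Cmod_ge_0 s) as Ps; pose proof (pow_lt q k ltac:(lra)) as Pq.
set (z := (- Z.of_nat (S k))%Z).
specialize (Hs z); rewrite powerRZ_double in Hs |- * by lra.
set (p := powerRZ q z) in *.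
assert (Hp : 0 < p) by (apply powerRZ_lt; lra).
assert (Epq : p * q ^ (S k) = 1).
{ unfold p, z; rewrite (pow_powerRZ q (S k)), <- powerRZ_add by lra.
  replace (- Z.of_nat (S k) + Z.of_nat (S k))%Z with 0%Z by ring; reflexivity. }
assert (Hpq : p * q ^ k >= 1).
{ simpl in Epq; assert (q * (p * q ^ k) = 1) by lra.
  assert (0 < p * q ^ k) by (apply Rmult_lt_0_compat; auto); nra. }
set (D := Cmod (s ^ 2 - RtoC (p * p))%C) in *.
assert (HD : p * p - r * r <= D).
{ pose proof (Cmod_triangle_inv (RtoC (p * p)) (s ^ 2)%C) as T.
  rewrite Cmod_minus_sym, Cmod_R, Rabs_pos_eq in T by nra.
  assert (Hs2 : Cmod (s ^ 2)%C = Cmod s * Cmod s) by (rewrite Cmod_pow; simpl; ring).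
  rewrite Hs2 in T.
  assert (Cmod s * Cmod s <= r * r) by (apply Rmult_le_compat; lra).
  unfold D; lra. }
assert (Hr0 : 0 <= r) by lra.
assert (Hrrr : 0 <= r * r * r) by (repeat apply Rmult_le_pos; auto).
apply Rmult_le_reg_r with D; [lra|].
unfold Rdiv at 1; rewrite Rmult_assoc, Rinv_l, Rmult_1_r by lra.
apply Rle_trans with (2 * r * p); [apply Rmult_le_compat_r; lra|].
assert (H3 : 4 * (r * r * r) / rho * rho = 4 * (r * r * r)) by (field; lra).
assert (H30 : 0 <= 4 * (r * r * r) / rho) by (apply Rdiv_le_0_compat; lra).
assert (H20 : 0 <= 2 * r / rho) by (apply Rdiv_le_0_compat; lra).
destruct (Rle_lt_dec (2 * (r * r)) (p * p)) as [C1|C1].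
- assert (HD2 : p * p / 2 <= D) by lra.
  apply Rle_trans with (4 * r * q ^ k * D).
  + apply Rle_trans with (4 * r * q ^ k * (p * p / 2)).
    * replace (4 * r * q ^ k * (p * p / 2)) with (2 * r * p * (p * q ^ k)) by field.
      rewrite <- (Rmult_1_r (2 * r * p)) at 1.
      apply Rmult_le_compat_l; [|lra]; apply Rmult_le_pos; lra.
    * apply Rmult_le_compat_l; auto; apply Rmult_le_pos; lra.
  + apply Rmult_le_compat_r; [lra|]; apply Rmult_le_compat_r; [lra|]; unfold h_const; lra.
- apply Rle_trans with (4 * (r * r * r) / rho * q ^ k * rho).
  + replace (4 * (r * r * r) / rho * q ^ k * rho) with (4 * (r * r * r) / rho * rho * q ^ k) by ring.
    rewrite H3.
    apply Rle_trans with (2 * r * (p * p) * q ^ k).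
    * replace (2 * r * (p * p) * q ^ k) with (2 * r * p * (p * q ^ k)) by ring.
      rewrite <- (Rmult_1_r (2 * r * p)) at 1.
      apply Rmult_le_compat_l; [|lra]; apply Rmult_le_pos; lra.
    * apply Rmult_le_compat_r; [lra|].
      replace (4 * (r * r * r)) with (2 * r * (2 * (r * r))) by ring.
      apply Rmult_le_compat_l; lra.
  + apply Rmult_le_compat; try lra.
    * apply Rmult_le_pos; lra.
    * apply Rmult_le_compat_r; [lra|]; unfold h_const; lra.
Qed.

Definition h_partial (q : R) (n : nat) (s : C) : C :=
  (Csum n (fun k => hp q k s) + Csum n (fun k => hm q k s))%C.

Lemma h_approx (q rho r : R) (s : C) (n : nat) : 0 < q < 1 -> 0 < rho ->
  pole_region q rho r s ->
  Cmod (h_partial q n s - h q s) <= 2 * (h_const rho r * q ^ n / (1 - q)).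
Proof.
intros Hq Hrho Hs; unfold h_partial, h, C_Zseries.
pose proof (C_Series_tail q _ _ n ltac:(lra) (hp_dom q rho r s Hq Hrho Hs)) as T1.
pose proof (C_Series_tail q _ _ n ltac:(lra) (hm_dom q rho r s Hq Hrho Hs)) as T2.
unfold hp, hm in T1, T2 |- *.
match goal with |- Cmod (?a + ?b - (?x + ?y)) <= _ =>
  replace (a + b - (x + y))%C with ((a - x) + (b - y))%C by ring end.
eapply Rle_trans; [apply Cmod_triangle|lra].
Qed.

Lemma geom_small (q K eps : R) : 0 < q < 1 -> 0 <= K -> 0 < eps ->
  exists n, K * q ^ n <= eps.
Proof.
intros Hq HK He.
destruct (pow_lt_1_zero q) with (y := eps / (K + 1)) as [N HN].
- rewrite Rabs_pos_eq; lra.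
- apply Rdiv_lt_0_compat; lra.
- exists N; specialize (HN N (le_n N)).
  pose proof (pow_le q N ltac:(lra)) as P; rewrite Rabs_pos_eq in HN by auto.
  apply Rle_trans with ((K + 1) * q ^ N); [nra|].
  apply Rle_trans with ((K + 1) * (eps / (K + 1))); [apply Rmult_le_compat_l; lra|].
  right; field; lra.
Qed.

Lemma uniform_limit_cont (S : C -> Prop) (f : C -> C) (z : C) : S z ->
  (forall eps, 0 < eps -> exists g, ccont_on S g z /\ forall y, S y -> Cmod (g y - f y) <= eps) ->
  ccont_on S f z.
Proof.
intros Sz H eps He; destruct (H (eps / 4) ltac:(lra)) as [g [Hg K]].
destruct (Hg (eps / 4) ltac:(lra)) as [d [Hd Kd]]; exists d; split; auto; intros y Sy Hy.
specialize (Kd y Sy Hy); pose proof (K y Sy); pose proof (K z Sz).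
replace (f y - f z)%C with ((g y - g z) - (g y - f y) + (g z - f z))%C by ring.
eapply Rle_lt_trans; [apply Cmod_triangle|].
pose proof (Cmod_triangle_minus (g y - g z) (g y - f y)); lra.
Qed.

Lemma ccont_on_Csum (S : C -> Prop) (u : nat -> C -> C) (z : C) (n : nat) :
  (forall k, ccont_on S (u k) z) -> ccont_on S (fun s => Csum n (fun k => u k s)) z.
Proof.
intros H; induction n as [|n IH]; cbn [Csum].
- apply ccont_on_const.
- apply (ccont_on_plus S (fun s => Csum n (fun k => u k s)) (u n)); auto.
Qed.

Lemma h_term_cont (q rho : R) (S : C -> Prop) (z : C) (k : Z) : 0 < rho -> pole_dist q rho z ->
  ccont_on S (fun s => h_term q s k) z.
Proof.
intros Hrho Hz; unfold h_term; apply ccont_on_div.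
- eapply pole_dist_nz; eauto.
- apply ccont_on_mult; [|apply ccont_on_const].
  apply ccont_on_mult; [apply ccont_on_const|apply ccont_on_id].
- apply ccont_on_minus; [apply ccont_on_pow|apply ccont_on_const].
Qed.

Lemma h_partial_cont (q rho : R) (S : C -> Prop) (z : C) (n : nat) : 0 < rho ->
  pole_dist q rho z -> ccont_on S (h_partial q n) z.
Proof.
intros Hrho Hz; apply (ccont_on_plus S (fun s => Csum n (fun k => hp q k s))
  (fun s => Csum n (fun k => hm q k s)));
  apply ccont_on_Csum; intros; apply (h_term_cont q rho); auto.
Qed.

Lemma h_cont (q rho r : R) (z : C) : 0 < q < 1 -> 0 < rho -> pole_region q rho r z ->
  ccont_on (pole_region q rho r) (h q) z.
Proof.
intros Hq Hrho Hz; apply uniform_limit_cont; auto; intros eps He.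
assert (Hr : 0 <= r) by (destruct Hz; pose proof (Cmod_ge_0 z); lra).
pose proof (h_const_pos rho r Hrho Hr).
destruct (geom_small q (2 * (h_const rho r / (1 - q))) eps Hq) as [n Hn]; auto.
{ apply Rmult_le_pos; [lra|]; apply Rdiv_le_0_compat; lra. }
exists (h_partial q n); split; [apply (h_partial_cont q rho); auto; apply Hz|].
intros y Hy; eapply Rle_trans; [apply (h_approx q rho r); auto|].
eapply Rle_trans; [|exact Hn]; right; field; lra.
Qed.

(** Since [|s^2 - z^2| <= |z - s| (2 r + 1)], points near the curve keep half of the bound on the
    denominators. This gives the room in which [h] is continuous at the curve when approached from
    off the curve. *)
Lemma pole_dist_near (q rho r : R) (s z : C) : 0 < rho -> 0 <= r -> pole_region q rho r s ->
  Cmod (z - s) <= 1 -> Cmod (z - s) <= rho / (2 * (2 * r + 1)) ->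
  pole_region q (rho / 2) (r + 1) z.
Proof.
intros Hrho Hr [Hs Hsr] H1 H2.
assert (Hzr : Cmod z <= r + 1).
{ replace z with ((z - s) + s)%C by ring; eapply Rle_trans; [apply Cmod_triangle|lra]. }
split; auto; intros k; specialize (Hs k).
assert (Hd : Cmod (s ^ 2 - z ^ 2)%C <= rho / 2).
{ replace (s ^ 2 - z ^ 2)%C with (- ((z - s) * (z + s)))%C by ring.
  rewrite Cmod_opp, Cmod_mult.
  apply Rle_trans with (rho / (2 * (2 * r + 1)) * (2 * r + 1)); [|right; field; lra].
  apply Rmult_le_compat; try apply Cmod_ge_0; auto.
  eapply Rle_trans; [apply Cmod_triangle|lra]. }
replace (s ^ 2 - RtoC (powerRZ q (2 * k)))%C with
  ((s ^ 2 - z ^ 2) + (z ^ 2 - RtoC (powerRZ q (2 * k))))%C in Hs by ring.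
pose proof (Cmod_triangle (s ^ 2 - z ^ 2)%C (z ^ 2 - RtoC (powerRZ q (2 * k)))%C); lra.
Qed.

(** The infinitely many poles are handled through their limits 0 and infinity. For [k >= n] the
    squared pole is at most half the squared distance [r0] from the curve to 0; for [k <= -n] it
    exceeds [B^2] by at least 1, where [B] bounds the curve; the remaining [k] are finitely many,
    each with poles off the curve. *)
Lemma curve_pole_dist (q : R) (c : R -> C) : 0 < q < 1 -> regular_curve c ->
  ~ on_curve c (RtoC 0) ->
  (forall k : Z, ~ on_curve c (RtoC (powerRZ q k)) /\ ~ on_curve c (RtoC (- powerRZ q k))) ->
  exists rho r, 0 < rho /\ 0 < r /\ forall s, on_curve c s -> pole_region q rho r s.
Proof.
intros Hq Hr H0 Hk.
destruct (curve_bounded c Hr) as [B [HB HBc]].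
destruct (curve_dist_pos c _ (proj1 Hr) H0) as [r0 [Hr0 Hd0]].
assert (Hone : forall k : Z, exists rho, 0 < rho /\ forall s, on_curve c s ->
   rho <= Cmod (s ^ 2 - RtoC (powerRZ q (2 * k)))%C).
{ intros k; destruct (Hk k) as [K1 K2].
  destruct (curve_dist_pos c _ (proj1 Hr) K1) as [r1 [Hr1 Hd1]].
  destruct (curve_dist_pos c _ (proj1 Hr) K2) as [r2 [Hr2 Hd2]].
  exists (r1 * r2); split; [now apply Rmult_lt_0_compat|]; intros s Hs.
  rewrite powerRZ_double, RtoC_mult by lra.
  replace (s ^ 2 - RtoC (powerRZ q k) * RtoC (powerRZ q k))%C with
    ((s - RtoC (powerRZ q k)) * (s - RtoC (- powerRZ q k)))%C by (rewrite RtoC_opp; ring).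
  rewrite Cmod_mult; apply Rmult_le_compat; auto; lra. }
assert (Hfin : forall n : nat, exists rho, 0 < rho /\ forall k s, (Z.abs k < Z.of_nat n)%Z ->
   on_curve c s -> rho <= Cmod (s ^ 2 - RtoC (powerRZ q (2 * k)))%C).
{ induction n as [|n [rho [Hrho K]]]; [exists 1; split; [lra|]; intros; lia|].
  destruct (Hone (Z.of_nat n)) as [r1 [Hr1 K1]]; destruct (Hone (- Z.of_nat n)%Z) as [r2 [Hr2 K2]].
  exists (Rmin rho (Rmin r1 r2)); split; [repeat apply Rmin_glb_lt; auto|].
  assert (A1 : Rmin rho (Rmin r1 r2) <= rho) by apply Rmin_l.
  assert (A2 : Rmin rho (Rmin r1 r2) <= Rmin r1 r2) by apply Rmin_r.
  assert (A3 : Rmin r1 r2 <= r1) by apply Rmin_l.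
  assert (A4 : Rmin r1 r2 <= r2) by apply Rmin_r.
  intros k s Hks Hs.
  destruct (Z.eq_dec k (Z.of_nat n)) as [->|N1]; [specialize (K1 s Hs); lra|].
  destruct (Z.eq_dec k (- Z.of_nat n)) as [->|N2]; [specialize (K2 s Hs); lra|].
  specialize (K k s ltac:(lia) Hs); lra. }
destruct (geom_small q 1 (Rmin (r0 * r0 / 2) (/ (B * B + 1))) Hq) as [n Hn]; [lra| |].
{ apply Rmin_glb_lt; [nra|apply Rinv_0_lt_compat; nra]. }
rewrite Rmult_1_l in Hn.
assert (Hn1 : q ^ n <= r0 * r0 / 2) by (eapply Rle_trans; [exact Hn|apply Rmin_l]).
assert (Hn2 : q ^ n <= / (B * B + 1)) by (eapply Rle_trans; [exact Hn|apply Rmin_r]).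
pose proof (pow_lt q n ltac:(lra)) as Pn.
destruct (Hfin n) as [rho [Hrho K]].
exists (Rmin rho (Rmin (r0 * r0 / 2) 1)), B; split; [|split; auto].
{ apply Rmin_glb_lt; auto; apply Rmin_glb_lt; [nra|lra]. }
intros s Hs; split; auto; intros k.
assert (A1 : Rmin rho (Rmin (r0 * r0 / 2) 1) <= rho) by apply Rmin_l.
assert (A2 : Rmin rho (Rmin (r0 * r0 / 2) 1) <= Rmin (r0 * r0 / 2) 1) by apply Rmin_r.
assert (A3 : Rmin (r0 * r0 / 2) 1 <= r0 * r0 / 2) by apply Rmin_l.
assert (A4 : Rmin (r0 * r0 / 2) 1 <= 1) by apply Rmin_r.
specialize (HBc s Hs); specialize (Hd0 s Hs).
replace (s - RtoC 0)%C with s in Hd0 by ring.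
assert (Hs2 : Cmod (s ^ 2)%C = Cmod s * Cmod s) by (rewrite Cmod_pow; simpl; ring).
destruct (Z_lt_le_dec (Z.abs k) (Z.of_nat n)) as [Hkn|Hkn]; [specialize (K k s Hkn Hs); lra|].
assert (Hqn1 : forall m : nat, (n <= m)%nat -> q ^ m <= q ^ n).
{ intros m Hm; replace m with (n + (m - n))%nat by lia; rewrite pow_add.
  rewrite <- (Rmult_1_r (q ^ n)) at 2; apply Rmult_le_compat_l; [lra|].
  pose proof (pow_incr q 1 (m - n) ltac:(lra)) as P; rewrite pow1 in P; exact P. }
destruct (Z_le_gt_dec 0 k) as [Hk0|Hk0].
- assert (E : powerRZ q (2 * k) = q ^ (2 * Z.to_nat k)).
  { rewrite pow_powerRZ; f_equal; lia. }
  rewrite E; pose proof (pow_lt q (2 * Z.to_nat k) ltac:(lra)).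
  specialize (Hqn1 (2 * Z.to_nat k)%nat ltac:(lia)).
  pose proof (Cmod_triangle_inv (s ^ 2)%C (RtoC (q ^ (2 * Z.to_nat k)))) as T.
  rewrite Cmod_R, Rabs_pos_eq, Hs2 in T by lra.
  assert (r0 * r0 <= Cmod s * Cmod s) by (apply Rmult_le_compat; lra); lra.
- assert (E : powerRZ q (2 * k) = / q ^ (2 * Z.to_nat (- k))).
  { rewrite pow_powerRZ, <- powerRZ_neg'; f_equal; lia. }
  rewrite E; pose proof (pow_lt q (2 * Z.to_nat (- k)) ltac:(lra)).
  specialize (Hqn1 (2 * Z.to_nat (- k))%nat ltac:(lia)).
  assert (Hinv : B * B + 1 <= / q ^ (2 * Z.to_nat (- k))).
  { rewrite <- (Rinv_inv (B * B + 1)); apply Rinv_le_contravar; auto; lra. }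
  pose proof (Cmod_triangle_inv (RtoC (/ q ^ (2 * Z.to_nat (- k)))) (s ^ 2)%C) as T.
  rewrite Cmod_minus_sym, Cmod_R, Rabs_pos_eq, Hs2 in T by nra.
  pose proof (Cmod_ge_0 s).
  assert (Cmod s * Cmod s <= B * B) by (apply Rmult_le_compat; lra); lra.
Qed.

(** * Termwise integration against h *)

Lemma contour_int_Csum (c : R -> C) (u : nat -> C -> C) (n : nat) : regular_curve c ->
  (forall k, cont_on_curve c (u k)) ->
  contour_int c (fun s => Csum n (fun k => u k s)) = Csum n (fun k => contour_int c (u k)).
Proof.
intros Hr Hu; induction n as [|n IH]; cbn [Csum].
- pose proof (contour_int_linear c (u O) (u O) 0 0 Hr (Hu O) (Hu O)) as E.
  rewrite (contour_int_ext c (fun _ => RtoC 0) (fun s => 0 * u O s + 0 * u O s)%C); auto.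
  + rewrite E; ring.
  + intros s Hs; apply ccont_on_const.
  + intros; ring.
- rewrite <- IH.
  assert (HS : cont_on_curve c (fun s => Csum n (fun k => u k s))).
  { intros s Hs; apply ccont_on_Csum; intros; now apply Hu. }
  rewrite (contour_int_ext c _ (fun s => 1 * Csum n (fun k => u k s) + 1 * u n s)%C); auto.
  + rewrite contour_int_linear by auto; ring.
  + intros s Hs; apply ccont_on_plus; [now apply HS|now apply Hu].
  + intros; ring.
Qed.

Lemma h_cont_on_curve (q rho r : R) (c : R -> C) : 0 < q < 1 -> 0 < rho ->
  (forall s, on_curve c s -> pole_region q rho r s) -> cont_on_curve c (h q).
Proof.
intros Hq Hrho Hc s Hs; apply (ccont_on_sub (pole_region q rho r)); auto.
apply h_cont; auto.
Qed.

Lemma contour_int_h (q rho r : R) (c : R -> C) (g : C -> C) : 0 < q < 1 -> 0 < rho -> 0 < r ->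
  regular_curve c -> cont_on_curve c g -> (forall s, on_curve c s -> pole_region q rho r s) ->
  is_csum (fun k => contour_int c (fun s => g s * hp q k s)%C +
                    contour_int c (fun s => g s * hm q k s)%C)%C
    (contour_int c (fun s => g s * h q s)%C).
Proof.
intros Hq Hrho Hr0 Hr Hg Hc eps He.
destruct (rectifiable_length c (proj2 Hr)) as [l Hl].
pose proof (length_bound_mono c l 0 1 Hl ltac:(lra) ltac:(lra) ltac:(lra)) as HL.
destruct (curve_fun_bounded c g Hr Hg) as [M [HM HMg]].
assert (Ht : forall k, cont_on_curve c (fun s => h_term q s k)).
{ intros k s Hs; apply (h_term_cont q rho); auto; now apply Hc. }
assert (Hgt : forall k, cont_on_curve c (fun s => g s * h_term q s k)%C).
{ intros k; apply cont_on_curve_mult; auto. }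
assert (Hgh : cont_on_curve c (fun s => g s * h q s)%C).
{ apply cont_on_curve_mult; auto; apply (h_cont_on_curve q rho r); auto. }
pose proof (h_const_pos rho r Hrho ltac:(lra)) as HK.
set (Q := M * (2 * (h_const rho r / (1 - q))) * (l 1 - l 0)).
assert (HQ : 0 <= Q).
{ apply Rmult_le_pos; [|lra]; apply Rmult_le_pos; [lra|]; apply Rmult_le_pos; [lra|].
  apply Rdiv_le_0_compat; lra. }
destruct (geom_small q Q eps Hq HQ He) as [N HN].
exists N; intros n Hn.
assert (E : Csum n (fun k => contour_int c (fun s => g s * hp q k s)%C +
   contour_int c (fun s => g s * hm q k s)%C)%C = contour_int c (fun s => g s * h_partial q n s)%C).
{ rewrite Csum_plus.
  rewrite <- (contour_int_Csum c (fun k s => g s * hp q k s)%C) by (auto; intros; apply Hgt).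
  rewrite <- (contour_int_Csum c (fun k s => g s * hm q k s)%C) by (auto; intros; apply Hgt).
  assert (C1 : cont_on_curve c (fun s => Csum n (fun k => g s * hp q k s)%C))
    by (intros s Hs; apply (ccont_on_Csum (on_curve c) (fun k s => g s * hp q k s)%C); intros; now apply Hgt).
  assert (C2 : cont_on_curve c (fun s => Csum n (fun k => g s * hm q k s)%C))
    by (intros s Hs; apply (ccont_on_Csum (on_curve c) (fun k s => g s * hm q k s)%C); intros; now apply Hgt).
  rewrite (contour_int_ext c (fun s => g s * h_partial q n s)%C
    (fun s => 1 * Csum n (fun k => g s * hp q k s) + 1 * Csum n (fun k => g s * hm q k s))%C); auto.
  - rewrite contour_int_linear by auto; ring.
  - apply cont_on_curve_mult; auto; intros s Hs; apply (h_partial_cont q rho); auto; now apply Hc.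
  - intros s Hs; unfold h_partial; rewrite !Csum_scal; ring. }
rewrite E.
eapply Rle_trans; [apply (contour_int_diff_bound c l _ _ (M * (2 * (h_const rho r * q ^ n / (1 - q))))); auto|].
- apply cont_on_curve_mult; auto; intros s Hs; apply (h_partial_cont q rho); auto; now apply Hc.
- intros s Hs.
  replace (g s * h_partial q n s - g s * h q s)%C with (g s * (h_partial q n s - h q s))%C by ring.
  rewrite Cmod_mult; apply Rmult_le_compat; try apply Cmod_ge_0; auto.
  apply (h_approx q rho r); auto.
- assert (Hqn : q ^ n <= q ^ N).
  { replace n with (N + (n - N))%nat by lia; rewrite pow_add.
    rewrite <- (Rmult_1_r (q ^ N)) at 2; apply Rmult_le_compat_l; [apply pow_le; lra|].
    pose proof (pow_incr q 1 (n - N) ltac:(lra)) as P; rewrite pow1 in P; exact P. }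
  apply Rle_trans with (Q * q ^ n); [right; unfold Q; field; lra|].
  apply Rle_trans with (Q * q ^ N); auto.
  apply Rmult_le_compat_l; auto.
Qed.

(** * The Cauchy transform of G h *)

Definition q_curve (q : R) (c : R -> C) : Prop :=
  0 < q < 1 /\ good_curve c /\ interior c (RtoC 0) /\
  (forall k : nat, interior c (RtoC (q ^ k)%R) /\ interior c (RtoC (- q ^ k)%R)) /\
  (forall k : nat, exterior c (RtoC (powerRZ q (- Z.of_nat (S k)))) /\
                   exterior c (RtoC (- powerRZ q (- Z.of_nat (S k))))).

Lemma appropriate_q_curve (q : R) (c : R -> C) : 0 < q < 1 -> appropriate q c -> q_curve q c.
Proof.
intros Hq [[Hc [H01 _]] [Hrec [Hpo [Hi0 [Hin Hex]]]]].
split; auto; split; [|split; auto; split].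
- split; [|split]; auto.
  + split; auto; now apply continuous_on_Rcont_on.
  + intros z Hz; apply contour_int_unique, Hpo, Hz.
- intros k; rewrite pow_powerRZ; apply Hin; lia.
- intros k; apply Hex; lia.
Qed.

Lemma q_curve_off (q : R) (c : R -> C) (k : Z) : q_curve q c ->
  ~ on_curve c (RtoC (powerRZ q k)) /\ ~ on_curve c (RtoC (- powerRZ q k)).
Proof.
intros [_ [_ [_ [Hin Hex]]]]; destruct (Z_le_gt_dec 0 k) as [H|H].
- destruct (Hin (Z.to_nat k)) as [A1 A2]; rewrite pow_powerRZ, Z2Nat.id in A1, A2 by auto.
  split; [apply A1|apply A2].
- destruct (Hex (Z.to_nat (- k - 1))) as [A1 A2].
  replace (- Z.of_nat (S (Z.to_nat (- k - 1))))%Z with k in A1, A2 by lia.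
  split; [apply A1|apply A2].
Qed.

(** The points accumulate only at 0, which is interior: continuity there bounds all but finitely
    many values, and the sum of the remaining moduli bounds the others. *)
Lemma jack_bounded_interior (q : R) (c : R -> C) (F : C -> C) : q_curve q c ->
  (forall z, interior c z -> cdiff F z) -> exists B, 0 <= B /\ jack_bounded q B F.
Proof.
intros [Hq [_ [Hi0 [Hin _]]]] HF.
destruct (cdiff_ccont F _ (HF _ Hi0) 1 Rlt_0_1) as [d [Hd Kd]].
destruct (geom_small q 1 (d / 2) Hq) as [n Hn]; [lra|lra|].
set (u := fun k : nat => Cmod (F (RtoC (q ^ k)%R)) + Cmod (F (RtoC (- q ^ k)%R))).
assert (Pu : forall k, 0 <= u k) by (intros; unfold u; apply Rplus_le_le_0_compat; apply Cmod_ge_0).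
assert (Ps : 0 <= Rsum n u) by (apply Rsum_pos; auto).
pose proof (Cmod_ge_0 (F 0)).
exists (Cmod (F 0) + 1 + Rsum n u); split; [lra|]; intros k.
assert (Hbig : forall x : R, Rabs x < d -> Cmod (F x) <= Cmod (F 0) + 1).
{ intros x Hx; specialize (Kd x I).
  replace (x - 0)%C with (RtoC x) in Kd by ring; rewrite Cmod_R in Kd; specialize (Kd Hx).
  pose proof (Cmod_triangle_inv (F x) (F 0)); lra. }
destruct (le_lt_dec n k) as [Hk|Hk].
- assert (Hqk : 0 <= q ^ k < d).
  { split; [apply pow_le; lra|].
    replace k with (n + (k - n))%nat by lia; rewrite pow_add.
    pose proof (pow_incr q 1 (k - n) ltac:(lra)) as P; rewrite pow1 in P.
    pose proof (pow_le q n ltac:(lra)); pose proof (pow_le q (k - n) ltac:(lra)); nra. }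
  split; eapply Rle_trans; try apply Hbig; try rewrite Rabs_Ropp; try rewrite Rabs_pos_eq; lra.
- pose proof (Rsum_nonneg_term n k u Pu Hk) as P; unfold u at 1 in P.
  pose proof (Cmod_ge_0 (F (RtoC (q ^ k)%R))); pose proof (Cmod_ge_0 (F (RtoC (- q ^ k)%R))).
  split; lra.
Qed.

Lemma contour_int_scal (c : R -> C) (f : C -> C) (a : C) : regular_curve c -> cont_on_curve c f ->
  contour_int c (fun s => a * f s)%C = (a * contour_int c f)%C.
Proof.
intros Hr Hf; rewrite (contour_int_ext c _ (fun s => a * f s + 0 * f s)%C); auto.
- rewrite contour_int_linear by auto; ring.
- apply cont_on_curve_mult; auto; intros s Hs; apply ccont_on_const.
- intros; ring.
Qed.

Lemma contour_int_plus (c : R -> C) (f g : C -> C) : regular_curve c ->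
  cont_on_curve c f -> cont_on_curve c g ->
  contour_int c (fun s => f s + g s)%C = (contour_int c f + contour_int c g)%C.
Proof.
intros Hr Hf Hg; rewrite (contour_int_ext c _ (fun s => 1 * f s + 1 * g s)%C); auto.
- rewrite contour_int_linear by auto; ring.
- intros s Hs; apply ccont_on_plus; auto.
- intros; ring.
Qed.

Lemma contour_int_h_term (q : R) (c : R -> C) (g : C -> C) (k : Z) : q_curve q c ->
  cont_on_curve c g ->
  let x := RtoC (powerRZ q k) in let x' := RtoC (- powerRZ q k) in
  contour_int c (fun s => g s * h_term q s k)%C =
  (x * (contour_int c (fun s => g s / (s - x)) + contour_int c (fun s => g s / (s - x'))))%C.
Proof.
intros Hqc Hg x x'.
assert (Hr : regular_curve c) by apply Hqc.
destruct (q_curve_off q c k Hqc) as [O1 O2]; fold x in O1; fold x' in O2.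
assert (C1 : cont_on_curve c (fun s => g s / (s - x))%C)
  by (apply cont_on_curve_mult; auto; now apply cauchy_kernel_cont).
assert (C2 : cont_on_curve c (fun s => g s / (s - x'))%C)
  by (apply cont_on_curve_mult; auto; now apply cauchy_kernel_cont).
assert (C3 : cont_on_curve c (fun s => g s / (s - x) + g s / (s - x'))%C)
  by (intros s Hs; apply ccont_on_plus; auto).
rewrite <- contour_int_plus by auto.
rewrite <- contour_int_scal by auto.
symmetry; apply contour_int_ext; auto.
- apply cont_on_curve_mult; auto; intros s Hs; apply ccont_on_const.
- intros s Hs.
  rewrite h_termE; [|apply Hqc|intros ->; now apply O1|intros ->; now apply O2].
  fold x; unfold x' in *; rewrite RtoC_opp in *; fold x in O2 |- *.
  replace (s - - x)%C with (s + x)%C by ring; unfold Cdiv; ring.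
Qed.

(** The Cauchy transform of [G h] with kernel [1 / (z - s)], opposite in sign to the usual one; this
    is why the interior formula subtracts [G h] and the jump from inside to outside is [+ G h]. *)
Definition hilb (q : R) (c : R -> C) (G : C -> C) (z : C) : C :=
  contour_int c (fun s => G s * h q s / (two_pi_i * (z - s)))%C.

Lemma two_pi_i_neq_0 : two_pi_i <> RtoC 0.
Proof. apply Cmod_gt_0; rewrite Cmod_two_pi_i; pose proof two_pi_gt_6; lra. Qed.

(** The kernel is absorbed in the factor [g], so that termwise integration against [h] applies to
    [hilb]. *)
Lemma hilb_kernel (q : R) (c : R -> C) (G : C -> C) (z : C) : q_curve q c ->
  cont_on_curve c G -> ~ on_curve c z ->
  let g := fun s => (- / two_pi_i * (G s / (s - z)))%C in
  cont_on_curve c g /\ hilb q c G z = contour_int c (fun s => g s * h q s)%C.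
Proof.
intros Hqc HG Hz g.
assert (Hr : regular_curve c) by apply Hqc.
assert (Cg : cont_on_curve c g).
{ apply cont_on_curve_mult; [intros s Hs; apply ccont_on_const|].
  apply cont_on_curve_mult; auto; now apply cauchy_kernel_cont. }
split; auto; symmetry; apply contour_int_ext; auto.
- destruct (curve_pole_dist q c) as [rho [r [Hrho [Hr0 Hreg]]]]; auto; try apply Hqc.
  + intros k; now apply q_curve_off.
  + apply cont_on_curve_mult; auto; apply (h_cont_on_curve q rho r); auto; apply Hqc.
- intros s Hs; unfold g.
  assert (N1 : (s - z)%C <> RtoC 0) by (apply Cminus_neq_0; intros ->; auto).
  assert (N2 : (z - s)%C <> RtoC 0) by (apply Cminus_neq_0; intros ->; auto).
  pose proof two_pi_i_neq_0.
  replace (z - s)%C with (- (s - z))%C in * by ring; field; repeat split; auto.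
Qed.

Lemma hilb_csum (q : R) (c : R -> C) (g : C -> C) : q_curve q c -> cont_on_curve c g ->
  is_csum (fun k =>
    RtoC (powerRZ q (Z.of_nat k)) *
      (contour_int c (fun s => g s / (s - RtoC (powerRZ q (Z.of_nat k)))) +
       contour_int c (fun s => g s / (s - RtoC (- powerRZ q (Z.of_nat k))))) +
    RtoC (powerRZ q (- Z.of_nat (S k))) *
      (contour_int c (fun s => g s / (s - RtoC (powerRZ q (- Z.of_nat (S k))))) +
       contour_int c (fun s => g s / (s - RtoC (- powerRZ q (- Z.of_nat (S k)))))))%C
  (contour_int c (fun s => g s * h q s)%C).
Proof.
intros Hqc Hg.
destruct (curve_pole_dist q c) as [rho [r [Hrho [Hr0 Hreg]]]]; auto; try apply Hqc.
{ intros k; now apply q_curve_off. }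
eapply is_csum_ext; [|apply (contour_int_h q rho r); auto; apply Hqc].
intros k; unfold hp, hm; rewrite !contour_int_h_term by auto; reflexivity.
Qed.

Lemma jack_bounded_weaken (q B : R) (f g : C -> C) :
  (forall k : nat, f (RtoC (q ^ k)%R) = g (RtoC (q ^ k)%R) /\
     f (RtoC (- q ^ k)%R) = g (RtoC (- q ^ k)%R)) ->
  jack_bounded q B f -> jack_bounded q B g.
Proof. intros E H k; destruct (E k) as [<- <-]; apply H. Qed.

(** For [z] outside, [g] is holomorphic inside the curve: the terms of [h] with poles inside give
    the values of [g] there, and those with poles outside integrate to zero. *)
Lemma hilb_exterior (q : R) (c : R -> C) (G : C -> C) (z : C) : q_curve q c ->
  interior_fun c G -> exterior c z ->
  hilb q c G z = jack_sum q (fun x => G x / (z - x))%C.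
Proof.
intros Hqc HG Hz.
pose proof (interior_fun_curve c G HG) as HGc.
destruct (hilb_kernel q c G z Hqc HGc (proj1 Hz)) as [Cg ->].
set (g := fun s => (- / two_pi_i * (G s / (s - z)))%C) in *.
assert (Ig : interior_fun c g).
{ apply interior_fun_mult; [split; intros; [apply ccont_on_const|apply cdiff_const]|].
  apply interior_fun_mult; auto; now apply interior_fun_kernel. }
assert (Hgood : good_curve c) by apply Hqc.
pose proof two_pi_i_neq_0 as Npi.
assert (Hval : forall x, interior c x -> (two_pi_i * g x = G x / (z - x))%C).
{ intros x Hx; unfold g.
  assert (Hne : x <> z) by (eapply closed_interior_neq_exterior; eauto; left; auto).
  assert (N1 : (x - z)%C <> RtoC 0) by now apply Cminus_neq_0.
  replace (z - x)%C with (- (x - z))%C by ring; field; repeat split; auto. }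
destruct (jack_bounded_interior q c (fun x => two_pi_i * g x)%C Hqc) as [B [HB Hjb]].
{ intros x Hx; apply cdiff_mult; [apply cdiff_const|now apply Ig]. }
apply (is_csum_unique (fun k => (G (RtoC (q ^ k)%R) / (z - RtoC (q ^ k)%R) +
   G (RtoC (- q ^ k)%R) / (z - RtoC (- q ^ k)%R)) * RtoC (q ^ k)%R)%C).
- eapply is_csum_ext; [|apply (hilb_csum q c g Hqc Cg)].
  intros k; destruct Hqc as [Hq [_ [_ [Hin Hex]]]].
  destruct (Hin k) as [A1 A2]; destruct (Hex k) as [A3 A4].
  rewrite <- !pow_powerRZ.
  rewrite !(cauchy_interior c g) by auto.
  rewrite !(cauchy_exterior c g) by auto.
  rewrite !Hval by auto; ring.
- apply (is_csum_C_Series q (2 * B)); [destruct Hqc; lra|].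
  apply (jack_bounded_dom q B (fun x => G x / (z - x))%C); [destruct Hqc; lra|].
  eapply jack_bounded_weaken; [|exact Hjb].
  intros k; destruct Hqc as [Hq [_ [_ [Hin _]]]]; split; apply Hval, Hin.
Qed.

(** [v] is [G a] for [a] inside and 0 for [a] outside, so that one statement treats both kinds of
    poles of [h]. *)
Lemma partial_fraction_int (c : R -> C) (G : C -> C) (z a : C) (v : C) : good_curve c ->
  interior_fun c G -> interior c z -> ~ on_curve c a -> a <> z ->
  contour_int c (fun s => G s / (s - a))%C = (two_pi_i * v)%C ->
  contour_int c (fun s => (- / two_pi_i * (G s / (s - z))) / (s - a))%C =
  ((v - G z) / (z - a))%C.
Proof.
intros Hgood HG Hz Ha Hne Hv.
pose proof (interior_fun_curve c G HG) as HGc.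
assert (Hr : regular_curve c) by apply Hgood.
pose proof two_pi_i_neq_0 as Npi.
assert (Nza : (z - a)%C <> RtoC 0) by (apply Cminus_neq_0; auto).
assert (K1 : cont_on_curve c (fun s => G s / (s - a))%C)
  by (apply cont_on_curve_mult; auto; now apply cauchy_kernel_cont).
assert (K2 : cont_on_curve c (fun s => G s / (s - z))%C)
  by (apply cont_on_curve_mult; auto; apply cauchy_kernel_cont, Hz).
rewrite (contour_int_ext c _ (fun s => / (two_pi_i * (z - a)) * (G s / (s - a)) +
  (- / (two_pi_i * (z - a))) * (G s / (s - z)))%C); auto.
- rewrite contour_int_linear, Hv, (cauchy_interior c G z) by auto.
  field; auto.
- apply cont_on_curve_mult; [|now apply cauchy_kernel_cont].
  apply cont_on_curve_mult; auto; intros s Hs; apply ccont_on_const.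
- intros s Hs.
  assert (N1 : (s - z)%C <> RtoC 0) by (apply Cminus_neq_0; intros ->; now apply (proj1 Hz)).
  assert (N2 : (s - a)%C <> RtoC 0) by (apply Cminus_neq_0; intros ->; auto).
  field; auto.
Qed.

Lemma pole_dist_neq (q rho : R) (z : C) (k : Z) : 0 < q -> 0 < rho -> pole_dist q rho z ->
  RtoC (powerRZ q k) <> z /\ RtoC (- powerRZ q k) <> z.
Proof.
intros Hq Hrho H; pose proof (pole_dist_nz q rho z k Hrho H) as N.
rewrite powerRZ_double, RtoC_mult in N by auto.
split; intros E; apply N; rewrite <- E; [|rewrite RtoC_opp]; ring.
Qed.

Lemma pole_region_dist (q rho r : R) (z : C) (k : nat) : 0 < q < 1 -> 0 < rho ->
  pole_region q rho r z ->
  rho / (r + 1) <= Cmod (z - RtoC (q ^ k)%R) /\ rho / (r + 1) <= Cmod (z - RtoC (- q ^ k)%R).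
Proof.
intros Hq Hrho [Hz Hr].
specialize (Hz (Z.of_nat k)); rewrite powerRZ_double, <- pow_powerRZ, RtoC_mult in Hz by lra.
replace (z ^ 2 - RtoC (q ^ k)%R * RtoC (q ^ k)%R)%C with
  ((z - RtoC (q ^ k)%R) * (z - RtoC (- q ^ k)%R))%C in Hz by (rewrite RtoC_opp; ring).
rewrite Cmod_mult in Hz.
assert (Hqk : 0 <= q ^ k <= 1).
{ split; [apply pow_le; lra|].
  pose proof (pow_incr q 1 k ltac:(lra)) as P; rewrite pow1 in P; auto. }
pose proof (Cmod_ge_0 z).
assert (U1 : Cmod (z - RtoC (q ^ k)%R) <= r + 1).
{ eapply Rle_trans; [apply Cmod_triangle_minus|]; rewrite Cmod_R, Rabs_pos_eq; lra. }
assert (U2 : Cmod (z - RtoC (- q ^ k)%R) <= r + 1).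
{ eapply Rle_trans; [apply Cmod_triangle_minus|]; rewrite Cmod_R, Rabs_Ropp, Rabs_pos_eq; lra. }
pose proof (Cmod_ge_0 (z - RtoC (q ^ k)%R)); pose proof (Cmod_ge_0 (z - RtoC (- q ^ k)%R)).
assert (E : rho / (r + 1) * (r + 1) = rho) by (field; lra).
split; apply Rmult_le_reg_r with (r + 1); try lra; rewrite E.
- eapply Rle_trans; [exact Hz|]; apply Rmult_le_compat_l; auto.
- eapply Rle_trans; [exact Hz|]; rewrite Rmult_comm; apply Rmult_le_compat_l; auto.
Qed.

Definition jack_far (q m : R) (z : C) : Prop := forall k : nat,
  m <= Cmod (z - RtoC (q ^ k)%R) /\ m <= Cmod (z - RtoC (- q ^ k)%R).

Lemma jack_transform_bounded (q B m : R) (G : C -> C) (z : C) : 0 < m -> jack_far q m z ->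
  jack_bounded q B G -> jack_bounded q (B / m) (fun x => G x / (z - x))%C.
Proof.
intros Hm Hz HG k; destruct (Hz k) as [Z1 Z2]; destruct (HG k) as [G1 G2].
split; rewrite Cmod_div by (apply Cmod_gt_0; lra);
  apply Rmult_le_compat; auto using Cmod_ge_0;
  try (left; apply Rinv_0_lt_compat; lra); apply Rinv_le_contravar; auto.
Qed.

(** The pole of the kernel at [z] adds [- G z / (z - a)] for every pole [a] of [h], inside or
    outside the curve; weighted and summed, these give [- G z * h q z]. The poles inside the curve
    contribute the discrete sum as in the exterior case. *)
Lemma hilb_interior (q rho : R) (c : R -> C) (G : C -> C) (z : C) : q_curve q c ->
  interior_fun c G -> interior c z -> 0 < rho -> pole_dist q rho z ->
  hilb q c G z = (jack_sum q (fun x => G x / (z - x)) - G z * h q z)%C.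
Proof.
intros Hqc HG Hz Hrho Hpd.
pose proof (interior_fun_curve c G HG) as HGc.
destruct (hilb_kernel q c G z Hqc HGc (proj1 Hz)) as [Cg ->].
set (g := fun s => (- / two_pi_i * (G s / (s - z)))%C) in *.
assert (Hgood : good_curve c) by apply Hqc.
assert (Hq : 0 < q < 1) by apply Hqc.
assert (Hpr : pole_region q rho (Cmod z) z) by (split; [auto|lra]).
destruct (jack_bounded_interior q c G Hqc) as [B [HB Hjb]]; [apply HG|].
assert (Hm : 0 < rho / (Cmod z + 1)) by (pose proof (Cmod_ge_0 z); apply Rdiv_lt_0_compat; lra).
assert (Hjb' : jack_bounded q (B / (rho / (Cmod z + 1))) (fun x => G x / (z - x))%C).
{ apply jack_transform_bounded; auto; intros k; now apply pole_region_dist. }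
set (J := fun k : nat => ((G (RtoC (q ^ k)%R) / (z - RtoC (q ^ k)%R) +
   G (RtoC (- q ^ k)%R) / (z - RtoC (- q ^ k)%R)) * RtoC (q ^ k)%R)%C).
assert (SJ : is_csum J (jack_sum q (fun x => G x / (z - x))%C)).
{ apply (is_csum_C_Series q (2 * (B / (rho / (Cmod z + 1))))); [lra|].
  apply (jack_bounded_dom q _ (fun x => G x / (z - x))%C); auto; lra. }
assert (Shp : is_csum (fun k => hp q k z) (C_Series (fun k => hp q k z))).
{ apply (is_csum_C_Series q (h_const rho (Cmod z))); [lra|now apply hp_dom]. }
assert (Shm : is_csum (fun k => hm q k z) (C_Series (fun k => hm q k z))).
{ apply (is_csum_C_Series q (h_const rho (Cmod z))); [lra|now apply hm_dom]. }
apply (is_csum_unique (fun k => 1 * (1 * J k + (- G z) * hp q k z) + (- G z) * hm q k z)%C).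
- eapply is_csum_ext; [|apply (hilb_csum q c g Hqc Cg)].
  intros k.
  destruct (pole_dist_neq q rho z (Z.of_nat k)) as [N1 N2]; try lra; auto.
  destruct (pole_dist_neq q rho z (- Z.of_nat (S k))) as [N3 N4]; try lra; auto.
  unfold hp, hm; rewrite !h_termE by (auto; lra).
  rewrite <- !pow_powerRZ in *.
  destruct Hqc as [_ [_ [_ [Hin Hex]]]].
  destruct (Hin k) as [A1 A2]; destruct (Hex k) as [A3 A4].
  unfold g.
  rewrite (partial_fraction_int c G z (RtoC (q ^ k)%R) (G (RtoC (q ^ k)%R)));
    auto; [|apply A1|now apply cauchy_interior].
  rewrite (partial_fraction_int c G z (RtoC (- q ^ k)%R) (G (RtoC (- q ^ k)%R)));
    auto; [|apply A2|now apply cauchy_interior].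
  rewrite (partial_fraction_int c G z (RtoC (powerRZ q (- Z.of_nat (S k)))) 0);
    auto; [|apply A3|rewrite cauchy_exterior by auto; ring].
  rewrite (partial_fraction_int c G z (RtoC (- powerRZ q (- Z.of_nat (S k)))) 0);
    auto; [|apply A4|rewrite cauchy_exterior by auto; ring].
  unfold J.
  set (x := RtoC (q ^ k)%R) in *; set (p := RtoC (powerRZ q (- Z.of_nat (S k)))) in *.
  rewrite !RtoC_opp in *; fold x p in N2, N4 |- *.
  assert (M1 : (z - x)%C <> RtoC 0) by now apply Cminus_neq_0, not_eq_sym.
  assert (M2 : (z - - x)%C <> RtoC 0) by now apply Cminus_neq_0, not_eq_sym.
  assert (M3 : (z - p)%C <> RtoC 0) by now apply Cminus_neq_0, not_eq_sym.
  assert (M4 : (z - - p)%C <> RtoC 0) by now apply Cminus_neq_0, not_eq_sym.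
  assert (M2' : (z + x)%C <> RtoC 0) by (replace (z + x)%C with (z - - x)%C by ring; auto).
  assert (M4' : (z + p)%C <> RtoC 0) by (replace (z + p)%C with (z - - p)%C by ring; auto).
  replace (z - - x)%C with (z + x)%C by ring; replace (z - - p)%C with (z + p)%C by ring.
  field; repeat split; auto.
- replace (jack_sum q (fun x => G x / (z - x)) - G z * h q z)%C with
   (1 * (1 * jack_sum q (fun x => G x / (z - x)) + (- G z) * C_Series (fun k => hp q k z)) +
    (- G z) * C_Series (fun k => hm q k z))%C.
  + apply is_csum_linear; auto; apply is_csum_linear; auto.
  + unfold h, C_Zseries, hp, hm; ring.
Qed.

Lemma hilb_cdiff (q : R) (c : R -> C) (G : C -> C) (z : C) : q_curve q c ->
  cont_on_curve c G -> ~ on_curve c z -> cdiff (hilb q c G) z.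
Proof.
intros Hqc HG Hz.
assert (Hr : regular_curve c) by apply Hqc.
destruct (curve_pole_dist q c) as [rho [r [Hrho [Hr0 Hreg]]]]; auto; try apply Hqc.
{ intros k; now apply q_curve_off. }
assert (Hh : cont_on_curve c (h q)) by (apply (h_cont_on_curve q rho r); auto; apply Hqc).
set (phi := fun s => (- / two_pi_i * (G s * h q s))%C).
assert (Cphi : cont_on_curve c phi).
{ apply cont_on_curve_mult; [intros s Hs; apply ccont_on_const|now apply cont_on_curve_mult]. }
destruct (off_curve_ball c z (proj1 Hr) Hz) as [e [He Hball]].
apply (cdiff_ext_loc (fun z => contour_int c (fun s => phi s * / (s - z)))%C _ z e); auto.
- intros y Hy; assert (Hyo : ~ on_curve c y) by (eapply connected_off_r; eauto).
  apply contour_int_ext; auto.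
  + apply cont_on_curve_mult; auto; now apply cauchy_kernel_cont.
  + intros s Hs; unfold phi.
    assert (N1 : (s - y)%C <> RtoC 0) by (apply Cminus_neq_0; intros ->; auto).
    assert (N2 : (y - s)%C <> RtoC 0) by (apply Cminus_neq_0; intros ->; auto).
    pose proof two_pi_i_neq_0.
    replace (y - s)%C with (- (s - y))%C in * by ring; field; repeat split; auto.
- now apply cauchy_type_cdiff.
Qed.

(** The sum of the residue terms, common to both sides of the curve. *)
Definition jack_transform (q : R) (G : C -> C) (z : C) : C :=
  jack_sum q (fun x => G x / (z - x))%C.

Lemma jack_transform_cont (q rho r B : R) (G : C -> C) (s : C) : 0 < q < 1 -> 0 < rho ->
  0 <= r -> pole_region q rho r s -> 0 <= B -> jack_bounded q B G ->
  ccont (jack_transform q G) s.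
Proof.
intros Hq Hrho Hr Hs HB HG eps He.
(* The distance that [pole_region_dist] guarantees in the enlarged region with [rho / 2] and
   [r + 1], valid at [s] and at all nearby [z]. *)
set (m := rho / 2 / (r + 1 + 1)).
assert (Hm : 0 < m) by (unfold m; repeat apply Rdiv_lt_0_compat; lra).
assert (Fs : jack_far q m s).
{ intros k; destruct (pole_region_dist q rho r s k Hq Hrho Hs) as [D1 D2].
  assert (m <= rho / (r + 1)); [|lra].
  unfold m, Rdiv; rewrite Rmult_assoc, <- Rinv_mult; apply Rmult_le_compat_l; [lra|].
  apply Rinv_le_contravar; lra. }
set (Q := 2 * (B / (m * m)) / (1 - q)).
assert (HQ : 0 <= Q).
{ unfold Q; apply Rdiv_le_0_compat; [|lra]; apply Rmult_le_pos; [lra|].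
  apply Rdiv_le_0_compat; [auto|nra]. }
set (d := Rmin (Rmin 1 (rho / (2 * (2 * r + 1)))) (eps / (Q + 1))).
assert (Hd : 0 < d).
{ repeat apply Rmin_glb_lt; try lra; apply Rdiv_lt_0_compat; lra. }
exists d; split; auto; intros z _ Hz.
assert (D1 : d <= Rmin 1 (rho / (2 * (2 * r + 1)))) by apply Rmin_l.
assert (D2 : Rmin 1 (rho / (2 * (2 * r + 1))) <= 1) by apply Rmin_l.
assert (D3 : Rmin 1 (rho / (2 * (2 * r + 1))) <= rho / (2 * (2 * r + 1))) by apply Rmin_r.
assert (D4 : d <= eps / (Q + 1)) by apply Rmin_r.
assert (Fz : jack_far q m z).
{ intros k; apply (pole_region_dist q (rho / 2) (r + 1) z k Hq); [lra|].
  apply (pole_dist_near q rho r s); auto; lra. }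
assert (E : (jack_transform q G z - jack_transform q G s)%C =
  jack_sum q (fun x => 1 * (G x / (z - x)) + (- (1)) * (G x / (s - x)))%C).
{ rewrite (jack_sum_linear q (B / m) (B / m)); [unfold jack_transform; ring|lra| |];
    apply jack_transform_bounded; auto. }
rewrite E.
assert (HJ : jack_bounded q (B / (m * m) * Cmod (z - s))
  (fun x => 1 * (G x / (z - x)) + (- (1)) * (G x / (s - x)))%C).
{ assert (K : forall x : C, m <= Cmod (z - x) -> m <= Cmod (s - x) -> Cmod (G x) <= B ->
    Cmod (1 * (G x / (z - x)) + (- (1)) * (G x / (s - x)))%C <= B / (m * m) * Cmod (z - s)).
  { intros x X1 X2 X3.
    replace (1 * (G x / (z - x)) + (- (1)) * (G x / (s - x)))%C with
      (G x * (/ (z - x) - / (s - x)))%C by (unfold Cdiv; ring).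
    rewrite Cmod_mult.
    replace (B / (m * m) * Cmod (z - s)) with (B * (Cmod (z - s) / (m * m))) by (field; lra).
    apply Rmult_le_compat; auto using Cmod_ge_0; now apply inv_diff. }
  intros k; destruct (Fz k), (Fs k), (HG k); auto. }
eapply Rle_lt_trans; [apply jack_sum_bound; [lra|exact HJ]|].
apply Rle_lt_trans with (Q * Cmod (z - s)); [right; unfold Q; field; lra|].
pose proof (Cmod_ge_0 (z - s)).
apply Rle_lt_trans with ((Q + 1) * Cmod (z - s)); [nra|].
apply Rlt_le_trans with ((Q + 1) * (eps / (Q + 1))); [|right; field; lra].
apply Rmult_lt_compat_l; lra.
Qed.

(** * Boundary values of the Cauchy transform *)

(** The closed formulas for the two sides extend continuously to the curve, so the boundary values
    are read off without singular integrals. *)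
Lemma hilb_boundary (q : R) (c : R -> C) (G : C -> C) (s : C) : q_curve q c ->
  interior_fun c G -> on_curve c s ->
  (forall eps, 0 < eps -> exists del, 0 < del /\ forall z, interior c z -> Cmod (z - s) < del ->
     Cmod (hilb q c G z - (jack_transform q G s - G s * h q s)) < eps) /\
  (forall eps, 0 < eps -> exists del, 0 < del /\ forall z, exterior c z -> Cmod (z - s) < del ->
     Cmod (hilb q c G z - jack_transform q G s) < eps).
Proof.
intros Hqc HG Hs.
assert (Hr : regular_curve c) by apply Hqc.
assert (Hq : 0 < q < 1) by apply Hqc.
destruct (curve_pole_dist q c) as [rho [r [Hrho [Hr0 Hreg]]]]; auto; try apply Hqc.
{ intros k; now apply q_curve_off. }
destruct (jack_bounded_interior q c G Hqc) as [B [HB Hjb]]; [apply HG|].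
pose proof (jack_transform_cont q rho r B G s Hq Hrho ltac:(lra) (Hreg s Hs) HB Hjb) as HJ.
split; intros eps He.
- set (Sn := fun z => closed_interior c z /\ pole_region q (rho / 2) (r + 1) z).
  assert (Hss : pole_region q (rho / 2) (r + 1) s).
  { apply (pole_dist_near q rho r s); auto; try lra;
      replace (s - s)%C with (RtoC 0) by ring; rewrite Cmod_0; [lra|].
    left; apply Rdiv_lt_0_compat; lra. }
  assert (Hc : ccont_on Sn (fun z => jack_transform q G z - G z * h q z)%C s).
  { apply ccont_on_minus; [apply (ccont_on_sub (fun _ => True)); auto|].
    apply ccont_on_mult.
    - apply (ccont_on_sub (closed_interior c)); [intros y [Hy _]; auto|].
      apply HG; right; auto.
    - apply (ccont_on_sub (pole_region q (rho / 2) (r + 1))); [intros y [_ Hy]; auto|].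
      apply h_cont; auto; lra. }
  destruct (Hc eps He) as [d [Hd K]].
  assert (Hdd : 0 < rho / (2 * (2 * r + 1))) by (apply Rdiv_lt_0_compat; lra).
  exists (Rmin d (Rmin 1 (rho / (2 * (2 * r + 1))))); split.
  { repeat apply Rmin_glb_lt; lra. }
  intros z Hz Hzs.
  assert (D1 : Cmod (z - s) < d) by (eapply Rlt_le_trans; [exact Hzs|apply Rmin_l]).
  assert (D2 : Cmod (z - s) < Rmin 1 (rho / (2 * (2 * r + 1))))
    by (eapply Rlt_le_trans; [exact Hzs|apply Rmin_r]).
  assert (D3 : Rmin 1 (rho / (2 * (2 * r + 1))) <= 1) by apply Rmin_l.
  assert (D4 : Rmin 1 (rho / (2 * (2 * r + 1))) <= rho / (2 * (2 * r + 1))) by apply Rmin_r.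
  assert (Hzr : pole_region q (rho / 2) (r + 1) z)
    by (apply (pole_dist_near q rho r s); auto; lra).
  rewrite (hilb_interior q (rho / 2)); auto; [|lra|apply Hzr].
  apply K; auto; split; auto; left; auto.
- destruct (HJ eps He) as [d [Hd K]]; exists d; split; auto; intros z Hz Hzs.
  rewrite hilb_exterior by auto; apply K; auto.
Qed.

Lemma jack_transform_cont_curve (q : R) (c : R -> C) (G : C -> C) : q_curve q c ->
  interior_fun c G -> cont_on_curve c (jack_transform q G).
Proof.
intros Hqc HG s Hs.
assert (Hq : 0 < q < 1) by apply Hqc.
destruct (curve_pole_dist q c) as [rho [r [Hrho [Hr0 Hreg]]]]; auto; try apply Hqc.
{ intros k; now apply q_curve_off. }
destruct (jack_bounded_interior q c G Hqc) as [B [HB Hjb]]; [apply HG|].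
apply (ccont_on_sub (fun _ => True)); auto.
apply (jack_transform_cont q rho r B); auto; lra.
Qed.

Lemma h_cont_q_curve (q : R) (c : R -> C) : q_curve q c -> cont_on_curve c (h q).
Proof.
intros Hqc.
destruct (curve_pole_dist q c) as [rho [r [Hrho [Hr0 Hreg]]]]; auto; try apply Hqc.
{ intros k; now apply q_curve_off. }
apply (h_cont_on_curve q rho r); auto; apply Hqc.
Qed.

(** * Moments and the expansion at infinity *)

Lemma jack_far_large (q : R) (z : C) : 0 < q < 1 -> 2 <= Cmod z -> jack_far q (Cmod z / 2) z.
Proof.
intros Hq Hz k.
assert (Hqk : 0 <= q ^ k <= 1).
{ split; [apply pow_le; lra|].
  pose proof (pow_incr q 1 k ltac:(lra)) as P; rewrite pow1 in P; auto. }
pose proof (Cmod_triangle_inv z (RtoC (q ^ k)%R)) as T1.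
pose proof (Cmod_triangle_inv z (RtoC (- q ^ k)%R)) as T2.
rewrite Cmod_R in T1, T2; rewrite Rabs_Ropp in T2; rewrite Rabs_pos_eq in T1, T2 by lra.
lra.
Qed.

Lemma jack_bounded_pow (q B : R) (G : C -> C) (j : nat) : 0 < q < 1 -> jack_bounded q B G ->
  jack_bounded q B (fun x => x ^ j * G x)%C.
Proof.
intros Hq HG k; destruct (HG k) as [G1 G2].
assert (Hqk : 0 <= q ^ k <= 1).
{ split; [apply pow_le; lra|].
  pose proof (pow_incr q 1 k ltac:(lra)) as P; rewrite pow1 in P; auto. }
assert (P1 : 0 <= (q ^ k) ^ j <= 1).
{ split; [apply pow_le; lra|].
  pose proof (pow_incr (q ^ k) 1 j ltac:(lra)) as P; rewrite pow1 in P; auto. }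
split; rewrite Cmod_mult, Cmod_pow, Cmod_R; rewrite ?Rabs_Ropp; rewrite Rabs_pos_eq by lra;
  match goal with |- _ * ?x <= _ => pose proof (Cmod_ge_0 (G (RtoC (q ^ k)%R)));
    pose proof (Cmod_ge_0 (G (RtoC (- q ^ k)%R))) end; nra.
Qed.

(** [z / (z - x) = 1 + x / (z - x)] under the sum. Iteration expands the transform at infinity, one
    moment at a time. *)
Lemma jack_transform_shift (q B : R) (G : C -> C) (z : C) (j : nat) : 0 < q < 1 ->
  2 <= Cmod z -> jack_bounded q B G ->
  (z * jack_transform q (fun x => x ^ j * G x) z)%C =
  (jack_sum q (fun x => x ^ j * G x)%C + jack_transform q (fun x => x ^ (S j) * G x) z)%C.
Proof.
intros Hq Hz HG.
pose proof (jack_far_large q z Hq Hz) as Hfar.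
pose proof (jack_bounded_pow q B G j Hq HG) as Hj.
pose proof (jack_bounded_pow q B G (S j) Hq HG) as HSj.
pose proof (jack_transform_bounded q B (Cmod z / 2) _ z ltac:(lra) Hfar Hj) as Tj.
pose proof (jack_transform_bounded q B (Cmod z / 2) _ z ltac:(lra) Hfar HSj) as TSj.
transitivity (jack_sum q (fun x => z * (x ^ j * G x / (z - x)) + 0 * (x ^ j * G x / (z - x)))%C).
- rewrite (jack_sum_linear q _ _ _ _ z 0 ltac:(lra) Tj Tj); unfold jack_transform; ring.
- transitivity (jack_sum q (fun x => 1 * (x ^ j * G x) + 1 * (x ^ (S j) * G x / (z - x)))%C).
  + apply jack_sum_ext; intros k; destruct (Hfar k) as [F1 F2].
    assert (N1 : (z - RtoC (q ^ k)%R)%C <> RtoC 0) by (apply Cmod_gt_0; lra).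
    assert (N2 : (z - RtoC (- q ^ k)%R)%C <> RtoC 0) by (apply Cmod_gt_0; lra).
    split; cbn [Cpow]; field; auto.
  + rewrite (jack_sum_linear q _ _ _ _ 1 1 ltac:(lra) Hj TSj); unfold jack_transform; ring.
Qed.

Lemma jack_transform_moments (q B : R) (G : C -> C) (z : C) (n : nat) : 0 < q < 1 ->
  2 <= Cmod z -> jack_bounded q B G ->
  (forall j, (j < n)%nat -> jack_sum q (fun x => x ^ j * G x)%C = RtoC 0) ->
  (z ^ n * jack_transform q G z)%C = jack_transform q (fun x => x ^ n * G x)%C z.
Proof.
intros Hq Hz HG; induction n as [|n IH]; intros Hm.
- replace (z ^ 0 * jack_transform q G z)%C with (jack_transform q G z) by (simpl; ring).
  apply jack_sum_ext; intros k; split; simpl; unfold Cdiv; ring.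
- cbn [Cpow]; rewrite <- Cmult_assoc, IH by (intros; apply Hm; lia).
  rewrite (jack_transform_shift q B) by auto.
  rewrite Hm by lia; cbn [Cpow]; ring.
Qed.

Lemma jack_transform_decay (q B : R) (G : C -> C) (z : C) (n : nat) : 0 < q < 1 ->
  2 <= Cmod z -> jack_bounded q B G ->
  Cmod (jack_transform q (fun x => x ^ n * G x)%C z) <= 4 * B / (1 - q) / Cmod z.
Proof.
intros Hq Hz HG.
eapply Rle_trans; [apply jack_sum_bound; [lra|]|].
- apply (jack_transform_bounded q B (Cmod z / 2)); [lra|now apply jack_far_large|].
  now apply jack_bounded_pow.
- right; field; lra.
Qed.

(** * Monic polynomials and the moments of orthogonal polynomials *)

Lemma monic_poly_split (n : nat) (p : C -> C) : monic_poly n p ->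
  exists a : nat -> C, forall z, p z = (Csum n (fun k => a k * z ^ k) + z ^ n)%C.
Proof.
intros [a [Ha Hp]]; exists a; intros z; rewrite Hp.
apply (@eq_trans C _ (Csum (S n) (fun k => a k * z ^ k)%C)); [apply sum_n_Csum|].
cbn [Csum]; rewrite Ha; ring.
Qed.

Lemma cdiff_Csum (u : nat -> C -> C) (z : C) (n : nat) :
  (forall k, cdiff (u k) z) -> cdiff (fun s => Csum n (fun k => u k s)) z.
Proof.
intros H; induction n as [|n IH]; cbn [Csum].
- apply cdiff_const.
- apply (cdiff_plus (fun s => Csum n (fun k => u k s)) (u n)); auto.
Qed.

Lemma monic_poly_cdiff (n : nat) (p : C -> C) (z : C) : monic_poly n p -> cdiff p z.
Proof.
intros Hp; destruct (monic_poly_split n p Hp) as [a Ha].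
apply (cdiff_ext_loc (fun z => Csum n (fun k => a k * z ^ k) + z ^ n)%C _ z 1); [lra|auto|].
apply cdiff_plus; [|apply cdiff_pow].
apply (cdiff_Csum (fun k s => a k * s ^ k)%C); intros k.
apply cdiff_mult; [apply cdiff_const|apply cdiff_pow].
Qed.

Lemma jack_sum_Csum (q B : R) (G : C -> C) (a : nat -> C) (n : nat) : 0 < q < 1 ->
  jack_bounded q B G ->
  (exists B', jack_bounded q B' (fun x => Csum n (fun k => a k * (x ^ k * G x)))%C) /\
  jack_sum q (fun x => Csum n (fun k => a k * (x ^ k * G x)))%C =
  Csum n (fun k => a k * jack_sum q (fun x => x ^ k * G x))%C.
Proof.
intros Hq HG; induction n as [|n [[B' HB'] IH]]; cbn [Csum].
- split.
  + exists 0; intros k; rewrite Cmod_0; lra.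
  + pose proof (jack_sum_linear q B B G G 0 0 ltac:(lra) HG HG) as E.
    transitivity (jack_sum q (fun s => 0 * G s + 0 * G s)%C); [|rewrite E; ring].
    apply jack_sum_ext; intros; split; ring.
- pose proof (jack_bounded_pow q B G n Hq HG) as Hn.
  split.
  + exists (B' + Cmod (a n) * B); intros k.
    destruct (HB' k) as [B1 B2]; destruct (Hn k) as [N1 N2].
    pose proof (Cmod_ge_0 (a n)).
    split; (eapply Rle_trans; [apply Cmod_triangle|]; rewrite (Cmod_mult (a n));
      apply Rplus_le_compat; auto; apply Rmult_le_compat_l; auto).
  + rewrite <- IH.
    transitivity (jack_sum q (fun x => 1 * Csum n (fun k => a k * (x ^ k * G x)) + a n * (x ^ n * G x))%C).
    * apply jack_sum_ext; intros; split; ring.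
    * rewrite (jack_sum_linear q _ _ _ _ 1 (a n) ltac:(lra) HB' Hn); ring.
Qed.

(** [x^j] is [P j] minus lower powers, so once the moments below [j] vanish, the moment of order [j]
    is the sum against [P j]. Strong induction gives zero below [n]; at [n] the factor [1 - q] of
    the Jackson integral passes to the denominator. *)
Lemma orthogonal_moments (q : R) (w : C -> C) (P : nat -> C -> C) (gamma : nat -> C) (B : R)
  (n : nat) : 0 < q < 1 -> orthogonal_polys q w P gamma ->
  jack_bounded q B (fun x => P n x * w x)%C ->
  (forall j, (j < n)%nat -> jack_sum q (fun x => x ^ j * (P n x * w x))%C = RtoC 0) /\
  jack_sum q (fun x => x ^ n * (P n x * w x))%C = (gamma n / RtoC (1 - q))%C.
Proof.
intros Hq [Hm Ho] HB.
set (G := fun x => (P n x * w x)%C) in *.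
assert (Hq1 : RtoC (1 - q) <> RtoC 0) by (intros E; apply RtoC_inj in E; lra).
assert (HP : forall m, jack_sum q (fun x => P m x * G x)%C =
  (if Nat.eqb n m then gamma n / RtoC (1 - q) else RtoC 0)%C).
{ intros m; specialize (Ho n m); rewrite jackson_jack_sum in Ho.
  rewrite (jack_sum_ext q _ (fun x => P m x * G x)%C) in Ho
    by (intros; unfold G; split; ring).
  destruct (Nat.eqb n m).
  - rewrite <- Ho; field; auto.
  - replace (jack_sum q (fun x => P m x * G x)%C) with
      (/ RtoC (1 - q) * (RtoC (1 - q) * jack_sum q (fun x => P m x * G x)))%C by (field; auto).
    rewrite Ho; ring. }
assert (Hrec : forall j, (forall i, (i < j)%nat -> jack_sum q (fun x => x ^ i * G x)%C = RtoC 0) ->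
  jack_sum q (fun x => x ^ j * G x)%C = jack_sum q (fun x => P j x * G x)%C).
{ intros j Hj; destruct (monic_poly_split j (P j) (Hm j)) as [a Ha].
  destruct (jack_sum_Csum q B G a j Hq HB) as [[B' HB'] HS].
  pose proof (jack_bounded_pow q B G j Hq HB) as Hjb.
  transitivity (jack_sum q (fun x => 1 * Csum j (fun k => a k * (x ^ k * G x)) + 1 * (x ^ j * G x))%C).
  - rewrite (jack_sum_linear q _ _ _ _ 1 1 ltac:(lra) HB' Hjb), HS.
    rewrite Csum_zero; [ring|]; intros k Hk; rewrite Hj by auto; ring.
  - apply jack_sum_ext; intros k; rewrite !Ha.
    assert (E : forall x, (1 * Csum j (fun k => a k * (x ^ k * G x)) + 1 * (x ^ j * G x))%C =
      ((Csum j (fun k => a k * x ^ k) + x ^ j) * G x)%C).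
    { intros x.
      rewrite (Csum_ext j (fun k => a k * (x ^ k * G x))%C (fun k => G x * (a k * x ^ k))%C)
        by (intros; ring).
      rewrite Csum_scal; ring. }
    split; apply E. }
assert (Hlow : forall j, (j < n)%nat -> jack_sum q (fun x => x ^ j * G x)%C = RtoC 0).
{ intros j; induction j as [j IH] using (well_founded_induction lt_wf); intros Hj.
  rewrite Hrec by (intros i Hi; apply IH; lia).
  rewrite HP; destruct (Nat.eqb_spec n j); [lia|easy]. }
split; auto; rewrite Hrec by auto; rewrite HP, Nat.eqb_refl; easy.
Qed.

Lemma monic_poly_asymptotics (n : nat) (p : C -> C) : monic_poly n p ->
  exists K, 0 <= K /\ forall z, 1 <= Cmod z -> Cmod (p z * / z ^ n - 1)%C <= K / Cmod z.
Proof.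
intros Hp; destruct (monic_poly_split n p Hp) as [a Ha].
exists (Rsum n (fun k => Cmod (a k))); split; [apply Rsum_pos; intros; apply Cmod_ge_0|].
intros z Hz.
assert (Hz0 : z <> RtoC 0) by (apply Cmod_gt_0; lra).
assert (Hzn : (z ^ n)%C <> RtoC 0) by now apply Cpow_nz.
rewrite Ha.
replace ((Csum n (fun k => a k * z ^ k) + z ^ n) * / z ^ n - 1)%C with
  (Csum n (fun k => / z ^ n * (a k * z ^ k)))%C by (rewrite Csum_scal; field; auto).
unfold Rdiv; rewrite Rmult_comm, <- Rsum_scal.
eapply Rle_trans; [apply Cmod_Csum|]; apply Rsum_le; intros k Hk.
rewrite !Cmod_mult, Cmod_inv, !Cmod_pow by auto.
assert (P : Cmod z ^ k * Cmod z <= Cmod z ^ n).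
{ replace (Cmod z ^ k * Cmod z) with (Cmod z ^ (S k)) by (simpl; ring).
  now apply Rle_pow. }
assert (Pn : 0 < Cmod z ^ n) by (apply pow_lt; lra).
pose proof (Cmod_ge_0 (a k)).
replace (/ Cmod z ^ n * (Cmod (a k) * Cmod z ^ k)) with (Cmod (a k) * (/ Cmod z ^ n * Cmod z ^ k)) by ring.
rewrite (Rmult_comm (/ Cmod z)); apply Rmult_le_compat_l; auto.
apply Rmult_le_reg_r with (Cmod z ^ n * Cmod z); [apply Rmult_lt_0_compat; lra|].
replace (/ Cmod z ^ n * Cmod z ^ k * (Cmod z ^ n * Cmod z)) with (Cmod z ^ k * Cmod z) by (field; lra).
replace (/ Cmod z * (Cmod z ^ n * Cmod z)) with (Cmod z ^ n) by (field; lra); auto.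
Qed.

(** * Liouville's theorem for functions holomorphic off a thin set *)

(** The difference quotient at [a] has zero integral around a large square centred at [a], by
    [painleve_square]. It splits into [(f - l) / (z - a)], which is small on the edges, and
    [l - f a] times the Cauchy kernel. *)
Lemma liouville_thin (f : C -> C) (E : C -> Prop) (l a : C) : thin E ->
  (forall z, ccont f z) -> (forall z, ~ E z -> cdiff f z) ->
  (forall eps, 0 < eps -> exists M, forall z, M < Cmod z -> Cmod (f z - l) <= eps) ->
  ~ E a -> f a = l.
Proof.
intros HE Hc Hd Hl Ha.
destruct (Hd a Ha) as [f' Hf'].
symmetry; apply Cmod_le_eps_eq; intros eps He.
destruct (Hl (eps / 2) ltac:(lra)) as [M HM].
(* Points of the edges are at distance at least [r] from [a], hence have modulus above [M]. *)
set (r := Rabs M + Cmod a + 1).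
pose proof (Cmod_ge_0 a); pose proof (Rabs_pos M).
assert (Hr : 0 < r) by (unfold r; lra).
set (x := Re a - r); set (y := Im a - r).
assert (Ex : Re a + r = x + 2 * r) by (unfold x; ring).
assert (Ey : Im a + r = y + 2 * r) by (unfold y; ring).
set (g := diff_quot f a f').
assert (Hg0 : rect g x (x + 2 * r) y (y + 2 * r) = RtoC 0).
{ apply (painleve_square g (fun z => E z \/ z = a)); [lra|apply thin_union; auto using thin_single| |].
  - intros z _; apply diff_quot_cont; auto; apply (ccont_on_sub (fun _ => True)); auto; apply Hc.
  - intros z _ Hz; apply diff_quot_cdiff; [tauto|apply Hd; tauto]. }
assert (Hedge : forall z, on_edges x (x + 2 * r) y (y + 2 * r) z -> r <= Cmod (z - a)).
{ intros z [_ Hz].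
  pose proof (re_le_Cmod (z - a)) as R1; pose proof (Im_le_Cmod (z - a)) as R2.
  change (Re (z - a)%C) with (Re z - Re a) in R1; change (Im (z - a)%C) with (Im z - Im a) in R2.
  unfold x, y in Hz; unfold Rabs in R1, R2; repeat destruct Rcase_abs;
    destruct Hz as [Hz|[Hz|[Hz|Hz]]]; lra. }
assert (Hne : forall z, on_edges x (x + 2 * r) y (y + 2 * r) z -> z <> a).
{ intros z Hz ->; specialize (Hedge a Hz); replace (a - a)%C with (RtoC 0) in Hedge by ring.
  rewrite Cmod_0 in Hedge; lra. }
set (S := fun z : C => z <> a).
assert (Hk : forall z, S z -> ccont_on S (fun z => / (z - a))%C z).
{ intros z Hz; apply ccont_on_inv; [now apply Cminus_neq_0|].
  apply ccont_on_minus; [apply ccont_on_id|apply ccont_on_const]. }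
assert (Hu : forall z, S z -> ccont_on S (fun z => (f z - l) * / (z - a))%C z).
{ intros z Hz; apply ccont_on_mult; auto; apply ccont_on_minus; [|apply ccont_on_const].
  apply (ccont_on_sub (fun _ => True)); auto; apply Hc. }
assert (Hsplit : rect g x (x + 2 * r) y (y + 2 * r) =
  (rect (fun z => (f z - l) * / (z - a)) x (x + 2 * r) y (y + 2 * r) + (l - f a) * two_pi_i)%C).
{ rewrite <- (rect_inv a r Hr); fold x y; rewrite Ex, Ey.
  rewrite <- (rect_lincomb S) by (auto; lra).
  apply rect_ext; try lra.
  intros z Hz; unfold g; rewrite diff_quot_neq by auto.
  unfold Cdiv; ring. }
rewrite Hg0 in Hsplit.
assert (HB : Cmod (rect (fun z => (f z - l) * / (z - a)) x (x + 2 * r) y (y + 2 * r))%C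
  <= 4 * (2 * r) * (eps / 2 * / r)).
{ apply (rect_bound S); auto; [lra|]; intros z Hz.
  specialize (Hedge z Hz).
  rewrite Cmod_mult, Cmod_inv by (apply Cmod_gt_0; lra).
  apply Rmult_le_compat; try apply Cmod_ge_0.
  - left; apply Rinv_0_lt_compat; lra.
  - apply HM; pose proof (Cmod_triangle_inv (z - a) (- a)) as T.
    replace (z - a - - a)%C with z in T by ring; rewrite Cmod_opp in T.
    pose proof (Rle_abs M); unfold r in Hedge; lra.
  - apply Rinv_le_contravar; lra. }
replace (rect (fun z => (f z - l) * / (z - a)) x (x + 2 * r) y (y + 2 * r))%C
  with (- ((l - f a) * two_pi_i))%C in HB.
2:{ match type of Hsplit with _ = (?u + ?v)%C => replace u with ((u + v) - v)%C by ring end.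
    rewrite <- Hsplit; ring. }
rewrite Cmod_opp, Cmod_mult, Cmod_two_pi_i in HB.
replace (4 * (2 * r) * (eps / 2 * / r)) with (4 * eps) in HB by (field; lra).
pose proof two_pi_gt_6; pose proof (Cmod_ge_0 (l - f a)); nra.
Qed.

(** * Uniqueness *)

Lemma entry_Mmult2 (A B : mat2) (i j : nat) : (i < 2)%nat -> (j < 2)%nat ->
  entry (Mmult2 A B) i j = (entry A i 0 * entry B 0 j + entry A i 1 * entry B 1 j)%C.
Proof.
intros Hi Hj.
destruct A as [[a [b []]] [[c [d []]] []]], B as [[a' [b' []]] [[c' [d' []]] []]].
unfold entry, Mmult2, Mmult.
rewrite coeff_mat_bij by auto.
change (pred 2) with 1%nat; rewrite sum_Sn, sum_O; reflexivity.
Qed.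

Lemma mat2_ext (A B : mat2) :
  (forall i j, (i < 2)%nat -> (j < 2)%nat -> entry A i j = entry B i j) -> A = B.
Proof.
intros H.
destruct A as [[a [b []]] [[c [d []]] []]], B as [[a' [b' []]] [[c' [d' []]] []]].
pose proof (H 0%nat 0%nat ltac:(lia) ltac:(lia)) as E1; pose proof (H 0%nat 1%nat ltac:(lia) ltac:(lia)) as E2.
pose proof (H 1%nat 0%nat ltac:(lia) ltac:(lia)) as E3; pose proof (H 1%nat 1%nat ltac:(lia) ltac:(lia)) as E4.
unfold entry, coeff_mat in E1, E2, E3, E4; simpl in E1, E2, E3, E4.
now rewrite E1, E2, E3, E4.
Qed.

Definition clim_on (S : C -> Prop) (f : C -> C) (s L : C) : Prop :=
  forall eps, 0 < eps -> exists del, 0 < del /\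
    forall y, S y -> Cmod (y - s) < del -> Cmod (f y - L) < eps.

(** Determinant with rows [(a0, a1)] and [(b0, b1)], each row taken from one of two solutions. *)
Definition wedge (a0 a1 b0 b1 : C) : C := (a0 * b1 - a1 * b0)%C.

(** A limit at a point off [S] is continuity of the function redefined at that point; rules for
    limits then follow from those for continuity. *)
Lemma clim_on_upd (S : C -> Prop) (f : C -> C) (s L : C) : ~ S s ->
  clim_on S f s L <-> ccont_on S (fun y => if excluded_middle_informative (y = s) then L else f y) s.
Proof.
intros Hs; split; intros H eps He; destruct (H eps He) as [d [Hd K]]; exists d; split; auto;
  intros y Sy Hy; specialize (K y Sy Hy); repeat destruct excluded_middle_informative;
  subst; try tauto.
Qed.

Lemma clim_on_wedge (S : C -> Prop) (a0 a1 b0 b1 : C -> C) (s A0 A1 B0 B1 : C) : ~ S s ->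
  clim_on S a0 s A0 -> clim_on S a1 s A1 -> clim_on S b0 s B0 -> clim_on S b1 s B1 ->
  clim_on S (fun y => wedge (a0 y) (a1 y) (b0 y) (b1 y)) s (wedge A0 A1 B0 B1).
Proof.
intros Hs H1 H2 H3 H4; apply clim_on_upd in H1, H2, H3, H4; auto.
pose proof (ccont_on_minus S _ _ s (ccont_on_mult S _ _ s H1 H4) (ccont_on_mult S _ _ s H2 H3)) as H.
intros eps He; destruct (H eps He) as [d [Hd K]]; exists d; split; auto; intros y Sy Hy.
specialize (K y Sy Hy); cbv beta in K.
destruct (excluded_middle_informative (y = s)) as [->|Hne]; [tauto|].
destruct (excluded_middle_informative (s = s)) as [_|]; [exact K|tauto].
Qed.

Definition delta2 (i j : nat) : C := if Nat.eqb i j then RtoC 1 else RtoC 0.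

Lemma rhp_asymptotics_entries (n : nat) (Y : C -> mat2) : rhp_asymptotics n Y ->
  exists K M, 0 <= K /\ 0 < M /\ forall z i, M < Cmod z -> (i < 2)%nat ->
    Cmod (entry (Y z) i 0 * / z ^ n - delta2 i 0)%C <= K / Cmod z /\
    Cmod (entry (Y z) i 1 * z ^ n - delta2 i 1)%C <= K / Cmod z.
Proof.
intros [K [M [HM H]]]; exists (Rabs K), M; split; [apply Rabs_pos|split; auto].
intros z i Hz Hi.
assert (HK : K / Cmod z <= Rabs K / Cmod z).
{ unfold Rdiv; apply Rmult_le_compat_r; [left; apply Rinv_0_lt_compat; lra|apply Rle_abs]. }
assert (Hid : forall j, (j < 2)%nat ->
  entry (mat (RtoC 1) (RtoC 0) (RtoC 0) (RtoC 1)) i j = delta2 i j).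
{ intros j Hj; destruct i as [|[|i]]; destruct j as [|[|j]]; try lia; reflexivity. }
pose proof (H z Hz i 0%nat Hi ltac:(lia)) as H0; pose proof (H z Hz i 1%nat Hi ltac:(lia)) as H1.
rewrite entry_Mmult2, Hid in H0, H1 by lia.
unfold entry at 2 4 in H0; unfold entry at 2 4 in H1.
unfold mat, coeff_mat in H0, H1; simpl in H0, H1.
split.
- eapply Rle_trans; [|exact HK]; eapply Rle_trans; [|exact H0]; right; f_equal; ring.
- eapply Rle_trans; [|exact HK]; eapply Rle_trans; [|exact H1]; right; f_equal; ring.
Qed.

Lemma boundary_limit_clim (D : C -> Prop) (Y : C -> mat2) (s : C) (L : mat2) :
  boundary_limit D Y s L <-> forall i j, (i < 2)%nat -> (j < 2)%nat ->
    clim_on D (fun z => entry (Y z) i j) s (entry L i j).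
Proof.
split; intros H i j Hi Hj;
  pose proof (within_locally_Cmod D (fun z => entry (Y z) i j) s (entry L i j)) as [W1 W2].
- exact (W1 (H i j Hi Hj)).
- exact (W2 (H i j Hi Hj)).
Qed.

Lemma Cmod_mult_close (x y x0 y0 : C) (e : R) : e <= 1 -> Cmod x0 <= 1 -> Cmod y0 <= 1 ->
  Cmod (x - x0) <= e -> Cmod (y - y0) <= e -> Cmod (x * y - x0 * y0) <= 3 * e.
Proof.
intros He Hx0 Hy0 Hx Hy.
replace (x * y - x0 * y0)%C with ((x - x0) * (y - y0) + x0 * (y - y0) + (x - x0) * y0)%C by ring.
eapply Rle_trans; [apply Cmod_triangle|].
eapply Rle_trans; [apply Rplus_le_compat_r, Cmod_triangle|].
rewrite !Cmod_mult.
pose proof (Cmod_ge_0 (x - x0)); pose proof (Cmod_ge_0 (y - y0)).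
pose proof (Cmod_ge_0 x0); pose proof (Cmod_ge_0 y0).
nra.
Qed.

Lemma Cmod_delta2 (i j : nat) : Cmod (delta2 i j) <= 1.
Proof. unfold delta2; destruct (Nat.eqb i j); rewrite ?Cmod_1, ?Cmod_0; lra. Qed.

(* The 2x2 minors built from one row of each solution have no jump, hence extend to
   bounded entire functions. *)
Lemma wedge_solutions (q : R) (c : R -> C) (w : C -> C) (n : nat) (Y1 Y2 : C -> mat2)
  (i j : nat) (a : C) : regular_curve c -> q_RHP q c w n Y1 -> q_RHP q c w n Y2 ->
  (i < 2)%nat -> (j < 2)%nat -> ~ on_curve c a ->
  wedge (entry (Y1 a) i 0) (entry (Y1 a) i 1) (entry (Y2 a) j 0) (entry (Y2 a) j 1) =
  wedge (delta2 i 0) (delta2 i 1) (delta2 j 0) (delta2 j 1).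
Proof.
intros Hr [An1 [[Ym1 [Yp1 [Cm1 [Cp1 J1]]]] As1]] [An2 [[Ym2 [Yp2 [Cm2 [Cp2 J2]]]] As2]] Hi Hj Ha.
set (W := fun z => wedge (entry (Y1 z) i 0) (entry (Y1 z) i 1) (entry (Y2 z) j 0) (entry (Y2 z) j 1)).
set (Wm := fun z => wedge (entry (Ym1 z) i 0) (entry (Ym1 z) i 1) (entry (Ym2 z) j 0) (entry (Ym2 z) j 1)).
(* The values of [W] on the curve are arbitrary, so [f] takes there the boundary values from the
   interior. *)
set (f := fun z => if excluded_middle_informative (on_curve c z) then Wm z else W z).
assert (Foff : forall z, ~ on_curve c z -> f z = W z).
{ intros z Hz; unfold f; destruct excluded_middle_informative; tauto. }
assert (Fon : forall z, on_curve c z -> f z = Wm z).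
{ intros z Hz; unfold f; destruct excluded_middle_informative; tauto. }
assert (HWd : forall z, ~ on_curve c z -> cdiff W z).
{ intros z Hz.
  assert (D1 : forall k, (k < 2)%nat -> cdiff (fun z => entry (Y1 z) i k) z)
    by (intros k Hk; apply ex_derive_cdiff, (An1 i k Hi Hk z Hz)).
  assert (D2 : forall k, (k < 2)%nat -> cdiff (fun z => entry (Y2 z) j k) z)
    by (intros k Hk; apply ex_derive_cdiff, (An2 j k Hj Hk z Hz)).
  apply cdiff_minus; apply cdiff_mult; auto. }
assert (Hfd : forall z, ~ on_curve c z -> cdiff f z).
{ intros z Hz; destruct (off_curve_ball c z (proj1 Hr) Hz) as [e [He Hball]].
  apply (cdiff_ext_loc W f z e); auto.
  intros y Hy; symmetry; apply Foff; eapply connected_off_r; eauto. }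
assert (Hfc : forall z, ccont f z).
{ intros s; destruct (classic (on_curve c s)) as [Hs|Hs]; [|apply cdiff_ccont; auto].
  destruct (J1 s Hs) as [L1 [L2 L3]]; destruct (J2 s Hs) as [M1 [M2 M3]].
  rewrite boundary_limit_clim in L1, L2, M1, M2.
  set (Wp := wedge (entry (Yp1 s) i 0) (entry (Yp1 s) i 1) (entry (Yp2 s) j 0) (entry (Yp2 s) j 1)).
  assert (Hin : clim_on (interior c) W s (Wm s)).
  { apply clim_on_wedge; auto; intros [H _]; auto. }
  assert (Hex : clim_on (exterior c) W s Wp).
  { apply clim_on_wedge; auto; intros [H _]; auto. }
  (* The jump matrix has determinant 1 and multiplies both rows from the right, so the minor is
     unchanged. *)
  assert (HWp : Wp = Wm s).
  { unfold Wp, Wm; rewrite L3, M3, !entry_Mmult2 by lia.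
    unfold entry at 2 4 6 8 10 12 14 16; unfold mat, coeff_mat; simpl.
    unfold wedge; ring. }
  rewrite HWp in Hex.
  assert (Hon : ccont_on (on_curve c) Wm s).
  { assert (E1 : forall k, (k < 2)%nat -> ccont_on (on_curve c) (fun z => entry (Ym1 z) i k) s)
      by (intros k Hk; apply continuous_on_ccont_on; auto; apply Cm1; auto).
    assert (E2 : forall k, (k < 2)%nat -> ccont_on (on_curve c) (fun z => entry (Ym2 z) j k) s)
      by (intros k Hk; apply continuous_on_ccont_on; auto; apply Cm2; auto).
    apply ccont_on_minus; apply ccont_on_mult; auto. }
  intros eps He; rewrite (Fon s Hs).
  destruct (Hin eps He) as [d1 [Hd1 K1]]; destruct (Hex eps He) as [d2 [Hd2 K2]];
    destruct (Hon eps He) as [d3 [Hd3 K3]].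
  exists (Rmin d1 (Rmin d2 d3)); split; [repeat apply Rmin_glb_lt; auto|].
  intros y _ Hy.
  destruct (Rmin_Rgt_l _ _ _ Hy) as [Y1' Y'].
  destruct (Rmin_Rgt_l _ _ _ Y') as [Y2' Y3'].
  destruct (classic (on_curve c y)) as [Hon'|Hoff].
  - rewrite Fon by auto; auto.
  - rewrite Foff by auto; destruct (off_curve_cases c y Hoff); auto. }
rewrite <- (liouville_thin f (on_curve c) (wedge (delta2 i 0) (delta2 i 1) (delta2 j 0) (delta2 j 1)) a);
  auto using thin_curve.
- rewrite Foff by auto; reflexivity.
- intros eps He.
  destruct (rhp_asymptotics_entries n Y1 As1) as [K1 [M1 [HK1 [HM1 H1]]]].
  destruct (rhp_asymptotics_entries n Y2 As2) as [K2 [M2 [HK2 [HM2 H2]]]].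
  destruct (curve_bounded c Hr) as [B [HB HBc]].
  set (K := K1 + K2).
  (* The summands [K] and [6 * K / eps] give [K / |z| <= 1] and [6 * (K / |z|) <= eps]; [B] keeps
     [z] off the curve. *)
  exists (M1 + M2 + B + K + 6 * K / eps); intros z Hz.
  assert (P6 : 0 <= 6 * K / eps) by (apply Rdiv_le_0_compat; unfold K; lra).
  assert (HK : 0 <= K) by (unfold K; lra).
  assert (Hz0 : 0 < Cmod z) by lra.
  destruct (H1 z i ltac:(lra) Hi) as [A1 A2]; destruct (H2 z j ltac:(lra) Hj) as [B1 B2].
  rewrite Foff by (intros Hs; specialize (HBc z Hs); lra).
  set (e := K / Cmod z).
  assert (Hiz : 0 < / Cmod z) by now apply Rinv_0_lt_compat.
  assert (E1 : K1 / Cmod z <= e) by (unfold e, K, Rdiv; apply Rmult_le_compat_r; lra).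
  assert (E2 : K2 / Cmod z <= e) by (unfold e, K, Rdiv; apply Rmult_le_compat_r; lra).
  assert (E3 : e <= 1).
  { unfold e; apply Rmult_le_reg_r with (Cmod z); auto.
    unfold Rdiv; rewrite Rmult_assoc, Rinv_l by lra; lra. }
  assert (E4 : 6 * e <= eps).
  { unfold e; apply Rmult_le_reg_r with (Cmod z); auto.
    replace (6 * (K / Cmod z) * Cmod z) with (6 * K) by (field; lra).
    replace (6 * K) with (eps * (6 * K / eps)) by (field; lra).
    apply Rmult_le_compat_l; lra. }
  assert (Hzn : (z ^ n)%C <> RtoC 0) by (apply Cpow_nz, Cmod_gt_0; auto).
  set (a0 := (entry (Y1 z) i 0 * / z ^ n)%C) in *; set (a1 := (entry (Y1 z) i 1 * z ^ n)%C) in *.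
  set (b0 := (entry (Y2 z) j 0 * / z ^ n)%C) in *; set (b1 := (entry (Y2 z) j 1 * z ^ n)%C) in *.
  (* Each product pairs an entry of the first column with one of the second, so the powers [z ^ n]
     cancel. *)
  replace (W z) with (a0 * b1 - a1 * b0)%C
    by (unfold W, wedge, a0, a1, b0, b1; field; auto).
  unfold wedge.
  match goal with |- Cmod (?x - ?y - (?u - ?v)) <= _ =>
    replace (x - y - (u - v))%C with ((x - u) - (y - v))%C by ring end.
  eapply Rle_trans; [apply Cmod_triangle_minus|].
  assert (F1 : Cmod (a0 * b1 - delta2 i 0 * delta2 j 1) <= 3 * e)
    by (apply Cmod_mult_close; auto using Cmod_delta2; lra).
  assert (F2 : Cmod (a1 * b0 - delta2 i 1 * delta2 j 0) <= 3 * e)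
    by (apply Cmod_mult_close; auto using Cmod_delta2; lra).
  lra.
Qed.

(** Cramer's rule. The minor of the two rows of [Y2] is 1, so each row of [Y1] is a combination of
    the rows of [Y2] with coefficients given, up to sign, by its minors with them. These minors are
    those of the identity, hence the combination is the corresponding row of [Y2]. *)
Lemma q_RHP_unique (q : R) (c : R -> C) (w : C -> C) (n : nat) (Y1 Y2 : C -> mat2) (z : C) :
  regular_curve c -> q_RHP q c w n Y1 -> q_RHP q c w n Y2 -> ~ on_curve c z -> Y1 z = Y2 z.
Proof.
intros Hr H1 H2 Hz.
pose proof (wedge_solutions q c w n Y2 Y2 0 1 z Hr H2 H2 ltac:(lia) ltac:(lia) Hz) as D.
assert (E : forall i, (i < 2)%nat ->
  wedge (entry (Y1 z) i 0) (entry (Y1 z) i 1) (entry (Y2 z) 0 0) (entry (Y2 z) 0 1) =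
    wedge (delta2 i 0) (delta2 i 1) (delta2 0 0) (delta2 0 1) /\
  wedge (entry (Y1 z) i 0) (entry (Y1 z) i 1) (entry (Y2 z) 1 0) (entry (Y2 z) 1 1) =
    wedge (delta2 i 0) (delta2 i 1) (delta2 1 0) (delta2 1 1)).
{ intros i Hi; split; apply (wedge_solutions q c w n Y1 Y2); auto. }
unfold wedge in D, E.
set (b00 := entry (Y2 z) 0 0) in *; set (b01 := entry (Y2 z) 0 1) in *.
set (b10 := entry (Y2 z) 1 0) in *; set (b11 := entry (Y2 z) 1 1) in *.
unfold delta2 in D, E; simpl in D, E.
assert (D1 : (b00 * b11 - b01 * b10 = 1)%C) by (rewrite D; ring).
apply mat2_ext; intros i j Hi Hj; destruct (E i Hi) as [E0 E1].
set (a0 := entry (Y1 z) i 0) in *; set (a1 := entry (Y1 z) i 1) in *.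
assert (R0 : a0 = (b00 * (a0 * b11 - a1 * b10) - b10 * (a0 * b01 - a1 * b00))%C).
{ transitivity (a0 * (b00 * b11 - b01 * b10))%C; [rewrite D1|]; ring. }
assert (R1 : a1 = (b01 * (a0 * b11 - a1 * b10) - b11 * (a0 * b01 - a1 * b00))%C).
{ transitivity (a1 * (b00 * b11 - b01 * b10))%C; [rewrite D1|]; ring. }
rewrite E0, E1 in R0, R1.
destruct i as [|[|i]]; [| |lia]; destruct j as [|[|j]]; try lia;
  simpl in R0, R1; fold a0 a1 b00 b01 b10 b11; rewrite ?R0, ?R1; ring.
Qed.

(** * Existence *)

Lemma admissible_interior_fun (c : R -> C) (w : C -> C) : admissible c w -> interior_fun c w.
Proof.
intros [Hw1 [Hw2 _]]; split; intros z Hz.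
- now apply (proj1 (continuous_on_ccont_on _ _) Hw2).
- now apply ex_derive_cdiff, Hw1.
Qed.

Lemma interior_fun_entire (c : R -> C) (f : C -> C) : (forall z, cdiff f z) -> interior_fun c f.
Proof.
intros H; split; intros z Hz; auto.
apply (ccont_on_sub (fun _ => True)); auto; apply cdiff_ccont; auto.
Qed.

Lemma hilb_alt (q : R) (c : R -> C) (G F : C -> C) (z : C) : q_curve q c ->
  cont_on_curve c G -> ~ on_curve c z ->
  (forall s, on_curve c s -> F s = (G s * h q s / (two_pi_i * (z - s)))%C) ->
  contour_int c F = hilb q c G z.
Proof.
intros Hqc HG Hz HF.
assert (Hr : regular_curve c) by apply Hqc.
symmetry; apply contour_int_ext; auto.
- intros s Hs; apply ccont_on_div.
  + apply Cmult_neq_0; [apply two_pi_i_neq_0|apply Cminus_neq_0; intros ->; auto].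
  + apply ccont_on_mult; [now apply HG|now apply h_cont_q_curve].
  + apply ccont_on_mult; [apply ccont_on_const|].
    apply ccont_on_minus; [apply ccont_on_const|apply ccont_on_id].
- intros s Hs; symmetry; auto.
Qed.

Section Solution.

Context (q : R) (c : R -> C) (w : C -> C) (P : nat -> C -> C) (gamma : nat -> C) (n : nat).
Context (Hqc : q_curve q c) (Hw : interior_fun c w) (HP : orthogonal_polys q w P gamma).
Context (Hn : (1 <= n)%nat) (Hgamma : gamma (n - 1)%nat <> RtoC 0).

(** The normalisation for which the moment of order [n - 1] of [G2] is 1. *)
Let kappa : C := (RtoC (1 - q) / gamma (n - 1)%nat)%C.
Let G1 (s : C) : C := (P n s * w s)%C.
Let G2 (s : C) : C := (kappa * (P (n - 1)%nat s * w s))%C.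

Lemma poly_cdiff (m : nat) (z : C) : cdiff (P m) z.
Proof. apply (monic_poly_cdiff m), HP. Qed.

Lemma poly_interior_fun (m : nat) : interior_fun c (P m).
Proof. apply interior_fun_entire, poly_cdiff. Qed.

Lemma G1_interior_fun : interior_fun c G1.
Proof. apply interior_fun_mult; auto using poly_interior_fun. Qed.

Lemma G2_interior_fun : interior_fun c G2.
Proof.
apply (interior_fun_mult c (fun _ => kappa)).
- apply interior_fun_entire; intros; apply cdiff_const.
- apply interior_fun_mult; auto using poly_interior_fun.
Qed.

Lemma Y_sol_entries (z : C) : ~ on_curve c z ->
  Y_sol q c w P gamma n z =
  mat (P n z) (hilb q c G1 z) (kappa * P (n - 1)%nat z)%C (hilb q c G2 z).
Proof.
intros Hz; unfold Y_sol; f_equal.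
apply hilb_alt; auto; [apply interior_fun_curve, G2_interior_fun|].
intros s Hs; unfold G2, kappa.
assert ((z - s)%C <> RtoC 0) by (apply Cminus_neq_0; intros ->; auto).
pose proof two_pi_i_neq_0; field; auto.
Qed.

Lemma Y_sol_analytic : rhp_analytic c (Y_sol q c w P gamma n).
Proof.
intros i j Hi Hj z Hz; apply ex_derive_cdiff.
assert (Hr : regular_curve c) by apply Hqc.
destruct (off_curve_ball c z (proj1 Hr) Hz) as [e [He Hball]].
apply (cdiff_ext_loc (fun z => entry (mat (P n z) (hilb q c G1 z)
  (kappa * P (n - 1)%nat z)%C (hilb q c G2 z)) i j) _ z e); auto.
- intros y Hy; rewrite Y_sol_entries; [easy|eapply connected_off_r; eauto].
- destruct i as [|[|i]]; [| |lia]; destruct j as [|[|j]]; try lia;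
    unfold entry, mat, coeff_mat; simpl.
  + apply poly_cdiff.
  + apply hilb_cdiff; auto; apply interior_fun_curve, G1_interior_fun.
  + apply cdiff_mult; [apply cdiff_const|apply poly_cdiff].
  + apply hilb_cdiff; auto; apply interior_fun_curve, G2_interior_fun.
Qed.

Let Ym (s : C) : mat2 :=
  mat (P n s) (jack_transform q G1 s - G1 s * h q s)%C
    (kappa * P (n - 1)%nat s)%C (jack_transform q G2 s - G2 s * h q s)%C.
Let Yp (s : C) : mat2 :=
  mat (P n s) (jack_transform q G1 s) (kappa * P (n - 1)%nat s)%C (jack_transform q G2 s).

Lemma clim_on_ext_ccont (D : C -> Prop) (f g : C -> C) (s : C) :
  (forall z, D z -> f z = g z) -> ccont g s -> clim_on D f s (g s).
Proof.
intros E H eps He; destruct (H eps He) as [d [Hd K]]; exists d; split; auto.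
intros y Dy Hy; rewrite E by auto; auto.
Qed.

Lemma clim_on_ext (D : C -> Prop) (f g : C -> C) (s l : C) :
  (forall z, D z -> f z = g z) -> clim_on D g s l -> clim_on D f s l.
Proof.
intros E H eps He; destruct (H eps He) as [d [Hd K]]; exists d; split; auto.
intros y Dy Hy; rewrite E by auto; auto.
Qed.

Lemma Y_sol_jump : rhp_jump c w (h q) (Y_sol q c w P gamma n).
Proof.
assert (Hoff : forall D : C -> Prop, (forall z, D z -> ~ on_curve c z) -> forall i j z, D z ->
  entry (Y_sol q c w P gamma n z) i j = entry (mat (P n z) (hilb q c G1 z)
  (kappa * P (n - 1)%nat z)%C (hilb q c G2 z)) i j).
{ intros D HD i j z Hz; rewrite Y_sol_entries; auto. }
assert (Hp : forall m (S : C -> Prop) s, ccont_on S (P m) s).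
{ intros m S s; apply (ccont_on_sub (fun _ => True)); auto; apply cdiff_ccont, poly_cdiff. }
assert (Hkp : forall (S : C -> Prop) s, ccont_on S (fun z => kappa * P (n - 1)%nat z)%C s).
{ intros S s; apply ccont_on_mult; auto using ccont_on_const. }
pose proof (h_cont_q_curve q c Hqc) as Hh.
pose proof (jack_transform_cont_curve q c G1 Hqc G1_interior_fun) as J1.
pose proof (jack_transform_cont_curve q c G2 Hqc G2_interior_fun) as J2.
pose proof (interior_fun_curve c G1 G1_interior_fun) as C1.
pose proof (interior_fun_curve c G2 G2_interior_fun) as C2.
exists Ym, Yp; split; [|split].
- intros i j Hi Hj; apply continuous_on_ccont_on; intros s Hs.
  destruct i as [|[|i]]; [| |lia]; destruct j as [|[|j]]; try lia;
    unfold entry, Ym, mat, coeff_mat; simpl; auto.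
  + apply ccont_on_minus; [now apply J1|apply ccont_on_mult; auto].
  + apply ccont_on_minus; [now apply J2|apply ccont_on_mult; auto].
- intros i j Hi Hj; apply continuous_on_ccont_on; intros s Hs.
  destruct i as [|[|i]]; [| |lia]; destruct j as [|[|j]]; try lia;
    unfold entry, Yp, mat, coeff_mat; simpl; auto.
- intros s Hs.
  destruct (hilb_boundary q c G1 s Hqc G1_interior_fun Hs) as [B1 B2].
  destruct (hilb_boundary q c G2 s Hqc G2_interior_fun Hs) as [B3 B4].
  split; [|split].
  + apply boundary_limit_clim; intros i j Hi Hj.
    eapply clim_on_ext; [apply (Hoff (interior c)); intros z Hz; apply Hz|].
    destruct i as [|[|i]]; [| |lia]; destruct j as [|[|j]]; try lia;
      unfold entry, Ym, mat, coeff_mat; simpl.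
    * apply (clim_on_ext_ccont _ (P n) (P n)); auto; apply Hp.
    * exact B1.
    * apply (clim_on_ext_ccont _ _ (fun z => kappa * P (n - 1)%nat z)%C); auto; apply Hkp.
    * exact B3.
  + apply boundary_limit_clim; intros i j Hi Hj.
    eapply clim_on_ext; [apply (Hoff (exterior c)); intros z Hz; apply Hz|].
    destruct i as [|[|i]]; [| |lia]; destruct j as [|[|j]]; try lia;
      unfold entry, Yp, mat, coeff_mat; simpl.
    * apply (clim_on_ext_ccont _ (P n) (P n)); auto; apply Hp.
    * exact B2.
    * apply (clim_on_ext_ccont _ _ (fun z => kappa * P (n - 1)%nat z)%C); auto; apply Hkp.
    * exact B4.
  + apply mat2_ext; intros i j Hi Hj; rewrite entry_Mmult2 by auto.
    destruct i as [|[|i]]; [| |lia]; destruct j as [|[|j]]; try lia;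
      unfold entry, Ym, Yp, mat, coeff_mat, G1, G2; simpl; ring.
Qed.

(** In the second column, the [n] vanishing moments of [G1] turn [z^n] times its transform into the
    transform of [x^n G1], which is [O(1/z)]. [G2] has [n - 1] vanishing moments followed by a
    moment equal to 1, which becomes the constant term of the entry (2,2). *)
Lemma Y_sol_asymptotics : rhp_asymptotics n (Y_sol q c w P gamma n).
Proof.
assert (Hq : 0 < q < 1) by apply Hqc.
assert (Hr : regular_curve c) by apply Hqc.
assert (Hq1 : RtoC (1 - q) <> RtoC 0) by (intros E; apply RtoC_inj in E; lra).
destruct (curve_bounded c Hr) as [B0 [HB0 HBc]].
destruct (monic_poly_asymptotics n (P n)) as [K1 [HK1 A1]]; [apply HP|].
destruct (monic_poly_asymptotics (n - 1) (P (n - 1)%nat)) as [K2 [HK2 A2]]; [apply HP|].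
destruct (jack_bounded_interior q c G1 Hqc) as [B1 [HB1 J1]]; [apply G1_interior_fun|].
destruct (jack_bounded_interior q c G2 Hqc) as [B2 [HB2 J2]]; [apply G2_interior_fun|].
destruct (jack_bounded_interior q c (fun x => P (n - 1)%nat x * w x)%C Hqc) as [B3 [HB3 J3]].
{ intros z Hz; apply cdiff_mult; [apply poly_cdiff|now apply Hw]. }
destruct (orthogonal_moments q w P gamma B1 n Hq HP J1) as [M1 _].
destruct (orthogonal_moments q w P gamma B3 (n - 1) Hq HP J3) as [M3 M3'].
assert (Hk : forall j, jack_sum q (fun x => x ^ j * G2 x)%C =
  (kappa * jack_sum q (fun x => x ^ j * (P (n - 1)%nat x * w x)))%C).
{ intros j; pose proof (jack_bounded_pow q B3 _ j Hq J3) as Jj.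
  transitivity (jack_sum q (fun x => kappa * (x ^ j * (P (n - 1)%nat x * w x)) +
     0 * (x ^ j * (P (n - 1)%nat x * w x)))%C).
  - apply jack_sum_ext; intros; unfold G2; split; ring.
  - rewrite (jack_sum_linear q _ _ _ _ kappa 0 ltac:(lra) Jj Jj); ring. }
assert (M2 : forall j, (j < n - 1)%nat -> jack_sum q (fun x => x ^ j * G2 x)%C = RtoC 0).
{ intros j Hj; rewrite Hk, M3 by auto; ring. }
assert (M2' : jack_sum q (fun x => x ^ (n - 1) * G2 x)%C = RtoC 1).
{ rewrite Hk, M3'; unfold kappa; field; auto. }
set (D1 := 4 * B1 / (1 - q)); set (D2 := 4 * B2 / (1 - q)).
assert (HD1 : 0 <= D1) by (apply Rdiv_le_0_compat; lra).
assert (HD2 : 0 <= D2) by (apply Rdiv_le_0_compat; lra).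
pose proof (Cmod_ge_0 kappa) as Pk.
assert (HkK : 0 <= Cmod kappa * (K2 + 1)) by (apply Rmult_le_pos; lra).
set (K := K1 + D1 + Cmod kappa * (K2 + 1) + D2).
exists K, (B0 + 2); split; [lra|]; intros z Hz i j Hi Hj.
assert (Hz0 : 0 < Cmod z) by lra.
assert (Hiz : 0 < / Cmod z) by now apply Rinv_0_lt_compat.
assert (Hex : exterior c z) by (apply (far_exterior c B0); auto; lra).
rewrite Y_sol_entries by apply Hex.
rewrite entry_Mmult2, !hilb_exterior by (auto using G1_interior_fun, G2_interior_fun).
fold (jack_transform q G1 z); fold (jack_transform q G2 z).
assert (Hznz : z <> RtoC 0) by now apply Cmod_gt_0.
assert (Hzn : (z ^ n)%C <> RtoC 0) by now apply Cpow_nz.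
assert (HKz : forall u, u <= K -> u / Cmod z <= K / Cmod z)
  by (intros u Hu; unfold Rdiv; apply Rmult_le_compat_r; lra).
specialize (A1 z ltac:(lra)); specialize (A2 z ltac:(lra)).
assert (En : (z ^ n = z * z ^ (n - 1))%C).
{ replace n with (S (n - 1)) at 1 by lia; reflexivity. }
destruct i as [|[|i]]; [| |lia]; destruct j as [|[|j]]; try lia;
  unfold entry, mat, coeff_mat; simpl.
- replace (P n z * / z ^ n + jack_transform q G1 z * 0 - 1)%C
    with (P n z * / z ^ n - 1)%C by ring.
  eapply Rle_trans; [exact A1|]; apply HKz; unfold K; lra.
- replace (P n z * 0 + jack_transform q G1 z * z ^ n - 0)%C
    with (z ^ n * jack_transform q G1 z)%C by ring.
  rewrite (jack_transform_moments q B1) by (auto; lra).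
  eapply Rle_trans; [apply (jack_transform_decay q B1); auto; lra|].
  apply HKz; fold D1; unfold K; lra.
- assert (Hzn1 : (z ^ (n - 1))%C <> RtoC 0) by now apply Cpow_nz.
  replace (kappa * P (n - 1)%nat z * / z ^ n + jack_transform q G2 z * 0 - 0)%C
    with (kappa * (P (n - 1)%nat z * / z ^ (n - 1) - 1 + 1) * / z)%C
    by (rewrite En; field; auto).
  rewrite !Cmod_mult, Cmod_inv by auto.
  apply Rle_trans with (Cmod kappa * (K2 + 1) / Cmod z); [|apply HKz; unfold K; lra].
  unfold Rdiv; apply Rmult_le_compat_r; [lra|]; apply Rmult_le_compat_l; auto.
  eapply Rle_trans; [apply Cmod_triangle|]; rewrite Cmod_1; apply Rplus_le_compat_r.
  eapply Rle_trans; [exact A2|].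
  apply Rmult_le_reg_r with (Cmod z); auto.
  unfold Rdiv; rewrite Rmult_assoc, Rinv_l by lra; nra.
- replace (kappa * P (n - 1)%nat z * 0 + jack_transform q G2 z * z ^ n - 1)%C
    with (z * (z ^ (n - 1) * jack_transform q G2 z) - 1)%C by (rewrite En; ring).
  rewrite (jack_transform_moments q B2), (jack_transform_shift q B2), M2' by (auto; lra).
  replace (S (n - 1)) with n by lia.
  match goal with |- Cmod ?X <= _ => replace X with (jack_transform q (fun x => x ^ n * G2 x) z)%C by ring end.
  eapply Rle_trans; [apply (jack_transform_decay q B2); auto; lra|].
  apply HKz; fold D2; unfold K; lra.
Qed.

Lemma Y_sol_q_RHP : q_RHP q c w n (Y_sol q c w P gamma n).
Proof. split; [apply Y_sol_analytic|split; [apply Y_sol_jump|apply Y_sol_asymptotics]]. Qed.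

End Solution.

(** [gamma (n - 1)] divides the second row and [n - 1] is a subtraction of natural numbers, hence
    the conditions on both. Agreement is claimed off the curve, since on it the problem prescribes
    only limits from the two sides. *)
Theorem theorem1p1 :
  forall (q : R) (c : R -> C) (w : C -> C)
         (P : nat -> C -> C) (gamma : nat -> C) (n : nat),
    0 < q < 1 ->
    appropriate q c ->
    admissible c w ->
    orthogonal_polys q w P gamma ->
    (1 <= n)%nat ->
    gamma (n - 1)%nat <> RtoC 0 ->
    q_RHP q c w n (Y_sol q c w P gamma n) /\
    (forall Y : C -> mat2,
       q_RHP q c w n Y ->
       forall z : C, ~ on_curve c z -> Y z = Y_sol q c w P gamma n z).
Proof.
intros q c w P gamma n Hq Hc Hw HP Hn Hgamma.
pose proof (appropriate_q_curve q c Hq Hc) as Hqc.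
pose proof (Y_sol_q_RHP q c w P gamma n Hqc (admissible_interior_fun c w Hw) HP Hn Hgamma) as HY.
split; auto; intros Y HYY z Hz.
apply (q_RHP_unique q c w n); auto; apply Hqc.
Qed.
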